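(* $I_i(t)$ is a rational function if and only if the combinatorial monodromy of $I_i$ is trivial, i.e. $A_i(\hat S)=0$ for any $\hat S\in\pi_1(U,c)$.
   Context: $\gamma\subset\mathbb C$ is an oriented piecewise-smooth curve (closed or non-closed) with only transversal self-intersections, $\Sigma\subset\gamma$ is a finite set, and $g$ is a function on $\gamma\setminus\Sigma$ which on each component (segment) $\gamma_s$ of $\gamma\setminus\Sigma$ is given by analytic continuation of a germ of an algebraic function, the branches being chosen so that $g$ is single-valued on $\gamma\setminus\Sigma$. The set $\Sigma$ contains the end-points and multiple points of $\gamma$ and all points of $\gamma$ at which $g$ has a jump or a ramification; the singular points of $g$ on $\gamma$ are assumed to lie in $\Sigma$; at points of $\Sigma$ the function $g$ may ramify but has no poles. ($g$ has a jump at $z\in\gamma$ if the branches of $g$ on the two sides of $z$ on $\gamma$ cannot be obtained from one another by analytic continuation along a curve inside any given neighborhood of $z$.) $\Sigma_1$ is the set of singular points of (all the branches of) $g$ not lying on $\gamma$, and $U=\mathbb C\setminus(\Sigma\cup\Sigma_1)$. For $t\notin\gamma$, $I(t)=\frac1{2\pi i}\int_\gamma\frac{g(z)dz}{z-t}$; $D_0,D_1,\dots$ are the components of $\mathbb C\setminus\gamma$ ($D_0$ unbounded), and $I_i=I|_{D_i}$. A curve $S=S_{c,d}$ from $c\in\mathbb C\setminus\gamma$ to $d\in\mathbb C\setminus\gamma$ is admissible if it avoids the singularities of $g$ and crosses $\gamma$ transversally and only at interior points of the segments $\gamma_s$. $S^*$ denotes analytic continuation of germs at $c$ to germs at $d$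 along $S$. If $S\cap\gamma=\{a_1,\dots,a_r\}$ and $g_k$ is the germ at $a_k$ of the branch of $g$ given on $\gamma$, the sum of branches of $g$ along $S$ across $\gamma$ is the germ at $d$ $$g(S,\gamma)=\sum_{k=1}^r\mathrm{sgn}(a_k)\,S^*_{a_k,d}(g_k),$$ where $S_{a_k,d}$ is the part of $S$ from $a_k$ to $d$ and $\mathrm{sgn}(a_k)=+1$ if $S$ crosses $\gamma$ at $a_k$ from the right to the left of $\gamma$, $-1$ otherwise. It depends only on the homotopy class of $S$ in $U$ with fixed end-points. Fix $c\in D_i$. The combinatorial monodromy $A_i$ of $I_i$ is the map sending $\hat S\in\pi_1(U,c)$ to the germ $g(S,\gamma)$ at $c$, where $S$ is an admissible loop at $c$ representing $\hat S$. *)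

(* Defs.v *)
From Stdlib Require Import Reals List.
From Coquelicot Require Import Coquelicot.

Open Scope R_scope.

(** Curves are maps [R -> C] of which only the restriction to [[0,1]] matters. *)

Definition I01 (t : R) : Prop := 0 <= t <= 1.

Definition image (gamma : R -> C) (z : C) : Prop :=
  exists s, I01 s /\ gamma s = z.

(** ** Connectedness *)

Definition connected (E : C -> Prop) : Prop :=
  forall A B : C -> Prop,
    open A -> open B ->
    (forall z, E z -> A z \/ B z) ->
    (exists z, E z /\ A z) -> (exists z, E z /\ B z) ->
    exists z, E z /\ A z /\ B z.

Definition is_component (E D : C -> Prop) : Prop :=
  (exists z, D z) /\ (forall z, D z -> E z) /\ connected D /\
  (forall D' : C -> Prop,
      connected D' -> (forall z, D' z -> E z) -> (forall z, D z -> D' z) ->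
      forall z, D' z -> D z).

(** ** Polynomials, given by their lists of coefficients (lowest degree first) *)

Definition peval (p : list C) (z : C) : C :=
  fold_right (fun a r => (a + z * r)%C) (RtoC 0) p.

Definition pnonzero (p : list C) : Prop := exists a, In a p /\ a <> RtoC 0.

(** [P] is a polynomial in [w] whose coefficients are polynomials in [z]. *)
Definition peval2 (P : list (list C)) (z w : C) : C :=
  peval (map (fun p => peval p z) P) w.

Definition pnonzero2 (P : list (list C)) : Prop := exists p, In p P /\ pnonzero p.

Definition rational_on (D : C -> Prop) (f : C -> C) : Prop :=
  exists p q : list C, pnonzero q /\
    forall t, D t -> peval q t <> RtoC 0 /\ f t = (peval p t / peval q t)%C.

(** ** Germs and analytic continuation

    A germ at [z] is represented by a function [C -> C], two functions being
    identified when they satisfy [germ_eq z]. *)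

Definition germ_eq (z : C) (f h : C -> C) : Prop :=
  locally z (fun w : C => f w = h w).

Definition holomorphic_at (f : C -> C) (z : C) : Prop :=
  locally z (fun w : C => ex_derive (K := C_AbsRing) (V := C_NormedModule) f w).

Definition algebraic_germ (f : C -> C) (z : C) : Prop :=
  holomorphic_at f z /\
  exists P, pnonzero2 P /\ locally z (fun w : C => peval2 P w (f w) = RtoC 0).

(** [F tau] represents the germ at [S tau]. *)
Definition continuation_along (S : R -> C) (u v : R) (F : R -> C -> C) : Prop :=
  forall tau, u <= tau <= v ->
    holomorphic_at (F tau) (S tau) /\
    exists delta, 0 < delta /\
      forall tau', u <= tau' <= v -> Rabs (tau' - tau) < delta ->
        germ_eq (S tau') (F tau') (F tau).

(** [h = S*_{S u, S v} f]. *)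
Definition continues_to (S : R -> C) (u v : R) (f h : C -> C) : Prop :=
  exists F, continuation_along S u v F /\
    germ_eq (S u) (F u) f /\ germ_eq (S v) (F v) h.

(** ** The curve [gamma] *)

(** The piece over [[u,v]] is the restriction of a curve which is C^1 on [R],
    which makes the derivatives at [u] and [v] one-sided. *)
Definition smooth_arc (gamma : R -> C) (u v : R) : Prop :=
  exists d d' : R -> C,
    (forall t, is_derive (K := R_AbsRing) (V := C_R_NormedModule) d t (d' t)) /\
    (forall t, continuous (T := R_UniformSpace) (U := C_UniformSpace) d' t) /\
    (forall t, u <= t <= v -> gamma t = d t /\ d' t <> RtoC 0).

Definition piecewise_smooth (gamma : R -> C) : Prop :=
  exists (n : nat) (p : nat -> R),
    p 0%nat = 0 /\ p n = 1 /\
    forall i, (i < n)%nat ->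
      p i < p (Datatypes.S i) /\ smooth_arc gamma (p i) (p (Datatypes.S i)).

(** [v] is a right or left derivative of [gamma] at [s]; both are oriented along
    [gamma], and they coincide where [gamma] is smooth. *)
Definition velocity (gamma : R -> C) (s : R) (v : C) : Prop :=
  let q := fun t : R => (RtoC (/ (t - s)) * (gamma t - gamma s))%C in
  (0 <= s < 1 /\ filterlim q (at_right s) (locally (T := C_UniformSpace) v)) \/
  (0 < s <= 1 /\ filterlim q (at_left s) (locally (T := C_UniformSpace) v)).

(** The area of the parallelogram spanned by [v] and [w]: positive iff [w]
    points to the left of [v], zero iff they are parallel. *)
Definition cross (v w : C) : R := Im (Cconj v * w)%C.

(** [gamma] passes twice through [gamma s = gamma t]; the coincidence of the two
    ends of a closed curve does not count. *)
Definition self_intersection (gamma : R -> C) (s t : R) : Prop :=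
  0 <= s /\ s < t /\ t <= 1 /\ gamma s = gamma t /\ ~ (s = 0 /\ t = 1).

Definition transversal_self_intersections (gamma : R -> C) : Prop :=
  forall s t, self_intersection gamma s t ->
    forall v w, velocity gamma s v -> velocity gamma t w -> cross v w <> 0.

(** ** The function [g] on [gamma] *)

Definition punctured (gamma : R -> C) (Sigma : list C) (z : C) : Prop :=
  image gamma z /\ ~ In z Sigma.

(** The segments [gamma_s] are the components of [punctured gamma Sigma].  On a
    segment, [G z] is the germ at [z] of the branch chosen there.  Indexing the
    germs by points of the plane makes [g] single-valued also on a segment which
    closes up, and [g] has neither a jump nor a ramification off [Sigma]. *)
Definition algebraic_on_segments
    (gamma : R -> C) (Sigma : list C) (g : C -> C) : Prop :=
  forall Gs : C -> Prop, is_component (punctured gamma Sigma) Gs ->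
    exists G : C -> C -> C,
      (exists z0, Gs z0 /\ algebraic_germ (G z0) z0) /\
      (forall z, Gs z ->
         holomorphic_at (G z) z /\ G z z = g z /\
         locally z (fun z' : C => Gs z' -> germ_eq z' (G z') (G z))).

(** The germ [f] at [a] of the branch of [g] given on [gamma]; it is unique for
    [a] in [punctured gamma Sigma]. *)
Definition branch_at (gamma : R -> C) (g : C -> C) (a : C) (f : C -> C) : Prop :=
  holomorphic_at f a /\ locally a (fun z : C => image gamma z -> f z = g z).

(** A pole of [g] at [gamma s]: [|g|] tends to infinity on a side of [gamma s]. *)
Definition no_poles_on (gamma : R -> C) (Sigma : list C) (g : C -> C) : Prop :=
  forall s, I01 s -> In (gamma s) Sigma ->
    (s < 1 -> ~ filterlim (fun t : R => Cmod (g (gamma t)))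
                  (at_right s) (Rbar_locally p_infty)) /\
    (0 < s -> ~ filterlim (fun t : R => Cmod (g (gamma t)))
                  (at_left s) (Rbar_locally p_infty)).

(** [z] is singular if some germ of [g] can be continued along a path up to, but
    not including, its end-point [z].  Ramification points and poles of every
    branch of the complete analytic functions defined by [g] are thus singular. *)
Definition singular_point
    (gamma : R -> C) (Sigma : list C) (g : C -> C) (z : C) : Prop :=
  exists (S : R -> C) (f : C -> C),
    continuous_on (T := R_UniformSpace) (U := C_UniformSpace) I01 S /\
    punctured gamma Sigma (S 0) /\ S 1 = z /\
    branch_at gamma g (S 0) f /\
    (forall tau, 0 <= tau < 1 -> exists h, continues_to S 0 tau f h) /\
    ~ (exists h, continues_to S 0 1 f h).

Definition Sigma1 (gamma : R -> C) (Sigma : list C) (g : C -> C) (z : C) : Prop :=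
  singular_point gamma Sigma g z /\ ~ image gamma z.

Definition U_set (gamma : R -> C) (Sigma : list C) (g : C -> C) (z : C) : Prop :=
  ~ In z Sigma /\ ~ Sigma1 gamma Sigma g z.

(** ** The standing assumptions *)

Record setting (gamma : R -> C) (Sigma : list C) (g : C -> C) : Prop := {
  gamma_piecewise_smooth : piecewise_smooth gamma;
  gamma_transversal : transversal_self_intersections gamma;
  Sigma_on_gamma : forall z, In z Sigma -> image gamma z;
  Sigma_end_points :
    gamma 0 <> gamma 1 -> In (gamma 0) Sigma /\ In (gamma 1) Sigma;
  Sigma_multiple_points :
    forall s t, self_intersection gamma s t -> In (gamma s) Sigma;
  g_algebraic : algebraic_on_segments gamma Sigma g;
  g_singular_in_Sigma :
    forall z, singular_point gamma Sigma g z -> image gamma z -> In z Sigma;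
  g_no_poles : no_poles_on gamma Sigma g
}.

(** ** The Cauchy type integral *)

(** At the finitely many break points of [gamma] the value is irrelevant. *)
Definition curve_derivative (gamma : R -> C) (s : R) : C :=
  (Derive (fun t => Re (gamma t)) s, Derive (fun t => Im (gamma t)) s).

Definition cauchy_integral (gamma : R -> C) (g : C -> C) (t : C) : C :=
  (/ (RtoC (2 * PI) * Ci) *
   RInt (V := C_R_CompleteNormedModule)
     (fun s : R => g (gamma s) / (gamma s - t) * curve_derivative gamma s) 0 1)%C.

(** ** Admissible curves and sums of branches *)

(** [S] crosses [gamma] transversally at the parameter [tau], from the right to
    the left if [e = 1] and from the left to the right if [e = -1].  At a point
    of [gamma] which is not smooth, this is asked for both one-sided tangents. *)
Definition crosses (gamma S : R -> C) (tau e : R) : Prop :=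
  (e = 1 \/ e = -1) /\
  exists w : C, is_derive (K := R_AbsRing) (V := C_R_NormedModule) S tau w /\
    forall s v, I01 s -> gamma s = S tau -> velocity gamma s v ->
      0 < e * cross v w.

(** [U_set] contains no point of [Sigma], so the crossings are at interior
    points of segments. *)
Definition admissible (gamma : R -> C) (Sigma : list C) (g : C -> C)
    (c d : C) (S : R -> C) : Prop :=
  ~ image gamma c /\ ~ image gamma d /\
  continuous_on (T := R_UniformSpace) (U := C_UniformSpace) I01 S /\
  S 0 = c /\ S 1 = d /\
  (forall tau, I01 tau -> U_set gamma Sigma g (S tau)) /\
  (forall tau, I01 tau -> image gamma (S tau) -> exists e, crosses gamma S tau e).

(** [h] represents the germ [g(S,gamma)] at [S 1].  The list [l] enumerates the
    parameters of the points of intersection. *)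
Definition sum_of_branches (gamma : R -> C) (g : C -> C) (S : R -> C)
    (h : C -> C) : Prop :=
  exists (l : list R) (e : R -> R) (k : R -> C -> C),
    NoDup l /\
    (forall tau, In tau l <-> I01 tau /\ image gamma (S tau)) /\
    (forall tau, In tau l ->
       crosses gamma S tau (e tau) /\
       exists f, branch_at gamma g (S tau) f /\ continues_to S tau 1 f (k tau)) /\
    germ_eq (S 1) h
      (fun w => fold_right Cplus (RtoC 0)
                  (map (fun tau => (RtoC (e tau) * k tau w)%C) l)).

(** ** The combinatorial monodromy *)

Definition loop_in (E : C -> Prop) (c : C) (S : R -> C) : Prop :=
  continuous_on (T := R_UniformSpace) (U := C_UniformSpace) I01 S /\
  S 0 = c /\ S 1 = c /\ (forall tau, I01 tau -> E (S tau)).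

Definition homotopic_in (E : C -> Prop) (S T : R -> C) : Prop :=
  exists H : R * R -> C,
    continuous_on (T := prod_UniformSpace R_UniformSpace R_UniformSpace)
      (U := C_UniformSpace) (fun x => I01 (fst x) /\ I01 (snd x)) H /\
    (forall x y, I01 x -> I01 y -> E (H (x, y))) /\
    (forall y, I01 y -> H (0, y) = S y /\ H (1, y) = T y) /\
    (forall x, I01 x -> H (x, 0) = S 0 /\ H (x, 1) = S 1).

(** The elements of [pi_1(E,c)], as homotopy classes of loops. *)
Definition is_pi1_class (E : C -> Prop) (c : C) (K : (R -> C) -> Prop) : Prop :=
  exists S0, loop_in E c S0 /\
    forall S, K S <-> loop_in E c S /\ homotopic_in E S0 S.

(** The graph of the combinatorial monodromy: [h] represents its value on the
    class [K]. *)
Definition combinatorial_monodromy (gamma : R -> C) (Sigma : list C) (g : C -> C)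
    (c : C) (K : (R -> C) -> Prop) (h : C -> C) : Prop :=
  exists S, K S /\ admissible gamma Sigma g c c S /\ sum_of_branches gamma g S h.

Definition trivial_monodromy (gamma : R -> C) (Sigma : list C) (g : C -> C)
    (c : C) : Prop :=
  forall K, is_pi1_class (U_set gamma Sigma g) c K ->
    forall h, combinatorial_monodromy gamma Sigma g c K h ->
      germ_eq c h (fun _ => RtoC 0).

(* Main.v *)
(* The integral [I] jumps by the branch of [g] across [gamma].  Hence [I] minus the
 sum of the branches met so far continues analytically along admissible paths.

 If [I] = p/q near [c], the identity q (I - sum) = p propagates along a loop [S], so
 that the sum of branches along [S] vanishes.  Conversely, if the monodromy is trivial,
 then I - sum, continued along arbitrary paths from [c], is single-valued and
 holomorphic off a finite set.  Close to a point of this set a small circle meets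
 [gamma] in a bounded number of points, near which [I] has a controlled growth, and
 [g] is bounded by a power of the distance.  So the singularities are poles, the growth
 at infinity is polynomial, and the function is rational by Liouville's theorem. *)
Require Import Defs.
From Stdlib Require Import Reals List.
From Coquelicot Require Import Coquelicot.
From Stdlib Require Import Lra Lia Psatz Classical ClassicalEpsilon.
From Stdlib Require FinFun.
From HB Require structures.
From mathcomp Require seq all_boot all_order all_algebra boolp.
Open Scope R_scope.

(** One polynomial [P(z,w)] annihilates all the branches of [g] given on the curve. Its separable
    factors satisfy Bezout relations, which bound their derivatives in [w] at the roots from below
    off a finite set. A uniform implicit function theorem then extends every germ annihilated by [P]
    to a disc whose radius does not depend on the germ. The exceptional points go into one finite
    list [Bad]. It may contain points of [U], even the base point [c]: there continuation rests on
    the definition of singular points alone. The continued function is [I] minus a sum of branches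
    whose number of terms is not bounded a priori, since paths may wind around a point. So the terms
    are counted: moving along a path raises the number needed only where the path meets the curve.
    Starting on a ray that avoids the curve near the point, one number serves for all small circles
    around it. The jump of [I] is computed with explicit logarithms: near a crossing the curve is a
    graph, and turning the cut to either side of it gives two expressions that differ by
    [2 pi i]. *)

Notation "`| x |" := (Cmod x) (at level 0, format "`| x |").

#[global] Hint Resolve Cmod_ge_0 : core.

(** * Tactics and elementary inequalities for the modulus *)

Lemma lt_minl {x a b : R} : x < Rmin a b -> x < a.
Proof. intros H. eapply Rlt_le_trans. apply H. apply Rmin_l. Qed.

Lemma lt_minr {x a b : R} : x < Rmin a b -> x < b.
Proof. intros H. eapply Rlt_le_trans. apply H. apply Rmin_r. Qed.

Ltac rmin_of a b := lazymatch goal with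
 | _ : Rmin a b <= a |- _ => fail
 | _ => assert (Rmin a b <= a) by apply Rmin_l; assert (Rmin a b <= b) by apply Rmin_r
 end.

Ltac rmin := repeat match goal with
 | _ : context [Rmin ?a ?b] |- _ => rmin_of a b
 | |- context [Rmin ?a ?b] => rmin_of a b
 end.

Ltac ar := intros; unfold I01 in *; rmin; lra.

Ltac cpos x := lazymatch goal with _ : 0 <= Cmod x |- _ => fail | _ => assert (0 <= Cmod x) by apply Cmod_ge_0 end.

Ltac cm := repeat match goal with |- context [Cmod ?x] => cpos x | _ : context [Cmod ?x] |- _ => cpos x end; lra.

Ltac tri := eapply Rle_trans; [apply Cmod_triangle|].

Ltac minmax := rewrite Rmin_left, Rmax_right by lra.

Ltac sa := split; auto.

Ltac pos := solve [repeat first [assumption | apply Rmin_glb_lt | apply Rdiv_lt_0_compat | apply Rmult_lt_0_compat]; auto; lra].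

Ltac sp := split; [first [lra|pos]|].

Ltac rabs := apply Rabs_def1; lra.

Notation LRA := (ltac:(lra)) (only parsing).

Lemma norm_C_R (z : C) : @norm R_AbsRing C_R_NormedModule z = `|z|.
Proof.
 change (sqrt (Rabs (fst z) ^ 2 + Rabs (snd z) ^ 2) = `|z|).
 unfold Cmod. now rewrite !pow2_abs.
Qed.

Lemma Cmod_minus_sym (x y : C) : `|x - y| = `|y - x|.
Proof. rewrite <- Cmod_opp. f_equal. ring. Qed.

Lemma Cmod_triangle_minus (x y z : C) : `|x - z| <= `|x - y| + `|y - z|.
Proof. replace (x - z)%C with ((x - y) + (y - z))%C by ring. apply Cmod_triangle. Qed.

(** A marker for the context: [triang] records with it the complex numbers that occur in distances,
    and then instantiates the triangle inequality once for each triple of them. *)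
Definition point (x : C) := True.

Ltac mark x := lazymatch goal with _ : point x |- _ => fail | _ => assert (point x) by exact I end.

Ltac triang := intros; rmin;
 repeat match goal with |- context [Cmod (?x - ?y)] => first [mark x|mark y] | _ : context [Cmod (?x - ?y)] |- _ => first [mark x|mark y] end;
 repeat match goal with _ : point ?x, _ : point ?y |- _ => lazymatch goal with
  | _ : Cmod (x - y) = Cmod (y - x) |- _ => fail
  | _ => assert (Cmod (x - y) = Cmod (y - x)) by apply Cmod_minus_sym end end;
 repeat match goal with _ : point ?x, _ : point ?y, _ : point ?z |- _ => lazymatch goal with
  | _ : Cmod (x - z) <= Cmod (x - y) + Cmod (y - z) |- _ => fail
  | _ => assert (Cmod (x - z) <= Cmod (x - y) + Cmod (y - z)) by apply Cmod_triangle_minus end end;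
 cm.

Lemma Cmod_minus_le (x y : C) : `|x - y| <= `|x| + `|y|.
Proof. unfold Cminus. rewrite <- (Cmod_opp y). apply Cmod_triangle. Qed.

Lemma Cmod_minus_ge (x y : C) : `|x| - `|y| <= `|x - y|.
Proof. generalize (Cmod_triangle (x - y) y). replace (x - y + y)%C with x by ring. lra. Qed.

Lemma Cmod_plus_ge (x y : C) : `|x| - `|y| <= `|x + y|.
Proof. rewrite <- (Cmod_opp y). replace (x + y)%C with (x - - y)%C by ring. apply Cmod_minus_ge. Qed.

Lemma Cmod_sub_self (x : C) : `|x - x| = 0.
Proof. replace (x - x)%C with (RtoC 0) by ring. apply Cmod_0. Qed.

Ltac self := rewrite Cmod_sub_self; auto; lra.

Lemma Cmod_eq_zero (x : C) : `|x| <= 0 -> x = RtoC 0.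
Proof. intros H. apply Cmod_eq_0. generalize (Cmod_ge_0 x). lra. Qed.

Lemma Cmod_small (x : C) : (forall e, 0 < e -> `|x| <= e) -> x = RtoC 0.
Proof.
 intros H. apply Cmod_eq_zero. apply Rnot_lt_le. intros L.
 specialize (H (`|x| / 2)). lra.
Qed.

Lemma Cminus_eq0 (x y : C) : (x - y)%C = RtoC 0 -> x = y.
Proof. intros H. replace x with (x - y + y)%C by ring. rewrite H. ring. Qed.

Lemma Cminus_neq0 (x y : C) : x <> y -> (x - y)%C <> RtoC 0.
Proof. intros H E. apply H. now apply Cminus_eq0. Qed.

Lemma Cmult_integral (x y : C) : (x * y)%C = RtoC 0 -> x = RtoC 0 \/ y = RtoC 0.
Proof.
 intros H. destruct (Ceq_dec x 0) as [|Hx]; auto. destruct (Ceq_dec y 0) as [|Hy]; auto.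
 now destruct (Cmult_neq_0 x y Hx Hy).
Qed.

Lemma im_le_Cmod (z : C) : Rabs (Im z) <= `|z|.
Proof. eapply Rle_trans; [|apply Rmax_Cmod]. apply Rmax_r. Qed.

Lemma Cmod_le_re_im (z : C) : `|z| <= Rabs (Re z) + Rabs (Im z).
Proof.
 unfold Cmod, Re, Im. destruct z as [x y]. simpl fst; simpl snd.
 rewrite <- (sqrt_Rsqr (Rabs x + Rabs y)).
 - apply sqrt_le_1_alt. unfold Rsqr. rewrite <- (pow2_abs x), <- (pow2_abs y).
  generalize (Rabs_pos x) (Rabs_pos y). nra.
 - generalize (Rabs_pos x) (Rabs_pos y). lra.
Qed.

Lemma C_ext (x y : C) : Re x = Re y -> Im x = Im y -> x = y.
Proof. destruct x, y. unfold Re, Im. simpl. congruence. Qed.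

(** * The topology of [C] and differentiability *)

(** The balls of the uniform structure of [C] are squares. A square contains the disc of the same
    radius, and a disc of radius [r] contains the square of radius [r/2]. *)
Lemma locally_Cmod (z : C) (P : C -> Prop) :
 locally z P <-> exists r, 0 < r /\ forall w, `|w - z| < r -> P w.
Proof.
 split.
 - intros [e He]. exists e. split; [apply cond_pos|]. intros w Hw. apply He.
  change (Rabs (fst w - fst z) < e /\ Rabs (snd w - snd z) < e).
  split; (eapply Rle_lt_trans; [|apply Hw]).
  + apply (re_le_Cmod (w - z)).
  + apply (im_le_Cmod (w - z)).
 - intros [r [Hr H]]. assert (Hr2 : 0 < r / 2) by lra. exists (mkposreal _ Hr2).
  intros w [H1 H2]. apply H. eapply Rle_lt_trans. apply Cmod_le_re_im.
  change (Rabs (Re (w - z)) < r/2) in H1. change (Rabs (Im (w - z)) < r/2) in H2. lra.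
Qed.

Lemma locally_Rabs (t : R) (P : R -> Prop) :
 locally t P <-> exists r, 0 < r /\ forall s, Rabs (s - t) < r -> P s.
Proof.
 split.
 - intros [e He]. exists e. split; [apply cond_pos|]. auto.
 - intros [r [Hr H]]. exists (mkposreal _ Hr). auto.
Qed.

Definition cderiv (f : C -> C) (z l : C) : Prop :=
 forall e, 0 < e -> exists d, 0 < d /\ forall w, `|w - z| < d ->
  `|f w - f z - l * (w - z)| <= e * `|w - z|.

Lemma cderiv_is_derive (f : C -> C) (z l : C) :
 is_derive (K := C_AbsRing) (V := C_NormedModule) f z l <-> cderiv f z l.
Proof.
 split.
 - intros [_ H] e He. specialize (H z (fun P HP => HP) (mkposreal e He)).
  apply locally_C in H. apply locally_Cmod in H. destruct H as [r [Hr H]].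
  exists r. sa. intros w Hw. specialize (H w Hw).
  change (Cmod (f w - f z - (w - z) * l)%C <= e * `|w - z|) in H.
  now replace (f w - f z - l * (w - z))%C with (f w - f z - (w - z) * l)%C by ring.
 - intros H. split.
  + apply is_linear_scal_l.
  + intros x Hx. apply (@is_filter_lim_locally_unique C_AbsRing (AbsRing_NormedModule C_AbsRing) z x) in Hx.
   rewrite <- Hx.
   intros e. destruct (H e (cond_pos e)) as [d [Hd H']].
   apply (proj1 (locally_C z _)). apply locally_Cmod. exists d. sa.
   intros w Hw. specialize (H' w Hw).
   change (Cmod (f w - f z - (w - z) * l)%C <= e * `|w - z|).
   now replace (f w - f z - (w - z) * l)%C with (f w - f z - l * (w - z))%C by ring.
Qed.

Definition rderiv (f : R -> C) (t : R) (l : C) : Prop :=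
 forall e, 0 < e -> exists d, 0 < d /\ forall s, Rabs (s - t) < d ->
  `|f s - f t - RtoC (s - t) * l| <= e * Rabs (s - t).

Lemma rderiv_is_derive (f : R -> C) (t : R) (l : C) :
 is_derive (K := R_AbsRing) (V := C_R_NormedModule) f t l <-> rderiv f t l.
Proof.
 split.
 - intros [_ H] e He. specialize (H t (fun P HP => HP) (mkposreal e He)).
  apply locally_Rabs in H. destruct H as [r [Hr H]].
  exists r. sa. intros w Hw. specialize (H w Hw). rewrite norm_C_R in H.
  change (norm (minus w t)) with (Rabs (w - t)) in H. simpl pos in H.
  rewrite <- scal_R_Cmult. auto.
 - intros H. split.
  + apply is_linear_scal_l.
  + intros x Hx. apply (@is_filter_lim_locally_unique R_AbsRing (AbsRing_NormedModule R_AbsRing) t x) in Hx.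
   rewrite <- Hx.
   intros e. destruct (H e (cond_pos e)) as [d [Hd H']].
   apply locally_Rabs. exists d. sa.
   intros w Hw. specialize (H' w Hw). rewrite norm_C_R.
   change (norm (minus w t)) with (Rabs (w - t)). rewrite <- scal_R_Cmult in H'. auto.
Qed.

Definition ccont (f : C -> C) (z : C) : Prop :=
 forall e, 0 < e -> exists d, 0 < d /\ forall w, `|w - z| < d -> `|f w - f z| < e.

Definition rcont (f : R -> C) (t : R) : Prop :=
 forall e, 0 < e -> exists d, 0 < d /\ forall s, Rabs (s - t) < d -> `|f s - f t| < e.

Lemma rcont_continuous (f : R -> C) (t : R) :
 continuous (T := R_UniformSpace) (U := C_UniformSpace) f t <-> rcont f t.
Proof.
 split.
 - intros H e He. apply locally_Rabs.
  apply (H (fun w => `|w - f t| < e)). apply locally_Cmod. eauto.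
 - intros H P HP. apply locally_Cmod in HP. destruct HP as [r [Hr HP]].
  destruct (H r Hr) as [d [Hd H']]. apply locally_Rabs. eauto.
Qed.

(* [B d x] says that [x] is [d]-close to the base point. *)
Definition tends {T} (B : R -> T -> Prop) (f : T -> C) (l : C) : Prop :=
 forall e, 0 < e -> exists d, 0 < d /\ forall x, B d x -> `|f x - l| < e.

Lemma tends_minus {T} (B : R -> T -> Prop) f g l m : (forall d d' x, d <= d' -> B d x -> B d' x) -> tends B f l -> tends B g m ->
 tends B (fun x => f x - g x)%C (l - m)%C.
Proof.
 intros HB H1 H2 e He. destruct (H1 (e / 2)) as [d1 [Hd1 K1]]. lra. destruct (H2 (e / 2)) as [d2 [Hd2 K2]]. lra.
 exists (Rmin d1 d2). sp. intros x Hx. specialize (K1 x (HB _ _ x (Rmin_l _ _) Hx)). specialize (K2 x (HB _ _ x (Rmin_r _ _) Hx)).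
 replace (f x - g x - (l - m))%C with ((f x - l) - (g x - m))%C by ring. eapply Rle_lt_trans. apply Cmod_minus_le. lra.
Qed.

Lemma tends_mult {T} (B : R -> T -> Prop) f g l m : (forall d d' x, d <= d' -> B d x -> B d' x) -> tends B f l -> tends B g m ->
 tends B (fun x => f x * g x)%C (l * m)%C.
Proof.
 intros HB H1 H2 e He. set (A := 2 * (1 + `|l| + `|m|)). assert (PA : 0 < A) by (unfold A; generalize (Cmod_ge_0 l) (Cmod_ge_0 m); lra).
 set (q := Rmin 1 (e / A)). assert (Hq : 0 < q) by pos. assert (Hq1 : q <= 1) by apply Rmin_l.
 assert (Hq2 : q * A <= e). { apply Rle_div_r; auto. apply Rmin_r. }
 destruct (H1 q Hq) as [d1 [Hd1 K1]]. destruct (H2 q Hq) as [d2 [Hd2 K2]].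
 exists (Rmin d1 d2). sp. intros x Hx. specialize (K1 x (HB _ _ x (Rmin_l _ _) Hx)). specialize (K2 x (HB _ _ x (Rmin_r _ _) Hx)).
 replace (f x * g x - l * m)%C with ((f x - l) * (g x - m) + ((f x - l) * m + l * (g x - m)))%C by ring.
 eapply Rle_lt_trans. apply Cmod_triangle. eapply Rle_lt_trans. apply Rplus_le_compat_l, Cmod_triangle.
 rewrite !Cmod_mult. generalize (Cmod_ge_0 l) (Cmod_ge_0 m) (Cmod_ge_0 (f x - l)) (Cmod_ge_0 (g x - m)). intros. unfold A in *. nra.
Qed.

Lemma tends_of_linear {T} (B : R -> T -> Prop) (X : T -> C) f f0 l : (forall d d' x, d <= d' -> B d x -> B d' x) -> (forall d x, B d x -> `|X x| < d) ->
 (exists d, 0 < d /\ forall x, B d x -> `|f x - f0 - l * X x| <= `|X x|) -> tends B f f0.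
Proof.
 intros HB HX [d [Hd H]] e He. generalize (Cmod_ge_0 l); intros Hl. exists (Rmin d (e / (2 + `|l|))). split. pos.
 intros x Hx. specialize (H x (HB _ _ x (Rmin_l _ _) Hx)). assert (Q := HX _ x (HB _ _ x (Rmin_r _ _) Hx)).
 replace (f x - f0)%C with ((f x - f0 - l * X x) + l * X x)%C by ring.
 eapply Rle_lt_trans. apply Cmod_triangle. rewrite Cmod_mult. apply Rlt_div_r in Q; [|lra]. nra.
Qed.

(** Proved for an abstract family [B] of neighbourhoods and an increment [X], so that one argument
    serves both for curves and for functions of a complex variable. *)
Lemma chain_rule {T} (B : R -> T -> Prop) (X : T -> C) f g f0 l m : (forall d d' x, d <= d' -> B d x -> B d' x) -> tends B f f0 ->
 (forall e, 0 < e -> exists d, 0 < d /\ forall x, B d x -> `|f x - f0 - l * X x| <= e * `|X x|) -> cderiv g f0 m ->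
 forall e, 0 < e -> exists d, 0 < d /\ forall x, B d x -> `|g (f x) - g f0 - m * l * X x| <= e * `|X x|.
Proof.
 intros HB Hf H1 H2 e He. set (A := 2 + `|l| + `|m|). assert (PA : 0 < A) by (unfold A; generalize (Cmod_ge_0 l) (Cmod_ge_0 m); lra).
 set (q := Rmin 1 (e / A)). assert (Hq : 0 < q) by pos. assert (Hq1 : q <= 1) by apply Rmin_l.
 assert (Hq2 : q * A <= e). { apply Rle_div_r; auto. apply Rmin_r. }
 destruct (H2 _ Hq) as [d2 [Hd2 K2]]. destruct (Hf d2 Hd2) as [d3 [Hd3 K3]]. destruct (H1 _ Hq) as [d1 [Hd1 K1]].
 exists (Rmin d1 d3). sp. intros x Hx. specialize (K1 x (HB _ _ x (Rmin_l _ _) Hx)). specialize (K2 _ (K3 x (HB _ _ x (Rmin_r _ _) Hx))).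
 replace (g (f x) - g f0 - m * l * X x)%C with ((g (f x) - g f0 - m * (f x - f0)) + m * (f x - f0 - l * X x))%C by ring.
 tri. rewrite Cmod_mult.
 assert (`|f x - f0| <= (q + `|l|) * `|X x|).
 { replace (f x - f0)%C with ((f x - f0 - l * X x) + l * X x)%C by ring. tri. rewrite Cmod_mult. lra. }
 generalize (Cmod_ge_0 (X x)) (Cmod_ge_0 l) (Cmod_ge_0 m); intros P1 P2 P3.
 assert (q * `|f x - f0| <= q * ((q + `|l|) * `|X x|)) by nra.
 assert (`|m| * `|f x - f0 - l * X x| <= `|m| * (q * `|X x|)) by nra.
 apply Rle_trans with (q * A * `|X x|); [|apply Rmult_le_compat_r; lra].
 replace (q * A * `|X x|) with (q * (`|X x| * A)) by ring. apply Rle_trans with (q * (`|X x| * (q + `|l| + `|m|))); [lra|].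
 apply Rmult_le_compat_l; [lra|]. apply Rmult_le_compat_l; [lra|]. unfold A. lra.
Qed.

Lemma rderiv_linear f t l : rderiv f t l <-> forall e, 0 < e -> exists d, 0 < d /\ forall s, Rabs (s - t) < d ->
 `|f s - f t - l * RtoC (s - t)| <= e * `|RtoC (s - t)|.
Proof.
 split; intros H e He; destruct (H e He) as [d [Hd K]]; exists d; sa; intros s Hs; specialize (K s Hs); rewrite Cmod_R, (Cmult_comm l) in *; auto.
Qed.

Lemma ccont_minus f g z : ccont f z -> ccont g z -> ccont (fun w => f w - g w)%C z.
Proof. apply (tends_minus (fun d w => `|w - z| < d)). ar. Qed.

Lemma ccont_mult f g z : ccont f z -> ccont g z -> ccont (fun w => f w * g w)%C z.
Proof. apply (tends_mult (fun d w => `|w - z| < d)). ar. Qed.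

Lemma rcont_mult f g t : rcont f t -> rcont g t -> rcont (fun t => f t * g t)%C t.
Proof. apply (tends_mult (fun d s => Rabs (s - t) < d)). ar. Qed.

Lemma cderiv_ccont f z l : cderiv f z l -> ccont f z.
Proof.
 intros H. apply (tends_of_linear (fun d w => `|w - z| < d) (fun w => (w - z)%C) f (f z) l); auto. ar.
 destruct (H 1 Rlt_0_1) as [d [Hd K]]. exists d. sa. intros x Hx. specialize (K x Hx). lra.
Qed.

Lemma rderiv_rcont f t l : rderiv f t l -> rcont f t.
Proof.
 intros H. apply (tends_of_linear (fun d s => Rabs (s - t) < d) (fun s => RtoC (s - t)) f (f t) l). ar. intros; now rewrite Cmod_R.
 destruct (proj1 (rderiv_linear f t l) H 1 Rlt_0_1) as [d [Hd K]]. exists d. sa. intros x Hx. specialize (K x Hx). lra.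
Qed.

Lemma cderiv_ext_loc f g z l r : 0 < r -> (forall w, `|w - z| < r -> f w = g w) ->
 cderiv f z l -> cderiv g z l.
Proof.
 intros Hr E H e He. destruct (H e He) as [d [Hd H']].
 exists (Rmin d r). sp.
 intros w Hw. rewrite <- !E; [|self |].
 - apply H'. apply (lt_minl Hw).
 - ar.
Qed.

Lemma cderiv_const c z : cderiv (fun _ => c) z 0.
Proof.
 intros e He. exists 1. sp. intros w _.
 replace (c - c - 0 * (w - z))%C with (RtoC 0) by ring. rewrite Cmod_0.
 generalize (Cmod_ge_0 (w - z)). nra.
Qed.

Lemma cderiv_id z : cderiv (fun w => w) z 1.
Proof.
 intros e He. exists 1. sp. intros w _.
 replace (w - z - 1 * (w - z))%C with (RtoC 0) by ring. rewrite Cmod_0.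
 generalize (Cmod_ge_0 (w - z)). nra.
Qed.

Lemma cderiv_plus f g z l m : cderiv f z l -> cderiv g z m -> cderiv (fun w => f w + g w)%C z (l + m).
Proof.
 intros H1 H2 e He. assert (He2 : 0 < e / 2) by lra.
 destruct (H1 _ He2) as [d1 [Hd1 K1]]. destruct (H2 _ He2) as [d2 [Hd2 K2]].
 exists (Rmin d1 d2). sp. intros w Hw.
 specialize (K1 w (lt_minl Hw)).
 specialize (K2 w (lt_minr Hw)).
 replace (f w + g w - (f z + g z) - (l + m) * (w - z))%C
  with ((f w - f z - l * (w - z)) + (g w - g z - m * (w - z)))%C by ring.
 tri. lra.
Qed.

Lemma cderiv_mult f g z l m : cderiv f z l -> cderiv g z m ->
 cderiv (fun w => f w * g w)%C z (l * g z + f z * m).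
Proof.
 intros H1 H2 e He.
 pose (A := 3 * (1 + `|g z| + `|f z| + `|l| + 1)).
 assert (PA : 0 < A) by (unfold A; generalize (Cmod_ge_0 (g z)) (Cmod_ge_0 (f z)) (Cmod_ge_0 l); lra).
 assert (He2 : 0 < e / A) by pos.
 destruct (H1 _ He2) as [d1 [Hd1 K1]]. destruct (H2 _ He2) as [d2 [Hd2 K2]].
 destruct (cderiv_ccont _ _ _ H2 (Rmin 1 (e / A))) as [d3 [Hd3 K3]]. pos.
 exists (Rmin d1 (Rmin d2 d3)). sp. intros w Hw.
 specialize (K1 w (lt_minl Hw)).
 assert (Hw' := lt_minr Hw).
 specialize (K2 w (lt_minl Hw')).
 specialize (K3 w (lt_minr Hw')).
 assert (K4 := lt_minl K3).
 assert (K5 := lt_minr K3).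
 replace (f w * g w - f z * g z - (l * g z + f z * m) * (w - z))%C
  with ((f w - f z - l * (w - z)) * g w + (l * (g w - g z)) * (w - z)
     + f z * (g w - g z - m * (w - z)))%C by ring.
 assert (G : `|g w| <= 1 + `|g z|).
 { replace (g w) with ((g w - g z) + g z)%C by ring.
  tri. lra. }
 tri.
 eapply Rle_trans. apply Rplus_le_compat_r, Cmod_triangle.
 rewrite !Cmod_mult. set (D := `|w - z|) in *.
 assert (PD : 0 <= D) by apply Cmod_ge_0.
 assert (E : e = e / A * A) by (field; lra).
 set (q := e / A) in *. 
 assert (B1 : `|f w - f z - l * (w - z)| * `|g w| <= (q * D) * (1 + `|g z|)).
 { apply Rmult_le_compat; auto. }
 assert (B2 : `|l| * `|g w - g z| * D <= `|l| * q * D).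
 { apply Rmult_le_compat_r; auto. apply Rmult_le_compat_l; auto. lra. }
 assert (B3 : `|f z| * `|g w - g z - m * (w - z)| <= `|f z| * (q * D)).
 { apply Rmult_le_compat_l; auto. }
 assert (PqD : 0 <= q * D) by nra.
 assert (Fin : (q * D) * (1 + `|g z|) + `|l| * q * D + `|f z| * (q * D) <= q * A * D).
 { replace (q * A * D) with (q * D * A) by ring.
  replace ((q * D) * (1 + `|g z|) + `|l| * q * D + `|f z| * (q * D))
   with (q * D * (1 + `|g z| + `|l| + `|f z|)) by ring.
  apply Rmult_le_compat_l; auto. unfold A.
  generalize (Cmod_ge_0 (g z)) (Cmod_ge_0 (f z)) (Cmod_ge_0 l); lra. }
 rewrite E. lra.
Qed.

Lemma cderiv_ext f g z l : (forall w, f w = g w) -> cderiv f z l -> cderiv g z l.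
Proof. intros E. apply (cderiv_ext_loc f g z l 1); auto. lra. Qed.

Lemma cderiv_val f z l m : l = m -> cderiv f z l -> cderiv f z m.
Proof. now intros ->. Qed.

Lemma cderiv_scal c f z l : cderiv f z l -> cderiv (fun w => c * f w)%C z (c * l).
Proof.
 intros H. eapply cderiv_val; [|apply cderiv_mult; [apply cderiv_const|apply H]]. cbv beta; ring.
Qed.

Lemma cderiv_minus f g z l m : cderiv f z l -> cderiv g z m -> cderiv (fun w => f w - g w)%C z (l - m).
Proof.
 intros H1 H2. apply (cderiv_ext (fun w => f w + RtoC (-1) * g w)%C).
 - intros w. ring.
 - eapply cderiv_val; [|apply cderiv_plus; [apply H1|apply cderiv_scal, H2]]. ring.
Qed.

Lemma cderiv_comp f g z l m : cderiv f z l -> cderiv g (f z) m -> cderiv (fun w => g (f w)) z (m * l).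
Proof. intros H1 H2. refine (chain_rule (fun d w => `|w - z| < d) (fun w => (w - z)%C) f g (f z) l m _ (cderiv_ccont _ _ _ H1) H1 H2). ar. Qed.

Lemma rderiv_comp f g t l m : rderiv f t l -> cderiv g (f t) m -> rderiv (fun w => g (f w)) t (m * l).
Proof.
 intros H1 H2. apply (proj2 (rderiv_linear _ _ _)). refine (chain_rule (fun d s => Rabs (s - t) < d) (fun s => RtoC (s - t)) f g (f t) l m _ (rderiv_rcont _ _ _ H1) (proj1 (rderiv_linear f t l) H1) H2). ar.
Qed.

Lemma cderiv_inv z : z <> RtoC 0 -> cderiv Cinv z (- / (z * z)).
Proof.
 intros Hz e He. assert (Pz : 0 < `|z|) by now apply Cmod_gt_0.
 set (M := `|z|). fold M in Pz.
 exists (Rmin (M / 2) (e * (M * M * M) / 2)). split. pos.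
 intros w Hw. assert (H1 := lt_minl Hw).
 assert (H2 := lt_minr Hw).
 assert (Pw : M / 2 < `|w|).
 { generalize (Cmod_minus_ge z w). rewrite (Cmod_minus_sym z w). fold M. lra. }
 assert (Hw0 : w <> RtoC 0) by (apply Cmod_gt_0; lra).
 replace (/ w - / z - - / (z * z) * (w - z))%C with ((w - z) * ((w - z) * / (w * (z * z))))%C
  by (field; auto).
 rewrite Cmod_mult, Rmult_comm. apply Rmult_le_compat_r; [apply Cmod_ge_0|].
 rewrite Cmod_mult, Cmod_inv by (repeat apply Cmult_neq_0; auto).
 rewrite !Cmod_mult. fold M.
 assert (PP : 0 < `|w| * (M * M)) by pos.
 apply Rle_div_l; auto. 
 apply Rlt_le. eapply Rlt_le_trans. eauto.
 replace (e * (M * M * M) / 2) with (e * (M / 2 * (M * M))) by lra.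
 apply Rmult_le_compat_l; [lra|]. nra.
Qed.

Lemma cderiv_div f g z l m : cderiv f z l -> cderiv g z m -> g z <> RtoC 0 ->
 cderiv (fun w => f w / g w)%C z ((l * g z - f z * m) / (g z * g z)).
Proof.
 intros H1 H2 Hz. eapply cderiv_val; [|apply cderiv_mult; [apply H1|]].
 2:{ apply (cderiv_comp g Cinv z m _ H2 (cderiv_inv _ Hz)). }
 cbv beta; field; auto.
Qed.

(** * Holomorphic functions *)

Definition holo (f : C -> C) (z : C) : Prop := exists l, cderiv f z l.

Definition hold (f : C -> C) (a : C) (r : R) : Prop := forall z, `|z - a| < r -> holo f z.

Lemma holomorphic_at_hold f a : holomorphic_at f a <-> exists r, 0 < r /\ hold f a r.
Proof.
 unfold holomorphic_at. rewrite locally_Cmod.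
 split; intros [r [Hr H]]; exists r; split; auto; intros z Hz.
 - destruct (H z Hz) as [l Hl]. exists l. now apply cderiv_is_derive.
 - destruct (H z Hz) as [l Hl]. exists l. now apply cderiv_is_derive.
Qed.

Lemma germ_eq_Cmod z f h : germ_eq z f h <-> exists r, 0 < r /\ forall w, `|w - z| < r -> f w = h w.
Proof. apply locally_Cmod. Qed.

Lemma hold_sub f a r b s : hold f a r -> `|b - a| + s <= r -> hold f b s.
Proof.
 intros H L z Hz. apply H. triang.
Qed.

Lemma hold_holo f a r : 0 < r -> hold f a r -> holo f a.
Proof. intros Hr H. apply H. self. Qed.

Lemma holo_ccont f z : holo f z -> ccont f z.
Proof. intros [l H]. now apply cderiv_ccont with l. Qed.

Lemma holo_ext_loc f g z r : 0 < r -> (forall w, `|w - z| < r -> f w = g w) ->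
 holo f z -> holo g z.
Proof. intros Hr E [l H]. exists l. eapply cderiv_ext_loc; eauto. Qed.

Lemma hold_ext f g a r : (forall w, `|w - a| < r -> f w = g w) -> hold f a r -> hold g a r.
Proof.
 intros E H z Hz. apply (holo_ext_loc f g z (r - `|z - a|)). lra.
 - intros w Hw. apply E. generalize (Cmod_triangle_minus w z a). lra.
 - now apply H.
Qed.

Lemma holo_const c z : holo (fun _ => c) z.
Proof. eexists; apply cderiv_const. Qed.
Lemma holo_id z : holo (fun w => w) z.
Proof. eexists; apply cderiv_id. Qed.
Lemma holo_plus f g z : holo f z -> holo g z -> holo (fun w => f w + g w)%C z.
Proof. intros [l H] [m K]. eexists; apply cderiv_plus; eauto. Qed.
Lemma holo_minus f g z : holo f z -> holo g z -> holo (fun w => f w - g w)%C z.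
Proof. intros [l H] [m K]. eexists; apply cderiv_minus; eauto. Qed.
Lemma holo_mult f g z : holo f z -> holo g z -> holo (fun w => f w * g w)%C z.
Proof. intros [l H] [m K]. eexists; apply cderiv_mult; eauto. Qed.
Lemma holo_div f g z : holo f z -> holo g z -> g z <> RtoC 0 -> holo (fun w => f w / g w)%C z.
Proof. intros [l H] [m K] Hz. eexists; apply cderiv_div; eauto. Qed.
Lemma holo_comp f g z : holo f z -> holo g (f z) -> holo (fun w => g (f w)) z.
Proof. intros [l H] [m K]. eexists; eapply cderiv_comp; eauto. Qed.
Lemma holo_pow f z n : holo f z -> holo (fun w => f w ^ n)%C z.
Proof.
 intros H. induction n; simpl. apply holo_const. now apply holo_mult.
Qed.

#[global] Hint Resolve holo_const holo_id holo_plus holo_minus holo_mult holo_pow : core.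

(** * Integrals of complex valued functions *)

Definition is_CI (f : R -> C) (a b : R) (l : C) := is_RInt (V := C_R_NormedModule) f a b l.
Definition ex_CI (f : R -> C) (a b : R) := exists l, is_CI f a b l.
Definition CI (f : R -> C) (a b : R) : C := RInt (V := C_R_CompleteNormedModule) f a b.

Lemma is_CI_unique f a b l : is_CI f a b l -> CI f a b = l.
Proof. apply (is_RInt_unique (V := C_R_CompleteNormedModule)). Qed.

Lemma ex_CI_is f a b : ex_CI f a b -> is_CI f a b (CI f a b).
Proof. apply (RInt_correct (V := C_R_CompleteNormedModule)). Qed.

Lemma is_CI_parts f a b l :
 is_CI f a b l <-> is_RInt (fun t => Re (f t)) a b (Re l) /\ is_RInt (fun t => Im (f t)) a b (Im l).
Proof.
 split.
 - intros H. split.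
  + apply (is_RInt_fct_extend_fst (U := R_NormedModule) (V := R_NormedModule) _ _ _ _ H).
  + apply (is_RInt_fct_extend_snd (U := R_NormedModule) (V := R_NormedModule) _ _ _ _ H).
 - intros [H1 H2].
  apply (is_RInt_fct_extend_pair (U := R_NormedModule) (V := R_NormedModule) f a b (Re l) (Im l) H1 H2).
Qed.

Lemma is_CI_plus f g a b l m : is_CI f a b l -> is_CI g a b m -> is_CI (fun t => f t + g t)%C a b (l + m)%C.
Proof. apply (is_RInt_plus (V := C_R_NormedModule)). Qed.

Lemma is_CI_minus f g a b l m : is_CI f a b l -> is_CI g a b m -> is_CI (fun t => f t - g t)%C a b (l - m)%C.
Proof. apply (is_RInt_minus (V := C_R_NormedModule)). Qed.

(** The integral takes its values in a real normed module, so a complex factor is pulled out through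
    the real and imaginary parts. *)
Lemma is_CI_scal c f a b l : is_CI f a b l -> is_CI (fun t => c * f t)%C a b (c * l)%C.
Proof.
 intros H. apply is_CI_parts in H. destruct H as [H1 H2]. apply is_CI_parts. split.
 - apply (is_RInt_ext (fun t => minus (scal (Re c) (Re (f t))) (scal (Im c) (Im (f t))))). auto.
  rewrite re_mult. refine (is_RInt_minus (V := R_NormedModule) _ _ _ _ _ _ _ _); now apply (is_RInt_scal (V := R_NormedModule)).
 - apply (is_RInt_ext (fun t => plus (scal (Re c) (Im (f t))) (scal (Im c) (Re (f t))))). auto.
  rewrite im_mult. refine (is_RInt_plus (V := R_NormedModule) _ _ _ _ _ _ _ _); now apply (is_RInt_scal (V := R_NormedModule)).
Qed.

Lemma is_CI_ext f g a b l : (forall t, Rmin a b < t < Rmax a b -> f t = g t) -> is_CI f a b l -> is_CI g a b l.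
Proof. apply (is_RInt_ext (V := C_R_NormedModule)). Qed.

Lemma is_CI_Chasles f a b c l m : is_CI f a b l -> is_CI f b c m -> is_CI f a c (l + m)%C.
Proof. apply (is_RInt_Chasles (V := C_R_NormedModule)). Qed.

Lemma is_CI_const c a b : is_CI (fun _ => c) a b (RtoC (b - a) * c)%C.
Proof. rewrite <- scal_R_Cmult. apply (is_RInt_const (V := C_R_NormedModule)). Qed.

Lemma ex_CI_cont f a b : (forall t, Rmin a b <= t <= Rmax a b -> rcont f t) -> ex_CI f a b.
Proof.
 intros H. apply (ex_RInt_continuous (V := C_R_CompleteNormedModule)).
 intros t Ht. apply (proj2 (rcont_continuous f t)). auto.
Qed.

Lemma is_CI_FTC f df a b : (forall t, Rmin a b <= t <= Rmax a b -> rderiv f t (df t)) ->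
 (forall t, Rmin a b <= t <= Rmax a b -> rcont df t) -> is_CI df a b (f b - f a)%C.
Proof.
 intros H1 H2. apply (is_RInt_derive (V := C_R_CompleteNormedModule)).
 - intros t Ht. apply rderiv_is_derive. auto.
 - intros t Ht. apply (proj2 (rcont_continuous df t)). auto.
Qed.

Lemma is_CI_norm f a b l M : a <= b -> (forall t, a < t < b -> `|f t| <= M) ->
 is_CI f a b l -> `|l| <= M * (b - a).
Proof.
 intros Hab HM H. rewrite <- norm_C_R.
 destruct (Req_dec a b) as [<-|Hne].
 { replace l with (@zero C_R_NormedModule). rewrite norm_zero. lra.
  rewrite <- (is_CI_unique _ _ _ _ H). symmetry. apply is_CI_unique.
  apply (is_RInt_point (V := C_R_NormedModule)). }
 (* The bound [M] is given only inside the interval. Setting the function to zero at the end-points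
    makes it valid on the closed interval and leaves the integral unchanged. *)
 pose (h := fun t => if Rle_dec t a then RtoC 0 else if Rle_dec b t then RtoC 0 else f t).
 assert (Hh : is_CI h a b l).
 { apply is_CI_ext with f; auto. minmax. intros t Ht. unfold h.
  destruct (Rle_dec t a); [lra|]. destruct (Rle_dec b t); [lra|auto]. }
 rewrite Rmult_comm.
 assert (M0 : 0 <= M) by (eapply Rle_trans; [apply Cmod_ge_0|apply (HM ((a + b) / 2)); lra]).
 apply (norm_RInt_le_const (V := C_R_NormedModule) h a b l M Hab); auto.
 intros t Ht. rewrite norm_C_R. unfold h.
 destruct (Rle_dec t a); [now rewrite Cmod_0|].
 destruct (Rle_dec b t); [now rewrite Cmod_0|]. apply HM. lra.
Qed.

(** * Induction over a compact interval *)

(** The supremum of the points [x] with [P a x] is itself such a point, and it cannot lie before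
    [b]. This replaces compactness of the interval in all that follows. *)
Lemma interval_induction (P : R -> R -> Prop) (a b : R) : a <= b ->
 (forall x y z, a <= x <= y -> y <= z <= b -> P x y -> P y z -> P x z) ->
 (forall x, a <= x <= b -> exists d, 0 < d /\
  forall u v, a <= u <= x -> x <= v <= b -> x - d < u -> v < x + d -> P u v) ->
 P a b.
Proof.
 intros Hab Htr Hloc.
 set (E := fun x => a <= x <= b /\ P a x).
 assert (Ea : E a).
 { destruct (Hloc a LRA) as [d [Hd H]]. split; [|apply H]; lra. }
 destruct (completeness E) as [m [Hm1 Hm2]].
 { exists b. intros x [H _]. lra. }
 { now exists a. }
 assert (Ham : a <= m) by auto.
 assert (Hmb : m <= b) by (apply Hm2; intros x [H _]; lra).
 destruct (Hloc m LRA) as [d [Hd H]].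
 assert (exists x, E x /\ m - d < x <= m) as [x [[Hx Px] Hxm]].
 { apply NNPP. intros N. assert (m <= m - d); [|lra]. apply Hm2. intros x Ex.
  apply Rnot_lt_le. intros L. apply N. eauto. }
 set (v := Rmin b (m + d / 2)).
 assert (Hv : m <= v <= b /\ v < m + d).
 { unfold v, Rmin. destruct (Rle_dec b (m + d/2)); lra. }
 assert (Pv : P a v). { apply (Htr a x v); try lra; auto. apply H; lra. }
 destruct (Rle_lt_dec b m) as [L|L].
 - replace b with m by lra. apply (Htr a x m); try lra; auto. apply H; lra.
 - exfalso. assert (v <= m). { apply Hm1. sa. lra. }
  unfold v, Rmin in *. destruct (Rle_dec b (m + d/2)); lra.
Qed.

(** The form suited to analytic continuation: around every point the property passes from the left
    to the point, and from the point to the right. *)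
Lemma interval_induction_right (Q : R -> Prop) (a b : R) : a <= b -> Q a ->
 (forall x, a <= x <= b -> exists d, 0 < d /\
  (forall u, a <= u <= x -> x - d < u -> Q u -> Q x) /\
  (forall v, x <= v <= b -> v < x + d -> Q x -> Q v)) ->
 Q b.
Proof.
 intros Hab Qa H. cut (Q a -> Q b); auto.
 apply (interval_induction (fun x y => Q x -> Q y)); auto.
 intros x Hx. destruct (H x Hx) as [d [Hd [H1 H2]]]. eauto.
Qed.

(** * Continuity on compact intervals *)

Definition rcont_on (a b : R) (f : R -> C) : Prop :=
 forall t, a <= t <= b -> forall e, 0 < e -> exists d, 0 < d /\
  forall s, a <= s <= b -> Rabs (s - t) < d -> `|f s - f t| < e.

Lemma rcont_rcont_on a b f : (forall t, a <= t <= b -> rcont f t) -> rcont_on a b f.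
Proof. intros H t Ht e He. destruct (H t Ht e He) as [d [Hd K]]. eauto. Qed.

Lemma rcont_on_sub a b a' b' f : a <= a' -> b' <= b -> rcont_on a b f -> rcont_on a' b' f.
Proof.
 intros H1 H2 H t Ht e He. destruct (H t) with (e := e) as [d [Hd K]]; auto. lra.
 exists d. sa. intros s Hs. apply K. lra.
Qed.

Ltac rsub H := apply rcont_on_sub with (3 := H); lra.

Lemma rcont_on_ext a b f g : (forall t, a <= t <= b -> f t = g t) -> rcont_on a b f -> rcont_on a b g.
Proof.
 intros E H t Ht e He. destruct (H t Ht e He) as [d [Hd K]]. exists d. sa.
 intros s Hs L. rewrite <- !E; auto.
Qed.

Lemma rcont_on_comp a b f h : rcont_on a b f -> (forall t, a <= t <= b -> ccont h (f t)) ->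
 rcont_on a b (fun t => h (f t)).
Proof.
 intros H1 H2 t Ht e He. destruct (H2 t Ht e He) as [d [Hd K]].
 destruct (H1 t Ht d Hd) as [d' [Hd' K']]. eauto.
Qed.

Lemma rcont_on_const a b c : rcont_on a b (fun _ => c).
Proof. intros t _ e He. exists 1. sp. intros. self. Qed.

Lemma rcont_on_tends a b f : rcont_on a b f <-> forall t, a <= t <= b -> tends (fun d s => a <= s <= b /\ Rabs (s - t) < d) f (f t).
Proof. split; intros H t Ht e He; destruct (H t Ht e He) as [d [Hd K]]; exists d; sa. intros s [A B]. auto. Qed.

Lemma rcont_on_minus a b f g : rcont_on a b f -> rcont_on a b g -> rcont_on a b (fun t => f t - g t)%C.
Proof. rewrite !rcont_on_tends. intros H1 H2 t Ht. apply tends_minus; auto. ar. Qed.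

Lemma rcont_on_bounded a b f : a <= b -> rcont_on a b f -> exists M, 0 < M /\ forall t, a <= t <= b -> `|f t| <= M.
Proof.
 intros Hab H.
 apply (interval_induction (fun x y => exists M, 0 < M /\ forall t, x <= t <= y -> `|f t| <= M)); auto.
 - intros x y z _ _ [M [PM HM]] [N [PN HN]]. exists (M + N). sp. intros t Ht.
  destruct (Rle_dec t y).
  + assert (`|f t| <= M) by (apply HM; lra). lra.
  + assert (`|f t| <= N) by (apply HN; lra). lra.
 - intros x Hx. destruct (H x Hx 1) as [d [Hd K]]. lra. exists d. sa.
  intros u v Hu Hv L1 L2. exists (1 + `|f x|). generalize (Cmod_ge_0 (f x)). intros. sp.
  intros t Ht. replace (f t) with ((f t - f x) + f x)%C by ring.
  tri. assert (`|f t - f x| < 1); [|lra].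
  apply K. lra. rabs.
Qed.

Lemma rcont_on_mult a b f g : rcont_on a b f -> rcont_on a b g -> rcont_on a b (fun t => f t * g t)%C.
Proof. rewrite !rcont_on_tends. intros H1 H2 t Ht. apply tends_mult; auto. ar. Qed.

Lemma rcont_on_inv a b f : rcont_on a b f -> (forall t, a <= t <= b -> f t <> RtoC 0) ->
 rcont_on a b (fun t => / f t)%C.
Proof.
 intros H1 H2. apply (rcont_on_comp a b f Cinv); auto. intros t Ht.
 eapply cderiv_ccont, cderiv_inv; auto.
Qed.

(** The retraction of the line onto [[a,b]]. Composing with it extends a function continuous on
    [[a,b]] to the whole line. *)
Definition clamp (a b t : R) : R := Rmax a (Rmin b t).

Lemma clamp_in a b t : a <= b -> a <= clamp a b t <= b.
Proof. intros. unfold clamp, Rmax, Rmin. destruct (Rle_dec b t), (Rle_dec a _); lra. Qed.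

Lemma clamp_id a b t : a <= t <= b -> clamp a b t = t.
Proof. intros. unfold clamp. rewrite Rmin_right, Rmax_right; lra. Qed.

Lemma clamp_lip a b s t : a <= b -> Rabs (clamp a b s - clamp a b t) <= Rabs (s - t).
Proof.
 intros. unfold clamp, Rmax, Rmin.
 destruct (Rle_dec b s), (Rle_dec b t); repeat destruct (Rle_dec a _); apply Rabs_le;
 generalize (Rle_abs (s - t)) (Rle_abs (- (s - t))); rewrite Rabs_Ropp; lra.
Qed.

Lemma ex_CI_cont_on f a b : a <= b -> rcont_on a b f -> ex_CI f a b.
Proof.
 intros Hab H. destruct (ex_CI_cont (fun t => f (clamp a b t)) a b) as [l Hl].
 - intros t _ e He. destruct (H (clamp a b t) (clamp_in a b t Hab) e He) as [d [Hd K]].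
  exists d. sa. intros s Hs. apply K. now apply clamp_in.
  eapply Rle_lt_trans; [|apply Hs]. now apply clamp_lip.
 - exists l. apply is_CI_ext with (2 := Hl). minmax.
  intros t Ht. rewrite clamp_id; auto. lra.
Qed.

(** * The exponential *)

Lemma is_derive_eps (f : R -> R) t l : is_derive f t l -> forall e, 0 < e -> exists d, 0 < d /\
 forall s, Rabs (s - t) < d -> Rabs (f s - f t - (s - t) * l) <= e * Rabs (s - t).
Proof.
 intros [_ H] e He. specialize (H t (fun P HP => HP) (mkposreal e He)).
 apply locally_Rabs in H. auto.
Qed.

Lemma rderiv_pair f t l : is_derive (fun s => Re (f s)) t (Re l) -> is_derive (fun s => Im (f s)) t (Im l) ->
 rderiv f t l.
Proof.
 intros H1 H2 e He. destruct (is_derive_eps _ _ _ H1 (e/2)) as [d1 [Hd1 K1]]. lra.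
 destruct (is_derive_eps _ _ _ H2 (e/2)) as [d2 [Hd2 K2]]. lra.
 exists (Rmin d1 d2). sp. intros s Hs.
 specialize (K1 s (lt_minl Hs)).
 specialize (K2 s (lt_minr Hs)).
 eapply Rle_trans. apply Cmod_le_re_im.
 unfold Cminus. rewrite !re_plus, !im_plus, !re_opp, !im_opp, re_scal_l, im_scal_l. 
 unfold Rminus in *. lra.
Qed.

Definition Eit (x : R) : C := (cos x, sin x).

Lemma Cmod_Eit x : `|Eit x| = 1.
Proof.
 unfold Cmod, Eit. simpl fst; simpl snd. replace (cos x ^ 2 + sin x ^ 2) with 1. apply sqrt_1.
 generalize (sin2_cos2 x). unfold Rsqr. lra.
Qed.

Lemma Eit_0 : Eit 0 = RtoC 1.
Proof. unfold Eit. now rewrite cos_0, sin_0. Qed.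

Lemma Eit_2PI : Eit (2 * PI) = RtoC 1.
Proof. unfold Eit. now rewrite cos_2PI, sin_2PI. Qed.

Lemma Eit_plus x y : Eit (x + y) = (Eit x * Eit y)%C.
Proof. unfold Eit. rewrite cos_plus, sin_plus. apply C_ext; simpl; ring. Qed.

Lemma rderiv_Eit t : rderiv Eit t (Ci * Eit t)%C.
Proof.
 apply rderiv_pair; unfold Eit, Ci, Re, Im; simpl.
 - auto_derive; auto. lra.
 - auto_derive; auto. lra.
Qed.

Lemma rcont_Eit t : rcont Eit t.
Proof. eapply rderiv_rcont, rderiv_Eit. Qed.

Definition Cexp (z : C) : C := (RtoC (exp (Re z)) * Eit (Im z))%C.

Lemma Cexp_plus x y : Cexp (x + y) = (Cexp x * Cexp y)%C.
Proof. unfold Cexp. rewrite re_plus, im_plus, exp_plus, Eit_plus, RtoC_mult. ring. Qed.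

Lemma Cexp_0 : Cexp 0 = RtoC 1.
Proof. unfold Cexp. rewrite re_RtoC, im_RtoC, exp_0, Eit_0. ring. Qed.

Lemma cderiv_Cexp_0 : cderiv Cexp 0 1.
Proof.
 intros e He. set (q := Rmin 1 (e / 3)).
 assert (Hq : 0 < q) by pos.
 assert (Hq1 : q <= e / 3) by apply Rmin_r.
 destruct (is_derive_eps exp 0 (exp 0) (is_derive_exp 0) q Hq) as [d1 [Hd1 K1]].
 destruct (rderiv_Eit 0 q Hq) as [d2 [Hd2 K2]].
 destruct (rcont_Eit 0 q Hq) as [d3 [Hd3 K3]].
 exists (Rmin d1 (Rmin d2 d3)). split. pos.
 intros w Hw. rewrite Cexp_0. replace (w - 0)%C with w in * by ring.
 assert (Hre := re_le_Cmod w). assert (Him := im_le_Cmod w).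
 assert (L1 := lt_minl Hw).
 assert (Hw' := lt_minr Hw).
 assert (L2 := lt_minl Hw').
 assert (L3 := lt_minr Hw').
 specialize (K1 (Re w)). specialize (K2 (Im w)). specialize (K3 (Im w)).
 rewrite Rminus_0_r in K1, K2, K3. rewrite exp_0, Rmult_1_r in K1. rewrite Eit_0 in K2, K3.
 specialize (K1 LRA). specialize (K2 LRA). specialize (K3 LRA).
 unfold Cexp.
 assert (Ew : w = (RtoC (Re w) + Ci * RtoC (Im w))%C).
 { apply C_ext; unfold Re, Im, Ci; destruct w; simpl; ring. }
 replace (RtoC (exp (Re w)) * Eit (Im w) - 1 - 1 * w)%C
  with (RtoC (exp (Re w) - 1 - Re w) * Eit (Im w)
     + ((Eit (Im w) - 1 - RtoC (Im w) * (Ci * 1)) + RtoC (Re w) * (Eit (Im w) - 1)))%C.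
 2:{ rewrite !RtoC_minus. replace (1 * w)%C with (RtoC (Re w) + Ci * RtoC (Im w))%C by (rewrite <- Ew; ring). ring. }
 tri. eapply Rle_trans. apply Rplus_le_compat_l, Cmod_triangle.
 rewrite !Cmod_mult, !Cmod_R, Cmod_Eit. generalize (Rabs_pos (Re w)) (Rabs_pos (Im w)); intros. nra.
Qed.

Lemma cderiv_Cexp z : cderiv Cexp z (Cexp z).
Proof.
 apply (cderiv_ext (fun w => Cexp z * Cexp (w - z))%C).
 { intros w. rewrite <- Cexp_plus. f_equal. ring. }
 eapply cderiv_val; [|apply cderiv_scal; eapply (cderiv_comp (fun w => w - z)%C Cexp z (1 - 0) 1)].
 - ring.
 - apply (cderiv_minus (fun w => w) (fun _ => z)). apply cderiv_id. apply cderiv_const.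
 - cbv beta. replace (z - z)%C with (RtoC 0) by ring. apply cderiv_Cexp_0.
Qed.

(** * Goursat's lemma for rectangles *)

Definition xy (x y : R) : C := (x, y).

Lemma xy_minus x y x' y' : (xy x y - xy x' y')%C = xy (x - x') (y - y').
Proof. auto. Qed.

Lemma Cmod_xy_le x y : `|xy x y| <= Rabs x + Rabs y.
Proof. apply (Cmod_le_re_im (xy x y)). Qed.

Lemma rderiv_xy_h x y : rderiv (fun x => xy x y) x 1.
Proof. apply rderiv_pair; unfold xy, Re, Im; simpl; auto_derive; auto. Qed.

Lemma rderiv_xy_v x y : rderiv (fun y => xy x y) y Ci.
Proof. apply rderiv_pair; unfold xy, Re, Im, Ci; simpl; auto_derive; auto. Qed.

Definition edge_h (f : C -> C) (a b y : R) : C := CI (fun x => f (xy x y)) a b.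
Definition edge_v (f : C -> C) (x c d : R) : C := CI (fun y => f (xy x y)) c d.
(** The integral of [f(z) dz] over the boundary of the rectangle, counter-clockwise; the factor [Ci]
    is [dz/dy] on the vertical sides. *)
Definition rect (f : C -> C) (a b c d : R) : C :=
 (edge_h f a b c - edge_h f a b d + Ci * (edge_v f b c d - edge_v f a c d))%C.

Definition cont_rect (f : C -> C) (a b c d : R) : Prop :=
 forall x y, a <= x <= b -> c <= y <= d -> ccont f (xy x y).

Lemma rcont_xy_h f x y : ccont f (xy x y) -> rcont (fun x => f (xy x y)) x.
Proof.
 intros H e He. destruct (H e He) as [d [Hd K]]. exists d. sa.
 intros s Hs. apply K. rewrite xy_minus, Rminus_diag. eapply Rle_lt_trans. apply Cmod_xy_le.
 rewrite Rabs_R0. lra.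
Qed.

Lemma rcont_xy_v f x y : ccont f (xy x y) -> rcont (fun y => f (xy x y)) y.
Proof.
 intros H e He. destruct (H e He) as [d [Hd K]]. exists d. sa.
 intros s Hs. apply K. rewrite xy_minus, Rminus_diag. eapply Rle_lt_trans. apply Cmod_xy_le.
 rewrite Rabs_R0. lra.
Qed.

Lemma edge_h_is f a b y : a <= b -> (forall x, a <= x <= b -> ccont f (xy x y)) ->
 is_CI (fun x => f (xy x y)) a b (edge_h f a b y).
Proof.
 intros H K. apply ex_CI_is, ex_CI_cont. minmax.
 intros. apply rcont_xy_h. auto.
Qed.

Lemma edge_v_is f x c d : c <= d -> (forall y, c <= y <= d -> ccont f (xy x y)) ->
 is_CI (fun y => f (xy x y)) c d (edge_v f x c d).
Proof.
 intros H K. apply ex_CI_is, ex_CI_cont. minmax.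
 intros. apply rcont_xy_v. auto.
Qed.

Lemma edge_h_chasles f a m b y : a <= m <= b -> (forall x, a <= x <= b -> ccont f (xy x y)) ->
 edge_h f a b y = (edge_h f a m y + edge_h f m b y)%C.
Proof.
 intros H K. apply is_CI_unique. apply is_CI_Chasles with m; apply edge_h_is; try lra;
 intros; apply K; lra.
Qed.

Lemma edge_v_chasles f x c m d : c <= m <= d -> (forall y, c <= y <= d -> ccont f (xy x y)) ->
 edge_v f x c d = (edge_v f x c m + edge_v f x m d)%C.
Proof.
 intros H K. apply is_CI_unique. apply is_CI_Chasles with m; apply edge_v_is; try lra;
 intros; apply K; lra.
Qed.

Lemma rect_split f a m b c n d : a <= m <= b -> c <= n <= d -> cont_rect f a b c d ->
 rect f a b c d = (rect f a m c n + rect f m b c n + (rect f a m n d + rect f m b n d))%C.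
Proof.
 intros H1 H2 K. unfold rect.
 rewrite (edge_h_chasles f a m b c), (edge_h_chasles f a m b d), 
  (edge_v_chasles f a c n d), (edge_v_chasles f b c n d); auto; try (intros; apply K; lra). ring.
Qed.

Lemma rect_minus f g a b c d : a <= b -> c <= d -> cont_rect f a b c d -> cont_rect g a b c d ->
 rect (fun z => f z - g z)%C a b c d = (rect f a b c d - rect g a b c d)%C.
Proof.
 intros H1 H2 Kf Kg. unfold rect, edge_h at 1 2, edge_v at 1 2.
 rewrite !(is_CI_unique _ _ _ _ (is_CI_minus _ _ _ _ _ _ (edge_h_is f a b c H1 ltac:(intros; apply Kf; lra))
  (edge_h_is g a b c H1 ltac:(intros; apply Kg; lra)))).
 rewrite !(is_CI_unique _ _ _ _ (is_CI_minus _ _ _ _ _ _ (edge_h_is f a b d H1 ltac:(intros; apply Kf; lra))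
  (edge_h_is g a b d H1 ltac:(intros; apply Kg; lra)))).
 rewrite !(is_CI_unique _ _ _ _ (is_CI_minus _ _ _ _ _ _ (edge_v_is f a c d H2 ltac:(intros; apply Kf; lra))
  (edge_v_is g a c d H2 ltac:(intros; apply Kg; lra)))).
 rewrite !(is_CI_unique _ _ _ _ (is_CI_minus _ _ _ _ _ _ (edge_v_is f b c d H2 ltac:(intros; apply Kf; lra))
  (edge_v_is g b c d H2 ltac:(intros; apply Kg; lra)))). ring.
Qed.

Lemma rect_bound f a b c d M : a <= b -> c <= d -> cont_rect f a b c d ->
 (forall x y, a <= x <= b -> c <= y <= d -> `|f (xy x y)| <= M) ->
 `|rect f a b c d| <= 2 * M * ((b - a) + (d - c)).
Proof.
 intros H1 H2 K HM. unfold rect.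
 assert (B1 : `|edge_h f a b c| <= M * (b - a)).
 { eapply is_CI_norm; [lra| |apply edge_h_is; auto; intros; apply K; lra]. intros; apply HM; lra. }
 assert (B2 : `|edge_h f a b d| <= M * (b - a)).
 { eapply is_CI_norm; [lra| |apply edge_h_is; auto; intros; apply K; lra]. intros; apply HM; lra. }
 assert (B3 : `|edge_v f a c d| <= M * (d - c)).
 { eapply is_CI_norm; [lra| |apply edge_v_is; auto; intros; apply K; lra]. intros; apply HM; lra. }
 assert (B4 : `|edge_v f b c d| <= M * (d - c)).
 { eapply is_CI_norm; [lra| |apply edge_v_is; auto; intros; apply K; lra]. intros; apply HM; lra. }
 tri. rewrite Cmod_mult, Cmod_Ci, Rmult_1_l.
 eapply Rle_trans. apply Rplus_le_compat; apply Cmod_minus_le. lra.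
Qed.

Lemma rect_primitive F f a b c d : a <= b -> c <= d -> cont_rect f a b c d ->
 (forall z, cderiv F z (f z)) -> rect f a b c d = RtoC 0.
Proof.
 intros H1 H2 K HF. unfold rect.
 assert (EH : forall y, c <= y <= d -> edge_h f a b y = (F (xy b y) - F (xy a y))%C).
 { intros y Hy. apply is_CI_unique. apply (is_CI_FTC (fun x => F (xy x y))); minmax.
  - intros t Ht. replace (f (xy t y)) with (f (xy t y) * 1)%C by ring.
   apply (rderiv_comp (fun x => xy x y)). apply rderiv_xy_h. apply HF.
  - intros; apply rcont_xy_h, K; auto. }
 assert (EV : forall x, a <= x <= b -> (Ci * edge_v f x c d)%C = (F (xy x d) - F (xy x c))%C).
 { intros x Hx. rewrite <- (is_CI_unique _ _ _ _ (is_CI_scal Ci _ _ _ _ (edge_v_is f x c d H2 ltac:(intros; apply K; lra)))).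
  apply is_CI_unique. apply (is_CI_FTC (fun y => F (xy x y))); minmax.
  - intros t Ht. replace (Ci * f (xy x t))%C with (f (xy x t) * Ci)%C by ring.
   apply (rderiv_comp (fun y => xy x y)). apply rderiv_xy_v. apply HF.
  - intros t Ht. apply (rcont_xy_v (fun z => Ci * f z)%C). intros e He.
   destruct (K x t Hx Ht e He) as [dl [Hdl Kd]]. exists dl. sa. intros w Hw.
   replace (Ci * f w - Ci * f (xy x t))%C with (Ci * (f w - f (xy x t)))%C by ring.
   rewrite Cmod_mult, Cmod_Ci, Rmult_1_l. auto. }
 replace (Ci * (edge_v f b c d - edge_v f a c d))%C with (Ci * edge_v f b c d - Ci * edge_v f a c d)%C by ring.
 rewrite !EV, !EH by lra. ring.
Qed.

(** Each interval [[a n, a n + w/2^n]] is followed by one of its halves, so the supremum of the left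
    ends lies in all of them. *)
Lemma nested_bisection (a : nat -> R) (w : R) : 0 <= w ->
 (forall n, a (S n) = a n \/ a (S n) = a n + w / 2 ^ (S n)) ->
 exists x, forall n, a n <= x <= a n + w / 2 ^ n.
Proof.
 intros Hw H.
 assert (P2 : forall n, 0 < 2 ^ n) by (intros; apply pow_lt; lra).
 assert (Hs : forall n, w / 2 ^ n = 2 * (w / 2 ^ S n)).
 { intros n. simpl. field. apply Rgt_not_eq, P2. }
 assert (Hp : forall n, 0 <= w / 2 ^ n) by (intros; apply Rdiv_le_0_compat; auto).
 assert (M : forall n k, a n <= a (n + k)%nat /\ a (n + k)%nat + w / 2 ^ (n + k) <= a n + w / 2 ^ n).
 { intros n k. induction k. rewrite Nat.add_0_r. lra.
  rewrite Nat.add_succ_r. generalize (Hs (n + k)%nat) (Hp (S (n + k))). 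
  destruct (H (n + k)%nat) as [-> | ->]; lra. }
 assert (M2 : forall n m, a m <= a n + w / 2 ^ n).
 { intros n m. destruct (Nat.le_ge_cases n m) as [L|L].
  - destruct (M n (m - n)%nat) as [_ M1]. replace (n + (m - n))%nat with m in M1 by lia.
   generalize (Hp m). lra.
  - destruct (M m (n - m)%nat) as [M1 _]. replace (m + (n - m))%nat with n in M1 by lia.
   generalize (Hp n). lra. }
 destruct (completeness (fun y => exists n, y = a n)) as [x [X1 X2]].
 - exists (a 0%nat + w / 2 ^ 0). intros y [n ->]. apply M2.
 - now exists (a 0%nat), 0%nat.
 - exists x. intros n. split. eauto. apply X2. intros y [m ->]. auto.
Qed.

(** Among the four quarters of a rectangle one keeps at least a quarter of the integral. At the
    limit point of the nested rectangles [f] is affine up to a small remainder, the affine part has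
    a primitive, and the remainder is too small to carry what has been kept. *)
Lemma goursat f a b c d : a < b -> c < d ->
 (forall x y, a <= x <= b -> c <= y <= d -> holo f (xy x y)) -> rect f a b c d = RtoC 0.
Proof.
 intros Hab Hcd Hf.
 assert (Kf : cont_rect f a b c d) by (intros x y Hx Hy; apply holo_ccont; auto).
 set (w := b - a). set (h := d - c).
 assert (Pw : 0 < w) by (unfold w; lra). assert (Ph : 0 < h) by (unfold h; lra).
 apply NNPP. intros N.
 set (k := `|rect f a b c d|). assert (Pk : 0 < k) by now apply Cmod_gt_0.
 assert (P2 : forall n, 0 < 2 ^ n) by (intros; apply pow_lt; lra).
 assert (P4 : forall n, 0 < 4 ^ n) by (intros; apply pow_lt; lra).
 (* [p] is the lower left corner of a rectangle of generation [n] that keeps at least the fraction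
    [1/4^n] of the integral. *)
 set (bad := fun n (p : R * R) => a <= fst p /\ fst p + w / 2 ^ n <= b /\ c <= snd p /\ snd p + h / 2 ^ n <= d /\
  k / 4 ^ n <= `|rect f (fst p) (fst p + w / 2 ^ n) (snd p) (snd p + h / 2 ^ n)|).
 set (good := fun n (p q : R * R) => bad (S n) q /\ (fst q = fst p \/ fst q = fst p + w / 2 ^ S n) /\
  (snd q = snd p \/ snd q = snd p + h / 2 ^ S n)).
 assert (step : forall n p, bad n p -> exists q, good n p q).
 { intros n [x y] (B1 & B2 & B3 & B4 & B5). simpl in *.
  assert (Ew : w / 2 ^ n = w / 2 ^ S n + w / 2 ^ S n) by (simpl; field; apply Rgt_not_eq, P2).
  assert (Eh : h / 2 ^ n = h / 2 ^ S n + h / 2 ^ S n) by (simpl; field; apply Rgt_not_eq, P2).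
  assert (Pw' : 0 < w / 2 ^ S n) by pos.
  assert (Ph' : 0 < h / 2 ^ S n) by pos.
  assert (E4 : k / 4 ^ n = 4 * (k / 4 ^ S n)) by (simpl; field; apply Rgt_not_eq, P4).
  rewrite Ew, Eh, E4 in *. unfold good, bad. simpl fst in *; simpl snd in *.
  set (w' := w / 2 ^ S n) in *. set (h' := h / 2 ^ S n) in *. set (k' := k / 4 ^ S n) in *.
  rewrite (rect_split f x (x + w') (x + (w' + w')) y (y + h') (y + (h' + h'))) in B5;
   [|lra|lra|intros u v Hu Hv; apply Kf; lra].
  apply NNPP. intros NN.
  assert (G : forall u v, (u = x \/ u = x + w') -> (v = y \/ v = y + h') ->
   `|rect f u (u + w') v (v + h')| < k').
  { intros u v Hu Hv. apply Rnot_le_lt. intros L. apply NN. exists (u, v). simpl.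
   repeat split; auto; destruct Hu, Hv; lra. }
  assert (G1 := G x y (or_introl eq_refl) (or_introl eq_refl)).
  assert (G2 := G (x + w') y (or_intror eq_refl) (or_introl eq_refl)).
  assert (G3 := G x (y + h') (or_introl eq_refl) (or_intror eq_refl)).
  assert (G4 := G (x + w') (y + h') (or_intror eq_refl) (or_intror eq_refl)).
  rewrite <- !Rplus_assoc in B5.
  apply (Rlt_irrefl (4 * k')). eapply Rle_lt_trans. eauto.
  eapply Rle_lt_trans. apply Cmod_triangle.
  eapply Rle_lt_trans. apply Rplus_le_compat; apply Cmod_triangle. lra. }
 set (nxt := fun n p => epsilon (inhabits p) (good n p)).
 set (sq := fix sq n := match n with O => (a, c) | S m => nxt m (sq m) end).
 assert (Hsq : forall n, bad n (sq n) /\ good n (sq n) (sq (S n))).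
 { assert (forall n, bad n (sq n)).
  { induction n. unfold bad, w, h, k. simpl. rewrite !Rdiv_1_r.
   replace (a + (b - a)) with b by ring. replace (c + (d - c)) with d by ring. lra.
   destruct (step n (sq n) IHn) as [q Hq].
   apply (epsilon_spec (inhabits (sq n)) (good n (sq n)) (ex_intro _ q Hq)). }
  intros n; sa. destruct (step n (sq n) (H n)) as [q Hq].
  apply (epsilon_spec (inhabits (sq n)) (good n (sq n)) (ex_intro _ q Hq)). }
 destruct (nested_bisection (fun n => fst (sq n)) w) as [x Hx]. lra. { intros n. apply Hsq. }
 destruct (nested_bisection (fun n => snd (sq n)) h) as [y Hy]. lra. { intros n. apply Hsq. }
 assert (Hxab : a <= x <= b). { specialize (Hx 0%nat). simpl in Hx. unfold w in Hx. lra. }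
 assert (Hycd : c <= y <= d). { specialize (Hy 0%nat). simpl in Hy. unfold h in Hy. lra. }
 destruct (Hf x y Hxab Hycd) as [l Hl].
 (* With this [e] the integral kept on a rectangle of sides [w'], [h'] is at least [4 e (w'+h')^2],
    while the remainder of the affine approximation yields at most half of that. *)
 set (e := k / (4 * (w + h) * (w + h))).
 assert (Pe : 0 < e). pos.
 destruct (Hl e Pe) as [dl [Hdl Kd]].
 destruct (pow_lt_1_zero (/ 2) ltac:(rewrite Rabs_pos_eq; lra) (dl / (w + h))) as [n Hn]. pos.
 specialize (Hn n (le_n n)). rewrite Rabs_pos_eq in Hn by (apply pow_le; lra).
 destruct (Hsq n) as [(B1 & B2 & B3 & B4 & B5) _].
 specialize (Hx n). specialize (Hy n). destruct (sq n) as [u v]. simpl fst in *; simpl snd in *.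
 assert (En : forall t, t / 2 ^ n = t * (/ 2) ^ n). { intros t. rewrite pow_inv. auto. }
 assert (Pwn : 0 < w / 2 ^ n) by pos.
 assert (Phn : 0 < h / 2 ^ n) by pos.
 assert (Hs : w / 2 ^ n + h / 2 ^ n < dl).
 { rewrite !En. replace (w * (/ 2) ^ n + h * (/ 2) ^ n) with ((/ 2) ^ n * (w + h)) by ring.
  apply Rlt_div_r; auto. lra. }
 assert (Enn : k / 4 ^ n = 4 * e * (w / 2 ^ n + h / 2 ^ n) * (w / 2 ^ n + h / 2 ^ n)).
 { unfold e. replace (4 ^ n) with (2 ^ n * 2 ^ n). field. split. apply Rgt_not_eq, P2. lra.
  rewrite <- Rpow_mult_distr. auto. }
 rewrite Enn in B5. revert Hx Hy B2 B4 B5 Hs Pwn Phn.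
 generalize (w / 2 ^ n) (h / 2 ^ n). intros w' h' Hx Hy B2 B4 B5 Hs Pw' Ph'.
 set (z0 := xy x y) in *.
 set (A := fun z : C => (f z0 + l * (z - z0))%C).
 assert (DA : forall z, cderiv A z l).
 { intros z. eapply cderiv_val; [|apply (cderiv_plus (fun _ => f z0)); [apply cderiv_const|apply cderiv_scal]].
  2:{ apply (cderiv_minus (fun w => w) (fun _ => z0)). apply cderiv_id. apply cderiv_const. } ring. }
 assert (KA : cont_rect A u (u + w') v (v + h')) by (intros ? ? _ _; eapply cderiv_ccont, DA).
 assert (Kf' : cont_rect f u (u + w') v (v + h')) by (intros ? ? ? ?; apply Kf; lra).
 assert (RA : rect A u (u + w') v (v + h') = RtoC 0).
 { apply rect_primitive with (fun z => f z0 * z + l * ((z - z0) * (z - z0) / RtoC 2))%C; auto; try lra.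
  intros z. unfold A.
  assert (D0 : cderiv (fun z => z - z0)%C z 1%C).
  { eapply cderiv_val; [|apply (cderiv_minus (fun w => w) (fun _ => z0)); [apply cderiv_id|apply cderiv_const]]. ring. }
  eapply cderiv_val; [|apply (cderiv_plus (fun z => f z0 * z)%C); [apply cderiv_scal, cderiv_id|
   apply cderiv_scal; apply (cderiv_mult _ (fun _ => / RtoC 2)%C); [apply cderiv_mult; apply D0|apply cderiv_const]]].
  cbv beta. field. }
 assert (RR : rect f u (u + w') v (v + h') = rect (fun z => f z - A z)%C u (u + w') v (v + h')).
 { rewrite rect_minus, RA; auto; try lra. ring. }
 rewrite RR in B5.
 assert (KfA : cont_rect (fun z => f z - A z)%C u (u + w') v (v + h')).
 { intros s t Hs' Ht'. apply holo_ccont, holo_minus. apply Hf; lra. eexists; apply DA. }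
 apply (rect_bound _ _ _ _ _ (e * (w' + h'))) in KfA; try lra.
 - assert (0 < e * (w' + h') * (w' + h')) by pos. lra.
 - intros s t Hs' Ht'. unfold A. replace (f (xy s t) - (f z0 + l * (xy s t - z0)))%C
   with (f (xy s t) - f z0 - l * (xy s t - z0))%C by ring.
  assert (`|xy s t - z0| <= w' + h').
  { unfold z0. rewrite xy_minus. eapply Rle_trans. apply Cmod_xy_le.
   assert (Rabs (s - x) <= w') by (apply Rabs_le; lra).
   assert (Rabs (t - y) <= h') by (apply Rabs_le; lra). lra. }
  eapply Rle_trans. apply Kd. lra. nra.
Qed.

(** * Circle integrals and Cauchy's formula *)

Lemma ccont_const c z : ccont (fun _ => c) z.
Proof. apply holo_ccont, holo_const. Qed.

Lemma ccont_rcomp f z : ccont f z -> forall u : R -> C, forall t, rcont u t -> u t = z -> rcont (fun s => f (u s)) t.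
Proof.
 intros H u t Hu E e He. destruct (H e He) as [d [Hd K]]. destruct (Hu d Hd) as [d' [Hd' K']].
 exists d'. sa. intros s Hs. rewrite E. apply K. rewrite <- E. auto.
Qed.

Lemma ccont_comp f g z : ccont f z -> ccont g (f z) -> ccont (fun w => g (f w)) z.
Proof.
 intros H1 H2 e He. destruct (H2 e He) as [d [Hd K]]. destruct (H1 d Hd) as [d' [Hd' K']]. eauto.
Qed.

Lemma ccont_div f g z : ccont f z -> ccont g z -> g z <> RtoC 0 -> ccont (fun w => f w / g w)%C z.
Proof.
 intros H1 H2 Hz. apply ccont_mult; auto. apply (ccont_comp g Cinv); auto.
 eapply cderiv_ccont, cderiv_inv; auto.
Qed.

Lemma ccont_ext_loc f g z r : 0 < r -> (forall w, `|w - z| < r -> f w = g w) -> ccont f z -> ccont g z.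
Proof.
 intros Hr E H e He. destruct (H e He) as [d [Hd K]]. exists (Rmin d r). sp.
 intros w Hw. rewrite <- !E. apply K. apply (lt_minl Hw).
 self. ar.
Qed.

Definition circle (z0 : C) (r x : R) : C := (z0 + RtoC r * Eit x)%C.

(** An integral in the angle, without the differential: as [dz = i (z - z0) dx], the integral of
    [f(z) dz] over the circle is [i] times the [cint] of [f(z) (z - z0)]. *)
Definition cint (f : C -> C) (z0 : C) (r : R) : C := CI (fun x => f (circle z0 r x)) 0 (2 * PI).

Lemma circle_minus z0 r x : (circle z0 r x - z0)%C = (RtoC r * Eit x)%C.
Proof. unfold circle. ring. Qed.

Lemma Cmod_circle z0 r x : 0 <= r -> `|circle z0 r x - z0| = r.
Proof. intros. rewrite circle_minus, Cmod_mult, Cmod_R, Cmod_Eit, Rabs_pos_eq; auto. lra. Qed.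

Lemma rcont_circle z0 r x : rcont (circle z0 r) x.
Proof.
 intros e He. destruct (rcont_Eit x (e / (1 + Rabs r))) as [d [Hd K]].
 { apply Rdiv_lt_0_compat; auto. generalize (Rabs_pos r); lra. }
 exists d. sa. intros s Hs. specialize (K s Hs). unfold circle.
 replace (z0 + RtoC r * Eit s - (z0 + RtoC r * Eit x))%C with (RtoC r * (Eit s - Eit x))%C by ring.
 rewrite Cmod_mult, Cmod_R. generalize (Rabs_pos r) (Cmod_ge_0 (Eit s - Eit x)); intros.
 apply Rlt_div_r in K; [|lra]. nra.
Qed.

Lemma PI2_pos : 0 <= 2 * PI.
Proof. generalize PI_RGT_0. lra. Qed.

Lemma rcont_on_circle f z0 r a b : (forall x, ccont f (circle z0 r x)) -> rcont_on a b (fun x => f (circle z0 r x)).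
Proof.
 intros H. apply rcont_rcont_on. intros t _. apply (ccont_rcomp f (circle z0 r t)); auto. apply rcont_circle.
Qed.

Lemma cint_is f z0 r : (forall x, ccont f (circle z0 r x)) ->
 is_CI (fun x => f (circle z0 r x)) 0 (2 * PI) (cint f z0 r).
Proof. intros H. apply ex_CI_is, ex_CI_cont_on. apply PI2_pos. now apply rcont_on_circle. Qed.

Lemma cint_ext f g z0 r : (forall x, f (circle z0 r x) = g (circle z0 r x)) -> cint f z0 r = cint g z0 r.
Proof. intros E. apply (RInt_ext (V := C_R_CompleteNormedModule)). auto. Qed.

Lemma cint_bound f z0 r M : (forall x, ccont f (circle z0 r x)) ->
 (forall x, `|f (circle z0 r x)| <= M) -> `|cint f z0 r| <= 2 * PI * M.
Proof.
 intros H K. replace (2 * PI * M) with (M * (2 * PI - 0)) by ring.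
 eapply is_CI_norm; [apply PI2_pos| |apply cint_is; auto]. eauto.
Qed.

Lemma cint_minus f g z0 r : (forall x, ccont f (circle z0 r x)) -> (forall x, ccont g (circle z0 r x)) ->
 cint (fun z => f z - g z)%C z0 r = (cint f z0 r - cint g z0 r)%C.
Proof. intros H K. apply is_CI_unique. now apply is_CI_minus; apply cint_is. Qed.

Lemma cint_scal c f z0 r : (forall x, ccont f (circle z0 r x)) -> cint (fun z => c * f z)%C z0 r = (c * cint f z0 r)%C.
Proof. intros H. apply is_CI_unique. now apply is_CI_scal; apply cint_is. Qed.

Lemma cint_const c z0 r : cint (fun _ => c) z0 r = (RtoC (2 * PI) * c)%C.
Proof. apply is_CI_unique. replace (2 * PI) with (2 * PI - 0) at 2 by ring. apply is_CI_const. Qed.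

(* In the logarithmic coordinate [ln (z - z0)] the annulus becomes a rectangle
 whose horizontal sides cancel by periodicity. *)
Lemma cint_annulus f z0 r1 r2 r s : 0 <= r1 -> r1 < r -> r <= s -> s < r2 ->
 (forall z, r1 < `|z - z0| < r2 -> holo f z) -> cint f z0 r = cint f z0 s.
Proof.
 intros H0 H1 [H2|<-] H3 Hf; auto.
 set (phi := fun z => f (z0 + Cexp z)%C).
 assert (Hphi : forall x y, ln r <= x <= ln s -> holo phi (xy x y)).
 { intros x y Hx. apply (holo_comp (fun z => z0 + Cexp z)%C).
  - apply holo_plus. auto. eexists; apply cderiv_Cexp.
  - apply Hf. replace (z0 + Cexp (xy x y) - z0)%C with (Cexp (xy x y)) by ring.
   unfold Cexp. rewrite Cmod_mult, Cmod_R, Cmod_Eit, Rmult_1_r.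
   rewrite Rabs_pos_eq by (apply Rlt_le, exp_pos). unfold Re, xy; simpl.
   assert (r <= exp x). { rewrite <- (exp_ln r) by lra. destruct (proj1 Hx) as [L|<-]. left; now apply exp_increasing. right; auto. }
   assert (exp x <= s). { rewrite <- (exp_ln s) by lra. destruct (proj2 Hx) as [L|<-]. left; now apply exp_increasing. right; auto. }
   lra. }
 assert (G : rect phi (ln r) (ln s) 0 (2 * PI) = RtoC 0).
 { apply goursat. apply ln_increasing; lra. generalize PI_RGT_0; lra. auto. }
 unfold rect in G.
 assert (E1 : edge_h phi (ln r) (ln s) 0 = edge_h phi (ln r) (ln s) (2 * PI)).
 { apply (RInt_ext (V := C_R_CompleteNormedModule)). intros x _. unfold phi, Cexp, xy, Im; simpl.
  now rewrite Eit_0, Eit_2PI. }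
 assert (E2 : forall t, 0 < t -> edge_v phi (ln t) 0 (2 * PI) = cint f z0 t).
 { intros t Ht. apply (RInt_ext (V := C_R_CompleteNormedModule)). intros x _.
  unfold phi, Cexp, circle, xy, Re, Im; simpl. now rewrite exp_ln. }
 rewrite E1, !E2 in G by lra.
 assert (G' : (Ci * (cint f z0 s - cint f z0 r))%C = RtoC 0) by (rewrite <- G; ring).
 apply Cmult_integral in G'. destruct G' as [G'|G']. now destruct Ci_nz.
 symmetry. now apply Cminus_eq0.
Qed.

Lemma circle_dist z0 r r0 x x0 : 0 <= r0 ->
 `|circle z0 r x - circle z0 r0 x0| <= Rabs (r - r0) + r0 * `|Eit x - Eit x0|.
Proof.
 intros H. unfold circle.
 replace (z0 + RtoC r * Eit x - (z0 + RtoC r0 * Eit x0))%C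
  with (RtoC (r - r0) * Eit x + RtoC r0 * (Eit x - Eit x0))%C by (rewrite RtoC_minus; ring).
 tri. rewrite !Cmod_mult, !Cmod_R, Cmod_Eit, (Rabs_pos_eq r0); lra.
Qed.

Lemma circle_uniform f z0 r0 : 0 <= r0 -> (forall x, ccont f (circle z0 r0 x)) ->
 forall e, 0 < e -> exists d, 0 < d /\ forall r x, 0 <= x <= 2 * PI -> Rabs (r - r0) < d ->
  `|f (circle z0 r x) - f (circle z0 r0 x)| <= e.
Proof.
 intros Hr0 H e He.
 destruct (interval_induction (fun u v => exists d, 0 < d /\ forall r x, u <= x <= v -> Rabs (r - r0) < d ->
  `|f (circle z0 r x) - f (circle z0 r0 x)| <= e) 0 (2 * PI) PI2_pos) as [d [Hd K]].
 - intros x y z _ _ [d1 [Hd1 K1]] [d2 [Hd2 K2]]. exists (Rmin d1 d2). sp.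
  intros r t Ht L. destruct (Rle_dec t y).
  + apply K1. lra. apply (lt_minl L).
  + apply K2. lra. apply (lt_minr L).
 - intros x _. destruct (H x (e/2)) as [d [Hd K]]. lra.
  destruct (rcont_Eit x (d / 2 / (1 + r0))) as [d' [Hd' K']]. { pos. }
  exists d'. sa. intros u v _ _ L1 L2. exists (d / 2). sp.
  intros r t Ht L. assert (L3 : Rabs (t - x) < d') by (rabs).
  specialize (K' t L3). apply Rlt_div_r in K'; [|lra].
  assert (`|f (circle z0 r t) - f (circle z0 r0 x)| < e / 2).
  { apply K. eapply Rle_lt_trans. apply circle_dist; auto. generalize (Cmod_ge_0 (Eit t - Eit x)). nra. }
  assert (`|f (circle z0 r0 t) - f (circle z0 r0 x)| < e / 2).
  { apply K. eapply Rle_lt_trans. apply circle_dist; auto. rewrite Rminus_diag, Rabs_R0. generalize (Cmod_ge_0 (Eit t - Eit x)). nra. }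
  generalize (Cmod_triangle_minus (f (circle z0 r t)) (f (circle z0 r0 x)) (f (circle z0 r0 t))).
  rewrite (Cmod_minus_sym (f (circle z0 r0 x))). lra.
 - exists d. sa.
Qed.

Lemma cint_cont f z0 R r0 : 0 <= r0 < R -> (forall z, `|z - z0| < R -> ccont f z) ->
 forall e, 0 < e -> exists d, 0 < d /\ forall r, 0 <= r < R -> Rabs (r - r0) < d ->
  `|cint f z0 r - cint f z0 r0| <= e.
Proof.
 intros Hr H e He.
 assert (K : forall r x, 0 <= r < R -> ccont f (circle z0 r x)).
 { intros. apply H. rewrite Cmod_circle; lra. }
 destruct (circle_uniform f z0 r0) with (e := e / (2 * PI)) as [d [Hd L]]; try lra. auto. { apply Rdiv_lt_0_compat; auto. generalize PI_RGT_0; lra. }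
 exists d. sa. intros r Hr' Hd'.
 replace e with (e / (2 * PI) * (2 * PI - 0)) by (field; apply Rgt_not_eq, PI_RGT_0).
 eapply is_CI_norm; [apply PI2_pos| |apply is_CI_minus; apply cint_is; intros; apply K; lra].
 intros t Ht. apply L; auto. lra.
Qed.

(** As a function of the radius the integral is continuous, and it is constant below and above
    [|w - z0|] because [f] is holomorphic on these two annuli. So it equals its value at radius
    zero, where the factor [z - z0] vanishes. *)
Lemma cint_zero f z0 R r w : (forall z, `|z - z0| < R -> ccont f z) ->
 (forall z, `|z - z0| < R -> z <> z0 -> z <> w -> holo f z) -> 0 < r < R ->
 cint (fun z => f z * (z - z0))%C z0 r = RtoC 0.
Proof.
 intros Hc Hh Hr. set (h := fun z => (f z * (z - z0))%C). set (p := `|w - z0|).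
 assert (Pp : 0 <= p) by apply Cmod_ge_0.
 assert (Hch : forall z, `|z - z0| < R -> ccont h z).
 { intros z Hz. apply ccont_mult. auto. apply holo_ccont, holo_minus. auto. auto. }
 assert (Hhh : forall z, `|z - z0| < R -> 0 < `|z - z0| -> `|z - z0| <> p -> holo h z).
 { intros z Hz Hz1 Hz2. apply holo_mult. 2: apply holo_minus; [apply holo_id|apply holo_const].
  apply Hh; auto. intros ->. rewrite Cmod_sub_self in Hz1. lra. intros ->. now apply Hz2. }
 assert (M0 : cint h z0 0 = RtoC 0).
 { rewrite (cint_ext h (fun _ => RtoC 0)). rewrite cint_const. ring.
  intros x. unfold h, circle. ring. }
 assert (Msmall : forall r, 0 < r < R -> r < p -> cint h z0 r = RtoC 0).
 { intros s Hs Hsp. apply Cmod_small. intros e He.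
  destruct (cint_cont h z0 R 0 LRA Hch e He) as [d [Hd K]].
  set (s' := Rmin s (d / 2)). assert (0 < s' <= s /\ s' < d).
  { unfold s', Rmin. destruct (Rle_dec s (d/2)); lra. }
  rewrite <- (cint_annulus h z0 0 (Rmin p R) s' s); try lra.
  - replace (cint h z0 s') with (cint h z0 s' - cint h z0 0)%C by (rewrite M0; ring).
   apply K. lra. rewrite Rminus_0_r, Rabs_pos_eq; lra.
  - pos.
  - intros z [Hz1 Hz2]. rmin. apply Hhh; lra. }
 assert (Mp : p < R -> cint h z0 p = RtoC 0).
 { intros HpR. destruct (Req_dec p 0) as [->|Hp]; auto. apply Cmod_small. intros e He.
  destruct (cint_cont h z0 R p LRA Hch e He) as [d [Hd K]].
  set (s := Rmax (p / 2) (p - d / 2)). assert (0 < s < p /\ p - d < s).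
  { unfold s, Rmax. destruct (Rle_dec (p/2) (p - d/2)); lra. }
  replace (cint h z0 p) with (- (cint h z0 s - cint h z0 p))%C by (rewrite (Msmall s) by lra; ring).
  rewrite Cmod_opp. apply K. lra. rabs. }
 destruct (Rlt_le_dec r p) as [L|L]; auto.
 destruct (Req_dec r p) as [->|Hne]; [apply Mp; lra|].
 apply Cmod_small. intros e He.
 destruct (cint_cont h z0 R p LRA Hch e He) as [d [Hd K]].
 set (s := Rmin r (p + d / 2)). assert (p < s <= r /\ s < p + d).
 { unfold s, Rmin. destruct (Rle_dec r (p + d/2)); lra. }
 rewrite <- (cint_annulus h z0 p R s r); try lra.
 - replace (cint h z0 s) with (cint h z0 s - cint h z0 p)%C by (rewrite Mp by lra; ring).
  apply K. lra. rabs.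
 - intros z Hz. apply Hhh; lra.
Qed.

Lemma circle_neq z0 r x v : `|v - z0| < r -> (circle z0 r x - v)%C <> RtoC 0.
Proof.
 intros H E. apply Cminus_eq0 in E. subst v. rewrite Cmod_circle in H. lra. cm.
Qed.

Lemma circle_dist_ge z0 r x v : 0 <= r -> r - `|v - z0| <= `|circle z0 r x - v|.
Proof.
 intros H. replace (circle z0 r x - v)%C with ((circle z0 r x - z0) - (v - z0))%C by ring.
 eapply Rle_trans; [|apply Cmod_minus_ge]. rewrite Cmod_circle; lra.
Qed.

Lemma holo_kernel z0 v z : (z - v)%C <> RtoC 0 -> holo (fun z => (z - z0) / (z - v))%C z.
Proof.
 intros H. apply holo_div; auto; auto.
Qed.

(** The integral does not change when the radius grows, and the kernel tends to [1] at infinity. *)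
Lemma cint_kernel z0 v r : `|v - z0| < r -> cint (fun z => (z - z0) / (z - v))%C z0 r = RtoC (2 * PI).
Proof.
 intros H. set (p := `|v - z0|) in *. assert (Pp : 0 <= p) by apply Cmod_ge_0.
 apply Cminus_eq0, Cmod_small. intros e He.
 set (s := Rmax r (p + 1 + 2 * PI * p / e)).
 assert (Hs1 : r <= s) by apply Rmax_l. assert (Hs2 : p + 1 + 2 * PI * p / e <= s) by apply Rmax_r.
 assert (0 <= 2 * PI * p / e). { apply Rdiv_le_0_compat; auto. generalize PI_RGT_0. nra. }
 rewrite (cint_annulus _ z0 p (s + 1) r s); try lra.
 2:{ intros z Hz. apply holo_kernel. intros E. apply Cminus_eq0 in E. subst z. unfold p in Hz. lra. }
 replace (RtoC (2 * PI)) with (RtoC (2 * PI) * 1)%C by ring.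
 rewrite <- (cint_const 1 z0 s), <- cint_minus.
 2:{ intros x. apply holo_ccont, holo_kernel. apply circle_neq. fold p. lra. }
 2:{ intros x. apply ccont_const. }
 replace e with (2 * PI * (e / (2 * PI))) by (field; apply Rgt_not_eq, PI_RGT_0).
 apply cint_bound.
 - intros x. apply ccont_minus. apply holo_ccont, holo_kernel, circle_neq. fold p; lra. apply ccont_const.
 - intros x. assert (N := circle_neq z0 s x v ltac:(fold p; lra)).
  replace ((circle z0 s x - z0) / (circle z0 s x - v) - 1)%C with ((v - z0) / (circle z0 s x - v))%C by (field; auto).
  rewrite Cmod_div by auto. fold p. apply Rle_div_l. now apply Cmod_gt_0.
  assert (D := circle_dist_ge z0 s x v LRA). fold p in D.
  apply Rle_trans with (e / (2 * PI) * (2 * PI * p / e)).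
  + right. field. sp. apply Rgt_not_eq, PI_RGT_0.
  + apply Rmult_le_compat_l. apply Rdiv_le_0_compat. lra. generalize PI_RGT_0; lra. lra.
Qed.

(** The difference quotient of [f] at [v] stays continuous at [v], so [cint_zero] applies to it. The
    formula is stated for functions that are merely continuous at [z0], which is how [removable]
    uses it. *)
Lemma cauchy_formula f z0 R r v : (forall z, `|z - z0| < R -> ccont f z) ->
 (forall z, `|z - z0| < R -> z <> z0 -> holo f z) -> 0 < r < R -> `|v - z0| < r ->
 cint (fun z => f z * ((z - z0) / (z - v)))%C z0 r = (RtoC (2 * PI) * f v)%C.
Proof.
 intros Hc Hh Hr Hv. destruct (Ceq_dec v z0) as [->|Hne].
 (* At the centre the kernel is [1], and letting the radius tend to zero gives the mean value
    property. *)
 - rewrite (cint_ext _ f).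
  2:{ intros x. field. apply circle_neq; auto. }
  apply Cminus_eq0, Cmod_small. intros e He.
  destruct (cint_cont f z0 R 0 LRA Hc e He) as [d [Hd K]].
  set (s := Rmin r (d / 2)). assert (0 < s <= r /\ s < d).
  { unfold s, Rmin. destruct (Rle_dec r (d/2)); lra. }
  rewrite <- (cint_annulus f z0 0 R s r); try lra.
  + rewrite <- (cint_const (f z0) z0 0).
   rewrite (cint_ext (fun _ => f z0) f z0 0).
   2:{ intros x. f_equal. unfold circle. ring. }
   apply K. lra. rabs.
  + intros z Hz. apply Hh. lra. intros ->. rewrite Cmod_sub_self in Hz. lra.
 - destruct (Hh v LRA Hne) as [l Hl].
  set (Q := fun z => if Ceq_dec z v then l else ((f z - f v) / (z - v))%C).
  assert (EQ : forall z, z <> v -> forall w, `|w - z| < `|z - v| -> ((f w - f v) / (w - v))%C = Q w).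
  { intros z Hz w Hw. unfold Q. destruct (Ceq_dec w v) as [->|]; auto.
   rewrite Cmod_minus_sym in Hw. lra. }
  assert (QP : forall z, z <> v -> 0 < `|z - v|) by (intros; apply Cmod_gt_0; now apply Cminus_neq0).
  assert (QC : cint (fun z => Q z * (z - z0))%C z0 r = RtoC 0).
  { apply (cint_zero Q z0 R r v); auto.
   - intros z Hz. destruct (Ceq_dec z v) as [->|N].
    + intros e He. destruct (Hl (e / 2)) as [d [Hd K]]. lra. exists d. sa. intros w Hw.
     unfold Q at 2. destruct (Ceq_dec v v) as [_|]; [|congruence]. unfold Q.
     destruct (Ceq_dec w v) as [->|N]. self.
     specialize (K w Hw). assert (N' := Cminus_neq0 _ _ N).
     replace ((f w - f v) / (w - v) - l)%C with ((f w - f v - l * (w - v)) / (w - v))%C by (field; auto).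
     rewrite Cmod_div by auto. apply Rle_lt_trans with (e / 2); [|lra]. apply Rle_div_l; auto. now apply Cmod_gt_0.
    + apply ccont_ext_loc with (2 := EQ z N); auto. apply ccont_div; auto.
     * apply ccont_minus; auto using ccont_const.
     * apply holo_ccont, holo_minus; auto.
     * now apply Cminus_neq0.
   - intros z Hz N0 N. apply holo_ext_loc with (2 := EQ z N); auto. apply holo_div.
    + auto.
    + auto.
    + now apply Cminus_neq0. }
  assert (NC : forall x, (circle z0 r x - v)%C <> RtoC 0) by (intros; now apply circle_neq).
  rewrite (cint_ext _ (fun z => f z * ((z - z0) / (z - v)) - f v * ((z - z0) / (z - v)))%C) in QC.
  2:{ intros x. unfold Q. destruct (Ceq_dec (circle z0 r x) v) as [E|N].
    - exfalso. apply (NC x). rewrite E. ring.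
    - field. auto. }
  assert (KC : forall x, ccont (fun z => (z - z0) / (z - v))%C (circle z0 r x)).
  { intros x. now apply holo_ccont, holo_kernel. }
  assert (FC : forall x, ccont f (circle z0 r x)).
  { intros x. apply Hc. rewrite Cmod_circle; lra. }
  rewrite cint_minus, cint_scal, cint_kernel in QC; auto.
  + apply Cminus_eq0. rewrite <- QC. ring.
  + intros x. now apply ccont_mult.
  + intros x. apply ccont_mult; auto using ccont_const.
Qed.

(** * Cauchy type integrals *)

(** Integrability is asked against every continuous factor, so that a density with finitely many
    discontinuities can be paired with the Cauchy kernel, with its square and with other functions
    of the curve. *)
Definition density (phi : R -> C) (a b M : R) : Prop :=
 (forall u, rcont_on a b u -> ex_CI (fun s => phi s * u s)%C a b) /\
 (forall s, a < s < b -> `|phi s| <= M).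

Lemma density_cont phi a b : a <= b -> rcont_on a b phi -> exists M, 0 < M /\ density phi a b M.
Proof.
 intros H K. destruct (rcont_on_bounded a b phi H K) as [M [PM HM]]. exists M. sa. split.
 - intros u Hu. apply ex_CI_cont_on; auto. now apply rcont_on_mult.
 - intros s Hs. apply HM. lra.
Qed.

Definition ctype (phi zeta : R -> C) (a b : R) (t : C) : C := CI (fun s => phi s * / (zeta s - t))%C a b.

Lemma ctype_kernel_cont zeta a b t d : rcont_on a b zeta -> 0 < d ->
 (forall s, a <= s <= b -> d <= `|zeta s - t|) -> rcont_on a b (fun s => / (zeta s - t))%C.
Proof.
 intros Hz Hd H. apply (rcont_on_inv a b (fun s => zeta s - t)%C).
 - apply rcont_on_minus; auto. apply rcont_on_const.
 - intros s Hs. apply Cmod_gt_0. specialize (H s Hs). lra.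
Qed.

Lemma ctype_is phi zeta a b M t d : density phi a b M -> rcont_on a b zeta -> 0 < d ->
 (forall s, a <= s <= b -> d <= `|zeta s - t|) ->
 is_CI (fun s => phi s * / (zeta s - t))%C a b (ctype phi zeta a b t).
Proof.
 intros [H1 H2] Hz Hd H. apply ex_CI_is. apply (H1 (fun s => / (zeta s - t))%C).
 eapply ctype_kernel_cont; eauto.
Qed.

Lemma ctype_bound phi zeta a b M t d : a <= b -> 0 <= M -> density phi a b M -> rcont_on a b zeta -> 0 < d ->
 (forall s, a <= s <= b -> d <= `|zeta s - t|) -> `|ctype phi zeta a b t| <= M / d * (b - a).
Proof.
 intros Hab PM Hphi Hz Hd H. eapply is_CI_norm; [auto| |eapply ctype_is; eauto].
 intros s Hs. cbv beta. rewrite Cmod_mult. assert (K := H s LRA).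
 rewrite Cmod_inv by (apply Cmod_gt_0; lra). apply Rmult_le_compat; auto.
 - left. apply Rinv_0_lt_compat. lra.
 - now apply Hphi.
 - apply Rinv_le_contravar; auto.
Qed.

(** The remainder of the kernel is exactly [(t-t0)^2 / ((zeta-t) (zeta-t0)^2)], and
    [|zeta - t| >= d/2] gives the constant [2/d^3]. An explicit quadratic bound, uniform in the
    density, is needed to differentiate under a second integral in
    [difference_quotient_integral]. *)
Lemma ctype_cderiv phi zeta a b M t0 d : a <= b -> 0 <= M -> density phi a b M -> rcont_on a b zeta -> 0 < d ->
 (forall s, a <= s <= b -> d <= `|zeta s - t0|) ->
 let D := CI (fun s => phi s * (/ (zeta s - t0) * / (zeta s - t0)))%C a b in
 is_CI (fun s => phi s * (/ (zeta s - t0) * / (zeta s - t0)))%C a b D /\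
 forall t, `|t - t0| < d / 2 ->
  `|ctype phi zeta a b t - ctype phi zeta a b t0 - D * (t - t0)| <=
  M * (2 / (d * d * d)) * (b - a) * (`|t - t0| * `|t - t0|).
Proof.
 intros Hab PM Hphi Hz Hd H D.
 assert (HD : is_CI (fun s => phi s * (/ (zeta s - t0) * / (zeta s - t0)))%C a b D).
 { apply ex_CI_is. apply (proj1 Hphi (fun s => / (zeta s - t0) * / (zeta s - t0))%C).
  apply rcont_on_mult; eapply ctype_kernel_cont; eauto. }
 sa. intros t Ht.
 assert (H' : forall s, a <= s <= b -> d / 2 <= `|zeta s - t|).
 { intros s Hs. specialize (H s Hs). triang. }
 assert (HI := is_CI_minus _ _ _ _ _ _ (is_CI_minus _ _ _ _ _ _
  (ctype_is phi zeta a b M t (d/2) Hphi Hz LRA H') (ctype_is phi zeta a b M t0 d Hphi Hz Hd H))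
  (is_CI_scal (t - t0)%C _ _ _ _ HD)).
 rewrite (Cmult_comm D).
 replace (M * (2 / (d * d * d)) * (b - a) * (`|t - t0| * `|t - t0|)) with
  (M * (2 / (d * d * d)) * (`|t - t0| * `|t - t0|) * (b - a)) by ring.
 eapply is_CI_norm; [auto| |apply HI].
 intros s Hs. specialize (H s LRA). specialize (H' s LRA). cbv beta.
 assert (N1 : (zeta s - t0)%C <> RtoC 0) by (apply Cmod_gt_0; lra).
 assert (N2 : (zeta s - t)%C <> RtoC 0) by (apply Cmod_gt_0; lra).
 replace (phi s * / (zeta s - t) - phi s * / (zeta s - t0)
   - (t - t0) * (phi s * (/ (zeta s - t0) * / (zeta s - t0))))%C
  with (phi s * (/ (zeta s - t) * (/ (zeta s - t0) * / (zeta s - t0))) * ((t - t0) * (t - t0)))%C by (field; auto).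
 rewrite !Cmod_mult, !Cmod_inv by auto.
 apply Rmult_le_compat_r. nra.
 apply Rmult_le_compat. auto.
 repeat apply Rmult_le_pos; left; apply Rinv_0_lt_compat; lra.
 now apply Hphi.
 replace (2 / (d * d * d)) with (/ (d / 2) * (/ d * / d)) by (field; lra).
 assert (/ `|zeta s - t0| <= / d) by (apply Rinv_le_contravar; auto).
 assert (/ `|zeta s - t| <= / (d / 2)) by (apply Rinv_le_contravar; auto; lra).
 assert (0 < / `|zeta s - t0|) by (apply Rinv_0_lt_compat; lra).
 assert (0 < / `|zeta s - t|) by (apply Rinv_0_lt_compat; lra).
 apply Rmult_le_compat; try lra. nra. nra.
Qed.

Lemma cderiv_quadratic f z l K d : 0 < d -> 0 <= K ->
 (forall w, `|w - z| < d -> `|f w - f z - l * (w - z)| <= K * (`|w - z| * `|w - z|)) ->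
 cderiv f z l.
Proof.
 intros Hd HK H e He. exists (Rmin d (e / (K + 1))). split.
 - pos.
 - intros w Hw. assert (H1 := lt_minl Hw).
  assert (H2 := lt_minr Hw). apply Rlt_div_r in H2; [|lra].
  eapply Rle_trans. auto. rewrite <- Rmult_assoc. apply Rmult_le_compat_r. auto. nra.
Qed.

Lemma ctype_holo phi zeta a b M t0 d : a <= b -> 0 <= M -> density phi a b M -> rcont_on a b zeta -> 0 < d ->
 (forall s, a <= s <= b -> d <= `|zeta s - t0|) -> holo (ctype phi zeta a b) t0.
Proof.
 intros Hab PM Hphi Hz Hd H.
 destruct (ctype_cderiv phi zeta a b M t0 d Hab PM Hphi Hz Hd H) as [_ K].
 eexists. eapply cderiv_quadratic; [| |apply K]. lra.
 assert (0 < 2 / (d * d * d)). pos.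
 repeat apply Rmult_le_pos; lra.
Qed.

(** * Removable singularities, zeros and the identity theorem *)

(** By the Cauchy formula [f] coincides near [z0] with a Cauchy type integral over a circle around
    [z0], and such an integral is holomorphic off the circle. *)
Lemma removable f z0 R : 0 < R -> (forall z, `|z - z0| < R -> ccont f z) ->
 (forall z, `|z - z0| < R -> z <> z0 -> holo f z) -> hold f z0 R.
Proof.
 intros HR Hc Hh z Hz. destruct (Ceq_dec z z0) as [->|N]; auto.
 set (r := R / 2). assert (Hr : 0 < r < R) by (unfold r; lra).
 assert (C1 : rcont_on 0 (2 * PI) (fun x => f (circle z0 r x) * (circle z0 r x - z0))%C).
 { apply (rcont_on_circle (fun z => f z * (z - z0))%C). intros x. apply ccont_mult.
  apply Hc. rewrite Cmod_circle; lra. apply holo_ccont, holo_minus; auto. }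
 destruct (density_cont _ 0 (2 * PI) PI2_pos C1) as [M [PM HM]].
 apply (holo_ext_loc (fun v => / RtoC (2 * PI) * ctype (fun x => f (circle z0 r x) * (circle z0 r x - z0))%C (circle z0 r) 0 (2 * PI) v)%C f z0 r); try lra.
 - intros w Hw. assert (E := cauchy_formula f z0 R r w Hc Hh Hr Hw).
  unfold cint in E. unfold ctype.
  replace (CI (fun s => f (circle z0 r s) * (circle z0 r s - z0) * / (circle z0 r s - w)) 0 (2 * PI))%C
   with (RtoC (2 * PI) * f w)%C.
  + field. intros E'. apply RtoC_inj in E'. generalize PI_RGT_0. lra.
  + rewrite <- E. apply (RInt_ext (V := C_R_CompleteNormedModule)). intros x _. unfold Cdiv.
   change (f (circle z0 r x) * ((circle z0 r x - z0) * / (circle z0 r x - w)) =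
       f (circle z0 r x) * (circle z0 r x - z0) * / (circle z0 r x - w))%C. ring.
 - apply holo_mult. auto.
  apply (ctype_holo _ _ 0 (2 * PI) M z0 r PI2_pos); auto; try lra.
  + apply rcont_rcont_on. intros; apply rcont_circle.
  + intros s _. rewrite Cmod_circle; lra.
Qed.

Lemma cauchy_estimate h z0 R r M w : hold h z0 R -> 0 < r < R -> (forall x, `|h (circle z0 r x)| <= M) ->
 `|w - z0| < r -> `|h w| <= M * (r / (r - `|w - z0|)).
Proof.
 intros Hh Hr HM Hw.
 assert (E := cauchy_formula h z0 R r w (fun z Hz => holo_ccont _ _ (Hh z Hz)) (fun z Hz _ => Hh z Hz) Hr Hw).
 assert (P := PI_RGT_0). apply Rmult_le_reg_l with (2 * PI). lra.
 replace (2 * PI * `|h w|) with (`|RtoC (2 * PI) * h w|).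
 2:{ rewrite Cmod_mult, Cmod_R, Rabs_pos_eq; lra. }
 rewrite <- E. apply cint_bound.
 - intros x. apply holo_ccont, holo_mult. apply Hh. rewrite Cmod_circle; lra.
  apply holo_kernel, circle_neq; auto.
 - intros x. rewrite Cmod_mult. apply Rmult_le_compat; auto.
  assert (N := circle_neq z0 r x w Hw). rewrite Cmod_div, Cmod_circle by (auto; lra).
  apply Rmult_le_compat_l. lra. apply Rinv_le_contravar. lra. apply circle_dist_ge. lra.
Qed.

(** The quotient, completed by the derivative at [z0], is continuous there, so its singularity is
    removable. *)
Lemma divide_zero f z0 R : 0 < R -> hold f z0 R -> f z0 = RtoC 0 ->
 exists h, hold h z0 R /\ forall z, f z = ((z - z0) * h z)%C.
Proof.
 intros HR Hf E0. destruct (Hf z0) as [l Hl]. self.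
 exists (fun z => if Ceq_dec z z0 then l else (f z / (z - z0))%C). split.
 - assert (EQ : forall z, z <> z0 -> forall w, `|w - z| < `|z - z0| ->
   (f w / (w - z0))%C = if Ceq_dec w z0 then l else (f w / (w - z0))%C).
  { intros z Hz w Hw. destruct (Ceq_dec w z0) as [->|]; auto. rewrite Cmod_minus_sym in Hw. lra. }
  assert (QP : forall z, z <> z0 -> 0 < `|z - z0|) by (intros; apply Cmod_gt_0; now apply Cminus_neq0).
  assert (HH : forall z, `|z - z0| < R -> z <> z0 -> holo (fun z => if Ceq_dec z z0 then l else (f z / (z - z0))%C) z).
  { intros z Hz N. apply holo_ext_loc with (2 := EQ z N); auto. apply holo_div; auto.
   auto. now apply Cminus_neq0. }
  apply removable; auto. intros z Hz. destruct (Ceq_dec z z0) as [->|N]; [|apply holo_ccont; auto].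
  intros e He. destruct (Hl (e / 2)) as [d [Hd K]]. lra. exists d. sa. intros w Hw.
  destruct (Ceq_dec z0 z0) as [_|]; [|congruence].
  destruct (Ceq_dec w z0) as [->|N]. self.
  specialize (K w Hw). assert (N' := Cminus_neq0 _ _ N). rewrite E0 in K.
  replace (f w / (w - z0) - l)%C with ((f w - 0 - l * (w - z0)) / (w - z0))%C by (field; auto).
  rewrite Cmod_div by auto. apply Rle_lt_trans with (e / 2); [|lra]. apply Rle_div_l; auto. now apply Cmod_gt_0.
 - intros z. destruct (Ceq_dec z z0) as [->|N]. rewrite E0. ring. field. now apply Cminus_neq0.
Qed.

Lemma Eit_periodic x : exists y, - PI <= y <= PI /\ Eit y = Eit x.
Proof.
 assert (Hx : -1 <= cos x <= 1) by (generalize (COS_bound x); lra).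
 destruct (Rle_lt_dec 0 (sin x)) as [L|L].
 - exists (acos (cos x)). generalize (acos_bound (cos x)) PI_RGT_0. intros. sp.
  unfold Eit. rewrite cos_acos, sin_acos by auto. f_equal. rewrite <- (sqrt_Rsqr (sin x)); auto.
  f_equal. generalize (sin2_cos2 x). lra.
 - exists (- acos (cos x)). generalize (acos_bound (cos x)) PI_RGT_0. intros. sp.
  unfold Eit. rewrite cos_neg, sin_neg, cos_acos, sin_acos by auto. f_equal.
  replace (sin x) with (- (- sin x)) by ring. f_equal. rewrite <- (sqrt_Rsqr (- sin x)) by lra.
  f_equal. rewrite <- Rsqr_neg. generalize (sin2_cos2 x). lra.
Qed.

Lemma circle_bounded f z0 r : (forall x, ccont f (circle z0 r x)) -> exists B, 0 < B /\ forall x, `|f (circle z0 r x)| <= B.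
Proof.
 intros H. destruct (rcont_on_bounded (- PI) PI (fun x => f (circle z0 r x))) as [B [PB HB]].
 { generalize PI_RGT_0; lra. } { now apply rcont_on_circle. }
 exists B. sa. intros x. destruct (Eit_periodic x) as [y [Hy Ey]].
 replace (circle z0 r x) with (circle z0 r y). auto. unfold circle. congruence.
Qed.

Lemma polar z0 z : exists x, 0 <= x <= 2 * PI /\ z = circle z0 (`|z - z0|) x.
Proof.
 set (r := `|z - z0|). assert (P := PI_RGT_0).
 destruct (Ceq_dec z z0) as [E|N].
 { exists 0. sp. unfold r, circle. rewrite E, Cmod_sub_self. ring. }
 assert (Pr : 0 < r) by now apply Cmod_gt_0, Cminus_neq0.
 set (c := Re (z - z0) / r). set (s := Im (z - z0) / r).
 assert (E2 : c * c + s * s = 1).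
 { assert (E := Cmod2_alt (z - z0)). fold r in E. unfold c, s.
  replace (Re (z - z0) / r * (Re (z - z0) / r) + Im (z - z0) / r * (Im (z - z0) / r)) with
   ((Re (z - z0) * Re (z - z0) + Im (z - z0) * Im (z - z0)) / (r * r)) by (field; lra).
  replace (Re (z - z0) * Re (z - z0) + Im (z - z0) * Im (z - z0)) with (r ^ 2) by lra. field. lra. }
 assert (Hc : -1 <= c <= 1) by nra.
 assert (exists x, 0 <= x <= 2 * PI /\ Eit x = (c, s)) as [x [Hx Ex]].
 { generalize (acos_bound c). intros B. destruct (Rle_lt_dec 0 s) as [L|L].
  - exists (acos c). sp. unfold Eit. rewrite cos_acos, sin_acos by auto. f_equal.
   rewrite <- (sqrt_Rsqr s); auto. f_equal. unfold Rsqr. lra.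
  - exists (- acos c + 2 * PI). sp.
   unfold Eit.
   replace (- acos c + 2 * PI) with (- acos c + 2 * INR 1 * PI) by (simpl; ring).
   rewrite cos_period, sin_period, cos_neg, sin_neg, cos_acos, sin_acos by auto. f_equal.
   replace s with (- (- s)) by ring. f_equal. rewrite <- (sqrt_Rsqr (- s)) by lra. f_equal. unfold Rsqr. lra. }
 exists x. sa. unfold circle. rewrite Ex. unfold c, s. apply C_ext.
 - rewrite re_plus, re_scal_l. change (Re (Re (z - z0) / r, Im (z - z0) / r)) with (Re (z - z0) / r). unfold Cminus. rewrite re_plus, re_opp. field. lra.
 - rewrite im_plus, im_scal_l. change (Im (Re (z - z0) / r, Im (z - z0) / r)) with (Im (z - z0) / r). unfold Cminus. rewrite im_plus, im_opp. field. lra.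
Qed.

(** Cauchy's estimate for the quotient by [(z - z0)^n] bounds [f w] by a constant times
    [(|w - z0| / r)^n] for every [n]. This takes the place of the power series expansion. *)
Lemma zero_of_infinite_order f z0 R : hold f z0 R ->
 (forall n, exists h, hold h z0 R /\ forall z, f z = ((z - z0) ^ n * h z)%C) ->
 forall w, `|w - z0| < R -> f w = RtoC 0.
Proof.
 intros Hf H w Hw. set (p := `|w - z0|) in *. assert (Pp : 0 <= p) by apply Cmod_ge_0.
 set (r := (p + R) / 2). assert (Hr : p < r < R) by (unfold r; lra).
 assert (FC : forall x, ccont f (circle z0 r x)).
 { intros x. apply holo_ccont, Hf. rewrite Cmod_circle; lra. }
 destruct (circle_bounded f z0 r FC) as [B [PB HB]].
 apply Cmod_small. intros e He.
 assert (Pq : 0 <= p / r < 1). { split. apply Rdiv_le_0_compat; lra. apply Rlt_div_l; lra. }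
 set (K := B * (r / (r - p))).
 assert (PK : 0 < K). pos.
 destruct (pow_lt_1_zero (p / r) ltac:(rewrite Rabs_pos_eq; lra) (e / K)) as [n Hn]. pos.
 specialize (Hn n (le_n n)). rewrite Rabs_pos_eq in Hn by (apply pow_le; lra).
 destruct (H n) as [h [Hh E]].
 assert (Prn : 0 < r ^ n) by (apply pow_lt; lra).
 assert (Bh : `|h w| <= B / r ^ n * (r / (r - p))).
 { apply cauchy_estimate with R; auto; try (fold p; lra). intros x. specialize (HB x). rewrite E in HB.
  rewrite Cmod_mult, Cmod_pow, Cmod_circle in HB by lra. apply Rle_div_r; auto. lra. }
 rewrite E, Cmod_mult, Cmod_pow. fold p.
 apply Rle_trans with ((p / r) ^ n * K).
 - unfold Rdiv at 1. rewrite Rpow_mult_distr, pow_inv. unfold K.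
  replace (p ^ n * / r ^ n * (B * (r / (r - p)))) with (p ^ n * (B / r ^ n * (r / (r - p)))) by lra.
  apply Rmult_le_compat_l; auto. apply pow_le; lra.
 - apply Rlt_le, Rlt_div_r; auto.
Qed.

Lemma holo_zero_accumulation f z0 R : 0 < R -> hold f z0 R ->
 (forall p, 0 < p -> exists z, z <> z0 /\ `|z - z0| < p /\ f z = RtoC 0) ->
 forall w, `|w - z0| < R -> f w = RtoC 0.
Proof.
 intros HR Hf H. apply zero_of_infinite_order; auto. intros n.
 induction n as [|n [h [Hh E]]].
 - exists f. sa. intros; simpl; ring.
 - assert (Z : forall p, 0 < p -> exists z, z <> z0 /\ `|z - z0| < p /\ h z = RtoC 0).
  { intros p Pp. destruct (H p Pp) as [z [N [Hz Fz]]]. exists z. repeat sa.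
   rewrite E in Fz. apply Cmult_integral in Fz. destruct Fz as [Fz|]; auto.
   exfalso. revert Fz. now apply Cpow_nz, Cminus_neq0. }
  destruct (divide_zero h z0 R HR Hh) as [k [Hk Ek]].
  + apply Cmod_small. intros e He. destruct (holo_ccont h z0 (hold_holo h z0 R HR Hh) e He) as [d [Hd K]].
   destruct (Z d Hd) as [z [_ [Hz Ez]]]. specialize (K z Hz). rewrite Ez in K.
   rewrite <- Cmod_opp. replace (- h z0)%C with (0 - h z0)%C by ring. lra.
  + exists k. sa. intros z. rewrite E, Ek. simpl. ring.
Qed.

Lemma holo_zero_near f z0 R p : 0 < p -> 0 < R -> hold f z0 R -> (forall z, `|z - z0| < p -> f z = RtoC 0) ->
 forall w, `|w - z0| < R -> f w = RtoC 0.
Proof.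
 intros Hp HR Hf H. apply holo_zero_accumulation; auto. intros q Hq.
 set (m := Rmin p q). assert (0 < m) by pos.
 assert (E : (z0 + RtoC (m / 2) - z0)%C = RtoC (m / 2)) by ring.
 assert (L : `|z0 + RtoC (m / 2) - z0| < m). { rewrite E, Cmod_R, Rabs_pos_eq; lra. }
 exists (z0 + RtoC (m / 2))%C. repeat split.
 - intros E'. rewrite E', Cmod_sub_self in *. replace (z0 - z0)%C with (RtoC 0) in E by ring. apply RtoC_inj in E. lra.
 - apply (lt_minr L).
 - apply H. apply (lt_minl L).
Qed.

(** By the identity theorem in discs, vanishing of the continued germ is both an open and a closed
    condition on the parameter. *)
Lemma continuation_zero S u v F : u <= v -> rcont_on u v S -> continuation_along S u v F ->
 germ_eq (S u) (F u) (fun _ => RtoC 0) -> germ_eq (S v) (F v) (fun _ => RtoC 0).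
Proof.
 intros Huv HS HF H0.
 apply (interval_induction_right (fun t => germ_eq (S t) (F t) (fun _ => RtoC 0)) u v); auto.
 intros x Hx. destruct (HF x Hx) as [Hh [d [Hd K]]].
 apply holomorphic_at_hold in Hh. destruct Hh as [R [HR Hh]].
 destruct (HS x Hx (R / 2)) as [d' [Hd' KS]]. lra.
 (* For [t] near [x], vanishing of the germ at [S t] is equivalent to a condition on [F x] over its
    whole disc that does not depend on [t]; both directions of the induction follow. *)
 assert (W : forall t, u <= t <= v -> Rabs (t - x) < Rmin d d' ->
  (germ_eq (S t) (F t) (fun _ => RtoC 0) <-> forall w, `|w - S x| < R -> F x w = RtoC 0)).
 { intros t Ht L. assert (L1 := lt_minl L).
  assert (L2 := lt_minr L).
  specialize (K t Ht L1). specialize (KS t Ht L2). apply germ_eq_Cmod in K. destruct K as [p [Hp K]].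
  rewrite germ_eq_Cmod. split.
  - intros [q [Hq Q]].
   assert (Z1 : forall w, `|w - S t| < R / 2 -> F x w = RtoC 0).
   { apply (holo_zero_near (F x) (S t) (R / 2) (Rmin p q)); try lra. pos.
    apply hold_sub with (1 := Hh). lra.
    intros z Hz. rewrite <- K. apply Q. apply (lt_minr Hz).
    apply (lt_minl Hz). }
   apply (holo_zero_near (F x) (S x) R (R / 2 - `|S t - S x|)); auto; try lra.
   intros z Hz. apply Z1. triang.
  - intros Q. exists (Rmin p (R / 2)). sp. intros w Hw.
   rewrite K. apply Q. assert (Hw2 := lt_minr Hw).
   generalize (Cmod_triangle_minus w (S t) (S x)). lra.
   apply (lt_minl Hw). }
 assert (Pm : 0 < Rmin d d') by pos.
 exists (Rmin d d'). sa. split.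
 - intros t Ht L. rewrite (W t), (W x); auto; try lra. rabs. rabs.
 - intros t Ht L. rewrite (W t), (W x); auto; try lra. rabs. rabs.
Qed.

(** * Segments and the identity theorem in a disc *)

Definition seg (a b : C) (t : R) : C := (a + RtoC t * (b - a))%C.

Lemma seg_0 a b : seg a b 0 = a.
Proof. unfold seg. ring. Qed.

Lemma seg_1 a b : seg a b 1 = b.
Proof. unfold seg. ring. Qed.

Lemma rcont_seg a b t : rcont (seg a b) t.
Proof.
 intros e He. exists (e / (1 + `|b - a|)). generalize (Cmod_ge_0 (b - a)); intros P. split. pos. intros s Hs. unfold seg.
 replace (a + RtoC s * (b - a) - (a + RtoC t * (b - a)))%C with (RtoC (s - t) * (b - a))%C by (rewrite RtoC_minus; ring).
 rewrite Cmod_mult, Cmod_R. apply Rlt_div_r in Hs; [|lra]. nra.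
Qed.

Lemma seg_ball a b z r t : 0 <= t <= 1 -> `|a - z| < r -> `|b - z| < r -> `|seg a b t - z| < r.
Proof.
 intros Ht Ha Hb. unfold seg.
 replace (a + RtoC t * (b - a) - z)%C with (RtoC (1 - t) * (a - z) + RtoC t * (b - z))%C by (rewrite RtoC_minus; ring).
 eapply Rle_lt_trans. apply Cmod_triangle. rewrite !Cmod_mult, !Cmod_R, !Rabs_pos_eq by lra.
 generalize (Cmod_ge_0 (a - z)) (Cmod_ge_0 (b - z)). intros.
 destruct (Req_dec t 0) as [->|]. lra. nra.
Qed.

Lemma seg_identity f a b : (forall t, 0 <= t <= 1 -> holomorphic_at f (seg a b t)) ->
 germ_eq a f (fun _ => RtoC 0) -> germ_eq b f (fun _ => RtoC 0).
Proof.
 intros Hf H. rewrite <- (seg_1 a b). apply (continuation_zero (seg a b) 0 1 (fun _ => f)).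
 - lra.
 - apply rcont_rcont_on. intros; apply rcont_seg.
 - intros t Ht. sa. exists 1. sp. intros. apply germ_eq_Cmod. exists 1. split; auto; lra.
 - now rewrite seg_0.
Qed.

Lemma hold_holomorphic_at f a r z : hold f a r -> `|z - a| < r -> holomorphic_at f z.
Proof.
 intros H Hz. apply holomorphic_at_hold. exists (r - `|z - a|). sp. apply hold_sub with (1 := H). lra.
Qed.

Lemma hold_identity f a R b : hold f a R -> `|b - a| < R -> germ_eq b f (fun _ => RtoC 0) ->
 forall w, `|w - a| < R -> f w = RtoC 0.
Proof.
 intros Hf Hb H w Hw.
 assert (G : germ_eq w f (fun _ => RtoC 0)).
 { apply (seg_identity f b w); auto. intros t Ht. apply hold_holomorphic_at with a R; auto.
  now apply seg_ball. }
 apply germ_eq_Cmod in G. destruct G as [r [Hr G]]. apply G. self.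
Qed.

(** * Polynomial functions *)

Definition is_poly (f : C -> C) : Prop := exists p, forall z, f z = peval p z.

Lemma peval_nil z : peval nil z = RtoC 0.
Proof. auto. Qed.

Lemma peval_cons a p z : peval (a :: p) z = (a + z * peval p z)%C.
Proof. auto. Qed.

Lemma is_poly_const c : is_poly (fun _ => c).
Proof. exists (c :: nil). intros. rewrite peval_cons, peval_nil. ring. Qed.

Lemma is_poly_ext f g : (forall z, f z = g z) -> is_poly f -> is_poly g.
Proof. intros E [p H]. exists p. congruence. Qed.

Lemma is_poly_scal c f : is_poly f -> is_poly (fun z => c * f z)%C.
Proof.
 intros [p H]. exists (map (Cmult c) p). intros z. rewrite H. clear H. induction p; simpl map.
 rewrite peval_nil. ring. rewrite !peval_cons, <- IHp. ring.
Qed.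

Lemma is_poly_mulX f : is_poly f -> is_poly (fun z => z * f z)%C.
Proof. intros [p H]. exists (RtoC 0 :: p). intros. rewrite peval_cons, H. ring. Qed.

Lemma is_poly_plus f g : is_poly f -> is_poly g -> is_poly (fun z => f z + g z)%C.
Proof.
 intros [p Hp] [q Hq]. revert f g q Hp Hq. induction p as [|a p IH]; intros f g q Hp Hq.
 - exists q. intros z. rewrite Hp, Hq, peval_nil. ring.
 - destruct q as [|b q].
  + exists (a :: p). intros z. rewrite Hp, Hq, peval_nil. ring.
  + destruct (IH (peval p) (peval q) q (fun z => eq_refl) (fun z => eq_refl)) as [r Hr].
   exists ((a + b)%C :: r). intros z. rewrite Hp, Hq, !peval_cons, <- Hr. ring.
Qed.

Lemma is_poly_mult f g : is_poly f -> is_poly g -> is_poly (fun z => f z * g z)%C.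
Proof.
 intros [p Hp] Hg. revert f Hp. induction p as [|a p IH]; intros f Hp.
 - apply (is_poly_ext (fun _ => RtoC 0)). intros z. rewrite Hp, peval_nil. ring. apply is_poly_const.
 - apply (is_poly_ext (fun z => a * g z + z * (peval p z * g z))%C).
  + intros z. rewrite Hp, peval_cons. ring.
  + apply is_poly_plus. now apply is_poly_scal. apply is_poly_mulX. auto.
Qed.

Lemma is_poly_id : is_poly (fun z => z).
Proof. apply (is_poly_ext (fun z => z * 1)%C). intros; ring. apply is_poly_mulX, is_poly_const. Qed.

Lemma is_poly_pow f n : is_poly f -> is_poly (fun z => f z ^ n)%C.
Proof. intros H. induction n; simpl. apply is_poly_const. now apply is_poly_mult. Qed.

Lemma pnonzero_peval q z : peval q z <> RtoC 0 -> pnonzero q.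
Proof.
 induction q as [|a q IH]; intros H. easy.
 destruct (Ceq_dec a 0) as [->|N].
 - destruct IH as [b [Hb Nb]]. intros E. apply H. rewrite peval_cons, E. ring.
  exists b. sa. now right.
 - exists a. sa. now left.
Qed.

Lemma holo_peval p z : holo (peval p) z.
Proof.
 induction p as [|a p IH]. apply holo_const.
 apply (holo_plus (fun _ => a) (fun z => z * peval p z)%C). auto. auto.
Qed.

Lemma infinite_away (L : list C) a e : 0 < e -> exists z, `|z - a| < e /\ ~ In z L.
Proof.
 revert e. induction L as [|b L IH]; intros e He.
 - exists a. rewrite Cmod_sub_self. sa.
 - destruct (Ceq_dec b a) as [->|N].
  + assert (exists z, `|z - a| < e /\ z <> a /\ ~ In z L) as [z [H1 [H2 H3]]].
   2:{ exists z. sa. intros [E|E]; auto. }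
   destruct (classic (In a L)) as [Ha|Ha].
   * destruct (IH e He) as [z [H1 H2]]. exists z. repeat sa. congruence.
   * assert (exists d, 0 < d /\ forall z, In z L -> d <= `|z - a|) as [d [Hd K]].
    { clear IH. induction L as [|c L IH]. exists 1. sp. easy.
     destruct IH as [d [Hd K]]. intros H; apply Ha; now right.
     exists (Rmin d (`|c - a|)). split.
     - apply Rmin_glb_lt; auto. apply Cmod_gt_0, Cminus_neq0. intros ->. apply Ha. now left.
     - intros z [<-|Hz]. ar. eapply Rle_trans. apply Rmin_l. auto. }
    set (m := Rmin e d). assert (0 < m) by pos.
    exists (a + RtoC (m / 2))%C.
    assert (E : (a + RtoC (m / 2) - a)%C = RtoC (m / 2)) by ring.
    assert (E' : `|a + RtoC (m / 2) - a| = m / 2) by (rewrite E, Cmod_R, Rabs_pos_eq; lra).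
    assert (m <= e) by apply Rmin_l. assert (m <= d) by apply Rmin_r.
    repeat split. lra. intros E2. rewrite E2, Cmod_sub_self in E'. lra.
    intros Hz. specialize (K _ Hz). lra.
  + assert (0 < `|b - a|) by (apply Cmod_gt_0, Cminus_neq0; auto).
   destruct (IH (Rmin e (`|b - a|))) as [z [H1 H2]]. pos.
   exists z. split. ar.
   intros [E|E]; auto. subst z. ar.
Qed.

Lemma list_isolated (L : list C) a : exists e, 0 < e /\ forall z, In z L -> z <> a -> e <= `|z - a|.
Proof.
 induction L as [|c L [d [Hd K]]]. exists 1. sp. easy.
 destruct (Ceq_dec c a) as [->|N].
 - exists d. sa. intros z [->|Hz] Nz; auto. easy.
 - exists (Rmin d (`|c - a|)). split.
  + apply Rmin_glb_lt; auto. now apply Cmod_gt_0, Cminus_neq0.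
  + intros z [<-|Hz] Nz. ar. eapply Rle_trans. apply Rmin_l. auto.
Qed.

(** * Liouville's theorem for polynomial growth *)

Lemma entire_decay h C0 R0 : (forall z, holo h z) ->
 (forall z, R0 <= `|z| -> `|h z| * `|z| <= C0) -> forall w, h w = RtoC 0.
Proof.
 intros Hh HC w. apply Cmod_small. intros e He.
 assert (PC : 0 <= C0).
 { specialize (HC (RtoC (Rmax 0 R0))). rewrite Cmod_R, Rabs_pos_eq in HC by apply Rmax_l.
  eapply Rle_trans; [|apply HC; apply Rmax_r]. apply Rmult_le_pos. auto. apply Rmax_l. }
 set (p := `|w|). assert (Pp : 0 <= p) by apply Cmod_ge_0.
 set (r := Rmax (Rmax R0 1) (p + C0 / e + 1)).
 assert (Hr1 : R0 <= r). { eapply Rle_trans; [apply (Rmax_l R0 1)|apply Rmax_l]. }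
 assert (Hr3 : 1 <= r). { eapply Rle_trans; [apply (Rmax_r R0 1)|apply Rmax_l]. }
 assert (Hr2 : p + C0 / e + 1 <= r) by apply Rmax_r.
 assert (0 <= C0 / e) by (apply Rdiv_le_0_compat; lra).
 assert (Ew : `|w - 0| = p). { unfold p. f_equal. ring. }
 assert (B : `|h w| <= C0 / r * (r / (r - `|w - 0|))).
 { apply (cauchy_estimate h 0 (r + 1) r (C0 / r)); [intros z _; auto|lra| |].
  - intros x. assert (Hc : `|circle 0 r x| = r).
   { rewrite <- (Cmod_circle 0 r x) at 2 by lra. f_equal. ring. }
   specialize (HC (circle 0 r x)). rewrite Hc in HC. apply Rle_div_r; auto. lra.
  - lra. }
 rewrite Ew in B. eapply Rle_trans. eauto.
 replace (C0 / r * (r / (r - p))) with (C0 / (r - p)) by (field; lra).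
 apply Rle_div_l. lra.
 apply Rle_trans with (e * (C0 / e)). right; field; lra. apply Rmult_le_compat_l; lra.
Qed.

Lemma entire_divide G : (forall z, holo G z) -> exists h, (forall z, holo h z) /\
 forall z, G z = (G 0%C + z * h z)%C.
Proof.
 intros HG. destruct (divide_zero (fun z => G z - G 0%C)%C 0 1) as [h [Hh E]].
 - lra.
 - intros z _. apply holo_minus; auto. 
 - ring.
 - assert (E' : forall z, G z = (G 0%C + z * h z)%C).
  { intros z. apply Cminus_eq0. specialize (E z). cbv beta in E.
   replace (G z - (G 0%C + z * h z))%C with ((G z - G 0%C) - (z - 0) * h z)%C by ring. rewrite E. ring. }
  exists h. sa. intros z. destruct (Ceq_dec z 0) as [->|N].
  + apply Hh. self.
  + apply (holo_ext_loc (fun w => (G w - G 0%C) / w)%C h z (`|z|)).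
   * now apply Cmod_gt_0.
   * intros w Hw. rewrite (E' w). field. intros ->. replace (0 - z)%C with (- z)%C in Hw by ring.
    rewrite Cmod_opp in Hw. lra.
   * apply holo_div; auto. 
Qed.

(** Replacing [G] by [(G - G(0))/z] lowers the exponent of growth by one. At exponent zero the
    quotient decays at infinity, hence vanishes by Cauchy's estimate. *)
Lemma entire_polynomial N : forall G C0 R0, (forall z, holo G z) ->
 (forall z, R0 <= `|z| -> `|G z| <= C0 * `|z| ^ N) -> is_poly G.
Proof.
 induction N as [|N IH]; intros G C0 R0 HG HC; destruct (entire_divide G HG) as [h [Hh E]].
 - assert (Z : forall w, h w = RtoC 0).
  { apply (entire_decay h (C0 + `|G 0%C|) R0 Hh). intros z Hz. specialize (HC z Hz). simpl in HC.
   rewrite <- Cmod_mult. replace (h z * z)%C with (G z - G 0%C)%C by (rewrite (E z); ring).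
   eapply Rle_trans. apply Cmod_minus_le. lra. }
  apply (is_poly_ext (fun _ => G 0%C)). intros z. rewrite (E z), Z. ring. apply is_poly_const.
 - apply (is_poly_ext (fun z => G 0%C + z * h z)%C). auto.
  apply is_poly_plus. apply is_poly_const. apply is_poly_mulX.
  apply (IH h (C0 + `|G 0%C|) (Rmax 1 R0) Hh). intros z Hz.
  assert (H1 := Rle_trans _ _ _ (Rmax_l _ _) Hz). assert (H2 := Rle_trans _ _ _ (Rmax_r _ _) Hz).
  specialize (HC z H2). apply Rmult_le_reg_r with (`|z|). lra.
  rewrite <- Cmod_mult. replace (h z * z)%C with (G z - G 0%C)%C by (rewrite (E z); ring).
  eapply Rle_trans. apply Cmod_minus_le. simpl in HC.
  assert (1 <= `|z| ^ N) by (apply pow_R1_Rle; auto).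
  assert (1 <= `|z| ^ N * `|z|) by nra. generalize (Cmod_ge_0 (G 0%C)). nra.
Qed.

(** * Poles *)

(** The difference quotient of [u] at [w] is holomorphic on the punctured disc, so its integrals
    over the two circles agree. The kernel integrates to [2 pi] over the outer circle and to zero
    over the inner one, which does not surround [w]. *)
Lemma laurent u p R e r w : (forall z, 0 < `|z - p| < R -> holo u z) ->
 0 < e -> e < `|w - p| -> `|w - p| < r -> r < R ->
 (RtoC (2 * PI) * u w)%C = (cint (fun z => u z * ((z - p) / (z - w)))%C p r - cint (fun z => u z * ((z - p) / (z - w)))%C p e)%C.
Proof.
 intros Hu He H1 H2 H3. set (q := `|w - p|) in *.
 destruct (divide_zero (fun z => u z - u w)%C w (Rmin q (R - q))) as [h [Hh E]]. pos.
 { intros z Hz. assert (L1 := lt_minl Hz). assert (L2 := lt_minr Hz).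
  apply holo_minus. 2: apply holo_const. apply Hu.
  generalize (Cmod_triangle_minus z w p) (Cmod_triangle_minus w z p). rewrite (Cmod_minus_sym w z). fold q. lra. }
 { ring. }
 cbv beta in E.
 assert (HH : forall z, 0 < `|z - p| < R -> holo h z).
 { intros z Hz. destruct (Ceq_dec z w) as [->|N].
  - apply Hh. rewrite Cmod_sub_self. pos.
  - apply (holo_ext_loc (fun v => (u v - u w) / (v - w))%C h z (`|z - w|)).
   + now apply Cmod_gt_0, Cminus_neq0.
   + intros v Hv. rewrite (E v). field. apply Cminus_neq0. intros ->. rewrite Cmod_minus_sym in Hv. lra.
   + apply holo_div. auto. auto.
    now apply Cminus_neq0. }
 assert (EQ : cint (fun z => h z * (z - p))%C p e = cint (fun z => h z * (z - p))%C p r).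
 { apply (cint_annulus _ p 0 R); try lra. auto.
  }
 assert (EX : forall s, 0 < s < R -> s <> q ->
  cint (fun z => h z * (z - p))%C p s =
  (cint (fun z => u z * ((z - p) / (z - w)))%C p s - u w * cint (fun z => (z - p) / (z - w))%C p s)%C).
 { intros s Hs Hsq.
  assert (N : forall x, (circle p s x - w)%C <> RtoC 0).
  { intros x E0. apply Cminus_eq0 in E0. apply Hsq. unfold q. rewrite <- E0. rewrite Cmod_circle; lra. }
  assert (KC : forall x, ccont (fun z => (z - p) / (z - w))%C (circle p s x)).
  { intros x. now apply holo_ccont, holo_kernel. }
  assert (FC : forall x, ccont u (circle p s x)).
  { intros x. apply holo_ccont, Hu. rewrite Cmod_circle; lra. }
  rewrite <- cint_scal, <- cint_minus; auto.
  - apply cint_ext. intros x. specialize (N x). specialize (E (circle p s x)).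
   assert (Eh : h (circle p s x) = ((u (circle p s x) - u w) / (circle p s x - w))%C) by (rewrite E; field; auto).
   rewrite Eh. field. auto.
  - intros x. now apply ccont_mult.
  - intros x. apply ccont_mult; auto using ccont_const. }
 rewrite (EX e LRA (Rlt_not_eq _ _ H1)), (EX r LRA (Rgt_not_eq _ _ H2)) in EQ. rewrite (cint_kernel p w r H2) in EQ.
 assert (Z : cint (fun z => (z - p) / (z - w))%C p e = RtoC 0).
 { rewrite (cint_ext _ (fun z => / (z - w) * (z - p))%C). 2:{ intros; unfold Cdiv; ring. }
  assert (KK : forall z, `|z - p| < q -> holo (fun z => / (z - w))%C z).
  { intros z Hz. apply (holo_ext_loc (fun z => 1 / (z - w))%C _ z 1). lra. intros; unfold Cdiv; ring.
   apply holo_div; auto.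
   apply Cminus_neq0. intros ->. unfold q in Hz. lra. }
  apply (cint_zero _ p q e p); auto; try lra. intros; apply holo_ccont; auto. }
 rewrite Z in EQ. rewrite Cmult_0_r in EQ.
 apply Cminus_eq0. replace (RtoC (2 * PI) * u w - (cint (fun z => u z * ((z - p) / (z - w))) p r - cint (fun z => u z * ((z - p) / (z - w))) p e))%C
  with (cint (fun z => u z * ((z - p) / (z - w))) p e - 0 - (cint (fun z => u z * ((z - p) / (z - w))) p r - u w * RtoC (2 * PI)))%C by ring.
 rewrite EQ. ring.
Qed.

Definition roots_prod (l : list C) (z : C) : C := fold_right (fun a x => ((z - a) * x)%C) (RtoC 1) l.

Lemma holo_roots_prod l z : holo (roots_prod l) z.
Proof.
 induction l. apply holo_const. apply (holo_mult (fun z => z - a)%C (roots_prod l)); auto.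
 
Qed.

(** Replacing one factor [z - a] by [z - p] costs at most [e] times a bound [L] for each of the
    other factors. *)
Lemma roots_prod_near p e L : 0 <= e <= 1 -> 1 <= L -> forall l z, (forall a, In a l -> `|a - p| <= e) ->
 `|z - p| + 1 <= L -> `|roots_prod l z| <= L ^ length l /\
 `|roots_prod l z - (z - p) ^ length l| <= INR (length l) * e * L ^ length l.
Proof.
 intros He HL l z. induction l as [|a l IH]; intros Ha Hz.
 - simpl. rewrite Cmod_sub_self, Cmod_1. lra.
 - destruct IH as [I1 I2]; auto. { intros; apply Ha; now right. }
  assert (Ca : `|a - p| <= e) by (apply Ha; now left).
  assert (Cz : `|z - a| <= L). triang.
  assert (PL : 1 <= L ^ length l) by now apply pow_R1_Rle.
  simpl roots_prod. simpl length. rewrite S_INR. simpl pow. simpl Cpow. split.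
  + rewrite Cmod_mult. apply Rmult_le_compat; auto.
  + replace ((z - a) * roots_prod l z - (z - p) * (z - p) ^ length l)%C
    with ((z - p) * (roots_prod l z - (z - p) ^ length l) + (p - a) * roots_prod l z)%C by ring.
   tri. rewrite !Cmod_mult, (Cmod_minus_sym p a).
   assert (0 <= INR (length l) * e * L ^ length l) by cm.
   assert (`|z - p| * `|roots_prod l z - (z - p) ^ length l| <= L * (INR (length l) * e * L ^ length l)).
   { apply Rmult_le_compat; auto. lra. }
   assert (`|a - p| * `|roots_prod l z| <= e * L ^ length l).
   { apply Rmult_le_compat; auto. }
   assert (e * L ^ length l <= e * (L * L ^ length l)). { apply Rmult_le_compat_l; nra. }
   nra.
Qed.

(* On the circle of radius [e] the function may blow up at the [m] points of the
 list [l], which depend on [e].  Multiplying by the polynomial vanishing there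
 bounds the negative part of the Laurent expansion; this polynomial tends to
 [(z - p) ^ m] when [e] tends to [0]. *)
Lemma pole_of_moderate_growth f p R m N K e0 : 0 < R -> 0 < e0 -> 0 <= K ->
 (forall z, 0 < `|z - p| < R -> holo f z) ->
 (forall e, 0 < e < e0 -> exists l, length l = m /\ (forall a, In a l -> `|a - p| = e) /\
  forall z, `|z - p| = e -> `|f z| * `|roots_prod l z| * e ^ N <= K) ->
 exists h, hold h p R /\ forall z, 0 < `|z - p| < R -> h z = ((z - p) ^ (S N + m) * f z)%C.
Proof.
 intros HR He0 HK Hf HG.
 set (Phi := fun z => (f z * (z - p) ^ S N)%C).
 assert (HPow : forall n z, holo (fun z => (z - p) ^ n)%C z). auto.
 assert (HPhi : forall z, 0 < `|z - p| < R -> holo Phi z).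
 { intros z Hz. apply holo_mult; [auto|apply (HPow (S N))]. }
 assert (P := PI_RGT_0).
 (* As the inner radius tends to zero in the Laurent formula of [Phi * roots_prod l], the inner
    integral disappears and the product tends to [(z - p)^m]. What remains is the Cauchy formula of
    a function without singularity at [p]. *)
 assert (key : forall r w, 0 < `|w - p| < r -> r < R ->
  (RtoC (2 * PI) * (Phi w * (w - p) ^ m))%C = cint (fun z => (Phi z * (z - p) ^ m) * ((z - p) / (z - w)))%C p r).
 { intros r w Hw Hr. set (q := `|w - p|) in *.
  assert (NC : forall x, (circle p r x - w)%C <> RtoC 0) by (intros; apply circle_neq; fold q; lra).
  assert (KC : forall x, ccont (fun z => Phi z * ((z - p) / (z - w)))%C (circle p r x)).
  { intros x. apply holo_ccont, holo_mult. apply HPhi. rewrite Cmod_circle; lra. now apply holo_kernel. }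
  assert (exists S, 0 < S /\ forall x, 0 <= x <= 2 * PI ->
   `|Phi (circle p r x) * ((circle p r x - p) / (circle p r x - w))| <= S) as [S [PS HS]].
  { apply (rcont_on_bounded 0 (2 * PI) (fun x => Phi (circle p r x) * ((circle p r x - p) / (circle p r x - w)))%C PI2_pos).
   now apply (rcont_on_circle (fun z => Phi z * ((z - p) / (z - w)))%C). }
  apply Cminus_eq0, Cmod_small. intros e He.
  set (L := r + 1).
  set (A := INR m * L ^ m). assert (PA : 0 <= A). { apply Rmult_le_pos. apply pos_INR. apply pow_le. unfold L; lra. }
  (* The three summands control the change of the product at [w], the inner integral and the change
     of the product on the outer circle; each error is at most its summand times [d]. *)
  set (B := 2 * PI * `|Phi w| * A + 2 * PI * (2 * K / q) + S * A * (2 * PI)).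
  assert (PB : 0 <= B).
  { assert (0 <= 2 * K / q) by (apply Rdiv_le_0_compat; lra).
   assert (0 <= 2 * PI * `|Phi w| * A) by (apply Rmult_le_pos; [apply Rmult_le_pos|]; auto; lra).
   assert (0 <= S * A * (2 * PI)) by (apply Rmult_le_pos; [apply Rmult_le_pos|]; auto; lra).
   unfold B. nra. }
  set (d := Rmin (Rmin 1 (e0 / 2)) (Rmin (q / 2) (e / (B + 1)))).
  assert (Pd : 0 < d). pos.
  assert (Hd1 : d <= 1) by (eapply Rle_trans; [apply Rmin_l|apply Rmin_l]).
  assert (Hd2 : d <= e0 / 2) by (eapply Rle_trans; [apply Rmin_l|apply Rmin_r]).
  assert (Hd3 : d <= q / 2) by (eapply Rle_trans; [apply Rmin_r|apply Rmin_l]).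
  assert (Hd4 : d <= e / (B + 1)) by (eapply Rle_trans; [apply Rmin_r|apply Rmin_r]).
  destruct (HG d LRA) as [l [Hm [Hl Hb]]].
  assert (LE := laurent (fun z => Phi z * roots_prod l z)%C p R d r w
   ltac:(intros z Hz; apply holo_mult; [now apply HPhi|apply holo_roots_prod]) Pd ltac:(fold q; lra) ltac:(fold q; lra) Hr).
  cbv beta in LE.
  assert (Q : forall z, `|z - p| <= r -> `|roots_prod l z - (z - p) ^ m| <= A * d).
  { intros z Hz. destruct (roots_prod_near p d L LRA ltac:(unfold L; lra) l z) as [_ Q].
   intros a Ha; rewrite Hl; auto; lra. unfold L; lra. rewrite Hm in Q. unfold A. lra. }
  assert (Bin : `|cint (fun z => Phi z * roots_prod l z * ((z - p) / (z - w)))%C p d| <= 2 * PI * (2 * K / q * d)).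
  { assert (Nd : forall x, q / 2 <= `|circle p d x - w|).
   { intros x. replace (circle p d x - w)%C with ((circle p d x - p) - (w - p))%C by ring.
    generalize (Cmod_minus_ge (w - p) (circle p d x - p)). rewrite (Cmod_minus_sym (w - p)).
    rewrite (Cmod_circle p d x) by lra. fold q. lra. }
   assert (Nd' : forall x, (circle p d x - w)%C <> RtoC 0). { intros x. apply Cmod_gt_0. specialize (Nd x). lra. }
   apply cint_bound.
   - intros x. apply holo_ccont, holo_mult. apply holo_mult. apply HPhi. rewrite Cmod_circle; lra. apply holo_roots_prod.
    now apply holo_kernel.
   - intros x. unfold Phi. specialize (Hb (circle p d x) (Cmod_circle p d x LRA)).
    rewrite !Cmod_mult, Cmod_div, Cmod_pow, Cmod_circle by (auto; lra).
    specialize (Nd x). simpl pow.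
    replace (`|f (circle p d x)| * (d * d ^ N) * `|roots_prod l (circle p d x)| * (d / `|circle p d x - w|))
     with ((`|f (circle p d x)| * `|roots_prod l (circle p d x)| * d ^ N) * (d * d * / `|circle p d x - w|)) by lra.
    replace (2 * K / q * d) with (K * (1 * d * / (q / 2))) by (field; lra).
    assert (0 < / `|circle p d x - w|) by (apply Rinv_0_lt_compat; lra).
    assert (/ `|circle p d x - w| <= / (q / 2)) by (apply Rinv_le_contravar; lra).
    apply Rmult_le_compat; auto.
    + repeat apply Rmult_le_pos; auto. apply pow_le; lra.
    + nra.
    + apply Rmult_le_compat; try lra. nra. nra. }
  assert (Bout : `|cint (fun z => Phi z * roots_prod l z * ((z - p) / (z - w)))%C p r
            - cint (fun z => Phi z * (z - p) ^ m * ((z - p) / (z - w)))%C p r| <= S * (A * d) * (2 * PI - 0)).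
  { rewrite <- cint_minus.
   - apply is_CI_norm with (f := fun x => (Phi (circle p r x) * ((circle p r x - p) / (circle p r x - w))
     * (roots_prod l (circle p r x) - (circle p r x - p) ^ m))%C) (1 := PI2_pos).
    + intros x Hx. rewrite Cmod_mult. apply Rmult_le_compat; auto. apply HS; lra.
     apply Q. rewrite Cmod_circle; lra.
    + rewrite (cint_ext _ (fun z => Phi z * ((z - p) / (z - w)) * (roots_prod l z - (z - p) ^ m))%C).
     2:{ intros x. ring. }
     apply (cint_is (fun z => Phi z * ((z - p) / (z - w)) * (roots_prod l z - (z - p) ^ m))%C).
     intros x. apply ccont_mult; auto. apply holo_ccont, holo_minus. apply holo_roots_prod. apply HPow.
   - intros x. apply holo_ccont, holo_mult. apply holo_mult. apply HPhi. rewrite Cmod_circle; lra. apply holo_roots_prod. now apply holo_kernel.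
   - intros x. apply holo_ccont, holo_mult. apply holo_mult. apply HPhi. rewrite Cmod_circle; lra. apply HPow. now apply holo_kernel. }
  replace (RtoC (2 * PI) * (Phi w * (w - p) ^ m) - cint (fun z => Phi z * (z - p) ^ m * ((z - p) / (z - w))) p r)%C
   with (RtoC (2 * PI) * (Phi w * ((w - p) ^ m - roots_prod l w)) +
    ((cint (fun z => Phi z * roots_prod l z * ((z - p) / (z - w))) p r - cint (fun z => Phi z * (z - p) ^ m * ((z - p) / (z - w))) p r)
    - cint (fun z => Phi z * roots_prod l z * ((z - p) / (z - w))) p d))%C.
  2:{ replace (RtoC (2 * PI) * (Phi w * ((w - p) ^ m - roots_prod l w)))%C with
    (RtoC (2 * PI) * (Phi w * (w - p) ^ m) - RtoC (2 * PI) * (Phi w * roots_prod l w))%C by ring.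
    rewrite LE. ring. }
  tri. eapply Rle_trans. apply Rplus_le_compat_l, Cmod_minus_le.
  rewrite !Cmod_mult, Cmod_R, Rabs_pos_eq by lra.
  specialize (Q w ltac:(fold q; lra)). rewrite Cmod_minus_sym in Q.
  assert (`|Phi w| * `|(w - p) ^ m - roots_prod l w| <= `|Phi w| * (A * d)).
  { apply Rmult_le_compat_l; auto. }
  apply Rle_trans with (B * d).
  + unfold B. nra.
  + apply Rle_trans with (B * (e / (B + 1))). nra.
   apply Rle_trans with ((B + 1) * (e / (B + 1))). lra.
   right. field. lra. }
 set (r := R / 2).
 set (dens := fun x => (Phi (circle p r x) * (circle p r x - p) ^ m * (circle p r x - p))%C).
 assert (C1 : rcont_on 0 (2 * PI) dens).
 { apply (rcont_on_circle (fun z => Phi z * (z - p) ^ m * (z - p))%C). intros x. apply holo_ccont, holo_mult.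
  apply holo_mult; auto. apply HPhi. rewrite Cmod_circle; unfold r; lra. auto. }
 destruct (density_cont _ 0 (2 * PI) PI2_pos C1) as [M [PM HM]].
 (* A Cauchy type integral over a fixed circle: it agrees with the product off [p] and is
    holomorphic at [p]. *)
 set (T := fun w => (/ RtoC (2 * PI) * ctype dens (circle p r) 0 (2 * PI) w)%C).
 assert (ET : forall w, 0 < `|w - p| < r -> T w = ((w - p) ^ (S N + m) * f w)%C).
 { intros w Hw. specialize (key r w Hw ltac:(unfold r; lra)). unfold T.
  replace (ctype dens (circle p r) 0 (2 * PI) w) with (RtoC (2 * PI) * (Phi w * (w - p) ^ m))%C.
  - unfold Phi. rewrite Cpow_add_r. field. intros E'. apply RtoC_inj in E'. lra.
  - rewrite key. apply (RInt_ext (V := C_R_CompleteNormedModule)). intros x _. unfold dens, Cdiv.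
   change (Phi (circle p r x) * (circle p r x - p) ^ m * ((circle p r x - p) * / (circle p r x - w)) =
    Phi (circle p r x) * (circle p r x - p) ^ m * (circle p r x - p) * / (circle p r x - w))%C. ring. }
 exists (fun z => if Ceq_dec z p then T p else ((z - p) ^ (S N + m) * f z)%C). split.
 - intros z Hz. destruct (Ceq_dec z p) as [->|Nz].
  + apply (holo_ext_loc T _ p r). pos.
   * intros w Hw. destruct (Ceq_dec w p) as [->|Nw]; auto. apply ET. sa. now apply Cmod_gt_0, Cminus_neq0.
   * unfold T. apply holo_mult. auto.
    apply (ctype_holo dens (circle p r) 0 (2 * PI) M p r PI2_pos); auto; try (unfold r; lra).
    apply rcont_rcont_on. intros; apply rcont_circle. intros s _. rewrite Cmod_circle; unfold r; lra.
  + assert (Pz : 0 < `|z - p|) by now apply Cmod_gt_0, Cminus_neq0.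
   apply (holo_ext_loc (fun z => (z - p) ^ (S N + m) * f z)%C _ z (`|z - p|)); auto.
   * intros w Hw. destruct (Ceq_dec w p) as [->|]; auto. rewrite Cmod_minus_sym in Hw. lra.
 - intros z Hz. destruct (Ceq_dec z p) as [->|]; auto. rewrite Cmod_sub_self in Hz. lra.
Qed.

(** Multiplying by [(z - p)^n] removes one pole at the price of [n] in the growth exponent. When no
    pole is left, the function is entire of polynomial growth. *)
Lemma rational_of_poles (L : list C) : forall F C0 R0 N,
 (forall z, ~ In z L -> holo F z) ->
 (forall p, In p L -> exists n h R, 0 < R /\ hold h p R /\ forall z, 0 < `|z - p| < R -> h z = ((z - p) ^ n * F z)%C) ->
 (forall z, R0 <= `|z| -> `|F z| <= C0 * `|z| ^ N) ->
 exists P Q, is_poly P /\ is_poly Q /\ forall z, ~ In z L -> Q z <> RtoC 0 /\ F z = (P z / Q z)%C.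
Proof.
 induction L as [|p L IH]; intros F C0 R0 N HF HP HG.
 - exists F, (fun _ => RtoC 1). split; [|split].
  + apply (entire_polynomial N F C0 R0); auto.
  + apply is_poly_const.
  + intros z _. split. apply C1_nz. field.
 - destruct (HP p (or_introl eq_refl)) as [n [h [R [HR [Hh E]]]]].
  destruct (classic (In p L)) as [Hp|Hp].
  { destruct (IH F C0 R0 N) as [P [Q H]]; auto.
   - intros z Hz. apply HF. intros [->|]; auto.
   - intros; apply HP; now right.
   - exists P, Q. destruct H as [H1 [H2 H3]]. repeat split; auto; apply H3; intros K; apply H; now right. }
  set (F1 := fun z => if Ceq_dec z p then h p else ((z - p) ^ n * F z)%C).
  assert (HPow : forall z, holo (fun z => (z - p) ^ n)%C z). auto.
  assert (EF : forall z, z <> p -> F1 z = ((z - p) ^ n * F z)%C).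
  { intros z Hz. unfold F1. destruct (Ceq_dec z p); congruence. }
  destruct (IH F1 (2 ^ n * C0) (Rmax (Rmax R0 1) (`|p| + 1)) (n + N)%nat) as [P [Q [H1 [H2 H3]]]].
  + intros z Hz. destruct (Ceq_dec z p) as [->|Nz].
   * apply (holo_ext_loc h _ p R); auto. 2:{ apply Hh. self. }
    intros w Hw. unfold F1. destruct (Ceq_dec w p) as [->|]; auto. apply E. sa. now apply Cmod_gt_0, Cminus_neq0.
   * assert (Pz : 0 < `|z - p|) by now apply Cmod_gt_0, Cminus_neq0.
    apply (holo_ext_loc (fun z => (z - p) ^ n * F z)%C _ z (`|z - p|)); auto.
    -- intros w Hw. symmetry. apply EF. intros ->. rewrite Cmod_minus_sym in Hw. lra.
    -- apply holo_mult. auto. apply HF. intros [->|]; auto.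
  + intros b Hb. destruct (HP b (or_intror Hb)) as [k [h' [R' [HR' [Hh' E']]]]].
   assert (Nb : b <> p) by congruence.
   assert (Pb : 0 < `|b - p|) by now apply Cmod_gt_0, Cminus_neq0.
   exists k, (fun z => (z - p) ^ n * h' z)%C, (Rmin R' (`|b - p|)). repeat split.
   * pos.
   * intros z Hz. apply holo_mult. auto. apply Hh'. ar.
   * intros z [Hz1 Hz2]. rewrite E', EF. ring. intros ->. generalize (lt_minr Hz2).
    rewrite Cmod_minus_sym. lra. sa. ar.
  + intros z Hz. assert (L1 := Rle_trans _ _ _ (Rmax_l _ _) Hz). assert (L2 := Rle_trans _ _ _ (Rmax_r _ _) Hz).
   assert (L3 := Rle_trans _ _ _ (Rmax_l _ _) L1). assert (L4 := Rle_trans _ _ _ (Rmax_r _ _) L1).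
   rewrite EF by (intros ->; lra). rewrite Cmod_mult, Cmod_pow, pow_add.
   replace (2 ^ n * C0 * (`|z| ^ n * `|z| ^ N)) with ((2 * `|z|) ^ n * (C0 * `|z| ^ N)).
   2:{ rewrite Rpow_mult_distr. lra. }
   apply Rmult_le_compat; auto. apply pow_le, Cmod_ge_0.
   apply pow_incr. split. auto. generalize (Cmod_minus_le z p). lra.
  + exists P, (fun z => Q z * (z - p) ^ n)%C. split; [auto|split].
   * apply is_poly_mult; auto. apply is_poly_pow. apply (is_poly_plus (fun z => z) (fun _ => - p)%C).
    apply is_poly_id. apply is_poly_const.
   * intros z Hz. assert (N1 : ~ In z L) by (intros K; apply Hz; now right).
    assert (N2 : z <> p) by (intros ->; apply Hz; now left).
    assert (N3 : ((z - p) ^ n)%C <> RtoC 0) by now apply Cpow_nz, Cminus_neq0.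
    destruct (H3 z N1) as [N4 E4]. split. now apply Cmult_neq_0.
    rewrite EF in E4 by auto. replace (F z) with ((z - p) ^ n * F z / (z - p) ^ n)%C by (field; auto).
    rewrite E4. field. auto.
Qed.

(** * Polynomials in two variables *)

(** Coefficient lists are translated into polynomials in [w] over the integral domain of polynomials
    in [z], where pseudo-division, gcd and Bezout relations are available. *)
Module PolyAlgebra.
Import HB.structures all_boot all_order all_algebra boolp.
Import GRing.Theory.
Local Open Scope ring_scope.

HB.instance Definition _ := gen_eqMixin C.
HB.instance Definition _ := gen_choiceMixin C.

Lemma C_add0 : left_id (RtoC 0) Cplus. Proof. exact: Cplus_0_l. Qed.
Lemma C_addN : left_inverse (RtoC 0) Copp Cplus.
Proof. by move=> x; rewrite Cplus_comm Cplus_opp_r. Qed.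
HB.instance Definition _ := GRing.isZmodule.Build C Cplus_assoc Cplus_comm C_add0 C_addN.

Lemma C_mul1 : left_id (RtoC 1) Cmult. Proof. exact: Cmult_1_l. Qed.
Lemma C_mulDl : left_distributive Cmult Cplus.
Proof. by move=> x y z; rewrite Cmult_plus_distr_r. Qed.
Lemma C_one_neq0 : RtoC 1 != 0. Proof. by apply/eqP; apply: C1_nz. Qed.
HB.instance Definition _ :=
 GRing.Zmodule_isComNzRing.Build C Cmult_assoc Cmult_comm C_mul1 C_mulDl C_one_neq0.

Definition C_inv (x : C) : C := if `[< x = RtoC 0 >] then RtoC 0 else Cinv x.
Lemma C_mulV (x : C) : x != 0 -> C_inv x * x = 1.
Proof.
move/eqP=> nz; rewrite /C_inv; case: asboolP => // _; exact: Cinv_l.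
Qed.
Lemma C_inv0 : C_inv 0 = 0.
Proof. by rewrite /C_inv; case: asboolP. Qed.
HB.instance Definition _ := GRing.ComNzRing_isField.Build C C_mulV C_inv0.

(** Characteristic zero, by which a polynomial of positive degree has a non-zero derivative. *)
Lemma C_natr_neq0 n : (n.+1%:R : C) != 0.
Proof.
suff -> : (n.+1%:R : C) = RtoC (INR n.+1).
 by apply/eqP => E; move: (RtoC_inj _ _ E); apply: not_0_INR.
elim: n => [|n IHn]; first by [].
by rewrite [INR n.+2](S_INR n.+1) RtoC_plus -IHn -[in LHS]addn1 natrD.
Qed.

Lemma horner_peval (p : seq C) (z : C) : (Poly p).[z] = peval p z.
Proof.
elim: p => [|a p IHp]; first by rewrite horner0.
rewrite peval_cons -[Poly (a :: p)]/(cons_poly a (Poly p)) cons_poly_def hornerMXaddC IHp.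
by rewrite [RHS]Cplus_comm [Cmult z _]Cmult_comm.
Qed.

Definition ev (z w : C) (P : {poly {poly C}}) : C := (map_poly (horner_eval z) P).[w].

Lemma evM z w P Q : ev z w (P * Q) = ev z w P * ev z w Q.
Proof. by rewrite /ev rmorphM hornerM. Qed.
Lemma evD z w P Q : ev z w (P + Q) = ev z w P + ev z w Q.
Proof. by rewrite /ev rmorphD hornerD. Qed.
Lemma evC z w (c : {poly C}) : ev z w c%:P = c.[z].
Proof. by rewrite /ev map_polyC hornerC. Qed.

Definition to_poly (P : seq (seq C)) : {poly {poly C}} := Poly [seq Poly p | p <- P].
Definition of_poly (P : {poly {poly C}}) : seq (seq C) := [seq polyseq p | p <- polyseq P].

Lemma ev_to_poly P z w : ev z w (to_poly P) = peval2 P z w.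
Proof.
rewrite /ev /peval2; elim: P => [|p P IHP]; first by rewrite /to_poly /= rmorph0 horner0.
rewrite /to_poly /= cons_poly_def rmorphD rmorphM /= map_polyX map_polyC hornerMXaddC /=.
rewrite [X in X * w]IHP /horner_eval horner_peval.
by rewrite [LHS]Cplus_comm [X in Cplus _ X]Cmult_comm.
Qed.

Lemma polyseqK' (R : nzRingType) (P : {poly R}) : Poly P = P.
Proof. exact: polyseqK. Qed.

Lemma of_polyK P : to_poly (of_poly P) = P.
Proof.
rewrite /to_poly /of_poly -map_comp -[RHS]polyseqK; congr Poly.
by rewrite -[RHS]map_id; apply: eq_map => p /=; rewrite polyseqK.
Qed.

Lemma Poly_eq0 (p : seq C) : Poly p = 0 -> ~ pnonzero p.
Proof.
move=> p0 [a [Ha Na]]; elim: p p0 Ha => [//|b p IHp] /=.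
rewrite cons_poly_def => /polyP p0 [E|Ha].
 by apply: Na; rewrite -E; have := p0 0%N; rewrite coefD coefMX coefC coef0 add0r.
apply: IHp Ha; apply/polyP => i; have := p0 i.+1.
by rewrite coefD coefMX coefC addr0 !coef0.
Qed.

Lemma to_poly_neq0 P : pnonzero2 P -> to_poly P != 0.
Proof.
case=> p [Hp Np]; apply/eqP; elim: P Hp => [//|q P IHP] /=.
rewrite /to_poly /= cons_poly_def => Hin /polyP P0; case: Hin => [E|Hin].
 apply: (Poly_eq0 p _ Np); rewrite -E.
 by have := P0 0%N; rewrite coefD coefMX coefC coef0 add0r.
apply: IHP Hin _; apply/polyP => i; have := P0 i.+1.
by rewrite coefD coefMX coefC addr0 !coef0.
Qed.

Lemma pnonzero_of (p : {poly C}) : p != 0 -> pnonzero p.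
Proof.
move=> nz; exists (lead_coef p); split; last by apply/eqP; rewrite lead_coef_eq0.
have s0 : (0 < size p)%N by rewrite size_poly_gt0.
rewrite lead_coefE; move: s0; case: (polyseq p) => // a s _ /=.
rewrite -last_nth; elim: s a => [|b s IHs] a /=; first by left.
by right; apply: IHs.
Qed.

Lemma pnonzero2_of (P : {poly {poly C}}) : P != 0 -> pnonzero2 (of_poly P).
Proof.
move=> nz; exists (lead_coef P); split; last by apply: pnonzero_of; rewrite lead_coef_eq0.
apply: (List.in_map (@polyseq C)).
have s0 : (0 < size P)%N by rewrite size_poly_gt0.
rewrite lead_coefE; move: s0; case: (polyseq P) => // a s _ /=.
rewrite -last_nth; elim: s a => [|b s IHs] a /=; first by left.
by right; apply: IHs.
Qed.

(* [P] has no multiple factor over the field of rational functions in [z]. *)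
Definition separable_bivariate (P : {poly {poly C}}) :=
 exists A B : {poly {poly C}}, exists D : {poly C}, D != 0 /\ A * P + B * P^`() = D%:P.

(** Let [G] be the gcd of [P] and its derivative. If [G] does not depend on [w], the Bezout relation
    makes [P] separable. Otherwise [P] is [Q G], up to a factor that depends only on [z], with both
    degrees smaller, and the induction applies to [Q] and [G]. The scalar [c] collects the factors
    due to division over a domain that is not a field. *)
Lemma separable_factors n (P : {poly {poly C}}) : (size P <= n)%N -> P != 0 ->
 exists (c : {poly C}) (l : seq {poly {poly C}}), c != 0 /\ c *: P = \prod_(Q <- l) Q /\
  (forall Q, List.In Q l -> Q != 0 /\ separable_bivariate Q).
Proof.
elim: n P => [|n IHn] P sP nzP; first by move: nzP; rewrite -size_poly_gt0 lt0n -leqn0 sP.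
pose G := gcdp P P^`().
have nzG : G != 0 by rewrite gcdp_eq0 (negPf nzP).
have [sG|sG] := leqP (size G) 1.
 exists 1, [:: P]; split; first exact: oner_neq0.
 split; first by rewrite scale1r big_seq1.
 move=> Q [<-|//]; split=> //.
 have [u eqG] := Pdiv.Idomain.Bezoutp P P^`().
 move/Pdiv.Idomain.eqpP: eqG => [[c1 c2] /andP[/= nz1 nz2] E].
 (* The Bezout relation holds up to the scalars [c1] and [c2], and [G] is its own constant
    coefficient. *)
 exists (c1 *: u.1), (c1 *: u.2), (c2 * G`_0); split.
  rewrite mulf_neq0 //; apply: contra nzG => /eqP G0.
  by rewrite (size1_polyC sG) G0.
 by rewrite -!scalerAl -scalerDr E -/G [in LHS](size1_polyC sG) -mul_polyC polyCM.
have sP2 : (1 < size P)%N by apply: leq_trans sG (dvdp_leq nzP (dvdp_gcdl _ _)).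
have nzP' : P^`() != 0.
 apply/eqP => /polyP /(_ (size P).-2); rewrite coef_deriv coef0.
 have -> : (size P).-2.+1 = (size P).-1 by case: (size P) sP2 => [|[]].
 rewrite -lead_coefE => /eqP; apply/negP.
 have -> : (size P).-1 = (size P).-2.+1 by case: (size P) sP2 => [|[]].
 rewrite -mulr_natr mulf_neq0 ?lead_coef_eq0 //.
 by rewrite -polyC_natr polyC_eq0; apply: C_natr_neq0.
have sGP : (size G < size P)%N.
 apply: leq_ltn_trans (dvdp_leq nzP' (dvdp_gcdr P _)) _.
 exact: lt_size_deriv.
have /Pdiv.Idomain.dvdpP [[c Q] /= nzc E] : G %| P by exact: dvdp_gcdl.
have nzcP : c *: P != 0 by rewrite -mul_polyC mulf_eq0 polyC_eq0 (negPf nzc).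
have nzQ : Q != 0 by apply: contra nzcP => /eqP Q0; rewrite E Q0 mul0r.
have sQ : (size Q < size P)%N.
 have := size_mul nzQ nzG; rewrite -E size_scale // => ->.
 by case: (size G) sG => [|[|k]] // _; rewrite addnS addnS /= ltnS leq_addr.
have [|cQ [lQ [nzcQ [EQ HQ]]]] := IHn Q _ nzQ; first by rewrite -ltnS (leq_trans sQ).
have [|cG [lG [nzcG [EG HG]]]] := IHn G _ nzG; first by rewrite -ltnS (leq_trans sGP).
exists (cQ * cG * c), (lQ ++ lG); split; first by rewrite !mulf_neq0.
split; last by move=> T /(List.in_app_or lQ lG) [/HQ|/HG].
by rewrite big_cat /= -EQ -EG -scalerA E -scalerAl -scalerAr scalerA.
Qed.

Definition dw (P : list (list C)) : list (list C) := of_poly (to_poly P)^`().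

Theorem separable_decomposition (P : list (list C)) : pnonzero2 P ->
 exists (c : list C) (l : list (list (list C))), pnonzero c /\
  (forall z w, (Cmult (peval c z) (peval2 P z w)) = fold_right Cmult (RtoC 1) (map (fun Q => peval2 Q z w) l)) /\
  (forall Q, In Q l -> pnonzero2 Q /\ exists A B D, pnonzero D /\
   forall z w, Cplus (Cmult (peval2 A z w) (peval2 Q z w)) (Cmult (peval2 B z w) (peval2 (dw Q) z w)) = peval D z).
Proof.
move=> /to_poly_neq0 nzP.
have [c [l [nzc [E H]]]] := separable_factors _ _ (leqnn _) nzP.
exists (polyseq c), (map of_poly l); split; first exact: pnonzero_of.
have evof z w Q : peval2 (of_poly Q) z w = ev z w Q by rewrite -ev_to_poly of_polyK.
split.
 move=> z w; rewrite -ev_to_poly -[peval c z]horner_peval polyseqK'.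
 have -> : Cmult c.[z] (ev z w (to_poly P)) = ev z w (c *: to_poly P).
  by rewrite -mul_polyC evM evC.
 rewrite E {E H}; elim: l => [|Q l IHl] /=.
  by rewrite big_nil -[1]/(1%:P) evC hornerC.
 by rewrite big_cons evM IHl evof.
move=> Q0 /List.in_map_iff [Q [<- /H [nzQ [A [B [D [nzD EQ]]]]]]].
split; first exact: pnonzero2_of.
exists (of_poly A), (of_poly B), (polyseq D); split; first exact: pnonzero_of.
move=> z w; rewrite /dw !evof of_polyK -[peval D z]horner_peval polyseqK'.
by rewrite -(evC z w D) -EQ evD !evM.
Qed.

Lemma peval2_mult P Q : pnonzero2 P -> pnonzero2 Q -> exists T, pnonzero2 T /\
 forall z w, peval2 T z w = Cmult (peval2 P z w) (peval2 Q z w).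
Proof.
move=> /to_poly_neq0 nzP /to_poly_neq0 nzQ; exists (of_poly (to_poly P * to_poly Q)).
split=> [|z w]; first by apply: pnonzero2_of; rewrite mulf_neq0.
by rewrite -!ev_to_poly of_polyK evM.
Qed.

Lemma dw_nil z w : peval2 (dw nil) z w = RtoC 0.
Proof. by rewrite /dw -ev_to_poly of_polyK /to_poly /= deriv0 /ev rmorph0 horner0. Qed.

Lemma dw_cons p P z w :
 peval2 (dw (p :: P)) z w = Cplus (peval2 P z w) (Cmult w (peval2 (dw P) z w)).
Proof.
rewrite /dw -!ev_to_poly !of_polyK -[to_poly (p :: P)]/(cons_poly (Poly p) (to_poly P)).
have evX : ev z w 'X = w by rewrite /ev map_polyX hornerX.
rewrite cons_poly_def derivD derivC addr0 derivM derivX mulr1 evD evM evX.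
by rewrite [RHS]Cplus_comm [Cmult w _]Cmult_comm.
Qed.
End PolyAlgebra.

(** * Continuation of algebraic germs *)

Lemma peval2_nil z w : peval2 nil z w = RtoC 0.
Proof. auto. Qed.

Lemma peval2_cons p P z w : peval2 (p :: P) z w = (peval p z + w * peval2 P z w)%C.
Proof. auto. Qed.

Lemma holo_peval2 P f z : holo f z -> holo (fun z => peval2 P z (f z)) z.
Proof.
 intros Hf. induction P as [|p P IH]. apply (holo_const (RtoC 0)).
 apply (holo_plus (peval p) (fun z => f z * peval2 P z (f z))%C). apply holo_peval. now apply holo_mult.
Qed.

Lemma peval_zero_not_pnonzero q : (forall z, peval q z = RtoC 0) -> ~ pnonzero q.
Proof.
 induction q as [|a q IH]; intros H [b [Hb Nb]]. easy.
 assert (Ea : a = RtoC 0). { specialize (H 0%C). rewrite peval_cons in H. rewrite <- H. ring. }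
 subst a. assert (Z : forall z, z <> RtoC 0 -> peval q z = RtoC 0).
 { intros z Hz. specialize (H z). rewrite peval_cons, Cplus_0_l in H. apply Cmult_integral in H. tauto. }
 apply IH.
 - intros z. destruct (Ceq_dec z 0) as [->|]; auto.
  apply (holo_zero_accumulation (peval q) 0%C 1); try lra. intros ? _; apply holo_peval.
  + intros p Hp. exists (RtoC (p / 2)). assert (E : (RtoC (p / 2) - 0)%C = RtoC (p / 2)) by ring.
   assert (N : RtoC (p / 2) <> RtoC 0). { intros E'. apply RtoC_inj in E'. lra. }
   repeat sa. rewrite E, Cmod_R, Rabs_pos_eq; lra.
  + self.
 - exists b. destruct Hb as [<-|Hb]; [congruence|auto].
Qed.

(** * Roots of polynomials and bounds for the roots of an algebraic equation *)

Lemma synthetic_division p : forall q, exists q', length q' = pred (length q) /\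
 forall z, (peval q z - peval q p)%C = ((z - p) * peval q' z)%C.
Proof.
 induction q as [|a q [q' [L E]]].
 - exists nil. sa. intros; rewrite !peval_nil; ring.
 - destruct q as [|b q].
  + exists nil. sa. intros; rewrite !peval_cons, !peval_nil; ring.
  + exists (peval (b :: q) p :: q'). split. simpl in *. auto.
   intros z. rewrite (peval_cons a), (peval_cons a), (peval_cons (peval (b :: q) p)).
   specialize (E z). replace (a + z * peval (b :: q) z - (a + p * peval (b :: q) p))%C with
    ((z - p) * peval (b :: q) p + z * (peval (b :: q) z - peval (b :: q) p))%C by ring.
   rewrite E. ring.
Qed.

Lemma factor_root p n : forall q, length q = n -> pnonzero q -> exists k u, peval u p <> RtoC 0 /\
 forall z, peval q z = ((z - p) ^ k * peval u z)%C.
Proof.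
 induction n as [|n IH]; intros q L H.
 - destruct q; [|easy]. now destruct H as [a [[] _]].
 - destruct (Ceq_dec (peval q p) 0) as [E|N].
  + destruct (synthetic_division p q) as [q' [L' E']].
   assert (E2 : forall z, peval q z = ((z - p) * peval q' z)%C). { intros z. rewrite <- E', E. ring. }
   destruct (IH q') as [k [u [Hu Eu]]]. lia.
   { apply NNPP. intros N. apply (peval_zero_not_pnonzero q); auto. intros z.
    destruct (Ceq_dec (peval q' z) 0) as [E0|N0]. rewrite E2, E0; ring.
    exfalso. apply N. now apply pnonzero_peval with z. }
   exists (S k), u. sa. intros z. rewrite E2, Eu. simpl. ring.
  + exists O, q. sa. intros; simpl; ring.
Qed.

Lemma finite_roots n : forall q, length q = n -> pnonzero q -> exists L, forall z, peval q z = RtoC 0 -> In z L.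
Proof.
 induction n as [|n IH]; intros q L H.
 - destruct q; [|easy]. now destruct H as [a [[] _]].
 - destruct (classic (exists p, peval q p = RtoC 0)) as [[p E]|N].
  + destruct (synthetic_division p q) as [q' [L' E']].
   assert (E2 : forall z, peval q z = ((z - p) * peval q' z)%C). { intros z. rewrite <- E', E. ring. }
   destruct (IH q') as [l Hl]. lia.
   { apply NNPP. intros N. apply (peval_zero_not_pnonzero q); auto. intros z.
    destruct (Ceq_dec (peval q' z) 0) as [E0|N0]. rewrite E2, E0; ring.
    exfalso. apply N. now apply pnonzero_peval with z. }
   exists (p :: l). intros z Hz. rewrite E2 in Hz. apply Cmult_integral in Hz. destruct Hz as [Hz|Hz].
   left. symmetry. now apply Cminus_eq0. right; auto.
  + exists nil. intros z Hz. exfalso. eauto.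
Qed.

Definition coef_sum (P : list (list C)) (z : C) : R := fold_right (fun p x => `|peval p z| + x) 0 P.

Lemma coef_sum_ge0 P z : 0 <= coef_sum P z.
Proof. induction P; simpl. lra. cm. Qed.

(** [q] is the last coefficient that is not the zero polynomial, the leading coefficient in [w]. A
    root of modulus at least [1] is bounded by comparing the leading term with the others. *)
Lemma root_bound P : pnonzero2 P -> exists q, pnonzero q /\ forall z w, peval2 P z w = RtoC 0 ->
 `|peval q z| * `|w| <= coef_sum P z.
Proof.
 intros HP.
 (* The term [|w| |P(z,w)|] vanishes at a root; it is kept so that the estimate survives passing
    from [P] to [p + w P]. *)
 assert (exists q n, In q P /\ pnonzero q /\ forall z w, 1 <= `|w| ->
  `|peval q z| * `|w| ^ S n <= `|w| * `|peval2 P z w| + coef_sum P z * `|w| ^ n) as [q [n [Hin [Hq K]]]].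
 { induction P as [|p P IH]. now destruct HP as [? [[] _]].
  destruct (classic (pnonzero2 P)) as [HP'|HP'].
  - destruct (IH HP') as [q [n [Hin [Hq K]]]]. exists q, (S n). split; [now right|]. sa. intros z w Hw.
   specialize (K z w Hw). rewrite peval2_cons. simpl coef_sum.
   assert (T : `|w| * `|peval2 P z w| <= `|peval p z + w * peval2 P z w| + `|peval p z|).
   { rewrite <- Cmod_mult. generalize (Cmod_plus_ge (w * peval2 P z w) (peval p z)).
    rewrite (Cplus_comm (w * peval2 P z w)). lra. }
   assert (W : 1 <= `|w| ^ n) by now apply pow_R1_Rle.
   generalize (Cmod_ge_0 (peval p z)) (coef_sum_ge0 P z). intros P1 P2. simpl pow in *.
   assert (M : `|w| * (`|peval q z| * (`|w| * `|w| ^ n)) <= `|w| *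
    (`|peval p z + w * peval2 P z w| + `|peval p z| + coef_sum P z * `|w| ^ n)). nra.
   assert (`|w| * `|peval p z| <= `|w| * (`|peval p z| * `|w| ^ n)).
   { apply Rmult_le_compat_l. lra. nra. }
   nra.
  - exists p, O. split; [now left|]. destruct HP as [p' [[->|Hp] Hn]]. 2:{ exfalso. apply HP'. now exists p'. }
   sa. intros z w Hw. rewrite peval2_cons.
   assert (Z : peval2 P z w = RtoC 0).
   { clear IH. induction P as [|q P IH]. auto. rewrite peval2_cons, IH.
    - destruct (Ceq_dec (peval q z) 0) as [->|N]. ring. exfalso. apply HP'. exists q. split. now left.
     now apply pnonzero_peval with z.
    - intros [r [Hr Nr]]. apply HP'. exists r. sa. now right. }
   rewrite Z, Cmult_0_r, Cplus_0_r. simpl. generalize (Cmod_ge_0 (peval p' z)) (coef_sum_ge0 P z). lra. }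
 exists q. sa. intros z w E.
 assert (Hs : `|peval q z| <= coef_sum P z).
 { clear - Hin. induction P as [|p P IH]. easy. simpl. generalize (Cmod_ge_0 (peval p z)) (coef_sum_ge0 P z).
  destruct Hin as [->|Hin]. lra. specialize (IH Hin). lra. }
 destruct (Rle_lt_dec 1 (`|w|)) as [L|L].
 - specialize (K z w L). rewrite E, Cmod_0, Rmult_0_r, Rplus_0_l in K. simpl in K.
  assert (W : 0 < `|w| ^ n) by (apply pow_lt; lra). nra.
 - generalize (Cmod_ge_0 (peval q z)) (Cmod_ge_0 w). nra.
Qed.

(** * The implicit function theorem for polynomial equations *)

Definition lipschitz2 (f : C -> C -> C) : Prop := forall M, exists K, 0 <= K /\
 forall z w z' w', `|z| <= M -> `|w| <= M -> `|z'| <= M -> `|w'| <= M ->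
  `|f z w| <= K /\ `|f z w - f z' w'| <= K * (`|z - z'| + `|w - w'|).

Lemma lipschitz2_const c : lipschitz2 (fun _ _ => c).
Proof.
 intros M. exists (`|c|). split. auto. intros z w z' w' _ _ _ _. sp.
 rewrite Cmod_sub_self. generalize (Cmod_ge_0 c) (Cmod_ge_0 (z - z')) (Cmod_ge_0 (w - w')). nra.
Qed.

Lemma lipschitz2_fst : lipschitz2 (fun z _ => z).
Proof.
 intros M. exists (Rmax M 1). generalize (Rmax_l M 1) (Rmax_r M 1); intros. sp.
 intros z w z' w' H1 _ _ _. sp. generalize (Cmod_ge_0 (z - z')) (Cmod_ge_0 (w - w')). nra.
Qed.

Lemma lipschitz2_snd : lipschitz2 (fun _ w => w).
Proof.
 intros M. exists (Rmax M 1). generalize (Rmax_l M 1) (Rmax_r M 1); intros. sp.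
 intros z w z' w' _ H1 _ _. sp. generalize (Cmod_ge_0 (z - z')) (Cmod_ge_0 (w - w')). nra.
Qed.

Lemma lipschitz2_plus f g : lipschitz2 f -> lipschitz2 g -> lipschitz2 (fun z w => f z w + g z w)%C.
Proof.
 intros Hf Hg M. destruct (Hf M) as [K [PK HK]]. destruct (Hg M) as [L [PL HL]].
 exists (K + L). sp. intros z w z' w' H1 H2 H3 H4.
 destruct (HK z w z' w') as [A1 A2]; auto. destruct (HL z w z' w') as [B1 B2]; auto. split.
 - tri. lra.
 - replace (f z w + g z w - (f z' w' + g z' w'))%C with ((f z w - f z' w') + (g z w - g z' w'))%C by ring.
  tri. lra.
Qed.

Lemma lipschitz2_mult f g : lipschitz2 f -> lipschitz2 g -> lipschitz2 (fun z w => f z w * g z w)%C.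
Proof.
 intros Hf Hg M. destruct (Hf M) as [K [PK HK]]. destruct (Hg M) as [L [PL HL]].
 exists (2 * (K * L)). split. nra. intros z w z' w' H1 H2 H3 H4.
 destruct (HK z w z' w') as [A1 A2]; auto. destruct (HL z w z' w') as [B1 B2]; auto.
 destruct (HK z' w' z w) as [C1 _]; auto.
 assert (0 <= K * L) by nra. split.
 - rewrite Cmod_mult. assert (`|f z w| * `|g z w| <= K * L).
  apply Rmult_le_compat; auto. lra.
 - replace (f z w * g z w - f z' w' * g z' w')%C
   with ((f z w - f z' w') * g z w + f z' w' * (g z w - g z' w'))%C by ring.
  tri. rewrite !Cmod_mult. set (D := `|z - z'| + `|w - w'|) in *.
  assert (0 <= D) by (unfold D; generalize (Cmod_ge_0 (z - z')) (Cmod_ge_0 (w - w')); lra).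
  assert (`|f z w - f z' w'| * `|g z w| <= (K * D) * L) by (apply Rmult_le_compat; auto).
  assert (`|f z' w'| * `|g z w - g z' w'| <= K * (L * D)) by (apply Rmult_le_compat; auto). lra.
Qed.

Lemma lipschitz2_peval p : lipschitz2 (fun z _ => peval p z).
Proof.
 induction p as [|a p IH]. apply (lipschitz2_const (RtoC 0)).
 apply (lipschitz2_plus (fun _ _ => a) (fun z _ => z * peval p z)%C). apply lipschitz2_const.
 apply lipschitz2_mult; auto. apply lipschitz2_fst.
Qed.

Lemma lipschitz2_peval2 P : lipschitz2 (peval2 P).
Proof.
 induction P as [|p P IH]. apply (lipschitz2_const (RtoC 0)).
 apply (lipschitz2_plus (fun z _ => peval p z) (fun z w => w * peval2 P z w)%C). apply lipschitz2_peval.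
 apply lipschitz2_mult; auto. apply lipschitz2_snd.
Qed.

Notation dw := PolyAlgebra.dw.

(** By Horner's recursion the remainder of [p + w P] is [w] times that of [P], plus [(w - w')^2]
    times the derivative of [P], which is bounded. *)
Lemma taylor2 P M : exists K, 0 <= K /\ forall z w w', `|z| <= M -> `|w| <= M -> `|w'| <= M ->
 `|peval2 P z w - peval2 P z w' - peval2 (dw P) z w' * (w - w')| <= K * (`|w - w'| * `|w - w'|).
Proof.
 induction P as [|p P [K [PK HK]]].
 - exists 0. sp. intros. rewrite PolyAlgebra.dw_nil, !peval2_nil.
  replace (0 - 0 - 0 * (w - w'))%C with (RtoC 0) by ring. rewrite Cmod_0. lra.
 - destruct (lipschitz2_peval2 (dw P) M) as [L [PL HL]].
  set (M' := Rmax M 0). assert (M <= M' /\ 0 <= M') by (split; [apply Rmax_l|apply Rmax_r]).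
  exists (M' * K + L). split. nra. intros z w w' Hz Hw Hw'.
  rewrite PolyAlgebra.dw_cons, !peval2_cons. specialize (HK z w w' Hz Hw Hw').
  destruct (HL z w' z w') as [HL1 _]; auto.
  replace (peval p z + w * peval2 P z w - (peval p z + w' * peval2 P z w') -
   (peval2 P z w' + w' * peval2 (dw P) z w') * (w - w'))%C with
   (w * (peval2 P z w - peval2 P z w' - peval2 (dw P) z w' * (w - w'))
    + (w - w') * (w - w') * peval2 (dw P) z w')%C by ring.
  tri. rewrite !Cmod_mult. set (D := `|w - w'| * `|w - w'|) in *.
  assert (0 <= D) by (apply Rmult_le_pos; apply Cmod_ge_0).
  assert (`|w| * `|peval2 P z w - peval2 P z w' - peval2 (dw P) z w' * (w - w')| <= M' * (K * D)).
  { apply Rmult_le_compat; auto. lra. }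
  nra.
Qed.

Lemma C_cauchy_complete (u : nat -> C) : (forall e, 0 < e -> exists N, forall n m, (N <= n)%nat -> (N <= m)%nat -> `|u n - u m| < e) ->
 exists l, forall e, 0 < e -> exists N, forall n, (N <= n)%nat -> `|u n - l| < e.
Proof.
 intros H.
 destruct (Rcomplete.R_complete (fun n => Re (u n))) as [x Hx].
 { intros e He. destruct (H e He) as [N HN]. exists N. intros n m Hn Hm. specialize (HN n m Hn Hm).
  unfold Rdist. eapply Rle_lt_trans; [|apply HN]. generalize (re_le_Cmod (u n - u m)). auto. }
 destruct (Rcomplete.R_complete (fun n => Im (u n))) as [y Hy].
 { intros e He. destruct (H e He) as [N HN]. exists N. intros n m Hn Hm. specialize (HN n m Hn Hm).
  unfold Rdist. eapply Rle_lt_trans; [|apply HN]. generalize (im_le_Cmod (u n - u m)). auto. }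
 exists (x, y). intros e He. destruct (Hx (e/2)) as [N1 H1]. lra. destruct (Hy (e/2)) as [N2 H2]. lra.
 exists (Nat.max N1 N2). intros n Hn. specialize (H1 n ltac:(lia)). specialize (H2 n ltac:(lia)).
 eapply Rle_lt_trans. apply Cmod_le_re_im. unfold Cminus. rewrite re_plus, im_plus, re_opp, im_opp.
 unfold Rdist in *. simpl. unfold Rminus in *. lra.
Qed.

Lemma contraction T w0 eta : 0 < eta ->
 (forall w w', `|w - w0| <= eta -> `|w' - w0| <= eta -> `|T w - T w'| <= / 2 * `|w - w'|) ->
 `|T w0 - w0| <= eta / 2 -> exists w, `|w - w0| <= eta /\ T w = w.
Proof.
 intros He HT H0. set (u := fix u n := match n with O => w0 | S n => T (u n) end).
 assert (Hu : forall n, `|u n - w0| <= eta).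
 { induction n; simpl. self. eapply Rle_trans. apply (Cmod_triangle_minus _ (T w0)).
  assert (`|T (u n) - T w0| <= / 2 * `|u n - w0|); [|lra]. apply HT; auto. self. }
 assert (P2 : forall n, 0 < (/ 2) ^ n) by (intros; apply pow_lt; lra).
 assert (Hd : forall n, `|u (S n) - u n| <= eta / 2 * (/ 2) ^ n).
 { induction n. simpl. lra. change (`|T (u (S n)) - T (u n)| <= eta / 2 * (/ 2) ^ S n).
  eapply Rle_trans. auto. simpl pow. lra. }
 assert (Hc : forall n k, `|u (n + k)%nat - u n| <= eta * (/ 2) ^ n * (1 - (/ 2) ^ k)).
 { induction k. rewrite Nat.add_0_r, Cmod_sub_self. lra. rewrite Nat.add_succ_r.
  eapply Rle_trans. apply (Cmod_triangle_minus _ (u (n + k)%nat)). specialize (Hd (n + k)%nat).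
  rewrite pow_add in Hd. simpl pow. lra. }
 destruct (C_cauchy_complete u) as [w Hw].
 { intros e Pe. destruct (pow_lt_1_zero (/ 2) ltac:(rewrite Rabs_pos_eq; lra) (e / (4 * eta))) as [N HN]. pos.
  specialize (HN N (le_n N)). rewrite Rabs_pos_eq in HN by (apply Rlt_le, P2). apply Rlt_div_r in HN; [|lra].
  assert (B : forall n, (N <= n)%nat -> `|u n - u N| <= e / 4).
  { intros n Hn. specialize (Hc N (n - N)%nat). replace (N + (n - N))%nat with n in Hc by lia.
   generalize (P2 N) (P2 (n - N)%nat). intros. eapply Rle_trans. eauto. assert (0 < eta * (/ 2) ^ N) by nra. nra. }
  exists N. intros n m Hn Hm. generalize (B n Hn) (B m Hm) (Cmod_triangle_minus (u n) (u N) (u m)).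
  rewrite (Cmod_minus_sym (u N)). lra. }
 assert (Hw0 : `|w - w0| <= eta).
 { apply Rnot_lt_le. intros L. destruct (Hw (`|w - w0| - eta)) as [N HN]. lra.
  specialize (HN N (le_n N)). generalize (Hu N) (Cmod_triangle_minus w (u N) w0). rewrite (Cmod_minus_sym w (u N)). lra. }
 exists w. sa. apply Cminus_eq0, Cmod_small. intros e Pe.
 destruct (Hw (e / 2)) as [N HN]. lra. assert (A := HN N (le_n N)). assert (B := HN (S N) ltac:(lia)).
 eapply Rle_trans. apply (Cmod_triangle_minus _ (u (S N))). change (u (S N)) with (T (u N)) at 1.
 assert (`|T w - T (u N)| <= / 2 * `|w - u N|) by auto. triang.
Qed.

(** The simplified Newton map [w - P(z,w)/a], with the slope [a] taken at the given root, is a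
    contraction. The radii [d] and [eta] depend only on [M] and [kap] and not on the root: this
    uniformity yields one disc for all the branches and all their starting points. *)
Lemma implicit_function P M kap : 0 < kap -> exists d eta, 0 < d /\ 0 < eta /\
 forall z1 w1, `|z1| <= M -> `|w1| <= M -> peval2 P z1 w1 = RtoC 0 -> kap <= `|peval2 (dw P) z1 w1| ->
 exists phi, hold phi z1 d /\ (forall z, `|z - z1| < d -> peval2 P z (phi z) = RtoC 0) /\
  forall z w, `|z - z1| < d -> `|w - w1| <= eta -> peval2 P z w = RtoC 0 -> w = phi z.
Proof.
 intros Hk.
 destruct (lipschitz2_peval2 P (M + 1)) as [L1 [PL1 HL1]].
 destruct (lipschitz2_peval2 (dw P) (M + 1)) as [L2 [PL2 HL2]].
 destruct (taylor2 P (M + 1)) as [K [PK HK]].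
 (* These constants make the slope vary by at most [kap/4], so that the Newton map contracts by the
    factor [1/2], and make its first step at most [eta/2]. *)
 set (A := 8 * (1 + L1 + L2 + K)).
 set (eta := Rmin 1 (kap / A)). assert (PA : 0 < A) by pos.
 assert (Peta : 0 < eta). pos.
 assert (He1 : eta <= 1) by apply Rmin_l.
 assert (He2 : eta * A <= kap). { apply Rle_div_r; auto. apply Rmin_r. }
 set (d := Rmin eta (eta * kap / A)).
 assert (Pd : 0 < d). pos.
 assert (Hd1 : d <= eta) by apply Rmin_l.
 assert (Hd2 : d * A <= eta * kap). { apply Rle_div_r; auto. apply Rmin_r. }
 exists d, eta. sa. sa. intros z1 w1 Hz1 Hw1 E1 Ha.
 set (a := peval2 (dw P) z1 w1) in *. assert (Na : a <> RtoC 0) by (apply Cmod_gt_0; lra).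
 assert (Bz : forall z, `|z - z1| < d -> `|z| <= M + 1).
 { intros z Hz. replace z with (z1 + (z - z1))%C by ring. tri. lra. }
 assert (Bw : forall w, `|w - w1| <= eta -> `|w| <= M + 1).
 { intros w Hw. replace w with (w1 + (w - w1))%C by ring. tri. lra. }
 assert (Hz1' : `|z1| <= M + 1) by lra. assert (Hw1' : `|w1| <= M + 1) by lra.
 set (T := fun z w => (w - peval2 P z w / a)%C).
 assert (dwa : forall z w, `|z - z1| < d -> `|w - w1| <= eta -> `|peval2 (dw P) z w - a| <= kap / 4).
 { intros z w Hz Hw. destruct (HL2 z w z1 w1) as [_ H]; auto. eapply Rle_trans. eauto.
  apply Rle_trans with (L2 * (eta + eta)). nra. unfold A in He2. nra. }
 assert (TC : forall z w w', `|z - z1| < d -> `|w - w1| <= eta -> `|w' - w1| <= eta ->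
  `|T z w - T z w'| <= / 2 * `|w - w'|).
 { intros z w w' Hz Hw Hw'. unfold T.
  replace (w - peval2 P z w / a - (w' - peval2 P z w' / a))%C with
  (- (((peval2 P z w - peval2 P z w' - peval2 (dw P) z w' * (w - w')) + (peval2 (dw P) z w' - a) * (w - w')) / a))%C by (field; auto).
  rewrite Cmod_opp, Cmod_div by auto. apply Rle_div_l. lra.
  tri. rewrite Cmod_mult.
  assert (B1 := HK z w w' (Bz z Hz) (Bw w Hw) (Bw w' Hw')). assert (B2 := dwa z w' Hz Hw').
  assert (B3 : `|w - w'| <= 2 * eta).
  { generalize (Cmod_triangle_minus w w1 w'). rewrite (Cmod_minus_sym w1). lra. }
  generalize (Cmod_ge_0 (w - w')). intros P0.
  assert (K * (`|w - w'| * `|w - w'|) <= kap / 4 * `|w - w'|).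
  { rewrite <- Rmult_assoc. apply Rmult_le_compat_r; auto. apply Rle_trans with (K * (2 * eta)).
   apply Rmult_le_compat_l; auto. unfold A in He2. nra. }
  assert (`|peval2 (dw P) z w' - a| * `|w - w'| <= kap / 4 * `|w - w'|) by nra. nra. }
 assert (FP : forall z, `|z - z1| < d -> exists w, `|w - w1| <= eta /\ peval2 P z w = RtoC 0).
 { intros z Hz. destruct (contraction (T z) w1 eta) as [w [Hw Ew]]; auto.
  - unfold T. replace (w1 - peval2 P z w1 / a - w1)%C with (- (peval2 P z w1 / a))%C by ring.
   rewrite Cmod_opp, Cmod_div by auto. apply Rle_div_l. lra.
   destruct (HL1 z w1 z1 w1) as [_ H]; auto. rewrite E1, Cmod_sub_self in H.
   replace (peval2 P z w1 - 0)%C with (peval2 P z w1) in H by ring.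
   eapply Rle_trans. eauto. apply Rle_trans with (L1 * d). nra.
   assert (eta / 2 * kap <= eta / 2 * `|a|) by nra. unfold A in Hd2. nra.
  - exists w. sa. unfold T in Ew.
   assert (E : (peval2 P z w / a)%C = RtoC 0).
   { replace (peval2 P z w / a)%C with (w - (w - peval2 P z w / a))%C by ring. rewrite Ew. ring. }
   replace (peval2 P z w) with (peval2 P z w / a * a)%C by (field; auto). rewrite E. ring. }
 assert (UQ : forall z w w', `|z - z1| < d -> `|w - w1| <= eta -> `|w' - w1| <= eta ->
  `|w - w'| <= 2 / kap * `|peval2 P z w - peval2 P z w'|).
 { intros z w w' Hz Hw Hw'. specialize (TC z w w' Hz Hw Hw'). unfold T in TC.
  replace (w - peval2 P z w / a - (w' - peval2 P z w' / a))%C with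
   ((w - w') - (peval2 P z w - peval2 P z w') / a)%C in TC by (field; auto).
  generalize (Cmod_minus_ge (w - w') ((peval2 P z w - peval2 P z w') / a)).
  rewrite Cmod_div by auto. intros H.
  assert (`|peval2 P z w - peval2 P z w'| / `|a| <= / kap * `|peval2 P z w - peval2 P z w'|).
  { unfold Rdiv. rewrite Rmult_comm. apply Rmult_le_compat_r. apply Cmod_ge_0. apply Rinv_le_contravar; auto. }
  unfold Rdiv. lra. }
 set (phi := fun z => epsilon (inhabits (RtoC 0)) (fun w => `|w - w1| <= eta /\ peval2 P z w = RtoC 0)).
 assert (Hphi : forall z, `|z - z1| < d -> `|phi z - w1| <= eta /\ peval2 P z (phi z) = RtoC 0).
 { intros z Hz. destruct (FP z Hz) as [w Hw].
  apply (epsilon_spec (inhabits (RtoC 0)) (fun w => `|w - w1| <= eta /\ peval2 P z w = RtoC 0) (ex_intro _ w Hw)). }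
 exists phi. split; [|split].
 - intros z Hz. destruct (Hphi z Hz) as [Bphi Ephi].
  destruct (holo_peval2 P (fun _ => phi z) z (holo_const _ _)) as [l Hl].
  set (b := peval2 (dw P) z (phi z)).
  assert (Hb : 3 * kap / 4 <= `|b|).
  { specialize (dwa z (phi z) Hz Bphi). fold b in dwa. generalize (Cmod_minus_ge a (a - b)).
   replace (a - (a - b))%C with b by ring. rewrite (Cmod_minus_sym a b). lra. }
  assert (Nb : b <> RtoC 0) by (apply Cmod_gt_0; lra).
  (* Implicit differentiation: [l] is the derivative of the equation in [z] for fixed [w], and [b]
     the derivative in [w]. *)
  exists (- l / b)%C. intros e He.
  set (Lp := 2 / kap * L1). assert (PLp : 0 <= Lp). { apply Rmult_le_pos; auto. apply Rdiv_le_0_compat; lra. }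
  destruct (Hl (e * kap / 4)) as [d1 [Pd1 H1]]. nra.
  set (Q := L2 * Lp + K * Lp * Lp). assert (PQ : 0 <= Q) by (unfold Q; assert (0 <= L2 * Lp) by nra; assert (0 <= K * Lp) by nra; nra).
  set (d2 := e * kap / 4 / (Q + 1)). assert (Pd2 : 0 < d2). pos.
  exists (Rmin (Rmin d1 d2) (d - `|z - z1|)). split. pos.
  intros x Hx. assert (X0 := lt_minl Hx). assert (X3 := lt_minr Hx).
  assert (X1 := lt_minl X0). assert (X2 := lt_minr X0).
  assert (Hxz : `|x - z1| < d) by triang.
  destruct (Hphi x Hxz) as [Bx Ex]. specialize (H1 x X1). cbv beta in H1. rewrite Ephi in H1.
  assert (Lip : `|phi x - phi z| <= Lp * `|x - z|).
  { eapply Rle_trans. eauto. rewrite Ex.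
   destruct (HL1 z (phi z) x (phi z)) as [_ H]; auto. rewrite Ephi, Cmod_sub_self in H.
   unfold Lp. rewrite Rmult_assoc. apply Rmult_le_compat_l. apply Rdiv_le_0_compat; lra.
   rewrite (Cmod_minus_sym x z). lra. }
  assert (T1 := HK x (phi x) (phi z) (Bz x Hxz) (Bw _ Bx) (Bw _ Bphi)). rewrite Ex in T1.
  destruct (HL2 x (phi z) z (phi z)) as [_ T2]; auto. rewrite Cmod_sub_self, Rplus_0_r in T2. fold b in T2.
  set (h := `|x - z|) in *. assert (Ph : 0 <= h) by apply Cmod_ge_0.
  assert (D : (b * (phi x - phi z - - l / b * (x - z)))%C =
   (- (0 - peval2 P x (phi z) - peval2 (dw P) x (phi z) * (phi x - phi z))
   + - (peval2 (dw P) x (phi z) - b) * (phi x - phi z) + - (peval2 P x (phi z) - 0 - l * (x - z)))%C) by (field; auto).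
  assert (Bd : `|b| * `|phi x - phi z - - l / b * (x - z)| <= K * (Lp * h * (Lp * h)) + L2 * h * (Lp * h) + e * kap / 4 * h).
  { rewrite <- Cmod_mult, D. tri. eapply Rle_trans. apply Rplus_le_compat_r, Cmod_triangle.
   rewrite !Cmod_mult, !Cmod_opp.
   assert (`|phi x - phi z| * `|phi x - phi z| <= Lp * h * (Lp * h)) by (apply Rmult_le_compat; auto).
   assert (K * (`|phi x - phi z| * `|phi x - phi z|) <= K * (Lp * h * (Lp * h))) by (apply Rmult_le_compat_l; auto).
   assert (`|peval2 (dw P) x (phi z) - b| * `|phi x - phi z| <= L2 * h * (Lp * h)) by (apply Rmult_le_compat; auto). lra. }
  assert (Hh : h * (Q + 1) <= e * kap / 4). { apply Rle_div_r. lra. left; exact X2. }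
  assert (QQ : K * (Lp * h * (Lp * h)) + L2 * h * (Lp * h) <= e * kap / 4 * h).
  { replace (K * (Lp * h * (Lp * h)) + L2 * h * (Lp * h)) with (h * Q * h) by (unfold Q; ring).
   apply Rmult_le_compat_r; auto. lra. }
  apply Rmult_le_reg_l with (3 * kap / 4). lra.
  apply Rle_trans with (`|b| * `|phi x - phi z - - l / b * (x - z)|).
  apply Rmult_le_compat_r; auto. assert (0 <= e * kap * h) by cm. nra.
 - intros z Hz. apply Hphi, Hz.
 - intros z w Hz Hw Ew. destruct (Hphi z Hz) as [B E]. apply Cminus_eq0, Cmod_eq_zero.
  eapply Rle_trans. eauto. rewrite Ew, E, Cmod_sub_self. lra.
Qed.

Lemma peval_nonzero_near q z0 : peval q z0 <> RtoC 0 -> exists d c, 0 < d /\ 0 < c /\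
 forall z, `|z - z0| < d -> c <= `|peval q z|.
Proof.
 intros H. apply Cmod_gt_0 in H.
 destruct (holo_ccont _ _ (holo_peval q z0) (`|peval q z0| / 2)) as [d [Hd K]]. lra.
 exists d, (`|peval q z0| / 2). repeat split; auto; try lra. intros z Hz. specialize (K z Hz).
 generalize (Cmod_minus_ge (peval q z0) (peval q z0 - peval q z)).
 replace (peval q z0 - (peval q z0 - peval q z))%C with (peval q z) by ring.
 rewrite (Cmod_minus_sym (peval q z0)). lra.
Qed.

Lemma coef_sum_bounded P z0 : exists K, 0 <= K /\ forall z, `|z - z0| < 1 -> coef_sum P z <= K.
Proof.
 induction P as [|p P [K [PK HK]]]. exists 0. sp. intros; simpl; lra.
 destruct (lipschitz2_peval p (`|z0| + 1)) as [L [PL HL]].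
 exists (L + K). sp. intros z Hz. simpl. specialize (HK z Hz).
 assert (`|z| <= `|z0| + 1).
 { replace z with (z0 + (z - z0))%C by ring. tri. lra. }
 destruct (HL z z z z) as [A _]; auto. lra.
Qed.

(** The germ may be given at any point of the disc around [z0], and the disc does not depend on it.
    A path inside the disc is thus followed without any loss of radius. *)
Definition extends_off (P : list (list C)) (Z : list C) : Prop :=
 forall z0, ~ In z0 Z -> exists d, 0 < d /\ forall z1 f, `|z1 - z0| < d -> holomorphic_at f z1 ->
  locally z1 (fun w : C => peval2 P w (f w) = RtoC 0) -> exists F, hold F z0 d /\ germ_eq z1 F f.

(** Where the leading coefficient [q] does not vanish the roots are bounded. Where [D] does not
    vanish the Bezout relation bounds the derivative in [w] from below at the roots. The uniform
    implicit function theorem then applies at all the points near [z0]. *)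
Lemma extends_off_separable Q A B D : pnonzero2 Q -> pnonzero D ->
 (forall z w, (peval2 A z w * peval2 Q z w + peval2 B z w * peval2 (dw Q) z w)%C = peval D z) ->
 exists Z, extends_off Q Z.
Proof.
 intros HQ HD E.
 destruct (root_bound Q HQ) as [q [Hq Kq]].
 destruct (finite_roots _ q eq_refl Hq) as [Z1 HZ1]. destruct (finite_roots _ D eq_refl HD) as [Z2 HZ2].
 exists (Z1 ++ Z2). intros z0 Hz0.
 assert (N1 : peval q z0 <> RtoC 0) by (intros E0; apply Hz0, in_or_app; left; auto).
 assert (N2 : peval D z0 <> RtoC 0) by (intros E0; apply Hz0, in_or_app; right; auto).
 destruct (peval_nonzero_near q z0 N1) as [d1 [c1 [Pd1 [Pc1 K1]]]].
 destruct (peval_nonzero_near D z0 N2) as [d2 [c2 [Pd2 [Pc2 K2]]]].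
 destruct (coef_sum_bounded Q z0) as [S [PS HS]].
 set (M := `|z0| + 1 + S / c1).
 assert (0 <= S / c1) by (apply Rdiv_le_0_compat; auto).
 destruct (lipschitz2_peval2 B M) as [L [PL HL]].
 assert (Pk : 0 < c2 / (L + 1)) by pos.
 destruct (implicit_function Q M (c2 / (L + 1)) Pk) as [d [eta [Pd [Pe IF]]]].
 (* The solution lives on the disc of radius [d] around [z1]; the bound [d/2] makes this disc
    contain the one of radius [dd] around [z0]. *)
 set (dd := Rmin (Rmin d1 d2) (Rmin 1 (d / 2))). exists dd.
 assert (Pdd : 0 < dd) by pos.
 assert (H1 : dd <= d1) by (eapply Rle_trans; apply Rmin_l).
 assert (H2 : dd <= d2) by (eapply Rle_trans; [apply Rmin_l|apply Rmin_r]).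
 assert (H3 : dd <= 1) by (eapply Rle_trans; [apply Rmin_r|apply Rmin_l]).
 assert (H4 : dd <= d / 2) by (eapply Rle_trans; [apply Rmin_r|apply Rmin_r]).
 sa. intros z1 f Hz1 Hf HE.
 apply holomorphic_at_hold in Hf. destruct Hf as [r [Pr Hf]]. apply locally_Cmod in HE. destruct HE as [r' [Pr' HE]].
 assert (E1 : peval2 Q z1 (f z1) = RtoC 0) by (apply HE; self).
 assert (Bz : `|z1| <= M).
 { replace z1 with (z0 + (z1 - z0))%C by ring. tri. unfold M. lra. }
 assert (Bw : `|f z1| <= M).
 { specialize (Kq z1 (f z1) E1). specialize (K1 z1 LRA). specialize (HS z1 LRA).
  apply Rle_trans with (S / c1). apply Rle_div_r; auto. nra.
  unfold M. cm. }
 assert (Kd : c2 / (L + 1) <= `|peval2 (dw Q) z1 (f z1)|).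
 { specialize (E z1 (f z1)). rewrite E1 in E. specialize (K2 z1 LRA). rewrite <- E in K2.
  replace (peval2 A z1 (f z1) * 0 + peval2 B z1 (f z1) * peval2 (dw Q) z1 (f z1))%C with
   (peval2 B z1 (f z1) * peval2 (dw Q) z1 (f z1))%C in K2 by ring.
  rewrite Cmod_mult in K2. destruct (HL z1 (f z1) z1 (f z1)) as [B1 _]; auto.
  apply Rle_div_l. lra. generalize (Cmod_ge_0 (peval2 (dw Q) z1 (f z1))). nra. }
 destruct (IF z1 (f z1) Bz Bw E1 Kd) as [phi [Hphi [_ Uphi]]].
 exists phi. split.
 - apply hold_sub with (1 := Hphi). triang.
 - destruct (holo_ccont f z1 (hold_holo f z1 r Pr Hf) eta Pe) as [d3 [Pd3 K3]].
  apply germ_eq_Cmod. exists (Rmin (Rmin r' d3) d). split. pos. intros w Hw.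
  assert (W1 := lt_minr Hw). assert (W2 := lt_minl Hw).
  symmetry. apply Uphi; auto. left. apply K3. ar.
  apply HE. ar.
Qed.

Lemma locally_zero_product f g z : holomorphic_at f z -> holomorphic_at g z ->
 locally z (fun w : C => (f w * g w)%C = RtoC 0) ->
 locally z (fun w : C => f w = RtoC 0) \/ locally z (fun w : C => g w = RtoC 0).
Proof.
 intros Hf Hg H. apply holomorphic_at_hold in Hf. apply holomorphic_at_hold in Hg.
 destruct Hf as [r [Pr Hf]]. destruct Hg as [s [Ps Hg]]. apply locally_Cmod in H. destruct H as [t [Pt H]].
 destruct (classic (forall w, `|w - z| < r -> f w = RtoC 0)) as [K|K].
 { left. apply locally_Cmod. eauto. }
 right. apply locally_Cmod. exists s. sa.
 assert (exists w, `|w - z| < Rmin (Rmin r s) t /\ f w <> RtoC 0) as [w [Hw Nw]].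
 { apply NNPP. intros N. apply K. apply (holo_zero_near f z r (Rmin (Rmin r s) t)); auto. pos. intros w Hw. destruct (Ceq_dec (f w) 0) as [|Nw]; auto. exfalso. eauto. }
 assert (W1 := lt_minr Hw). assert (W0 := lt_minl Hw).
 assert (W2 := lt_minl W0). assert (W3 := lt_minr W0).
 apply (hold_identity g z s w); auto.
 destruct (holo_ccont f w (Hf w W2) (`|f w|)) as [d [Pd Kd]]. now apply Cmod_gt_0.
 apply germ_eq_Cmod. exists (Rmin d (t - `|w - z|)). sp. intros x Hx.
 assert (X1 := lt_minl Hx). assert (X2 := lt_minr Hx).
 assert (E := H x ltac:(generalize (Cmod_triangle_minus x w z); lra)).
 apply Cmult_integral in E. destruct E as [E|]; auto. specialize (Kd x X1). rewrite E in Kd.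
 replace (0 - f w)%C with (- f w)%C in Kd by ring. rewrite Cmod_opp in Kd. lra.
Qed.

Lemma holomorphic_at_peval2 P f z : holomorphic_at f z -> holomorphic_at (fun z => peval2 P z (f z)) z.
Proof.
 rewrite !holomorphic_at_hold. intros [r [Pr H]]. exists r. sa. intros w Hw. now apply holo_peval2, H.
Qed.

Lemma holomorphic_at_ex f z : (forall w, holo f w) -> holomorphic_at f z.
Proof. intros H. apply holomorphic_at_hold. exists 1. sp. easy. Qed.

(** Germs at a point form an integral domain, so a germ annihilated by a product of separable
    factors is annihilated by one of them. *)
Theorem algebraic_continuation P : pnonzero2 P -> exists Z, extends_off P Z.
Proof.
 intros HP. destruct (PolyAlgebra.separable_decomposition P HP) as [c [l [Hc [E H]]]].
 assert (exists Z, forall z0, ~ In z0 Z -> exists d, 0 < d /\ forall Q, In Q l ->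
  forall z1 f, `|z1 - z0| < d -> holomorphic_at f z1 ->
  locally z1 (fun w : C => peval2 Q w (f w) = RtoC 0) -> exists F, hold F z0 d /\ germ_eq z1 F f) as [Z HZ].
 { clear E. induction l as [|Q l IH]. exists nil. intros. exists 1. sp. easy.
  destruct IH as [Z1 H1]. intros; apply H; now right.
  destruct (H Q (or_introl eq_refl)) as [HQ [A [B [D [HD ED]]]]].
  destruct (extends_off_separable Q A B D HQ HD ED) as [Z2 H2].
  exists (Z1 ++ Z2). intros z0 Hz0. destruct (H1 z0) as [d1 [Pd1 K1]]. { intros K; apply Hz0, in_or_app; auto. }
  destruct (H2 z0) as [d2 [Pd2 K2]]. { intros K; apply Hz0, in_or_app; auto. }
  exists (Rmin d1 d2). sp. intros T [<-|HT] z1 f Hz1 Hf HE.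
  - destruct (K2 z1 f (lt_minr Hz1) Hf HE) as [F [HF G]]. exists F. sa.
   apply hold_sub with (1 := HF). rewrite Cmod_sub_self. ar.
  - destruct (K1 T HT z1 f (lt_minl Hz1) Hf HE) as [F [HF G]]. exists F. sa.
   apply hold_sub with (1 := HF). rewrite Cmod_sub_self. ar. }
 exists Z. intros z0 Hz0. destruct (HZ z0 Hz0) as [d [Pd K]]. exists d. sa. intros z1 f Hz1 Hf HE.
 assert (exists Q, In Q l /\ locally z1 (fun w : C => peval2 Q w (f w) = RtoC 0)) as [Q [HQ EQ]].
 2:{ apply (K Q HQ z1 f); auto. }
 assert (HE' : locally z1 (fun w : C => fold_right Cmult (RtoC 1) (map (fun Q => peval2 Q w (f w)) l) = RtoC 0)).
 { apply locally_Cmod in HE. destruct HE as [r [Pr HE]]. apply locally_Cmod. exists r. sa.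
  intros w Hw. rewrite <- E, HE by auto. ring. }
 clear - HE' Hf. induction l as [|Q l IH].
 - exfalso. simpl in HE'. apply locally_Cmod in HE'. destruct HE' as [r [Pr H]]. apply C1_nz.
  apply (H z1). self.
 - simpl in HE'. apply locally_zero_product in HE'.
  + destruct HE' as [HQ|Hl]. exists Q. sa. now left. destruct (IH Hl) as [T [HT ET]]. exists T. sa. now right.
  + now apply holomorphic_at_peval2.
  + clear - Hf. apply holomorphic_at_hold in Hf. destruct Hf as [r [Pr Hf]]. apply holomorphic_at_hold. exists r. sa.
   intros w Hw. induction l. apply (holo_const (RtoC 1)). simpl. apply (holo_mult (fun z => peval2 a z (f z))); auto.
   now apply holo_peval2, Hf.
Qed.

(** * Local structure of the curve *)

(* [b] is a half-branch issuing from [b 0], strictly differentiable there with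
 non-zero derivative [u]. *)
Definition half_branch (b : R -> C) (u : C) : Prop :=
 u <> RtoC 0 /\ forall e, 0 < e -> exists d, 0 < d /\ forall x y, 0 <= x <= d -> 0 <= y <= d ->
  `|b x - b y - RtoC (x - y) * u| <= e * Rabs (x - y).

Lemma half_branch_injective b u : half_branch b u -> exists d, 0 < d /\
 forall x y, 0 <= x <= d -> 0 <= y <= d -> `|u| / 2 * Rabs (x - y) <= `|b x - b y|.
Proof.
 intros [Nu H]. apply Cmod_gt_0 in Nu. destruct (H (`|u| / 2)) as [d [Hd K]]. lra.
 exists d. sa. intros x y Hx Hy. specialize (K x y Hx Hy).
 generalize (Cmod_minus_ge (RtoC (x - y) * u) (- (b x - b y - RtoC (x - y) * u))).
 rewrite Cmod_opp. replace (RtoC (x - y) * u - - (b x - b y - RtoC (x - y) * u))%C with (b x - b y)%C by ring.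
 rewrite Cmod_mult, Cmod_R. lra.
Qed.

Lemma half_branch_lipschitz b u : half_branch b u -> exists d K, 0 < d /\ 0 < K /\
 forall x y, 0 <= x <= d -> 0 <= y <= d -> `|b x - b y| <= K * Rabs (x - y).
Proof.
 intros [Nu H]. destruct (H 1) as [d [Hd K]]. lra.
 exists d, (1 + `|u|). generalize (Cmod_ge_0 u); intros. repeat sa. lra.
 intros x y Hx Hy. specialize (K x y Hx Hy).
 replace (b x - b y)%C with ((b x - b y - RtoC (x - y) * u) + RtoC (x - y) * u)%C by ring.
 tri. rewrite Cmod_mult, Cmod_R. lra.
Qed.

(** The mean value estimate for [d' - d' x]. Unlike differentiability at [x] it lets both points
    vary, which is what makes a smooth arc injective and almost straight near [x]. *)
Lemma C1_strict d d' u v x : (forall t, rderiv d t (d' t)) -> (forall t, rcont d' t) -> u <= x <= v ->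
 forall e, 0 < e -> exists del, 0 < del /\ forall s t, Rabs (s - x) < del -> Rabs (t - x) < del ->
  `|d s - d t - RtoC (s - t) * d' x| <= e * Rabs (s - t).
Proof.
 intros Hd Hc Hx e He. destruct (Hc x e He) as [del [Pd K]]. exists del. sa.
 assert (L : forall s t, s <= t -> Rabs (s - x) < del -> Rabs (t - x) < del ->
  `|d t - d s - RtoC (t - s) * d' x| <= e * (t - s)).
 { intros s t Hst Hs Ht. apply (is_CI_norm (fun r => d' r - d' x)%C s t); auto.
  - intros r Hr. left. apply K. apply Rabs_def2 in Hs. apply Rabs_def2 in Ht. rabs.
  - apply is_CI_minus. apply is_CI_FTC; auto. apply is_CI_const. }
 intros s t Hs Ht. destruct (Rle_lt_dec s t) as [H|H].
 - specialize (L s t H Hs Ht). rewrite <- Cmod_opp, (Rabs_left1 (s - t)) by lra.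
  replace (- (d s - d t - RtoC (s - t) * d' x))%C with (d t - d s - RtoC (t - s) * d' x)%C by (rewrite !RtoC_minus; ring). lra.
 - specialize (L t s LRA Ht Hs). rewrite (Rabs_pos_eq (s - t)) by lra. auto.
Qed.

Lemma smooth_arc_eq gamma u v : smooth_arc gamma u v -> exists d d', (forall t, rderiv d t (d' t)) /\
 (forall t, rcont d' t) /\ forall t, u <= t <= v -> gamma t = d t /\ d' t <> RtoC 0.
Proof.
 intros [d [d' [H1 [H2 H3]]]]. exists d, d'. split; [|split]; auto.
 - intros t. apply rderiv_is_derive, H1.
 - intros t. apply rcont_continuous, H2.
Qed.

Lemma smooth_arc_sub gamma u v u' v' : u <= u' -> v' <= v -> smooth_arc gamma u v -> smooth_arc gamma u' v'.
Proof.
 intros Hu Hv [d [d' [H1 [H2 H3]]]]. exists d, d'. split; [|split]; auto. intros t Ht. apply H3. lra.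
Qed.

Lemma piecewise_right gamma s : piecewise_smooth gamma -> 0 <= s < 1 ->
 exists h, 0 < h /\ s + h <= 1 /\ smooth_arc gamma s (s + h).
Proof.
 intros [n [p [H0 [H1 H]]]] Hs.
 assert (exists i, (i < n)%nat /\ p i <= s < p (S i)) as [i [Hi Hp]].
 { apply NNPP. intros N. assert (K : forall i, (i <= n)%nat -> p i <= s).
  { induction i; intros. lra. apply Rnot_lt_le. intros L. apply N. exists i. split. lia. sa. apply IHi. lia. }
  specialize (K n (le_n n)). lra. }
 destruct (H i Hi) as [_ A]. exists (p (S i) - s). replace (s + (p (S i) - s)) with (p (S i)) by ring.
 repeat split; try lra.
 - assert (K : forall k, (S i + k <= n)%nat -> p (S i) <= p (S i + k)%nat).
  { induction k; intros. rewrite Nat.add_0_r; lra. rewrite Nat.add_succ_r.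
   destruct (H (S i + k)%nat) as [L _]. lia. specialize (IHk ltac:(lia)). lra. }
  specialize (K (n - S i)%nat ltac:(lia)). replace (S i + (n - S i))%nat with n in K by lia. lra.
 - apply smooth_arc_sub with (3 := A); lra.
Qed.

Lemma piecewise_left gamma s : piecewise_smooth gamma -> 0 < s <= 1 ->
 exists h, 0 < h /\ 0 <= s - h /\ smooth_arc gamma (s - h) s.
Proof.
 intros [n [p [H0 [H1 H]]]] Hs.
 assert (exists i, (i < n)%nat /\ p i < s <= p (S i)) as [i [Hi Hp]].
 { apply NNPP. intros N. assert (K : forall i, (i <= n)%nat -> p i < s).
  { induction i; intros. lra. apply Rnot_le_lt. intros L. apply N. exists i. split. lia. sa. apply IHi. lia. }
  specialize (K n (le_n n)). lra. }
 destruct (H i Hi) as [_ A]. exists (s - p i). replace (s - (s - p i)) with (p i) by ring.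
 repeat split; try lra.
 - assert (K : forall k, (k <= n)%nat -> 0 <= p k).
  { induction k; intros. lra. destruct (H k) as [L _]. lia. specialize (IHk ltac:(lia)). lra. }
  apply K. lia.
 - apply smooth_arc_sub with (3 := A); lra.
Qed.

Lemma piecewise_breaks gamma : piecewise_smooth gamma -> exists L : list R, In 0 L /\ In 1 L /\
 forall s, 0 <= s <= 1 -> ~ In s L -> exists h, 0 < h /\ 0 < s - h /\ s + h < 1 /\ smooth_arc gamma (s - h) (s + h).
Proof.
 intros [n [p [H0 [H1 H]]]]. exists (map p (seq 0 (S n))).
 assert (HIn : forall i, (i <= n)%nat -> In (p i) (map p (seq 0 (S n)))).
 { intros i Hi. apply in_map, in_seq. lia. }
 split. rewrite <- H0. apply HIn. lia. split. rewrite <- H1. auto.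
 intros s Hs Ns.
 assert (exists i, (i < n)%nat /\ p i <= s < p (S i)) as [i [Hi Hp]].
 { apply NNPP. intros N. assert (K : forall i, (i <= n)%nat -> p i <= s).
  { induction i; intros. lra. apply Rnot_lt_le. intros L. apply N. exists i. split. lia. sa. apply IHi. lia. }
  specialize (K n (le_n n)). apply Ns. replace s with (p n) by lra. auto. }
 assert (p i <> s) by (intros E; apply Ns; rewrite <- E; apply HIn; lia).
 assert (M0 : forall k, (k <= n)%nat -> 0 <= p k).
 { induction k; intros. lra. destruct (H k) as [L _]. lia. specialize (IHk ltac:(lia)). lra. }
 assert (M1 : forall k, (k <= n)%nat -> p (n - k)%nat <= 1).
 { induction k; intros. rewrite Nat.sub_0_r; lra. destruct (H (n - S k)%nat) as [L _]. lia.
  replace (S (n - S k))%nat with (n - k)%nat in L by lia. specialize (IHk ltac:(lia)). lra. }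
 specialize (M0 i ltac:(lia)). specialize (M1 (n - S i)%nat ltac:(lia)). replace (n - (n - S i))%nat with (S i) in M1 by lia.
 destruct (H i Hi) as [_ A]. exists (Rmin (s - p i) (p (S i) - s) / 2).
 rmin.
 assert (0 < Rmin (s - p i) (p (S i) - s)) by pos. intros.
 repeat split; try lra. apply smooth_arc_sub with (3 := A); lra.
Qed.

Lemma half_branch_right gamma s h : 0 < h -> smooth_arc gamma s (s + h) ->
 exists u, half_branch (fun x => gamma (s + x)) u.
Proof.
 intros Hh A. destruct (smooth_arc_eq _ _ _ A) as [d [d' [D1 [D2 D3]]]]. exists (d' s). split. apply D3; lra.
 intros e He. destruct (C1_strict d d' s (s + h) s D1 D2 LRA e He) as [del [Pd K]].
 exists (Rmin (del / 2) h). sp.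
 rmin. intros x y Hx Hy.
 rewrite (proj1 (D3 (s + x) LRA)), (proj1 (D3 (s + y) LRA)).
 replace (x - y) with (s + x - (s + y)) by ring. apply K; rabs.
Qed.

Lemma half_branch_left gamma s h : 0 < h -> smooth_arc gamma (s - h) s ->
 exists u, half_branch (fun x => gamma (s - x)) u.
Proof.
 intros Hh A. destruct (smooth_arc_eq _ _ _ A) as [d [d' [D1 [D2 D3]]]]. exists (- d' s)%C. split.
 { intros E. apply (proj2 (D3 s LRA)). replace (d' s) with (- - d' s)%C by ring. rewrite E. ring. }
 intros e He. destruct (C1_strict d d' (s - h) s s D1 D2 LRA e He) as [del [Pd K]].
 exists (Rmin (del / 2) h). sp.
 rmin. intros x y Hx Hy.
 rewrite (proj1 (D3 (s - x) LRA)), (proj1 (D3 (s - y) LRA)).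
 replace (RtoC (x - y) * - d' s)%C with (RtoC (s - x - (s - y)) * d' s)%C by (rewrite !RtoC_minus; ring).
 replace (Rabs (x - y)) with (Rabs (s - x - (s - y))) by (rewrite <- Rabs_Ropp; f_equal; ring).
 apply K; rabs.
Qed.

Lemma velocity_right gamma s u : 0 <= s < 1 -> half_branch (fun x => gamma (s + x)) u -> velocity gamma s u.
Proof.
 intros Hs [Nu H]. left. sa. intros P HP. apply locally_Cmod in HP. destruct HP as [e [He HP]].
 destruct (H (e / 2)) as [d [Pd K]]. lra.
 assert (Pd' : 0 < d). auto. exists (mkposreal d Pd'). refine (fun (t : R) Ht Hts => _). change (Rabs (t - s) < d) in Ht.
 apply HP. apply Rabs_def2 in Ht. specialize (K (t - s) 0 LRA LRA). cbv beta in K.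
 replace (s + (t - s)) with t in K by ring. replace (s + 0) with s in K by ring. rewrite Rminus_0_r in K.
 assert (N : RtoC (t - s) <> RtoC 0). { intros E. apply RtoC_inj in E. lra. }
 replace (RtoC (/ (t - s)) * (gamma t - gamma s) - u)%C with
  (/ RtoC (t - s) * (gamma t - gamma s - RtoC (t - s) * u))%C.
 2:{ rewrite RtoC_inv by lra. field. auto. }
 rewrite Cmod_mult, Cmod_inv, Cmod_R by auto. rewrite Rabs_pos_eq in * by lra.
 apply Rle_lt_trans with (/ (t - s) * (e / 2 * (t - s))). apply Rmult_le_compat_l; auto. left; apply Rinv_0_lt_compat; lra.
 replace (/ (t - s) * (e / 2 * (t - s))) with (e / 2) by (field; lra). lra.
Qed.

Lemma velocity_left gamma s u : 0 < s <= 1 -> half_branch (fun x => gamma (s - x)) u -> velocity gamma s (- u)%C.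
Proof.
 intros Hs [Nu H]. right. sa. intros P HP. apply locally_Cmod in HP. destruct HP as [e [He HP]].
 destruct (H (e / 2)) as [d [Pd K]]. lra.
 assert (Pd' : 0 < d). auto. exists (mkposreal d Pd'). refine (fun (t : R) Ht Hts => _). change (Rabs (t - s) < d) in Ht.
 apply HP. apply Rabs_def2 in Ht. specialize (K (s - t) 0 LRA LRA). cbv beta in K.
 replace (s - (s - t)) with t in K by ring. replace (s - 0) with s in K by ring. rewrite Rminus_0_r in K.
 assert (N : RtoC (s - t) <> RtoC 0). { intros E. apply RtoC_inj in E. lra. }
 replace (RtoC (/ (t - s)) * (gamma t - gamma s) - - u)%C with
  (- (/ RtoC (s - t) * (gamma t - gamma s - RtoC (s - t) * u)))%C.
 2:{ replace (t - s) with (- (s - t)) by ring. rewrite RtoC_inv, RtoC_opp by lra. field. auto. }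
 rewrite Cmod_opp, Cmod_mult, Cmod_inv, Cmod_R by auto. rewrite Rabs_pos_eq in * by lra.
 apply Rle_lt_trans with (/ (s - t) * (e / 2 * (s - t))). apply Rmult_le_compat_l; auto. left; apply Rinv_0_lt_compat; lra.
 replace (/ (s - t) * (e / 2 * (s - t))) with (e / 2) by (field; lra). lra.
Qed.

Lemma velocity_smooth gamma s h d d' v : 0 < h -> (forall t, rderiv d t (d' t)) ->
 (forall t, s - h <= t <= s + h -> gamma t = d t) -> velocity gamma s v -> v = d' s.
Proof.
 intros Hh Hd E V. symmetry. apply Cminus_eq0, Cmod_small. intros e He.
 assert (HP : locally (T := C_UniformSpace) v (fun w => `|w - v| < e / 2)). { apply locally_Cmod. exists (e / 2). sa. lra. }
 assert (exists t, t <> s /\ s - h <= t <= s + h /\ `|RtoC (/ (t - s)) * (gamma t - gamma s) - v| < e / 2 /\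
  `|d t - d s - RtoC (t - s) * d' s| <= e / 2 * Rabs (t - s)) as [t [Ht [Ht2 [K1 K2]]]].
 { destruct (Hd s (e / 2)) as [d0 [Pd0 K0]]. lra.
  destruct V as [[Hs V]|[Hs V]]; specialize (V _ HP); destruct V as [d1 K1].
  - set (m := Rmin (Rmin d0 d1) h / 2). assert (0 < Rmin (Rmin d0 d1) h).
   { repeat apply Rmin_glb_lt; auto. apply cond_pos. }
   assert (2 * m <= d0). { unfold m. ar. }
   assert (2 * m <= d1). { unfold m. ar. }
   assert (2 * m <= h). { unfold m. ar. } assert (0 < m) by pos.
   exists (s + m). repeat split; try lra. 
   + apply K1. change (Rabs (s + m - s) < d1). rewrite Rabs_pos_eq; lra. lra.
   + apply K0. rabs.
  - set (m := Rmin (Rmin d0 d1) h / 2). assert (0 < Rmin (Rmin d0 d1) h).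
   { repeat apply Rmin_glb_lt; auto. apply cond_pos. }
   assert (2 * m <= d0). { unfold m. ar. }
   assert (2 * m <= d1). { unfold m. ar. }
   assert (2 * m <= h). { unfold m. ar. } assert (0 < m) by pos.
   exists (s - m). repeat split; try lra.
   + apply K1. change (Rabs (s - m - s) < d1). rewrite Rabs_left; lra. lra.
   + apply K0. rabs. }
 rewrite !E in K1 by lra.
 assert (N : RtoC (t - s) <> RtoC 0). { intros E0. apply RtoC_inj in E0. lra. }
 replace (d' s - v)%C with ((RtoC (/ (t - s)) * (d t - d s) - v) - / RtoC (t - s) * (d t - d s - RtoC (t - s) * d' s))%C.
 2:{ rewrite RtoC_inv by lra. field. auto. }
 eapply Rle_trans. apply Cmod_minus_le. rewrite Cmod_mult, Cmod_inv, Cmod_R by auto.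
 assert (/ Rabs (t - s) * `|d t - d s - RtoC (t - s) * d' s| <= / Rabs (t - s) * (e / 2 * Rabs (t - s))).
 { apply Rmult_le_compat_l; auto. left. apply Rinv_0_lt_compat, Rabs_pos_lt. lra. }
 replace (/ Rabs (t - s) * (e / 2 * Rabs (t - s))) with (e / 2) in H. lra. field. apply Rabs_no_R0. lra.
Qed.

Lemma piecewise_rcont_on gamma : piecewise_smooth gamma -> rcont_on 0 1 gamma.
Proof.
 intros H s Hs e He.
 assert (HR : exists d, 0 < d /\ forall t, s <= t <= 1 -> t - s < d -> `|gamma t - gamma s| < e).
 { destruct (Rlt_le_dec s 1) as [L|L].
  - destruct (piecewise_right gamma s H LRA) as [h [Ph [_ A]]].
   destruct (half_branch_right gamma s h Ph A) as [u B]. destruct (half_branch_lipschitz _ _ B) as [d [K [Pd [PK HL]]]].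
   exists (Rmin d (e / K)). split. pos. intros t Ht L2.
   assert (L3 := lt_minl L2). assert (L4 := lt_minr L2).
   specialize (HL (t - s) 0 LRA LRA). cbv beta in HL. replace (s + (t - s)) with t in HL by ring.
   rewrite Rplus_0_r, Rminus_0_r, (Rabs_pos_eq (t - s)) in HL by lra. apply Rlt_div_r in L4; auto. lra.
  - exists 1. sp. intros t Ht _. replace t with s by lra. self. }
 assert (HL : exists d, 0 < d /\ forall t, 0 <= t <= s -> s - t < d -> `|gamma t - gamma s| < e).
 { destruct (Rlt_le_dec 0 s) as [L|L].
  - destruct (piecewise_left gamma s H LRA) as [h [Ph [_ A]]].
   destruct (half_branch_left gamma s h Ph A) as [u B]. destruct (half_branch_lipschitz _ _ B) as [d [K [Pd [PK HL]]]].
   exists (Rmin d (e / K)). split. pos. intros t Ht L2.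
   assert (L3 := lt_minl L2). assert (L4 := lt_minr L2).
   specialize (HL (s - t) 0 LRA LRA). cbv beta in HL. replace (s - (s - t)) with t in HL by ring.
   rewrite !Rminus_0_r, (Rabs_pos_eq (s - t)) in HL by lra. apply Rlt_div_r in L4; auto. lra.
  - exists 1. sp. intros t Ht _. replace t with s by lra. self. }
 destruct HR as [d1 [P1 K1]]. destruct HL as [d2 [P2 K2]]. exists (Rmin d1 d2). sp.
 intros t Ht L. apply Rabs_def2 in L. rmin.
 destruct (Rle_lt_dec s t). apply K1; lra. apply K2; lra.
Qed.

(** On each side of a parameter the curve is locally injective, so [p] has at most one preimage
    there. *)
Lemma finite_preimage gamma p : piecewise_smooth gamma -> exists L : list R, forall s, 0 <= s <= 1 -> gamma s = p -> In s L.
Proof.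
 intros H. apply (interval_induction (fun u v => exists L : list R, forall s, u <= s <= v -> gamma s = p -> In s L)). lra.
 - intros x y z _ _ [L1 H1] [L2 H2]. exists (L1 ++ L2). intros s Hs E. apply in_or_app.
  destruct (Rle_dec s y). left; apply H1; auto; lra. right; apply H2; auto; lra.
 - intros x Hx.
  assert (HR : exists d L, 0 < d /\ forall s, x <= s <= 1 -> s < x + d -> gamma s = p -> In s (L : list R)).
  { destruct (Rlt_le_dec x 1) as [L|L].
   - destruct (piecewise_right gamma x H LRA) as [h [Ph [_ A]]].
    destruct (half_branch_right gamma x h Ph A) as [u B]. destruct (half_branch_injective _ _ B) as [d [Pd K]].
    destruct (classic (exists s, x <= s < x + d /\ gamma s = p)) as [[s0 [Hs0 E0]]|N].
    + exists d, (s0 :: nil). sa. intros s Hs L2 E. left.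
     specialize (K (s0 - x) (s - x) LRA LRA). cbv beta in K.
     replace (x + (s0 - x)) with s0 in K by ring. replace (x + (s - x)) with s in K by ring.
     rewrite E, E0, Cmod_sub_self in K. replace (s0 - x - (s - x)) with (s0 - s) in K by ring.
     destruct (Req_dec s0 s) as [|Ne]; auto. assert (0 < Rabs (s0 - s)) by (apply Rabs_pos_lt; lra).
     assert (0 < `|u|) by (apply Cmod_gt_0; apply B). nra.
    + exists d, nil. sa. intros s Hs L2 E. apply N. exists s. easy.
   - exists 1, (1 :: nil). sp. intros s Hs _ _. left. lra. }
  assert (HL : exists d L, 0 < d /\ forall s, 0 <= s <= x -> x - d < s -> gamma s = p -> In s (L : list R)).
  { destruct (Rlt_le_dec 0 x) as [L|L].
   - destruct (piecewise_left gamma x H LRA) as [h [Ph [_ A]]].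
    destruct (half_branch_left gamma x h Ph A) as [u B]. destruct (half_branch_injective _ _ B) as [d [Pd K]].
    destruct (classic (exists s, x - d < s <= x /\ gamma s = p)) as [[s0 [Hs0 E0]]|N].
    + exists d, (s0 :: nil). sa. intros s Hs L2 E. left.
     specialize (K (x - s0) (x - s) LRA LRA). cbv beta in K.
     replace (x - (x - s0)) with s0 in K by ring. replace (x - (x - s)) with s in K by ring.
     rewrite E, E0, Cmod_sub_self in K. replace (x - s0 - (x - s)) with (s - s0) in K by ring.
     destruct (Req_dec s0 s) as [|Ne]; auto. assert (0 < Rabs (s - s0)) by (apply Rabs_pos_lt; lra).
     assert (0 < `|u|) by (apply Cmod_gt_0; apply B). nra.
    + exists d, nil. sa. intros s Hs L2 E. apply N. exists s. easy.
   - exists 1, (0 :: nil). sp. intros s Hs _ _. left. lra. }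
  destruct HR as [d1 [L1 [P1 K1]]]. destruct HL as [d2 [L2 [P2 K2]]]. exists (Rmin d1 d2). sp.
  intros u v Hu Hv M1 M2. rmin. exists (L1 ++ L2). intros s Hs E. apply in_or_app.
  destruct (Rle_lt_dec x s). left; apply K1; auto; lra. right; apply K2; auto; lra.
Qed.

Lemma finite_preimages gamma (S : list C) : piecewise_smooth gamma ->
 exists L : list R, forall s, 0 <= s <= 1 -> In (gamma s) S -> In s L.
Proof.
 intros H. induction S as [|p S [L HL]]. exists nil. auto.
 destruct (finite_preimage gamma p H) as [L' HL']. exists (L' ++ L). intros s Hs [E|E]; apply in_or_app; auto.
Qed.

Lemma distance_to_arc f a b t : a <= b -> rcont_on a b f -> (forall s, a <= s <= b -> f s <> t) ->
 exists d, 0 < d /\ forall s, a <= s <= b -> d <= `|f s - t|.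
Proof.
 intros Hab Hf N.
 apply (interval_induction (fun u v => exists d, 0 < d /\ forall s, u <= s <= v -> d <= `|f s - t|)); auto.
 - intros x y z _ _ [d1 [P1 H1]] [d2 [P2 H2]]. exists (Rmin d1 d2). sp. intros s Hs.
  destruct (Rle_dec s y). eapply Rle_trans; [apply Rmin_l|]. apply H1; lra. eapply Rle_trans; [apply Rmin_r|]. apply H2; lra.
 - intros x Hx. assert (P : 0 < `|f x - t|) by (apply Cmod_gt_0, Cminus_neq0; auto).
  destruct (Hf x Hx (`|f x - t| / 2)) as [d [Pd K]]. lra. exists d. sa.
  intros u v Hu Hv L1 L2. exists (`|f x - t| / 2). sp. intros s Hs.
  specialize (K s LRA ltac:(rabs)). triang.
Qed.

Lemma off_image_ball gamma t : piecewise_smooth gamma -> ~ image gamma t ->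
 exists d, 0 < d /\ forall s, 0 <= s <= 1 -> d <= `|gamma s - t|.
Proof.
 intros H N. apply distance_to_arc. lra. now apply piecewise_rcont_on. intros s Hs E. apply N. now exists s.
Qed.

Lemma Rlist_isolated (L : list R) a : exists e, 0 < e /\ forall z, In z L -> z <> a -> e <= Rabs (z - a).
Proof.
 induction L as [|c L [d [Hd K]]]. exists 1. sp. easy.
 destruct (Req_dec c a) as [->|N].
 - exists d. sa. intros z [->|Hz] Nz; auto. lra.
 - exists (Rmin d (Rabs (c - a))). split.
  + apply Rmin_glb_lt; auto. apply Rabs_pos_lt. lra.
  + intros z [<-|Hz] Nz. ar. eapply Rle_trans. apply Rmin_l. auto.
Qed.

Lemma Cmod_derive_parts d t l : rderiv d t l ->
 is_derive (fun s => Re (d s)) t (Re l) /\ is_derive (fun s => Im (d s)) t (Im l).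
Proof.
 intros H. assert (K : forall (p : C -> R), (forall x, Rabs (p x) <= `|x|) ->
  (forall x y r, p (x - y - RtoC r * l)%C = p x - p y - r * p l) -> is_derive (fun s => p (d s)) t (p l)).
 { intros p Hp Hl. split. apply is_linear_scal_l. intros x Hx.
  apply (@is_filter_lim_locally_unique R_AbsRing (AbsRing_NormedModule R_AbsRing) t x) in Hx. rewrite <- Hx.
  intros e. destruct (H e (cond_pos e)) as [del [Pd K]]. apply locally_Rabs. exists del. sa.
  intros s Hs. specialize (K s Hs). change (Rabs (p (d s) - p (d t) - (s - t) * p l) <= e * Rabs (s - t)).
  rewrite <- Hl. eapply Rle_trans. auto. auto. }
 split; apply K; auto using re_le_Cmod, im_le_Cmod.
 - intros. unfold Cminus. rewrite !re_plus, !re_opp, re_scal_l. ring.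
 - intros. unfold Cminus. rewrite !im_plus, !im_opp, im_scal_l. ring.
Qed.

Lemma curve_derivative_smooth gamma s h d d' : 0 < h -> (forall t, rderiv d t (d' t)) ->
 (forall t, s - h <= t <= s + h -> gamma t = d t) -> curve_derivative gamma s = d' s.
Proof.
 intros Hh Hd E. destruct (Cmod_derive_parts d s (d' s) (Hd s)) as [H1 H2].
 assert (EX : forall p : C -> R, locally s (fun t => p (d t) = p (gamma t))).
 { intros p. apply locally_Rabs. exists h. sa. intros t Ht. apply Rabs_def2 in Ht. rewrite E; auto. lra. }
 unfold curve_derivative. apply C_ext; simpl.
 - apply is_derive_unique. apply (is_derive_ext_loc (fun t => Re (d t))); [apply (EX Re)|auto].
 - apply is_derive_unique. apply (is_derive_ext_loc (fun t => Im (d t))); [apply (EX Im)|auto].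
Qed.

(** * Integrability of bounded functions with finitely many discontinuities *)

Notation C_Riemann_sum := (Riemann_sum (V := C_R_NormedModule)).

(** The Riemann sums of [f] differ from those of the integrable function [f'] by at most the sums of
    [h], which are small. So they satisfy Cauchy's criterion. *)
Lemma ex_CI_squeeze f a b : a < b ->
 (forall e, 0 < e -> exists f' h I, ex_CI f' a b /\ is_RInt h a b I /\ I <= e /\
  forall t, a <= t <= b -> `|f t - f' t| <= h t) -> ex_CI f a b.
Proof.
 intros Hab H.
 apply (proj1 (filterlim_locally_cauchy (U := C_R_CompleteNormedModule) (F := Riemann_fine a b)
  (fun ptd => scal (sign (b - a)) (C_Riemann_sum f ptd)))).
 (* Each Riemann sum of [f] lies within [4 e] of [l], so two of them differ by less than [eps]. *)
 intros eps. set (e := eps / 12). assert (He : 0 < e) by (unfold e; generalize (cond_pos eps); lra).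
 destruct (H e He) as [f' [h [I [[l Hl] [Hh [HI Hb]]]]]].
 assert (F1 := Hl (fun w => `|w - l| < e) ltac:(apply locally_Cmod; exists e; auto)).
 assert (F2 := Hh (fun w => Rabs (w - I) < e) ltac:(apply locally_Rabs; exists e; auto)).
 unfold filtermap in F1, F2.
 assert (F3 : Riemann_fine a b (fun ptd => pointed_subdiv ptd /\ SF_h ptd = Rmin a b /\ seq.last (SF_h ptd) (SF_lx ptd) = Rmax a b)).
 { exists (mkposreal 1 Rlt_0_1). auto. }
 assert (FF := filter_and _ _ (filter_and _ _ F1 F2) F3). clear F1 F2 F3.
 eexists. split. eauto.
 assert (Es : sign (b - a) = 1) by (apply sign_eq_1; lra).
 assert (Q : forall ptd, (`|scal (sign (b - a)) (C_Riemann_sum f' ptd) - l| < e /\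
  Rabs (scal (sign (b - a)) (Riemann_sum h ptd) - I) < e) /\
  (pointed_subdiv ptd /\ SF_h ptd = Rmin a b /\ seq.last (SF_h ptd) (SF_lx ptd) = Rmax a b) ->
  `|scal (sign (b - a)) (C_Riemann_sum f ptd) - l| < 4 * e).
 { intros ptd [[Q1 Q2] [Q3 [Q4 Q5]]]. rewrite Es in *. rewrite Rmin_left in Q4 by lra. rewrite Rmax_right in Q5 by lra.
  replace (scal 1 (C_Riemann_sum f ptd) - l)%C with
   ((scal 1 (C_Riemann_sum f' ptd) - l) + C_Riemann_sum (fun t => minus (f t) (f' t)) ptd)%C.
  - eapply Rle_lt_trans. apply Cmod_triangle.
   assert (B : `|C_Riemann_sum (fun t => minus (f t) (f' t)) ptd| <= Riemann_sum h ptd).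
   { rewrite <- norm_C_R. apply Riemann_sum_norm; auto. intros t Ht. rewrite norm_C_R. apply Hb. lra. }
   change (scal 1 (Riemann_sum h ptd)) with (1 * Riemann_sum h ptd) in Q2. rewrite Rmult_1_l in Q2.
   apply Rabs_def2 in Q2. lra.
  - assert (E : C_Riemann_sum (fun t => minus (f t) (f' t)) ptd =
    minus (C_Riemann_sum f ptd) (C_Riemann_sum f' ptd)) by apply (Riemann_sum_minus (V := C_R_NormedModule)).
   assert (S1 : forall x : C_R_NormedModule, scal 1 x = x) by apply (scal_one (V := C_R_NormedModule)).
   rewrite E, !S1. unfold minus, plus, opp; simpl.
   change (C_Riemann_sum f' ptd - l + (C_Riemann_sum f ptd + - C_Riemann_sum f' ptd)
    = C_Riemann_sum f ptd - l)%C. ring. }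
 intros u v Hu Hv. assert (Qu := Q u Hu). assert (Qv := Q v Hv).
 set (X := scal (sign (b - a)) (C_Riemann_sum f u)) in *.
 set (Y := scal (sign (b - a)) (C_Riemann_sum f v)) in *.
 assert (B : `|Y - X| < eps).
 { generalize (Cmod_triangle_minus Y l X). rewrite (Cmod_minus_sym l X). unfold e in *. lra. }
 split.
 - eapply Rle_lt_trans; [|apply B]. apply (re_le_Cmod (Y - X)).
 - eapply Rle_lt_trans; [|apply B]. apply (im_le_Cmod (Y - X)).
Qed.

Lemma ex_CI_Chasles f a b c : ex_CI f a b -> ex_CI f b c -> ex_CI f a c.
Proof. intros [l H] [m K]. eexists. eapply is_CI_Chasles; eauto. Qed.

Lemma ex_CI_ext f g a b : a <= b -> (forall t, a < t < b -> f t = g t) -> ex_CI f a b -> ex_CI g a b.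
Proof. intros Hab E [l H]. exists l. apply is_CI_ext with (2 := H). rewrite Rmin_left, Rmax_right; auto. Qed.

(** Putting the function to zero on end intervals of length [k] makes an error whose integral is at
    most [2 M k]. *)
Lemma ex_CI_bounded f a b M : a <= b -> (forall t, a < t < b -> rcont f t) -> (forall t, a < t < b -> `|f t| <= M) -> ex_CI f a b.
Proof.
 intros [Hab|<-] Hc HM.
 2:{ eexists. apply (is_RInt_point (V := C_R_NormedModule)). }
 set (f0 := fun t => if Rle_dec t a then RtoC 0 else if Rle_dec b t then RtoC 0 else f t).
 assert (PM : 0 <= M) by (eapply Rle_trans; [apply Cmod_ge_0|apply (HM ((a + b) / 2)); lra]).
 apply (ex_CI_ext f0). lra. { intros t Ht. unfold f0. destruct (Rle_dec t a); [lra|]. destruct (Rle_dec b t); [lra|auto]. }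
 apply ex_CI_squeeze; auto. intros e He.
 set (k := Rmin ((b - a) / 3) (e / (2 * M + 1))).
 assert (Pk : 0 < k). pos.
 assert (Hk1 : k <= (b - a) / 3) by apply Rmin_l. assert (Hk2 : k * (2 * M + 1) <= e). { apply Rle_div_r. lra. apply Rmin_r. }
 set (mid := fun t => if Rlt_dec t (a + k) then false else if Rlt_dec (b - k) t then false else true).
 assert (Mid : forall t, a + k < t < b - k -> mid t = true).
 { intros t Ht. unfold mid. destruct (Rlt_dec t (a + k)); [lra|]. destruct (Rlt_dec (b - k) t); [lra|auto]. }
 assert (MidL : forall t, t < a + k -> mid t = false). { intros t Ht. unfold mid. destruct (Rlt_dec t (a + k)); [auto|lra]. }
 assert (MidR : forall t, b - k < t -> mid t = false).
 { intros t Ht. unfold mid. destruct (Rlt_dec t (a + k)); auto. destruct (Rlt_dec (b - k) t); [auto|lra]. }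
 exists (fun t => if mid t then f t else RtoC 0), (fun t => if mid t then 0 else M), (M * k + 0 + M * k).
 split; [|split; [|split]].
 - apply ex_CI_Chasles with (b - k). apply ex_CI_Chasles with (a + k).
  + apply (ex_CI_ext (fun _ => RtoC 0)). lra. intros t Ht. rewrite MidL; auto. lra. eexists; apply is_CI_const.
  + apply (ex_CI_ext f). lra. intros t Ht. rewrite Mid; auto. apply ex_CI_cont. minmax.
   intros; apply Hc; lra.
  + apply (ex_CI_ext (fun _ => RtoC 0)). lra. intros t Ht. rewrite MidR; auto. lra. eexists; apply is_CI_const.
 - apply (is_RInt_Chasles (V := R_NormedModule)) with (b - k). apply (is_RInt_Chasles (V := R_NormedModule)) with (a + k).
  + apply (is_RInt_ext (fun _ => M)). minmax. intros t Ht. rewrite MidL; auto. lra.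
   replace (M * k) with (scal (a + k - a) M). apply (is_RInt_const (V := R_NormedModule)). unfold scal; simpl; unfold mult; simpl; ring.
  + apply (is_RInt_ext (fun _ => 0)). minmax. intros t Ht. rewrite Mid; auto.
   generalize (is_RInt_const (V := R_NormedModule) (a + k) (b - k) 0). unfold scal; simpl; unfold mult; simpl. rewrite Rmult_0_r. auto.
  + apply (is_RInt_ext (fun _ => M)). minmax. intros t Ht. rewrite MidR; auto. lra.
   replace (M * k) with (scal (b - (b - k)) M). apply (is_RInt_const (V := R_NormedModule)). unfold scal; simpl; unfold mult; simpl; ring.
 - nra.
 - intros t Ht. unfold f0. destruct (mid t) eqn:Et.
  + destruct (Rle_dec t a). rewrite MidL in Et by lra. lra.
   destruct (Rle_dec b t). rewrite MidR in Et by lra. discriminate. self.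
  + destruct (Rle_dec t a). self. destruct (Rle_dec b t). self.
   replace (f t - 0)%C with (f t) by ring. apply HM. lra.
Qed.

(** * Connected sets *)

Lemma connected_star (E : C -> Prop) a :
 (forall z, E z -> exists K, connected K /\ (forall w, K w -> E w) /\ K a /\ K z) -> connected E.
Proof.
 intros H A B oA oB cov [x [Ex Ax]] [y [Ey By]].
 destruct (H x Ex) as [Kx [cx [ix [ax xx]]]]. destruct (H y Ey) as [Ky [cy [iy [ay yy]]]].
 destruct (cov a (ix a ax)) as [Aa|Ba].
 - destruct (cy A B) as [z [Kz ABz]]; eauto. 
 - destruct (cx A B) as [z [Kz ABz]]; eauto.
Qed.

Lemma connected_arc f u v : rcont_on u v f -> connected (fun z => exists s, u <= s <= v /\ f s = z).
Proof.
 assert (W : forall A B : C -> Prop, open A -> open B -> rcont_on u v f -> (forall z, (exists s, u <= s <= v /\ f s = z) -> A z \/ B z) ->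
  forall s t, u <= s -> s <= t -> t <= v -> A (f s) -> B (f t) -> exists z, (exists s, u <= s <= v /\ f s = z) /\ A z /\ B z).
 { intros A B oA oB Hf cov s t Hs Hst Ht As Bt. apply NNPP. intros N.
  assert (N' : forall r, u <= r <= v -> A (f r) -> B (f r) -> False).
  { intros r Hr Ar Br. apply N. exists (f r). eauto. }
  apply (N' t); try lra; auto. apply (interval_induction_right (fun r => A (f r)) s t); auto.
  intros x Hx.
  assert (L : forall P : C -> Prop, open P -> P (f x) -> exists d, 0 < d /\ forall r, u <= r <= v -> Rabs (r - x) < d -> P (f r)).
  { intros P oP Px. apply oP in Px. apply locally_Cmod in Px. destruct Px as [e [He K]].
   destruct (Hf x LRA e He) as [d [Pd Kd]]. eauto. }
  destruct (cov (f x)) as [Ax|Bx]. { exists x. sa. lra. }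
  - destruct (L A oA Ax) as [d [Pd K]]. exists d. sa. sa.
   intros r Hr Hr2 _. apply K. lra. rabs.
  - destruct (L B oB Bx) as [d [Pd K]]. exists d. sa. split.
   + intros r Hr Hr2 Ar. exfalso. apply (N' r); auto. lra. apply K. lra. rabs.
   + intros r Hr Hr2 Ax. exfalso. apply (N' x); auto. lra. }
 intros Hf A B oA oB cov [x [[s [Hs <-]] As]] [y [[t [Ht <-]] Bt]].
 destruct (Rle_dec s t).
 - apply (W A B) with s t; auto; lra.
 - destruct (W B A oB oA Hf) with t s as [z [Hz [H1 H2]]]; auto; try lra.
  { intros z Hz. destruct (cov z Hz); auto. } eauto.
Qed.

Lemma component_of (E : C -> Prop) a : E a -> exists D, is_component E D /\ D a /\
 forall K, connected K -> (forall z, K z -> E z) -> K a -> forall z, K z -> D z.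
Proof.
 intros Ea. exists (fun z => exists K, connected K /\ (forall w, K w -> E w) /\ K a /\ K z).
 assert (Sa : connected (fun z => z = a)). { intros A B _ _ _ [x [-> Ax]] [y [-> By]]. eauto. }
 assert (Da : exists K : C -> Prop, connected K /\ (forall w, K w -> E w) /\ K a /\ K a).
 { exists (fun z => z = a). repeat sa. congruence. }
 split; [split; [|split; [|split]]|split]; auto.
 - eauto.
 - intros z [K [_ [HK [_ Kz]]]]. auto.
 - apply (connected_star _ a). intros z [K [cK [HK [Ka Kz]]]]. exists K. repeat sa.
  intros w Kw. exists K. auto.
 - intros D' cD' HD' incl z Hz. exists D'. repeat sa. 
 - intros K cK HK Ka z Kz. exists K. auto.
Qed.

(** * Preimages of the points of the curve off [Sigma] *)

(** The curve arrives at [a] at the parameter [l] and leaves at [r]. Normally [l = r]; at the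
    closing point of a closed curve they are [1] and [0]. This form treats both cases together,
    since multiple points and free ends lie in [Sigma]. *)
Lemma preimage_structure gamma Sigma g a : setting gamma Sigma g -> punctured gamma Sigma a ->
 exists l r, 0 < l <= 1 /\ 0 <= r < 1 /\ gamma l = a /\ gamma r = a /\ (l = r \/ (l = 1 /\ r = 0)) /\
  forall s, 0 <= s <= 1 -> gamma s = a -> s = l \/ s = r.
Proof.
 intros H [[s0 [Hs0 E0]] Na]. unfold I01 in Hs0.
 assert (U : forall s t, 0 <= s -> s < t -> t <= 1 -> gamma s = a -> gamma t = a -> s = 0 /\ t = 1).
 { intros s t H1 H2 H3 E1 E2. apply NNPP. intros N. apply Na. rewrite <- E1.
  apply (Sigma_multiple_points _ _ _ H s t). repeat sa. congruence. }
 assert (M : 0 < s0 < 1 -> forall s, 0 <= s <= 1 -> gamma s = a -> s = s0).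
 { intros Hi s Hs E. destruct (Rtotal_order s s0) as [L|[L|L]]; auto.
  destruct (U s s0); auto; lra. destruct (U s0 s); auto; lra. }
 destruct (Req_dec s0 0) as [Z|Z]; [|destruct (Req_dec s0 1) as [O|O]].
 - assert (E1 : gamma 1 = a).
  { apply NNPP. intros N. apply Na. rewrite <- E0, Z. apply (Sigma_end_points _ _ _ H). congruence. }
  subst s0. exists 1, 0. repeat split; auto; try lra. intros s Hs E.
  destruct (Req_dec s 0); auto. left. apply (U 0 s); auto; lra.
 - assert (E1 : gamma 0 = a).
  { apply NNPP. intros N. apply Na. rewrite <- E0, O. apply (Sigma_end_points _ _ _ H). congruence. }
  subst s0. exists 1, 0. repeat split; auto; try lra. intros s Hs E.
  destruct (Req_dec s 0); auto. left. apply (U 0 s); auto; lra.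
 - exists s0, s0. repeat split; auto; try lra. intros s Hs E. left. apply M; auto; lra.
Qed.

Lemma distance_outside f a b t (Q : R -> Prop) : a <= b -> rcont_on a b f ->
 (forall s, a <= s <= b -> f s = t -> exists h, 0 < h /\ forall s', a <= s' <= b -> Rabs (s' - s) < h -> Q s') ->
 exists d, 0 < d /\ forall s, a <= s <= b -> Q s \/ d <= `|f s - t|.
Proof.
 intros Hab Hf H.
 apply (interval_induction (fun u v => exists d, 0 < d /\ forall s, u <= s <= v -> Q s \/ d <= `|f s - t|)); auto.
 - intros x y z _ _ [d1 [P1 H1]] [d2 [P2 H2]]. exists (Rmin d1 d2). sp. intros s Hs.
  rmin.
  destruct (Rle_dec s y). destruct (H1 s) as [|K]; auto. lra. lra. destruct (H2 s) as [|K]; auto. lra. lra.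
 - intros x Hx. destruct (Ceq_dec (f x) t) as [E|N].
  + destruct (H x Hx E) as [h [Ph K]]. exists h. sa. intros u v Hu Hv L1 L2. exists 1. sp.
   intros s Hs. left. apply K. lra. rabs.
  + assert (P : 0 < `|f x - t|) by (apply Cmod_gt_0, Cminus_neq0; auto).
   destruct (Hf x Hx (`|f x - t| / 2)) as [d [Pd K]]. lra. exists d. sa.
   intros u v Hu Hv L1 L2. exists (`|f x - t| / 2). sp. intros s Hs. right.
   specialize (K s LRA ltac:(rabs)). triang.
Qed.

(** The last stretch of the curve before [a] and the first one after it, contiguous in the plane
    even if [a] is the closing point. *)
Definition near_params (l r d s : R) : Prop := l - d < s <= l \/ r <= s < r + d.

Lemma near_preimages gamma Sigma g a l r d : setting gamma Sigma g -> 0 < d ->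
 (l = r \/ (l = 1 /\ r = 0)) -> (forall s, 0 <= s <= 1 -> gamma s = a -> s = l \/ s = r) ->
 exists p, 0 < p /\ forall s, 0 <= s <= 1 -> `|gamma s - a| < p -> near_params l r d s.
Proof.
 intros H Hd Hlr HU.
 destruct (distance_outside gamma 0 1 a (near_params l r d)) as [p [Pp K]]. lra.
 - apply piecewise_rcont_on, (gamma_piecewise_smooth _ _ _ H).
 - intros s Hs E. exists d. sa. intros s' Hs' L. apply Rabs_def2 in L. unfold near_params.
  destruct Hlr as [<-|[-> ->]]. destruct (HU s Hs E) as [-> | ->]; destruct (Rle_dec s' l); lra.
  destruct (HU s Hs E) as [-> | ->]; lra.
 - exists p. sa. intros s Hs L. destruct (K s Hs); auto. lra.
Qed.

Lemma rcont_on_avoid gamma S a b s : rcont_on a b gamma -> a <= s <= b -> ~ In (gamma s) S -> exists d, 0 < d /\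
 forall t, a <= t <= b -> Rabs (t - s) < d -> ~ In (gamma t) S.
Proof.
 intros Hc Hs N. destruct (list_isolated S (gamma s)) as [e [He K]].
 destruct (Hc s Hs e He) as [d [Pd Kd]]. exists d. sa. intros t Ht L I.
 specialize (Kd t Ht L). specialize (K _ I). apply (Rlt_irrefl e). eapply Rle_lt_trans; [apply K|auto]. congruence.
Qed.

Lemma near_params_connected gamma l r d : rcont_on 0 1 gamma -> 0 <= l - d -> r + d <= 1 -> 0 < d -> l <= 1 -> 0 <= r -> gamma l = gamma r ->
 connected (fun z => exists s, near_params l r d s /\ gamma s = z).
Proof.
 intros Hc H1 H2 Hd Hl Hr E. apply (connected_star _ (gamma l)). intros z [s [[Hs|Hs] Ez]].
 - exists (fun z => exists t, s <= t <= l /\ gamma t = z). split; [|split; [|split]].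
  + apply connected_arc. rsub Hc.
  + intros w [t [Ht Ew]]. exists t. sa. left. lra.
  + exists l. easy.
  + exists s. easy.
 - exists (fun z => exists t, r <= t <= s /\ gamma t = z). split; [|split; [|split]].
  + apply connected_arc. rsub Hc.
  + intros w [t [Ht Ew]]. exists t. sa. right. lra.
  + exists r. easy.
  + exists s. easy.
Qed.

(** The arc of the parameters near [a] is connected, avoids [Sigma] and contains all points of the
    curve close to [a], so the maximality of the component absorbs it. *)
Lemma component_near gamma Sigma g Gs a : setting gamma Sigma g -> is_component (punctured gamma Sigma) Gs -> Gs a ->
 locally a (fun z : C => image gamma z -> Gs z).
Proof.
 intros H [_ [HE [cG HM]]] Ga.
 assert (Hc := piecewise_rcont_on _ (gamma_piecewise_smooth _ _ _ H)).
 destruct (preimage_structure _ _ _ a H (HE a Ga)) as [l [r [Hl [Hr [El [Er [Hlr HU]]]]]]].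
 assert (Na := proj2 (HE a Ga)).
 destruct (rcont_on_avoid gamma Sigma 0 1 l Hc LRA ltac:(now rewrite El)) as [d1 [P1 K1]].
 destruct (rcont_on_avoid gamma Sigma 0 1 r Hc LRA ltac:(now rewrite Er)) as [d2 [P2 K2]].
 set (d := Rmin (Rmin d1 d2) (Rmin l (1 - r))).
 assert (Pd : 0 < d) by pos.
 assert (D1 : d <= d1) by (eapply Rle_trans; apply Rmin_l).
 assert (D2 : d <= d2) by (eapply Rle_trans; [apply Rmin_l|apply Rmin_r]).
 assert (D3 : d <= l) by (eapply Rle_trans; [apply Rmin_r|apply Rmin_l]).
 assert (D4 : d <= 1 - r) by (eapply Rle_trans; [apply Rmin_r|apply Rmin_r]).
 destruct (near_preimages gamma Sigma g a l r d H Pd Hlr HU) as [p [Pp Kp]].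
 apply locally_Cmod. exists p. sa. intros z Hz [s [Hs Ez]]. subst z.
 set (A := fun z => exists s, near_params l r d s /\ gamma s = z).
 assert (cA : connected A). { apply near_params_connected; auto; try lra. congruence. }
 assert (iA : forall z, A z -> punctured gamma Sigma z).
 { intros z [t [[Ht|Ht] <-]]; split; try (exists t; split; [unfold I01; lra|auto]).
  apply K1. lra. rabs. apply K2. lra. rabs. }
 apply (HM (fun z => Gs z \/ A z)).
 - assert (Aa : A a). { exists l. sa. left. lra. }
  apply (connected_star _ a). intros w [Gw|Aw]. exists Gs; auto. exists A; auto.
 - intros w [Gw|Aw]; auto.
 - auto.
 - right. exists s. sa.
Qed.

(** Neighbouring germs on a segment come from one holomorphic function, so the set of points whose
    germ is annihilated by [P] is open and closed in the segment. *)
Lemma algebraic_on_component gamma Sigma g Gs : setting gamma Sigma g -> is_component (punctured gamma Sigma) Gs ->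
 exists P, pnonzero2 P /\ forall z, Gs z -> exists f, branch_at gamma g z f /\ locally z (fun w : C => peval2 P w (f w) = RtoC 0).
Proof.
 intros H HG. destruct (g_algebraic _ _ _ H Gs HG) as [G [[z0 [Gz0 [_ [P [HP EP]]]]] HGG]].
 exists P. sa.
 assert (BR : forall z, Gs z -> branch_at gamma g z (G z)).
 { intros z Gz. destruct (HGG z Gz) as [Hh [_ Hl]]. sa.
  assert (HN := component_near _ _ _ _ _ H HG Gz). generalize (filter_and _ _ Hl HN). apply filter_imp.
  intros w [K1 K2] Iw. specialize (K1 (K2 Iw)). destruct (HGG w (K2 Iw)) as [_ [Ew _]].
  apply germ_eq_Cmod in K1. destruct K1 as [r [Pr K1]]. rewrite <- K1, Ew; auto. self. }
 set (W := fun z p => 0 < p /\ hold (G z) z (2 * p) /\ forall z', Gs z' -> `|z' - z| < 2 * p -> germ_eq z' (G z') (G z)).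
 assert (HW : forall z, Gs z -> exists p, W z p).
 { intros z Gz. destruct (HGG z Gz) as [Hh [_ Hl]]. apply holomorphic_at_hold in Hh. destruct Hh as [r [Pr Hh]].
  apply locally_Cmod in Hl. destruct Hl as [r' [Pr' Hl]]. exists (Rmin r r' / 2).
  assert (0 < Rmin r r') by pos. sp. replace (2 * (Rmin r r' / 2)) with (Rmin r r') by lra. split.
  - apply hold_sub with (1 := Hh). rewrite Cmod_sub_self. ar.
  - intros z' Gz' Hz'. apply Hl; auto. ar. }
 set (Good := fun z : C => locally z (fun w : C => peval2 P w (G z w) = RtoC 0)).
 assert (prop : forall z p z', Gs z -> W z p -> Gs z' -> `|z' - z| < 2 * p -> (Good z <-> Good z')).
 { intros z p z' Gz [Pp [Wh Wl]] Gz' Hz'. specialize (Wl z' Gz' Hz').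
  assert (GG : Good z' <-> locally z' (fun w : C => peval2 P w (G z w) = RtoC 0)).
  { unfold Good. split; intros K; generalize (filter_and _ _ Wl K); apply filter_imp; intros w [E1 E2]; [now rewrite <- E1|now rewrite E1]. }
  rewrite GG. assert (Hol : hold (fun w => peval2 P w (G z w)) z (2 * p)). { intros w Hw. now apply holo_peval2, Wh. }
  assert (D : forall x, `|x - z| < 2 * p -> locally x (fun w : C => peval2 P w (G z w) = RtoC 0) ->
   forall y, `|y - z| < 2 * p -> locally y (fun w : C => peval2 P w (G z w) = RtoC 0)).
  { intros x Hx K y Hy. assert (Z := hold_identity _ _ _ _ Hol Hx K). apply locally_Cmod. exists (2 * p - `|y - z|).
   sp. intros w Hw. apply Z. triang. }
  assert (`|z - z| < 2 * p) by self. unfold Good. split; intros K; eapply D; eauto. }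
 assert (All : forall z, Gs z -> Good z).
 { destruct HG as [_ [_ [cG _]]]. intros z1 Gz1. apply NNPP. intros NG.
  assert (op : forall Q : C -> Prop, open (fun x => exists z p, Gs z /\ W z p /\ Q z /\ `|x - z| < p)).
  { intros Q x [z [p [Gz [Wz [Qz Hx]]]]]. apply locally_Cmod. exists (p - `|x - z|). sp.
   intros y Hy. exists z, p. repeat split; auto; try apply Wz. triang. }
  destruct (cG _ _ (op Good) (op (fun z => ~ Good z))) as [z [Gz [[x [p [Gx [Wx [Qx Hx]]]]] [y [q [Gy [Wy [Qy Hy]]]]]]]].
  - intros z Gz. destruct (HW z Gz) as [p Wz]. assert (`|z - z| < p) by (rewrite Cmod_sub_self; apply Wz).
   destruct (classic (Good z)); [left|right]; exists z, p; auto.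
  - exists z0. sa. destruct (HW z0 Gz0) as [p Wz]. exists z0, p. repeat split; auto; try apply Wz. 
   rewrite Cmod_sub_self; apply Wz.
  - exists z1. sa. destruct (HW z1 Gz1) as [p Wz]. exists z1, p. repeat split; auto; try apply Wz.
   rewrite Cmod_sub_self; apply Wz.
  - apply Qy. apply (prop y q z); auto. cm. apply (prop x p z); auto. cm. }
 intros z Gz. exists (G z). split. auto. apply All, Gz.
Qed.

Lemma algebraic_on_connected gamma Sigma g A : setting gamma Sigma g -> connected A -> (forall z, A z -> punctured gamma Sigma z) ->
 exists P, pnonzero2 P /\ forall z, A z -> exists f, branch_at gamma g z f /\ locally z (fun w : C => peval2 P w (f w) = RtoC 0).
Proof.
 intros H cA iA. destruct (classic (exists a, A a)) as [[a Aa]|N].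
 - destruct (component_of (punctured gamma Sigma) a (iA a Aa)) as [D [HD [Da HM]]].
  destruct (algebraic_on_component _ _ _ D H HD) as [P [HP K]]. eauto.
 - exists ((RtoC 1 :: nil) :: nil). split. { exists (RtoC 1 :: nil). split. now left. exists (RtoC 1). split. now left. apply C1_nz. }
  intros z Az. exfalso. eauto.
Qed.

Definition has_branch gamma g P z := exists f, branch_at gamma g z f /\ locally z (fun w : C => peval2 P w (f w) = RtoC 0).

(** The equations of finitely many arcs and points are multiplied together, the finiteness coming
    from induction over the parameter interval. *)
Lemma algebraic_global gamma Sigma g : setting gamma Sigma g -> exists P, pnonzero2 P /\
 forall z, punctured gamma Sigma z -> has_branch gamma g P z.
Proof.
 intros H. assert (HP := gamma_piecewise_smooth _ _ _ H). assert (Hc := piecewise_rcont_on _ HP).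
 destruct (finite_preimages gamma Sigma HP) as [L HL].
 assert (one : pnonzero2 ((RtoC 1 :: nil) :: nil)).
 { exists (RtoC 1 :: nil). split. now left. exists (RtoC 1). split. now left. apply C1_nz. }
 assert (mul : forall P1 P2, pnonzero2 P1 -> pnonzero2 P2 -> exists P, pnonzero2 P /\
  forall z, has_branch gamma g P1 z \/ has_branch gamma g P2 z -> has_branch gamma g P z).
 { intros P1 P2 N1 N2. destruct (PolyAlgebra.peval2_mult P1 P2 N1 N2) as [P [NP EP]]. exists P. sa.
  intros z [[f [Hf Ef]]|[f [Hf Ef]]]; exists f; split; auto; revert Ef; apply filter_imp; intros w E; rewrite EP, E; ring. }
 assert (PT : forall s, 0 <= s <= 1 -> exists P, pnonzero2 P /\ (~ In (gamma s) Sigma -> has_branch gamma g P (gamma s))).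
 { intros s Hs. destruct (classic (In (gamma s) Sigma)) as [I|I]. { exists ((RtoC 1 :: nil) :: nil). easy. }
  destruct (algebraic_on_connected gamma Sigma g (fun z => z = gamma s) H) as [P [P0 KP]].
  - intros A B _ _ _ [x [-> Ax]] [y [-> By]]. eauto.
  - intros z ->. sa. now exists s.
  - exists P. sa. intros _. now apply KP. }
 assert (OPEN : forall u v, 0 <= u -> v <= 1 -> (forall s, u < s < v -> ~ In (gamma s) Sigma) ->
  exists P, pnonzero2 P /\ forall s, u < s < v -> has_branch gamma g P (gamma s)).
 { intros u v Hu Hv K. 
  destruct (algebraic_on_connected gamma Sigma g (fun z => exists s, u < s < v /\ gamma s = z) H) as [P [P0 KP]].
  - apply (connected_star _ (gamma ((u + v) / 2))). intros z [s [Hs <-]].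
   exists (fun z => exists t, Rmin s ((u + v) / 2) <= t <= Rmax s ((u + v) / 2) /\ gamma t = z).
   assert (B : u < Rmin s ((u + v) / 2) /\ Rmax s ((u + v) / 2) < v).
   { sp. apply Rmax_lub_lt; lra. }
   split; [|split; [|split]].
   + apply connected_arc. rsub Hc.
   + intros w [t [Ht Ew]]. exists t. sa. lra.
   + exists ((u + v) / 2). sa. split. ar. apply Rmax_r.
   + exists s. sa. split. ar. apply Rmax_l.
  - intros z [s [Hs <-]]. sa. exists s. sa. ar.
  - exists P. sa. intros s Hs. apply KP. eauto. }
 destruct (interval_induction (fun u v => exists P, pnonzero2 P /\ forall s, u <= s <= v -> ~ In (gamma s) Sigma -> has_branch gamma g P (gamma s)) 0 1) as [P [NP KP]].
 - lra.
 - intros x y z _ _ [P1 [N1 K1]] [P2 [N2 K2]]. destruct (mul P1 P2 N1 N2) as [P [NP KP]]. exists P. sa.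
  intros s Hs I. apply KP. destruct (Rle_dec s y). left; apply K1; auto; lra. right; apply K2; auto; lra.
 - intros x Hx. destruct (Rlist_isolated L x) as [d [Pd Kd]]. exists d. sa. intros u v Hu Hv L1 L2.
  assert (NS : forall s, 0 <= s <= 1 -> s <> x -> Rabs (s - x) < d -> ~ In (gamma s) Sigma).
  { intros s Hs N L3 I. specialize (Kd s (HL s Hs I) N). lra. }
  destruct (PT u LRA) as [P1 [N1 K1]]. destruct (PT x Hx) as [P2 [N2 K2]]. destruct (PT v LRA) as [P3 [N3 K3]].
  destruct (OPEN u x LRA LRA) as [P4 [N4 K4]]. { intros s Hs. apply NS; try lra. rabs. }
  destruct (OPEN x v LRA LRA) as [P5 [N5 K5]]. { intros s Hs. apply NS; try lra. rabs. }
  destruct (mul P1 P2 N1 N2) as [P12 [N12 K12]]. destruct (mul P12 P3 N12 N3) as [P123 [N123 K123]].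
  destruct (mul P4 P5 N4 N5) as [P45 [N45 K45]]. destruct (mul P123 P45 N123 N45) as [P [NP KP]].
  exists P. sa. intros s Hs I. apply KP.
  destruct (Req_dec s u) as [->|]. left; apply K123; left; apply K12; left; auto.
  destruct (Req_dec s x) as [->|]. left; apply K123; left; apply K12; right; auto.
  destruct (Req_dec s v) as [->|]. auto.
  right. apply K45. destruct (Rlt_le_dec s x). left; apply K4; lra. right; apply K5; lra.
 - exists P. sa. intros z [[s [Hs <-]] I]. auto.
Qed.

(** * Uniqueness of the branch given on the curve *)

Lemma curve_not_isolated gamma Sigma g a : setting gamma Sigma g -> punctured gamma Sigma a ->
 forall p, 0 < p -> exists z, z <> a /\ `|z - a| < p /\ image gamma z.
Proof.
 intros H Ha p Pp. destruct (preimage_structure _ _ _ a H Ha) as [l [r [Hl [Hr [El [Er [Hlr HU]]]]]]].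
 assert (Hc := piecewise_rcont_on _ (gamma_piecewise_smooth _ _ _ H)).
 destruct (Hc r LRA p Pp) as [d [Pd K]].
 destruct (Rlist_isolated (l :: r :: nil) r) as [e [Pe Ke]].
 set (s := r + Rmin (Rmin d e) (1 - r) / 2).
 assert (0 < Rmin (Rmin d e) (1 - r)) by pos.
 rmin.
 exists (gamma s). split; [|split].
 - intros E. assert (Ns : s <> r) by (unfold s; lra).
  assert (Is : In s (l :: r :: nil)). { destruct (HU s) as [-> | ->]; auto. unfold s; lra. now left. lra. }
  specialize (Ke s Is Ns). rewrite Rabs_pos_eq in Ke by (unfold s; lra). unfold s in Ke. lra.
 - rewrite <- Er. apply K. unfold s; lra. rewrite Rabs_pos_eq; unfold s; lra.
 - exists s. sa. unfold I01, s; lra.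
Qed.

(** Two branches agree on the curve, whose points accumulate at [a]. *)
Lemma branch_unique gamma Sigma g a f f' : setting gamma Sigma g -> punctured gamma Sigma a ->
 branch_at gamma g a f -> branch_at gamma g a f' -> germ_eq a f f'.
Proof.
 intros H Ha [H1 E1] [H2 E2]. apply holomorphic_at_hold in H1. apply holomorphic_at_hold in H2.
 destruct H1 as [r [Pr H1]]. destruct H2 as [s [Ps H2]]. apply locally_Cmod in E1. apply locally_Cmod in E2.
 destruct E1 as [t1 [Pt1 E1]]. destruct E2 as [t2 [Pt2 E2]].
 assert (P : 0 < Rmin r s) by pos.
 apply germ_eq_Cmod. exists (Rmin r s). sa. intros w Hw. apply Cminus_eq0.
 apply (holo_zero_accumulation (fun z => f z - f' z)%C a (Rmin r s)); auto.
 - intros z Hz. apply holo_minus. apply H1. ar. apply H2. ar.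
 - intros p Pp. destruct (curve_not_isolated _ _ _ a H Ha (Rmin p (Rmin t1 t2))) as [z [Nz [Hz Iz]]]. pos.
  exists z. sa. assert (Z1 := lt_minl Hz). assert (Z2 := lt_minr Hz).
  sa. rewrite E1, E2; auto. ring. ar. ar.
Qed.

Lemma branch_algebraic gamma Sigma g P a f : setting gamma Sigma g -> punctured gamma Sigma a -> has_branch gamma g P a ->
 branch_at gamma g a f -> locally a (fun w : C => peval2 P w (f w) = RtoC 0).
Proof.
 intros H Ha [f' [Hf' E]] Hf. generalize (filter_and _ _ E (branch_unique _ _ _ _ _ _ H Ha Hf Hf')).
 apply filter_imp. intros w [E1 E2]. congruence.
Qed.

(** * Boundedness of [g] and regularity of the Cauchy type integral *)

(** As long as all coefficients vanish at [p], a factor [z - p] is split off; their lengths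
    decrease, so this stops. The specialisation at [z = p] is then a non-zero polynomial in [w]. *)
Lemma strip_zero p n : forall P, (forall q, In q P -> (length q <= n)%nat) -> pnonzero2 P ->
 exists k P', (forall z w, peval2 P z w = ((z - p) ^ k * peval2 P' z w)%C) /\ pnonzero (map (fun q => peval q p) P').
Proof.
 induction n as [|n IH]; intros P HL HP.
 - exfalso. destruct HP as [q [Hq [a [Ha _]]]]. specialize (HL q Hq). destruct q. auto. easy.
 - destruct (classic (pnonzero (map (fun q => peval q p) P))) as [Y|N].
  { exists O, P. sa. intros; simpl; ring. }
  assert (Z : forall q, In q P -> peval q p = RtoC 0).
  { intros q Hq. destruct (Ceq_dec (peval q p) 0) as [|E]; auto. exfalso. apply N. exists (peval q p). sa.
   apply in_map_iff. eauto. }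
  assert (exists P', (forall q, In q P' -> (length q <= n)%nat) /\ (pnonzero2 P -> pnonzero2 P') /\
   forall z w, peval2 P z w = ((z - p) * peval2 P' z w)%C) as [P' [HL' [HN' E']]].
  { clear N HP. induction P as [|q P IHP].
   - exists nil. repeat sa. easy. intros; rewrite !peval2_nil; ring.
   - destruct IHP as [P' [HL' [HN' E']]]; try (intros; apply HL; now right); try (intros; apply Z; now right).
    destruct (synthetic_division p q) as [q' [Lq Eq]].
    exists (q' :: P'). split; [|split].
    + intros r [<-|Hr]; auto. rewrite Lq. specialize (HL q (or_introl eq_refl)). lia.
    + intros [r [[<-|Hr] Nr]].
     * exists q'. split. now left. apply NNPP. intros NN. apply (peval_zero_not_pnonzero q); auto. intros z.
      specialize (Eq z). rewrite (Z q (or_introl eq_refl)) in Eq. replace (peval q z) with (peval q z - 0)%C by ring. rewrite Eq.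
      destruct (Ceq_dec (peval q' z) 0) as [->|NE]. ring. exfalso. apply NN. now apply pnonzero_peval with z.
     * destruct HN' as [r' [Hr' Nr']]. now exists r. exists r'. sa. now right.
    + intros z w. rewrite !peval2_cons, E'. specialize (Eq z). rewrite (Z q (or_introl eq_refl)) in Eq.
     replace (peval q z) with (peval q z - 0)%C by ring. rewrite Eq. ring. }
  destruct (IH P' HL' (HN' HP)) as [k [P'' [E'' N'']]]. exists (S k), P''. sa.
  intros z w. rewrite E', E''. simpl. ring.
Qed.

Lemma list_length_bound {A} (P : list (list A)) : exists n, forall q, In q P -> (length q <= n)%nat.
Proof.
 induction P as [|q P [n H]]. exists O. easy. exists (Nat.max n (length q)). intros r [<-|Hr]. lia.
 specialize (H r Hr). lia.
Qed.

Lemma rcont_Cmod f t : rcont f t -> forall e, 0 < e -> exists d, 0 < d /\ forall s, Rabs (s - t) < d -> Rabs (`|f s| - `|f t|) < e.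
Proof.
 intros H e He. destruct (H e He) as [d [Pd K]]. exists d. sa. intros s Hs. specialize (K s Hs).
 generalize (Cmod_minus_ge (f s) (f t)) (Cmod_minus_ge (f t) (f s)). rewrite (Cmod_minus_sym (f t)). intros. rabs.
Qed.

Lemma Cmod_trapped f M u v : (forall t, Rmin u v <= t <= Rmax u v -> rcont f t /\ `|f t| <> M) -> `|f u| < M -> `|f v| < M.
Proof.
 assert (W : forall u v f, u <= v -> (forall t, u <= t <= v -> rcont f t /\ `|f t| <> M) -> `|f u| < M -> `|f v| < M).
 { clear. intros u v f Huv H. apply (interval_induction_right (fun t => `|f u| < M -> `|f t| < M) u v); auto.
  intros x Hx. destruct (H x Hx) as [Hc N].
  destruct (rcont_Cmod f x Hc (Rabs (`|f x| - M))) as [d [Pd K]]. { apply Rabs_pos_lt. lra. }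
  exists d. sa. split; intros t Ht L Q Hu; specialize (Q Hu).
  - specialize (K t ltac:(rabs)). revert K. unfold Rabs. destruct (Rcase_abs (`|f x| - M)), (Rcase_abs (`|f t| - `|f x|)); lra.
  - specialize (K t ltac:(rabs)). revert K. unfold Rabs. destruct (Rcase_abs (`|f x| - M)), (Rcase_abs (`|f t| - `|f x|)); lra. }
 intros H Hu. destruct (Rle_lt_dec u v) as [L|L].
 - rewrite Rmin_left, Rmax_right in H by lra. eauto.
 - rewrite Rmin_right, Rmax_left in H by lra.
  replace (f v) with (f (- - v)) by (f_equal; ring). apply (W (- u) (- v) (fun t => f (- t))). lra.
  + intros t Ht. destruct (H (- t)) as [Hc N]. lra. sa. intros e He. destruct (Hc e He) as [d [Pd K]].
   exists d. sa. intros s Hs. apply K. replace (- s - - t) with (- (s - t)) by ring. now rewrite Rabs_Ropp.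
  + now rewrite Ropp_involutive.
Qed.

(** As [x] tends to zero, [h x] can only accumulate at the finitely many roots of the equation over
    [p] or at infinity. A circle that avoids these roots is not crossed for small [x], and since [h]
    does not tend to infinity it can be chosen so that [h] is inside. *)
Lemma algebraic_bounded P p d (zeta h : R -> C) : pnonzero2 P -> 0 < d ->
 (forall x, 0 < x < d -> zeta x <> p /\ rcont h x /\ peval2 P (zeta x) (h x) = RtoC 0) ->
 (forall e, 0 < e -> exists d', 0 < d' /\ forall x, 0 < x < d' -> `|zeta x - p| < e) ->
 ~ (forall K, exists d', 0 < d' /\ forall x, 0 < x < d' -> K < `|h x|) ->
 exists d' M, 0 < d' /\ 0 <= M /\ forall x, 0 < x < d' -> `|h x| <= M.
Proof.
 intros HP Hd Hz Hlim Hnp. destruct (list_length_bound P) as [n Hn].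
 destruct (strip_zero p n P Hn HP) as [k [P' [E' N']]].
 assert (Hz' : forall x, 0 < x < d -> peval2 P' (zeta x) (h x) = RtoC 0).
 { intros x Hx. destruct (Hz x Hx) as [N1 [_ E1]]. rewrite E' in E1. apply Cmult_integral in E1. destruct E1 as [E1|]; auto.
  exfalso. revert E1. now apply Cpow_nz, Cminus_neq0. }
 set (pp := map (fun q => peval q p) P') in *.
 destruct (finite_roots _ pp eq_refl N') as [L HL].
 apply not_all_ex_not in Hnp. destruct Hnp as [K0 Hnp].
 assert (HK : forall d', 0 < d' -> exists x, 0 < x < d' /\ `|h x| <= K0).
 { intros d' Pd'. apply NNPP. intros N. apply Hnp. exists d'. sa. intros x Hx. apply Rnot_le_lt. eauto. }
 set (m := Rmax K0 0). assert (M0 : K0 <= m /\ 0 <= m) by (split; [apply Rmax_l|apply Rmax_r]).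
 (* The radius exceeds the bound [m], below which [h] returns arbitrarily late, and is not the
    modulus of a root. *)
 assert (exists M, m < M /\ forall w, In w L -> `|w| <> M) as [M [HM1 HM2]].
 { destruct (Rlist_isolated (map Cmod L) m) as [e [Pe Ke]]. exists (m + e / 2). sp. intros w Hw E.
  specialize (Ke (`|w|) (in_map Cmod L w Hw) LRA). rewrite E in Ke. rewrite Rabs_pos_eq in Ke; lra. }
 assert (NZ : forall w, `|w| = M -> peval pp w <> RtoC 0). { intros w Ew E. apply (HM2 w); auto. }
 assert (C0 : forall x, `|circle 0 M x| = M).
 { intros x. rewrite <- (Cmod_circle 0 M x) at 2 by lra. f_equal. ring. }
 destruct (circle_bounded (fun w => / peval pp w)%C 0 M) as [B [PB HB]].
 { intros x. apply (ccont_comp (peval pp) Cinv). apply holo_ccont, holo_peval. eapply cderiv_ccont, cderiv_inv. auto. }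
 assert (low : forall w, `|w| = M -> / B <= `|peval pp w|).
 { intros w Ew. destruct (polar 0 w) as [x [_ Hx]]. replace (w - 0)%C with w in Hx by ring. rewrite Ew in Hx.
  specialize (HB x). rewrite <- Hx in HB. rewrite Cmod_inv in HB by auto.
  assert (0 < `|peval pp w|) by (apply Cmod_gt_0; auto).
  rewrite <- (Rinv_inv (`|peval pp w|)). apply Rinv_le_contravar; auto. now apply Rinv_0_lt_compat. }
 destruct (lipschitz2_peval2 P' (Rmax M (`|p| + 1))) as [Q [PQ HQ]].
 assert (PB' : 0 < / B) by now apply Rinv_0_lt_compat.
 destruct (Hlim (Rmin 1 (/ B / (Q + 1)))) as [d1 [Pd1 K1]]. pos.
 set (d2 := Rmin d d1). assert (Pd2 : 0 < d2) by pos.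
 assert (NM : forall x, 0 < x < d2 -> `|h x| <> M).
 { intros x Hx E. assert (X1 := Rlt_le_trans _ _ _ (proj2 Hx) (Rmin_l _ _)). assert (X2 := Rlt_le_trans _ _ _ (proj2 Hx) (Rmin_r _ _)).
  specialize (K1 x LRA). assert (Z1 := lt_minl K1). assert (Z2 := lt_minr K1).
  specialize (low (h x) E). change (peval pp (h x)) with (peval2 P' p (h x)) in low.
  destruct (HQ (zeta x) (h x) p (h x)) as [_ HQ2].
  { eapply Rle_trans; [|apply Rmax_r]. replace (zeta x) with (p + (zeta x - p))%C by ring. tri. lra. }
  { rewrite E. apply Rmax_l. } { eapply Rle_trans; [|apply Rmax_r]. lra. } { rewrite E. apply Rmax_l. }
  rewrite Hz', Cmod_sub_self, Rplus_0_r in HQ2 by lra. replace (0 - peval2 P' p (h x))%C with (- peval2 P' p (h x))%C in HQ2 by ring.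
  rewrite Cmod_opp in HQ2. apply Rlt_div_r in Z2; [|lra]. generalize (Cmod_ge_0 (zeta x - p)). nra. }
 exists d2, M. sa. sp. intros x Hx. left.
 destruct (HK d2 Pd2) as [y [Hy Ly]]. apply (Cmod_trapped h M y x). 2: lra.
 intros t Ht. assert (0 < t < d2).
 { destruct Ht as [T1 T2]. split. eapply Rlt_le_trans; [|apply T1]. pos. eapply Rle_lt_trans; [apply T2|]. apply Rmax_lub_lt; lra. }
 sa. apply Hz. sp. apply (lt_minl (proj2 H)).
Qed.

Lemma g_near_curve gamma Sigma g s : setting gamma Sigma g -> 0 <= s <= 1 -> ~ In (gamma s) Sigma ->
 exists f, ccont f (gamma s) /\ exists d, 0 < d /\ forall t, 0 <= t <= 1 -> Rabs (t - s) < d -> g (gamma t) = f (gamma t).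
Proof.
 intros H Hs N. destruct (algebraic_global _ _ _ H) as [P [NP KP]].
 destruct (KP (gamma s)) as [f [[Hf Ef] _]]. { sa. now exists s. }
 exists f. apply holomorphic_at_hold in Hf. destruct Hf as [r [Pr Hf]]. split. apply holo_ccont, (hold_holo f _ r); auto.
 apply locally_Cmod in Ef. destruct Ef as [e [Pe Ef]].
 destruct (piecewise_rcont_on _ (gamma_piecewise_smooth _ _ _ H) s Hs e Pe) as [d [Pd K]]. exists d. sa.
 intros t Ht L. symmetry. apply Ef. auto. now exists t.
Qed.

Lemma rcont_on_interior a b f s : rcont_on a b f -> a < s < b -> rcont f s.
Proof.
 intros H Hs e He. destruct (H s LRA e He) as [d [Pd K]]. exists (Rmin d (Rmin (s - a) (b - s))).
 sp. intros t Ht. generalize (Rmin_l d (Rmin (s - a) (b - s))) (Rmin_r d (Rmin (s - a) (b - s)))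
 (Rmin_l (s - a) (b - s)) (Rmin_r (s - a) (b - s)). intros. apply K. apply Rabs_def2 in Ht. lra. lra.
Qed.

Lemma g_curve_rcont gamma Sigma g s : setting gamma Sigma g -> 0 < s < 1 -> ~ In (gamma s) Sigma -> rcont (fun t => g (gamma t)) s.
Proof.
 intros H Hs N e He. destruct (g_near_curve _ _ _ s H LRA N) as [f [Hf [d [Pd E]]]].
 assert (Hc := rcont_on_interior _ _ _ s (piecewise_rcont_on _ (gamma_piecewise_smooth _ _ _ H)) Hs).
 destruct (ccont_rcomp f _ Hf gamma s Hc eq_refl e He) as [d' [Pd' K]].
 exists (Rmin (Rmin d d') (Rmin s (1 - s))). sp. intros t Ht.
 rmin.
 intros. assert (L := Rabs_def2 _ _ Ht). rewrite !E; try (rewrite ?Rminus_diag, ?Rabs_R0; lra). apply K. lra.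
Qed.

Lemma filterlim_infinity (F : (R -> Prop) -> Prop) (h : R -> R) : Filter F ->
 (forall K, F (fun x => K < h x)) -> filterlim h F (Rbar_locally p_infty).
Proof.
 intros FF H P [M HM]. unfold filtermap. generalize (H M). apply filter_imp. auto.
Qed.

(** At a parameter of a point of [Sigma] the two sides are treated by [algebraic_bounded], where the
    absence of poles excludes a limit at infinity. *)
Lemma g_bounded gamma Sigma g : setting gamma Sigma g -> exists M, 0 <= M /\
 forall s, 0 <= s <= 1 -> ~ In (gamma s) Sigma -> `|g (gamma s)| <= M.
Proof.
 intros H. assert (HP := gamma_piecewise_smooth _ _ _ H). assert (Hc := piecewise_rcont_on _ HP).
 destruct (finite_preimages gamma Sigma HP) as [L HL]. destruct (algebraic_global _ _ _ H) as [P [NP KP]].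
 apply (interval_induction (fun u v => exists M, 0 <= M /\ forall s, u <= s <= v -> ~ In (gamma s) Sigma -> `|g (gamma s)| <= M)). lra.
 - intros x y z _ _ [M1 [P1 H1]] [M2 [P2 H2]]. exists (M1 + M2). sp. intros s Hs N.
  destruct (Rle_dec s y). specialize (H1 s LRA N); lra. specialize (H2 s LRA N); lra.
 - intros x Hx. destruct (classic (In (gamma x) Sigma)) as [Ix|Nx].
  + destruct (Rlist_isolated L x) as [e [Pe Ke]].
   assert (NS : forall s, 0 <= s <= 1 -> s <> x -> Rabs (s - x) < e -> ~ In (gamma s) Sigma).
   { intros s Hs N L3 I. specialize (Ke s (HL s Hs I) N). lra. }
   assert (EQ : forall s, 0 <= s <= 1 -> ~ In (gamma s) Sigma -> peval2 P (gamma s) (g (gamma s)) = RtoC 0).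
   { intros s Hs N. assert (Pu : punctured gamma Sigma (gamma s)). { sa. now exists s. }
    destruct (KP _ Pu) as [f [[_ Hf] Ef]]. apply locally_Cmod in Hf. destruct Hf as [r [Pr Hf]].
    apply locally_Cmod in Ef. destruct Ef as [r' [Pr' Ef]]. rewrite <- Hf. apply Ef. self. self. now exists s. }
   assert (HR : exists d M, 0 < d /\ 0 <= M /\ forall s, x < s <= 1 -> s < x + d -> `|g (gamma s)| <= M).
   { destruct (Rlt_le_dec x 1) as [L1|L1]. 2:{ exists 1, 0. repeat split; try lra. ar. }
    destruct (algebraic_bounded P (gamma x) (Rmin e (1 - x)) (fun y => gamma (x + y)) (fun y => g (gamma (x + y))) NP) as [d [M [Pd [PM KM]]]].
    - pos.
    - intros y Hy. rmin.
     assert (N : ~ In (gamma (x + y)) Sigma). { apply NS; try lra. rabs. }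
     split; [|split]. congruence.
     + intros e' He'. destruct (g_curve_rcont _ _ _ (x + y) H LRA N e' He') as [d [Pd K]]. exists d. sa.
      intros s Hs. apply K. replace (x + s - (x + y)) with (s - y) by ring. auto.
     + apply EQ; auto. lra.
    - intros e' He'. destruct (Hc x Hx e' He') as [d [Pd K]]. exists (Rmin d (1 - x)). sp.
     intros y Hy. rmin. apply K. lra. rabs.
    - intros K. apply (proj1 (g_no_poles _ _ _ H x Hx Ix) L1). apply filterlim_infinity. apply at_right_proper_filter.
     intros K0. destruct (K K0) as [d' [Pd' K']]. exists (mkposreal d' Pd'). refine (fun (s : R) Hs Hxs => _).
     change (Rabs (s - x) < d') in Hs. apply Rabs_def2 in Hs. specialize (K' (s - x) LRA). now replace (x + (s - x)) with s in K' by ring.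
    - exists d, M. repeat sa. intros s Hs1 Hs2. specialize (KM (s - x) LRA). now replace (x + (s - x)) with s in KM by ring. }
   assert (HLf : exists d M, 0 < d /\ 0 <= M /\ forall s, 0 <= s < x -> x - d < s -> `|g (gamma s)| <= M).
   { destruct (Rlt_le_dec 0 x) as [L1|L1]. 2:{ exists 1, 0. repeat split; try lra. ar. }
    destruct (algebraic_bounded P (gamma x) (Rmin e x) (fun y => gamma (x - y)) (fun y => g (gamma (x - y))) NP) as [d [M [Pd [PM KM]]]].
    - pos.
    - intros y Hy. rmin.
     assert (N : ~ In (gamma (x - y)) Sigma). { apply NS; try lra. rabs. }
     split; [|split]. congruence.
     + intros e' He'. destruct (g_curve_rcont _ _ _ (x - y) H LRA N e' He') as [d [Pd K]]. exists d. sa.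
      intros s Hs. apply K. replace (x - s - (x - y)) with (- (s - y)) by ring. now rewrite Rabs_Ropp.
     + apply EQ; auto. lra.
    - intros e' He'. destruct (Hc x Hx e' He') as [d [Pd K]]. exists (Rmin d x). sp.
     intros y Hy. rmin. apply K. lra. rabs.
    - intros K. apply (proj2 (g_no_poles _ _ _ H x Hx Ix) L1). apply filterlim_infinity. apply at_left_proper_filter.
     intros K0. destruct (K K0) as [d' [Pd' K']]. exists (mkposreal d' Pd'). refine (fun (s : R) Hs Hxs => _).
     change (Rabs (s - x) < d') in Hs. apply Rabs_def2 in Hs. specialize (K' (x - s) LRA). now replace (x - (x - s)) with s in K' by ring.
    - exists d, M. repeat sa. intros s Hs1 Hs2. specialize (KM (x - s) LRA). now replace (x - (x - s)) with s in KM by ring. }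
   destruct HR as [d1 [M1 [Pd1 [PM1 K1]]]]. destruct HLf as [d2 [M2 [Pd2 [PM2 K2]]]].
   exists (Rmin d1 d2). sp. intros u v Hu Hv L1 L2. exists (M1 + M2). sp.
   rmin. intros. destruct (Rtotal_order s x) as [C|[C|C]].
   * specialize (K2 s LRA LRA). lra.
   * congruence.
   * specialize (K1 s LRA LRA). lra.
  + destruct (g_near_curve _ _ _ x H Hx Nx) as [f [Hf [d [Pd E]]]].
   destruct (Hf 1 Rlt_0_1) as [r [Pr Kr]]. destruct (Hc x Hx r Pr) as [d' [Pd' K']].
   exists (Rmin d d'). sp. intros u v Hu Hv L1 L2. exists (`|f (gamma x)| + 1).
   split. cm. rmin. intros.
   assert (A : Rabs (s - x) < Rmin d d') by rabs.
   rewrite E by lra. specialize (Kr _ (K' s LRA LRA)).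
   replace (f (gamma s)) with ((f (gamma s) - f (gamma x)) + f (gamma x))%C by ring. tri. lra.
Qed.

Lemma smooth_arc_derivative gamma u v : u <= v -> smooth_arc gamma u v -> exists K, 0 <= K /\
 forall s, u < s < v -> rcont (curve_derivative gamma) s /\ `|curve_derivative gamma s| <= K.
Proof.
 intros Huv A. destruct (smooth_arc_eq _ _ _ A) as [d [d' [D1 [D2 D3]]]].
 destruct (rcont_on_bounded u v d' Huv) as [K [PK HK]]. { apply rcont_rcont_on; auto. }
 assert (E : forall s, u < s < v -> curve_derivative gamma s = d' s).
 { intros s Hs. apply (curve_derivative_smooth gamma s (Rmin (s - u) (v - s)) d d'); auto. pos.
  intros t Ht. rmin. apply D3. lra. }
 exists K. sp. intros s Hs. split.
 - intros e He. destruct (D2 s e He) as [dl [Pd Kd]]. exists (Rmin dl (Rmin (s - u) (v - s))). sp.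
  intros t Ht. rmin.
  assert (L := Rabs_def2 _ _ Ht). rewrite !E by lra. apply Kd. lra.
 - rewrite E; auto. apply HK. lra.
Qed.

Lemma arcs_around gamma x : piecewise_smooth gamma -> 0 <= x <= 1 -> exists d K, 0 < d /\ 0 <= K /\
 forall s, 0 <= s <= 1 -> s <> x -> Rabs (s - x) < d -> s <> 0 -> s <> 1 ->
  rcont (curve_derivative gamma) s /\ `|curve_derivative gamma s| <= K.
Proof.
 intros HP Hx.
 assert (HR : exists d K, 0 < d /\ 0 <= K /\ forall s, x < s < 1 -> s < x + d -> rcont (curve_derivative gamma) s /\ `|curve_derivative gamma s| <= K).
 { destruct (Rlt_le_dec x 1) as [L|L]. 2:{ exists 1, 0. repeat split; try lra. }
  destruct (piecewise_right gamma x HP LRA) as [h [Ph [Hh A]]]. destruct (smooth_arc_derivative gamma x (x + h) LRA A) as [K [PK HK]].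
  exists h, K. repeat split; auto; apply HK; lra. }
 assert (HL : exists d K, 0 < d /\ 0 <= K /\ forall s, 0 < s < x -> x - d < s -> rcont (curve_derivative gamma) s /\ `|curve_derivative gamma s| <= K).
 { destruct (Rlt_le_dec 0 x) as [L|L]. 2:{ exists 1, 0. repeat split; try lra. }
  destruct (piecewise_left gamma x HP LRA) as [h [Ph [Hh A]]]. destruct (smooth_arc_derivative gamma (x - h) x LRA A) as [K [PK HK]].
  exists h, K. repeat split; auto; apply HK; lra. }
 destruct HR as [d1 [M1 [Pd1 [PM1 K1]]]]. destruct HL as [d2 [M2 [Pd2 [PM2 K2]]]].
 exists (Rmin d1 d2), (M1 + M2). sp. sp. intros s Hs N L N0 N1.
 apply Rabs_def2 in L. rmin.
 destruct (Rlt_le_dec s x). destruct (K2 s); try lra. split; auto; lra. destruct (K1 s); try lra. split; auto; lra.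
Qed.

Lemma curve_derivative_bounded gamma : piecewise_smooth gamma -> exists K, 0 <= K /\
 forall s, 0 <= s <= 1 -> `|curve_derivative gamma s| <= K.
Proof.
 intros HP. apply (interval_induction (fun u v => exists K, 0 <= K /\ forall s, u <= s <= v -> `|curve_derivative gamma s| <= K)). lra.
 - intros x y z _ _ [M1 [P1 H1]] [M2 [P2 H2]]. exists (M1 + M2). sp. intros s Hs.
  destruct (Rle_dec s y). specialize (H1 s LRA); lra. specialize (H2 s LRA); lra.
 - intros x Hx. destruct (arcs_around gamma x HP Hx) as [d [K [Pd [PK HK]]]]. exists d. sa. intros u v Hu Hv L1 L2.
  set (D := fun s => `|curve_derivative gamma s|). assert (P : forall s, 0 <= D s) by (intros; apply Cmod_ge_0).
  exists (K + D x + D 0 + D 1). generalize (P x) (P 0) (P 1). intros. sp. intros s Hs. fold (D s).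
  destruct (Req_dec s x) as [->|]. lra. destruct (Req_dec s 0) as [->|]. lra. destruct (Req_dec s 1) as [->|]. lra.
  destruct (HK s) as [_ B]; auto; try lra. rabs. unfold D in *. lra.
Qed.

Definition cauchy_density gamma (g : C -> C) (s : R) : C := (g (gamma s) * curve_derivative gamma s)%C.

(** The density is bounded and continuous off the break points and the preimages of [Sigma], which
    are finitely many; on each interval between them [ex_CI_bounded] applies. *)
Lemma cauchy_density_density gamma Sigma g a b : setting gamma Sigma g -> 0 <= a -> a <= b -> b <= 1 ->
 exists M, 0 <= M /\ density (cauchy_density gamma g) a b M.
Proof.
 intros H Ha Hab Hb. assert (HP := gamma_piecewise_smooth _ _ _ H).
 destruct (finite_preimages gamma Sigma HP) as [L HL]. destruct (g_bounded _ _ _ H) as [Mg [PMg KMg]].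
 destruct (curve_derivative_bounded gamma HP) as [Md [PMd KMd]].
 assert (B0 : forall s, 0 <= s <= 1 -> ~ In (gamma s) Sigma -> `|cauchy_density gamma g s| <= Mg * Md).
 { intros s Hs N. unfold cauchy_density. rewrite Cmod_mult. apply Rmult_le_compat; auto. }
 assert (exists M, 0 <= M /\ forall s, In s L -> `|cauchy_density gamma g s| <= M) as [M [PM KM]].
 { clear HL. induction L as [|x L [M [PM KM]]]. exists 0. easy.
  exists (M + `|cauchy_density gamma g x|). generalize (Cmod_ge_0 (cauchy_density gamma g x)). intros. sp.
  intros s [<-|Hs]. lra. specialize (KM s Hs). lra. }
 assert (0 <= Mg * Md) by nra.
 exists (M + Mg * Md). sp. split.
 - intros w Hw. destruct (rcont_on_bounded a b w Hab Hw) as [Mw [PMw KMw]].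
  apply (interval_induction (fun u v => ex_CI (fun s => cauchy_density gamma g s * w s)%C u v)); auto.
  + intros; eapply ex_CI_Chasles; eauto.
  + intros x Hx. destruct (arcs_around gamma x HP LRA) as [d1 [K1 [Pd1 [_ HK1]]]]. destruct (Rlist_isolated L x) as [d2 [Pd2 K2]].
   exists (Rmin d1 d2). sp. intros u v Hu Hv L1 L2.
   rmin.
   assert (W : forall u v, a <= u -> u <= v -> v <= b -> (forall s, u < s < v -> s <> x /\ Rabs (s - x) < Rmin d1 d2) ->
    ex_CI (fun s => cauchy_density gamma g s * w s)%C u v).
   { clear u v Hu Hv L1 L2. intros u v Hu Huv Hv K. apply (ex_CI_bounded _ u v (Mg * Md * Mw)); auto.
    - intros s Hs. destruct (K s Hs) as [N1 N2].
     assert (NS : ~ In (gamma s) Sigma). { intros I. specialize (K2 s (HL s LRA I) N1). lra. }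
     apply rcont_mult; [apply rcont_mult|].
     + apply (g_curve_rcont _ Sigma); auto. lra.
     + apply HK1; lra.
     + apply (rcont_on_interior a b); auto. lra.
    - intros s Hs. destruct (K s Hs) as [N1 N2].
     assert (NS : ~ In (gamma s) Sigma). { intros I. specialize (K2 s (HL s LRA I) N1). lra. }
     rewrite Cmod_mult. apply Rmult_le_compat; auto. apply B0; auto; lra. apply KMw. lra. }
   apply ex_CI_Chasles with x; apply W; try lra; intros s Hs; (split; [lra|rabs]).
 - intros s Hs. destruct (classic (In (gamma s) Sigma)) as [I|N].
  + specialize (KM s (HL s LRA I)). lra.
  + specialize (B0 s LRA N). lra.
Qed.

Definition two_pi_i_inv : C := (/ (RtoC (2 * PI) * Ci))%C.

Lemma cauchy_integral_ctype gamma g t :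
 cauchy_integral gamma g t = (two_pi_i_inv * ctype (cauchy_density gamma g) gamma 0 1 t)%C.
Proof.
 unfold cauchy_integral, two_pi_i_inv, ctype, CI. f_equal.
 apply (RInt_ext (V := C_R_CompleteNormedModule)). intros s _. unfold cauchy_density, Cdiv.
 change (g (gamma s) * / (gamma s - t) * curve_derivative gamma s = g (gamma s) * curve_derivative gamma s * / (gamma s - t))%C. ring.
Qed.

Lemma cauchy_integral_holo gamma Sigma g t : setting gamma Sigma g -> ~ image gamma t -> holo (cauchy_integral gamma g) t.
Proof.
 intros H N. assert (HP := gamma_piecewise_smooth _ _ _ H). destruct (off_image_ball gamma t HP N) as [d [Pd K]].
 destruct (cauchy_density_density gamma Sigma g 0 1 H) as [M [PM HM]]; try lra.
 apply (holo_ext_loc (fun t => two_pi_i_inv * ctype (cauchy_density gamma g) gamma 0 1 t)%C _ t 1). lra.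
 intros; symmetry; apply cauchy_integral_ctype.
 apply holo_mult. auto. apply (ctype_holo _ _ 0 1 M t d); auto. lra. now apply piecewise_rcont_on.
Qed.

Lemma cauchy_integral_bound gamma Sigma g : setting gamma Sigma g -> exists C0, 0 <= C0 /\ forall t d, 0 < d ->
 (forall s, 0 <= s <= 1 -> d <= `|gamma s - t|) -> `|cauchy_integral gamma g t| <= C0 / d.
Proof.
 intros H. destruct (cauchy_density_density gamma Sigma g 0 1 H) as [M [PM HM]]; try lra.
 exists (`|two_pi_i_inv| * M). split. apply Rmult_le_pos; auto. intros t d Pd K.
 rewrite cauchy_integral_ctype, Cmod_mult. unfold Rdiv. rewrite Rmult_assoc. apply Rmult_le_compat_l. auto.
 replace (M * / d) with (M / d * (1 - 0)) by lra.
 apply ctype_bound; auto. lra. apply piecewise_rcont_on, (gamma_piecewise_smooth _ _ _ H).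
Qed.

(** * The principal logarithm *)

(** By the half-angle formula [y / (x + |z|)] is the tangent of half the argument, so one formula
    serves on the whole slit plane. *)
Definition Log (z : C) : C := (ln (Re z * Re z + Im z * Im z) / 2, 2 * atan (Im z / (Re z + sqrt (Re z * Re z + Im z * Im z)))).

Definition slit (z : C) : Prop := Im z <> 0 \/ 0 < Re z.

Lemma slit_pos z : slit z -> 0 < Re z * Re z + Im z * Im z /\ 0 < Re z + sqrt (Re z * Re z + Im z * Im z).
Proof.
 intros H. assert (P : 0 < Re z * Re z + Im z * Im z) by (destruct H; nra). sa.
 assert (S := sqrt_lt_R0 _ P). assert (E := sqrt_sqrt _ (Rlt_le _ _ P)).
 destruct (Rlt_le_dec 0 (Re z)) as [L|L]. lra.
 destruct H as [H|H]; [|lra]. nra.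
Qed.

Lemma rderiv_Log zeta t l : rderiv zeta t l -> slit (zeta t) -> rderiv (fun s => Log (zeta s)) t (l / zeta t)%C.
Proof.
 intros H Hs. destruct (Cmod_derive_parts _ _ _ H) as [H1 H2]. destruct (slit_pos _ Hs) as [P1 P2].
 assert (N : zeta t <> RtoC 0). { intros E. rewrite E in P1. rewrite re_RtoC, im_RtoC in P1. lra. }
 assert (Q := sqrt_sqrt _ (Rlt_le _ _ P1)). assert (S := sqrt_lt_R0 _ P1).
 assert (EQ : (l / zeta t)%C = ((Re l * Re (zeta t) + Im l * Im (zeta t)) / (Re (zeta t) * Re (zeta t) + Im (zeta t) * Im (zeta t)),
  (Im l * Re (zeta t) - Re l * Im (zeta t)) / (Re (zeta t) * Re (zeta t) + Im (zeta t) * Im (zeta t)))).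
 { replace l with (l / zeta t * zeta t)%C at 2 3 4 5 by (field; auto). set (q := (l / zeta t)%C). rewrite !re_mult, !im_mult.
  apply C_ext; simpl; unfold Re, Im in *; field; lra. }
 rewrite EQ. revert H1 H2 P1 P2 Q S. clear. 
 set (x := fun s => Re (zeta s)). set (y := fun s => Im (zeta s)). fold (x t) (y t). intros H1 H2 P1 P2 Q S.
 assert (Dx : Derive (fun s => x s) t = Re l) by now apply is_derive_unique.
 assert (Dy : Derive (fun s => y s) t = Im l) by now apply is_derive_unique.
 apply rderiv_pair.
 - change (is_derive (fun s => ln (x s * x s + y s * y s) / 2) t ((Re l * x t + Im l * y t) / (x t * x t + y t * y t))).
  auto_derive. repeat split; auto; eexists; eauto. rewrite Dx, Dy. lra.
 - change (is_derive (fun s => 2 * atan (y s / (x s + sqrt (x s * x s + y s * y s)))) t ((Im l * x t - Re l * y t) / (x t * x t + y t * y t))).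
  auto_derive. repeat split; auto; try lra; eexists; eauto. rewrite Dx, Dy.
  set (r := sqrt (x t * x t + y t * y t)) in *. rewrite <- Q.
  (* With [y/(x+r)] the tangent of the half-angle, this is [1/cos^2] of the half-angle. *)
  assert (K : 1 + (y t / (x t + r)) * (y t / (x t + r)) = 2 * r / (x t + r)).
  { replace (1 + (y t / (x t + r)) * (y t / (x t + r))) with (((x t + r) * (x t + r) + y t * y t) / ((x t + r) * (x t + r))) by (field; lra).
   replace ((x t + r) * (x t + r) + y t * y t) with (2 * r * (x t + r)) by lra. field. lra. }
  replace (1 + y t * / (x t + r) * (y t * / (x t + r) * 1)) with (2 * r / (x t + r)) by lra.
  assert (E0 : Im l * (r * r - (x t * x t + y t * y t)) / (r * r * (x t + r)) = 0).
  { replace (r * r - (x t * x t + y t * y t)) with 0 by lra. lra. }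
  rewrite <- (Rplus_0_r ((Im l * x t - Re l * y t) / (r * r))), <- E0. field. lra.
Qed.

Lemma slit_near z : slit z -> exists d, 0 < d /\ d <= `|z| / 2 /\ forall h, `|h| < d -> slit (z + h).
Proof.
 intros H. assert (Pz : 0 < `|z|).
 { apply Cmod_gt_0. intros ->. destruct H as [H|H]; rewrite ?im_RtoC, ?re_RtoC in H; lra. }
 destruct H as [H|H].
 - assert (P := Rabs_pos_lt _ H). assert (L := im_le_Cmod z). exists (Rabs (Im z) / 2). sp. sp. intros h Hh. left. rewrite im_plus.
  generalize (im_le_Cmod h). revert P Hh. unfold Rabs. destruct (Rcase_abs (Im z)), (Rcase_abs (Im h)); lra.
 - assert (L := re_le_Cmod z). rewrite Rabs_pos_eq in L by lra. exists (Re z / 2). sp. sp. intros h Hh. right. rewrite re_plus.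
  generalize (re_le_Cmod h). unfold Rabs. destruct (Rcase_abs (Re h)); lra.
Qed.

(** Differentiability along real curves suffices: integrating [h / (z + s h)] over the segment from
    [z] to [z + h] gives the increment of [Log] with a quadratic remainder. *)
Lemma cderiv_Log z : slit z -> cderiv Log z (/ z)%C.
Proof.
 intros H. destruct (slit_near z H) as [d [Pd [Hd K]]].
 assert (Pz : 0 < `|z|) by lra. assert (Nz : z <> RtoC 0) by now apply Cmod_gt_0.
 apply cderiv_quadratic with (K := 2 / (`|z| * `|z|)) (d := d); auto.
 { apply Rdiv_le_0_compat. lra. nra. }
 intros w Hw. set (h := (w - z)%C) in *. replace w with (z + h)%C by (unfold h; ring).
 set (p := fun s => (z + RtoC s * h)%C).
 assert (Hp : forall s, 0 <= s <= 1 -> slit (p s) /\ `|z| / 2 <= `|p s|).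
 { intros s Hs. assert (B : `|RtoC s * h| < d).
  { rewrite Cmod_mult, Cmod_R, Rabs_pos_eq by lra. generalize (Cmod_ge_0 h). nra. }
  split. eauto. unfold p. generalize (Cmod_plus_ge z (RtoC s * h)). lra. }
 assert (Dp : forall s, rderiv p s h).
 { intros s e He. exists 1. sp. intros t _. unfold p.
  replace (z + RtoC t * h - (z + RtoC s * h) - RtoC (t - s) * h)%C with (RtoC 0) by (rewrite RtoC_minus; ring).
  rewrite Cmod_0. generalize (Rabs_pos (t - s)). nra. }
 assert (Np : forall s, 0 <= s <= 1 -> p s <> RtoC 0). { intros s Hs. apply Cmod_gt_0. destruct (Hp s Hs). lra. }
 assert (I : is_CI (fun s => h / p s)%C 0 1 (Log (p 1) - Log (p 0))%C).
 { apply (is_CI_FTC (fun s => Log (p s))); minmax.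
  - intros t Ht. apply rderiv_Log; auto. apply Hp, Ht.
  - intros t Ht. apply (ccont_rcomp (fun v => h / v)%C (p t)); auto. 2: eapply rderiv_rcont, Dp.
   apply ccont_div. apply ccont_const. apply holo_ccont, holo_id. auto. }
 replace (p 1) with (z + h)%C in I by (unfold p; ring). replace (p 0) with z in I by (unfold p; ring).
 assert (I2 := is_CI_minus _ _ _ _ _ _ I (is_CI_const (h / z)%C 0 1)).
 replace (Log (z + h) - Log z - / z * h)%C with (Log (z + h) - Log z - RtoC (1 - 0) * (h / z))%C by (rewrite RtoC_minus; field; auto).
 replace (2 / (`|z| * `|z|) * (`|h| * `|h|)) with (2 / (`|z| * `|z|) * (`|h| * `|h|) * (1 - 0)) by ring.
 eapply is_CI_norm; [lra| |apply I2]. intros s Hs. cbv beta. destruct (Hp s LRA) as [_ B]. assert (N := Np s LRA).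
 replace (h / p s - h / z)%C with (- (RtoC s * (h * h)) / (p s * z))%C.
 2:{ unfold p in *. field. auto. }
 rewrite Cmod_div, Cmod_opp, !Cmod_mult, Cmod_R, Rabs_pos_eq by (auto using Cmult_neq_0; lra).
 generalize (Cmod_ge_0 h). intros Ph.
 replace (2 / (`|z| * `|z|) * (`|h| * `|h|)) with (`|h| * `|h| * / (`|z| / 2 * `|z|)) by (field; lra).
 unfold Rdiv at 1. apply Rmult_le_compat.
 - nra.
 - left. apply Rinv_0_lt_compat. nra.
 - nra.
 - apply Rinv_le_contravar; nra.
Qed.

(** [Ci * z] and [- Ci * z] are opposite points, so their arguments differ by [pi]; which of them
    lies above the cut depends on the sign of [Re z]. *)
Lemma Log_jump z : Re z <> 0 -> (Log (Ci * z) - Log (- Ci * z))%C = (RtoC (if Rlt_dec 0 (Re z) then PI else - PI) * Ci)%C.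
Proof.
 intros H. set (x := Re z) in *. set (y := Im z).
 assert (E1 : Re (Ci * z) = - y /\ Im (Ci * z) = x). { rewrite re_mult, im_mult. unfold Ci, x, y; simpl. lra. }
 assert (E2 : Re (- Ci * z) = y /\ Im (- Ci * z) = - x). { rewrite re_mult, im_mult. unfold Ci, x, y; simpl. lra. }
 destruct E1 as [E1 E1']. destruct E2 as [E2 E2']. unfold Log. rewrite E1, E1', E2, E2'.
 replace (- y * - y + x * x) with (x * x + y * y) by ring. replace (y * y + - x * - x) with (x * x + y * y) by ring.
 assert (P : 0 < x * x + y * y) by nra. assert (S := sqrt_lt_R0 _ P). assert (Q := sqrt_sqrt _ (Rlt_le _ _ P)).
 set (r := sqrt (x * x + y * y)) in *.
 assert (R1 : 0 < r - y) by nra. assert (R2 : 0 < r + y) by nra.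
 replace (- y + r) with (r - y) by ring. replace (y + r) with (r + y) by ring.
 assert (A : forall u, 0 < u -> u * u = x * x -> atan (u / (r - y)) + atan (u / (r + y)) = PI / 2).
 { intros u Hu Eu. replace (u / (r + y)) with (/ (u / (r - y))).
  - rewrite atan_inv. lra. pos.
  - rewrite Rinv_div. apply Rmult_eq_reg_r with (u * (r + y)); [|nra]. replace ((r - y) / u * (u * (r + y))) with ((r - y) * (r + y)) by (field; lra).
   replace (u / (r + y) * (u * (r + y))) with (u * u) by (field; lra). lra. }
 apply C_ext.
 - rewrite re_scal_l. unfold Cminus. rewrite re_plus, re_opp. unfold Re, Ci; simpl. lra.
 - rewrite im_scal_l. unfold Cminus. rewrite im_plus, im_opp. unfold Im, Ci; simpl.
  destruct (Rlt_dec 0 x) as [L|L].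
  + specialize (A x L eq_refl). replace (- x / (r + y)) with (- (x / (r + y))) by lra. rewrite atan_opp. lra.
  + specialize (A (- x) LRA ltac:(ring)). replace (x / (r - y)) with (- (- x / (r - y))) by lra. rewrite atan_opp. lra.
Qed.

(** * The jump of the Cauchy type integral *)

Lemma density_of_cont phi a b M : a <= b -> rcont_on a b phi -> (forall s, a < s < b -> `|phi s| <= M) -> density phi a b M.
Proof. intros H K HM. sa. intros u Hu. apply ex_CI_cont_on; auto. now apply rcont_on_mult. Qed.

(** Write [f(gamma)/(gamma - t)] as [f(t)/(gamma - t)] plus the difference quotient of [f]. The
    latter extends holomorphically across the diagonal, so its integral [Cf] is holomorphic in [t]
    even on the curve. *)
Lemma difference_quotient_integral f a R0 r psi gamma p q M : hold f a R0 -> 0 < r < R0 -> p <= q -> 0 <= M -> density psi p q M ->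
 rcont_on p q gamma -> (forall s, p <= s <= q -> `|gamma s - a| <= r / 2) ->
 exists Cf, hold Cf a (r / 2) /\ forall t d, `|t - a| < r / 2 -> 0 < d -> (forall s, p <= s <= q -> d <= `|gamma s - t|) ->
  CI (fun s => psi s * (f (gamma s) * / (gamma s - t)))%C p q = (f t * ctype psi gamma p q t + Cf t)%C.
Proof.
 intros Hf Hr Hpq PM Hpsi Hg Hga.
 set (zt := circle a r). set (phi := fun x => (/ RtoC (2 * PI) * (f (zt x) * (zt x - a)))%C).
 assert (Nz : RtoC (2 * PI) <> RtoC 0). { intros E. apply RtoC_inj in E. generalize PI_RGT_0. lra. }
 assert (Cz : rcont_on 0 (2 * PI) zt) by (apply rcont_rcont_on; intros; apply rcont_circle).
 assert (Cphi : rcont_on 0 (2 * PI) phi).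
 { apply (rcont_on_circle (fun z => / RtoC (2 * PI) * (f z * (z - a)))%C). intros x. apply holo_ccont, holo_mult. auto.
  apply holo_mult. apply Hf. rewrite Cmod_circle; lra. auto. }
 destruct (rcont_on_bounded _ _ _ PI2_pos Cphi) as [B [PB HB]].
 assert (Dz : forall x z, `|z - a| <= r / 2 -> r / 2 <= `|zt x - z|).
 { intros x z Hz. generalize (circle_dist_ge a r x z LRA). fold zt. lra. }
 assert (Ik : forall z, `|z - a| <= r / 2 -> rcont_on 0 (2 * PI) (fun x => / (zt x - z))%C).
 { intros z Hz. apply ctype_kernel_cont with (r / 2); auto. lra. }
 assert (Bk : forall x z, `|z - a| <= r / 2 -> `|/ (zt x - z)| <= 2 / r).
 { intros x z Hz. specialize (Dz x z Hz). rewrite Cmod_inv by (apply Cmod_gt_0; lra). replace (2 / r) with (/ (r / 2)) by (field; lra). apply Rinv_le_contravar; lra. }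
 (* The difference quotient of [f] as a Cauchy integral over a circle, a formula that remains
    meaningful for [z = t] and is symmetric in the two variables. *)
 set (K := fun z t => ctype (fun x => phi x * / (zt x - z))%C zt 0 (2 * PI) t).
 assert (DK : forall z, `|z - a| <= r / 2 -> density (fun x => phi x * / (zt x - z))%C 0 (2 * PI) (B * (2 / r))).
 { intros z Hz. apply density_of_cont. apply PI2_pos. now apply rcont_on_mult; auto. intros x Hx. rewrite Cmod_mult.
  apply Rmult_le_compat; auto. apply HB; lra. }
 assert (KE : forall z t, `|z - a| <= r / 2 -> `|t - a| <= r / 2 -> ((z - t) * K z t)%C = (f z - f t)%C).
 { intros z t Hz Ht. assert (CF : forall v, `|v - a| <= r / 2 -> is_CI (fun x => phi x * / (zt x - v))%C 0 (2 * PI) (f v)).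
  { intros v Hv. assert (E := cauchy_formula f a R0 r v (fun z Hz => holo_ccont _ _ (Hf z Hz)) (fun z Hz _ => Hf z Hz) Hr LRA).
   replace (f v) with (/ RtoC (2 * PI) * (RtoC (2 * PI) * f v))%C by (field; auto). rewrite <- E.
   apply (is_CI_ext (fun x => / RtoC (2 * PI) * (f (zt x) * ((zt x - a) / (zt x - v))))%C).
   { intros x _. unfold phi, Cdiv. ring. }
   apply is_CI_scal, cint_is. intros x. apply holo_ccont, holo_mult. apply Hf. rewrite Cmod_circle; lra. apply holo_kernel, circle_neq. lra. }
  unfold K. symmetry. rewrite <- (is_CI_unique _ _ _ _ (is_CI_minus _ _ _ _ _ _ (CF z Hz) (CF t Ht))). apply is_CI_unique.
  apply (is_CI_ext (fun x => (z - t) * (phi x * / (zt x - z) * / (zt x - t)))%C).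
  { intros x _. assert (N1 : (zt x - z)%C <> RtoC 0) by (apply Cmod_gt_0; specialize (Dz x z Hz); lra).
   assert (N2 : (zt x - t)%C <> RtoC 0) by (apply Cmod_gt_0; specialize (Dz x t Ht); lra). field. auto. }
  apply is_CI_scal. apply (ctype_is _ zt 0 (2 * PI) (B * (2 / r)) t (r / 2)); auto. lra. }
 assert (KC : forall (w : R -> C), rcont_on 0 (2 * PI) w -> rcont_on p q (fun s => ctype (fun x => phi x * w x)%C zt 0 (2 * PI) (gamma s))).
 { intros w Hw. apply rcont_on_comp; auto. intros s Hs. apply holo_ccont.
  destruct (density_cont (fun x => phi x * w x)%C 0 (2 * PI) PI2_pos ltac:(now apply rcont_on_mult)) as [B' [PB' HB']].
  apply (ctype_holo _ zt 0 (2 * PI) B' (gamma s) (r / 2) PI2_pos); auto; lra. }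
 assert (KS : forall z t, K z t = ctype (fun x => phi x * / (zt x - t))%C zt 0 (2 * PI) z).
 { intros z t. apply (RInt_ext (V := C_R_CompleteNormedModule)). intros x _. 
  change (phi x * / (zt x - z) * / (zt x - t) = phi x * / (zt x - t) * / (zt x - z))%C. ring. }
 assert (KI : forall t, `|t - a| <= r / 2 -> is_CI (fun s => psi s * K (gamma s) t)%C p q (CI (fun s => psi s * K (gamma s) t)%C p q)).
 { intros t Ht. apply ex_CI_is. apply (proj1 Hpsi (fun s => K (gamma s) t)). apply rcont_on_ext with (2 := KC _ (Ik t Ht)). auto. }
 exists (fun t => CI (fun s => psi s * K (gamma s) t)%C p q). split.
 - intros t0 Ht0. set (d := r / 2).
  set (L := fun z => ctype (fun x => phi x * (/ (zt x - t0) * / (zt x - t0)))%C zt 0 (2 * PI) z).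
  assert (LI : is_CI (fun s => psi s * L (gamma s))%C p q (CI (fun s => psi s * L (gamma s))%C p q)).
  { apply ex_CI_is. apply (proj1 Hpsi (fun s => L (gamma s))). apply KC. apply rcont_on_mult; apply Ik; lra. }
  set (Q := M * (B * (2 / r) * (2 / (d * d * d)) * (2 * PI - 0)) * (q - p)).
  assert (P := PI_RGT_0). assert (Pd : 0 < d) by pos.
  assert (P2 : 0 < 2 / r) by pos. assert (P3 : 0 < 2 / (d * d * d)). pos.
  assert (PQ0 : 0 <= B * (2 / r) * (2 / (d * d * d)) * (2 * PI - 0)). { rewrite Rminus_0_r. repeat (apply Rmult_le_pos; try lra). }
  exists (CI (fun s => psi s * L (gamma s))%C p q). apply cderiv_quadratic with (K := Q) (d := Rmin (d / 2) (d - `|t0 - a|)).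
  + apply Rmin_glb_lt; unfold d; lra.
  + unfold Q. repeat (apply Rmult_le_pos; try lra).
  + intros t Ht. assert (T1 := lt_minl Ht). assert (T2 := lt_minr Ht).
   assert (Hta : `|t - a| <= r / 2). { generalize (Cmod_triangle_minus t t0 a). unfold d in T2. lra. }
   assert (I := is_CI_minus _ _ _ _ _ _ (is_CI_minus _ _ _ _ _ _ (KI t Hta) (KI t0 LRA)) (is_CI_scal (t - t0)%C _ _ _ _ LI)).
   rewrite (Cmult_comm (CI (fun s => psi s * L (gamma s))%C p q)).
   replace (Q * (`|t - t0| * `|t - t0|)) with
    (M * (B * (2 / r) * (2 / (d * d * d)) * (2 * PI - 0) * (`|t - t0| * `|t - t0|)) * (q - p)) by (unfold Q; ring).
   eapply is_CI_norm; [auto| |apply I]. intros s Hs. cbv beta.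
   replace (psi s * K (gamma s) t - psi s * K (gamma s) t0 - (t - t0) * (psi s * L (gamma s)))%C
    with (psi s * (K (gamma s) t - K (gamma s) t0 - L (gamma s) * (t - t0)))%C by ring.
   rewrite Cmod_mult. apply Rmult_le_compat; auto. now apply Hpsi.
   specialize (Hga s LRA).
   destruct (ctype_cderiv (fun x => phi x * / (zt x - gamma s))%C zt 0 (2 * PI) (B * (2 / r)) t0 d PI2_pos) as [_ QD]; auto. nra. { intros x _. apply Dz. lra. }
   specialize (QD t T1).
   replace (L (gamma s)) with (CI (fun x => phi x * / (zt x - gamma s) * (/ (zt x - t0) * / (zt x - t0)))%C 0 (2 * PI)). auto.
   apply (RInt_ext (V := C_R_CompleteNormedModule)). intros x _.
   change (phi x * / (zt x - gamma s) * (/ (zt x - t0) * / (zt x - t0)) = phi x * (/ (zt x - t0) * / (zt x - t0)) * / (zt x - gamma s))%C. ring.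
 - intros t d Ht Pd Hd. apply is_CI_unique.
  apply (is_CI_ext (fun s => f t * (psi s * / (gamma s - t)) + psi s * K (gamma s) t)%C).
  { minmax. intros s Hs. assert (N : (gamma s - t)%C <> RtoC 0) by (apply Cmod_gt_0; specialize (Hd s LRA); lra).
   assert (E := KE (gamma s) t (Hga s LRA) LRA). replace (f (gamma s)) with (f t + (gamma s - t) * K (gamma s) t)%C by (rewrite E; ring).
   field. auto. }
  apply is_CI_plus. apply is_CI_scal. apply (ctype_is psi gamma p q M t d); auto. apply KI. lra.
Qed.

(* In the coordinate [X + i Y = lam * (z - a)], where [lam = i * conj w], the
 direction [w] is vertical and the curve is a graph over the [X] axis.  [upper]
 and [lower] mean above and below this graph. *)
Record side_structure (gamma : R -> C) (g : C -> C) (a : C) (f : C -> C) (w : C)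
  (rho K : R) (Phi : C -> C) (upper lower : C -> Prop) : Prop := {
 ss_rho : 0 < rho;
 ss_K : 0 < K;
 ss_Phi : hold Phi a rho;
 ss_f : hold f a rho;
 ss_cases : forall t, `|t - a| < rho -> ~ image gamma t -> upper t \/ lower t;
 ss_upper : forall t, `|t - a| < rho -> upper t ->
  ~ image gamma t /\ germ_eq t (cauchy_integral gamma g) (fun z => Phi z + f z)%C;
 ss_lower : forall t, `|t - a| < rho -> lower t ->
  ~ image gamma t /\ germ_eq t (cauchy_integral gamma g) Phi;
 ss_cone_up : forall t, K * Rabs (cross (t - a) w) < Re (Cconj w * (t - a))%C -> upper t;
 ss_cone_low : forall t, K * Rabs (cross (t - a) w) < - Re (Cconj w * (t - a))%C -> lower t;
 ss_up : forall t x, upper t -> 0 <= x -> upper (t + RtoC x * w)%C;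
 ss_low : forall t x, lower t -> 0 <= x -> lower (t - RtoC x * w)%C
}.

Arguments ss_rho {_ _ _ _ _ _ _ _ _ _}.
Arguments ss_K {_ _ _ _ _ _ _ _ _ _}.
Arguments ss_Phi {_ _ _ _ _ _ _ _ _ _}.
Arguments ss_f {_ _ _ _ _ _ _ _ _ _}.
Arguments ss_cases {_ _ _ _ _ _ _ _ _ _}.
Arguments ss_upper {_ _ _ _ _ _ _ _ _ _}.
Arguments ss_lower {_ _ _ _ _ _ _ _ _ _}.
Arguments ss_cone_up {_ _ _ _ _ _ _ _ _ _}.
Arguments ss_cone_low {_ _ _ _ _ _ _ _ _ _}.
Arguments ss_up {_ _ _ _ _ _ _ _ _ _}.
Arguments ss_low {_ _ _ _ _ _ _ _ _ _}.

Lemma re_Ci_mult q : Re (Ci * q) = - Im q.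
Proof. rewrite re_mult. unfold Ci; simpl. lra. Qed.

Lemma im_Ci_mult q : Im (Ci * q) = Re q.
Proof. rewrite im_mult. unfold Ci; simpl. lra. Qed.

(** Hence [cross v w] is the abscissa of [v] in the coordinate of [side_structure], and a positive
    value means that the curve runs from left to right there. *)
Lemma cross_re v w : cross v w = Re (Ci * Cconj w * v)%C.
Proof.
 unfold cross. rewrite <- Cmult_assoc, re_Ci_mult, !im_mult, !re_conj, !im_conj. lra.
Qed.

(** Strict differentiability with an error below half the abscissa of the tangent: the abscissa
    increases at a positive rate and dominates the variation of the ordinate. *)
Lemma half_branch_graph b u lam : half_branch b u -> 0 < Re (lam * u) -> exists d c K, 0 < d /\ 0 < c /\ 0 < K /\
 forall x y, 0 <= y <= x -> x <= d -> c * (x - y) <= Re (lam * (b x - b y)) /\ Rabs (Im (lam * (b x - b y))) <= K * Re (lam * (b x - b y)).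
Proof.
 intros [Nu H] Hk. set (k := Re (lam * u)) in *.
 assert (Pl : 0 < `|lam|). { apply Cmod_gt_0. intros ->. unfold k in Hk. rewrite Cmult_0_l, re_RtoC in Hk. lra. }
 destruct (H (k / 2 / `|lam|)) as [d [Pd Kd]]. pos.
 exists d, (k / 2), ((`|lam * u| + k / 2) / (k / 2)). sa. sp. split.
 { apply Rdiv_lt_0_compat; generalize (Cmod_ge_0 (lam * u)); lra. }
 intros x y Hy Hx. specialize (Kd x y LRA LRA). rewrite Rabs_pos_eq in Kd by lra.
 set (e := (b x - b y - RtoC (x - y) * u)%C) in *.
 assert (E : (lam * (b x - b y))%C = (RtoC (x - y) * (lam * u) + lam * e)%C) by (unfold e; ring).
 assert (Be : `|lam * e| <= k / 2 * (x - y)).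
 { rewrite Cmod_mult. apply Rle_trans with (`|lam| * (k / 2 / `|lam| * (x - y))). nra. right. field. lra. }
 rewrite E, re_plus, im_plus, re_scal_l, im_scal_l. fold k.
 assert (B1 := re_le_Cmod (lam * e)). assert (B2 := im_le_Cmod (lam * e)). assert (B3 := im_le_Cmod (lam * u)).
 assert (L : k / 2 * (x - y) <= (x - y) * k + Re (lam * e)). { revert B1. unfold Rabs. destruct (Rcase_abs (Re (lam * e))); lra. }
 sa.
 apply Rle_trans with ((`|lam * u| + k / 2) * (x - y)).
 - eapply Rle_trans. apply Rabs_triang. rewrite Rabs_mult, (Rabs_pos_eq (x - y)) by lra. nra.
 - replace ((`|lam * u| + k / 2) * (x - y)) with ((`|lam * u| + k / 2) / (k / 2) * (k / 2 * (x - y))) by (field; lra).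
  apply Rmult_le_compat_l; auto. apply Rdiv_le_0_compat; generalize (Cmod_ge_0 (lam * u)); lra.
Qed.

Lemma arc_density gamma u v : u <= v -> smooth_arc gamma u v -> exists M, 0 <= M /\ density (curve_derivative gamma) u v M.
Proof.
 intros Huv A. destruct (smooth_arc_derivative gamma u v Huv A) as [M [PM HM]]. exists M. sa. split.
 - intros w Hw. destruct (rcont_on_bounded u v w Huv Hw) as [B [PB HB]]. apply (ex_CI_bounded _ u v (M * B) Huv).
  + intros t Ht. apply rcont_mult. apply HM, Ht. apply (rcont_on_interior u v); auto.
  + intros t Ht. rewrite Cmod_mult. apply Rmult_le_compat; auto. apply HM, Ht. apply HB. lra.
 - intros s Hs. apply HM, Hs.
Qed.

(** The factor [mu] turns the arc seen from [t] into the slit plane, where [Log] provides a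
    primitive of the kernel. *)
Lemma arc_log gamma u v mu t : u < v -> smooth_arc gamma u v -> mu <> RtoC 0 -> (forall s, u <= s <= v -> slit (mu * (gamma s - t))%C) ->
 ctype (curve_derivative gamma) gamma u v t = (Log (mu * (gamma v - t)) - Log (mu * (gamma u - t)))%C.
Proof.
 intros Huv A Nm HS. destruct (smooth_arc_eq _ _ _ A) as [d [d' [D1 [D2 D3]]]].
 assert (N : forall s, u <= s <= v -> (d s - t)%C <> RtoC 0).
 { intros s Hs E. specialize (HS s Hs). rewrite (proj1 (D3 s Hs)), E, Cmult_0_r in HS.
  destruct HS as [HS|HS]; rewrite ?im_RtoC, ?re_RtoC in HS; lra. }
 apply is_CI_unique. apply (is_CI_ext (fun s => (mu * d' s) / (mu * (d s - t)))%C).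
 { minmax. intros s Hs.
  rewrite (curve_derivative_smooth gamma s (Rmin (s - u) (v - s)) d d'); auto.
  - rewrite (proj1 (D3 s LRA)). field. sa. apply N. lra.
  - pos.
  - intros r Hr. rmin. apply D3. lra. }
 rewrite (proj1 (D3 v LRA)), (proj1 (D3 u LRA)).
 apply (is_CI_FTC (fun s => Log (mu * (d s - t)))); minmax; intros s Hs.
 - apply (rderiv_Log (fun s => mu * (d s - t))%C).
  + replace (mu * d' s)%C with (mu * (1 - 0) * d' s)%C by ring. apply (rderiv_comp d (fun z => mu * (z - t))%C); auto.
   apply cderiv_scal. apply (cderiv_minus (fun z => z) (fun _ => t)). apply cderiv_id. apply cderiv_const.
  + specialize (HS s Hs). now rewrite (proj1 (D3 s Hs)) in HS.
 - apply rcont_mult.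
  + intros e He. destruct (D2 s (e / `|mu|)) as [dl [Pd K]]. { apply Rdiv_lt_0_compat; auto. now apply Cmod_gt_0. }
   exists dl. sa. intros r Hr. replace (mu * d' r - mu * d' s)%C with (mu * (d' r - d' s))%C by ring.
   rewrite Cmod_mult. specialize (K r Hr). apply Rlt_div_r in K. lra. now apply Cmod_gt_0.
  + apply (ccont_rcomp (fun z => / (mu * (z - t)))%C (d s)); auto. 2: eapply rderiv_rcont, D1.
   apply (ccont_comp (fun z => mu * (z - t))%C Cinv).
   * apply holo_ccont, holo_mult. auto. auto.
   * eapply cderiv_ccont, cderiv_inv. apply Cmult_neq_0; auto.
Qed.

Lemma ctype_chasles phi gamma a b c M1 M2 t d : a <= b <= c -> density phi a b M1 -> density phi b c M2 -> rcont_on a c gamma -> 0 < d ->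
 (forall s, a <= s <= c -> d <= `|gamma s - t|) -> ctype phi gamma a c t = (ctype phi gamma a b t + ctype phi gamma b c t)%C.
Proof.
 intros H D1 D2 Hc Pd K. apply is_CI_unique. apply is_CI_Chasles with b.
 - apply (ctype_is phi gamma a b M1 t d); auto. rsub Hc. intros; apply K; lra.
 - apply (ctype_is phi gamma b c M2 t d); auto. rsub Hc. intros; apply K; lra.
Qed.

(** The part of the curve that stays at a distance from [a] contributes a function holomorphic near
    [a]. In the closed case [d <= 1 - d] keeps the two end arcs from overlapping. *)
Lemma far_part gamma Sigma g a l r d p : setting gamma Sigma g -> 0 < d -> 0 <= l - d -> l <= 1 -> 0 <= r -> r + d <= 1 ->
 (l = r \/ (l = 1 /\ r = 0 /\ d <= 1 - d)) -> 0 < p ->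
 (forall s, 0 <= s <= 1 -> `|gamma s - a| < p -> near_params l r d s) ->
 exists Rest, hold Rest a (p / 2) /\ forall t, `|t - a| < p / 2 -> ~ image gamma t ->
  ctype (cauchy_density gamma g) gamma 0 1 t =
  (Rest t + ctype (cauchy_density gamma g) gamma (l - d) l t + ctype (cauchy_density gamma g) gamma r (r + d) t)%C.
Proof.
 intros H Hd H1 H2 H3 H4 Hlr Pp HN. set (phi := cauchy_density gamma g).
 assert (HP := gamma_piecewise_smooth _ _ _ H). assert (Hc := piecewise_rcont_on _ HP).
 assert (Far : forall s t, 0 <= s <= 1 -> ~ near_params l r d s -> `|t - a| < p / 2 -> p / 2 <= `|gamma s - t|).
 { intros s t Hs N Ht. assert (p <= `|gamma s - a|) by (apply Rnot_lt_le; intros L; apply N; auto). triang. }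
 assert (FH : forall u v, 0 <= u -> u <= v -> v <= 1 -> (forall s, u <= s <= v -> ~ near_params l r d s) -> hold (ctype phi gamma u v) a (p / 2)).
 { intros u v Hu Huv Hv N t Ht. destruct (cauchy_density_density gamma Sigma g u v H) as [M [PM HM]]; auto.
  apply (ctype_holo phi gamma u v M t (p / 2)); auto. rsub Hc. lra. intros s Hs. apply Far; auto. lra. }
 assert (CH : forall u m v t, 0 <= u -> u <= m <= v -> v <= 1 -> ~ image gamma t -> ctype phi gamma u v t = (ctype phi gamma u m t + ctype phi gamma m v t)%C).
 { intros u m v t Hu Hm Hv N. destruct (off_image_ball gamma t HP N) as [e [Pe Ke]].
  destruct (cauchy_density_density gamma Sigma g u m H) as [M1 [_ HM1]]; try lra. destruct (cauchy_density_density gamma Sigma g m v H) as [M2 [_ HM2]]; try lra.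
  apply (ctype_chasles phi gamma u m v M1 M2 t e); auto. rsub Hc. intros; apply Ke; lra. }
 destruct Hlr as [<-|[-> [-> Hd2]]].
 - exists (fun t => ctype phi gamma 0 (l - d) t + ctype phi gamma (l + d) 1 t)%C. split.
  + intros t Ht. apply holo_plus; apply FH; auto; try lra; intros s Hs [Q|Q]; lra.
  + intros t Ht N. rewrite (CH 0 (l - d) 1), (CH (l - d) l 1), (CH l (l + d) 1); auto; try lra. ring.
 - exists (ctype phi gamma (0 + d) (1 - d)). split.
  + apply FH; try lra. intros s Hs [Q|Q]; lra.
  + intros t Ht N. rewrite (CH 0 (0 + d) 1), (CH (0 + d) (1 - d) 1); auto; try lra. ring.
Qed.

(** On a short arc [g] is the germ [f], so up to a holomorphic function the integral is [f t] times
    the integral of the bare kernel. *)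
Lemma near_part gamma g f a R0 r u v : smooth_arc gamma u v -> u < v -> rcont_on u v gamma -> hold f a R0 -> 0 < r < R0 ->
 (forall s, u <= s <= v -> `|gamma s - a| <= r / 2 /\ g (gamma s) = f (gamma s)) ->
 exists Cf, hold Cf a (r / 2) /\ forall t d, `|t - a| < r / 2 -> 0 < d -> (forall s, u <= s <= v -> d <= `|gamma s - t|) ->
  ctype (cauchy_density gamma g) gamma u v t = (f t * ctype (curve_derivative gamma) gamma u v t + Cf t)%C.
Proof.
 intros A Huv Hc Hf Hr Hg. destruct (arc_density gamma u v LRA A) as [M [PM HM]].
 destruct (difference_quotient_integral f a R0 r (curve_derivative gamma) gamma u v M Hf Hr LRA PM HM Hc) as [Cf [HC EC]].
 { intros s Hs. apply Hg, Hs. }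
 exists Cf. sa. intros t d Ht Pd Hd. rewrite <- (EC t d Ht Pd Hd).
 apply (RInt_ext (V := C_R_CompleteNormedModule)). minmax. intros s Hs. unfold cauchy_density.
 rewrite (proj2 (Hg s LRA)).
 change (f (gamma s) * curve_derivative gamma s * / (gamma s - t) = curve_derivative gamma s * (f (gamma s) * / (gamma s - t)))%C. ring.
Qed.

(** Near [a] the Cauchy integral is [f W / (2 pi i)] up to a holomorphic function, [W] being the
    integral of [1/(gamma - t)] over a short arc. For [t] on either side of the graph the factor
    [Ci] or [- Ci] moves the arc off the cut and expresses [W] by logarithms at its ends; the two
    expressions differ by [2 pi i]. *)
Lemma jump gamma Sigma g a f w : setting gamma Sigma g -> punctured gamma Sigma a -> branch_at gamma g a f ->
 (forall s v, I01 s -> gamma s = a -> velocity gamma s v -> 0 < cross v w) ->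
 exists rho K Phi upper lower, side_structure gamma g a f w rho K Phi upper lower.
Proof.
 intros H Ha [Hf Ef] Hw. assert (HP := gamma_piecewise_smooth _ _ _ H). assert (Hc := piecewise_rcont_on _ HP).
 destruct (preimage_structure _ _ _ a H Ha) as [l [r [Hl [Hr [El [Er [Hlr HU]]]]]]].
 destruct (piecewise_left gamma l HP Hl) as [hl [Phl [Hhl Al]]]. destruct (piecewise_right gamma r HP Hr) as [hr [Phr [Hhr Ar]]].
 destruct (half_branch_left gamma l hl Phl Al) as [ul Bl]. destruct (half_branch_right gamma r hr Phr Ar) as [ur Br].
 assert (Kl := Hw l _ ltac:(unfold I01; lra) El (velocity_left gamma l ul Hl Bl)).
 assert (Kr := Hw r _ ltac:(unfold I01; lra) Er (velocity_right gamma r ur Hr Br)).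
 set (lam := (Ci * Cconj w)%C). rewrite cross_re in Kl, Kr. fold lam in Kl, Kr.
 replace (lam * - ul)%C with (- lam * ul)%C in Kl by ring.
 assert (Nl : lam <> RtoC 0). { intros E. rewrite E, Cmult_0_l, re_RtoC in Kr. lra. }
 assert (Pl : 0 < `|lam|) by now apply Cmod_gt_0.
 destruct (half_branch_graph _ _ _ Bl Kl) as [dl [cl [Kl' [Pdl [Pcl [PKl Gl]]]]]]. cbv beta in Gl.
 destruct (half_branch_graph _ _ _ Br Kr) as [dr [cr [Kr' [Pdr [Pcr [PKr Gr]]]]]]. cbv beta in Gr.
 apply holomorphic_at_hold in Hf. destruct Hf as [R0 [PR0 Hf]].
 apply locally_Cmod in Ef. destruct Ef as [e0 [Pe0 Ef]].
 set (e := Rmin e0 (R0 / 4)). assert (Pe : 0 < e) by pos.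
 assert (He0 : e <= e0) by apply Rmin_l. assert (HeR : e <= R0 / 4) by apply Rmin_r.
 destruct (Hc l LRA e Pe) as [d1 [Pd1 C1]]. destruct (Hc r LRA e Pe) as [d2 [Pd2 C2]].
 set (d := Rmin (Rmin (Rmin hl hr) (Rmin dl dr)) (Rmin (Rmin (d1 / 2) (d2 / 2)) (1 / 2))).
 assert (Pd : 0 < d) by pos.
 assert (D : d <= hl /\ d <= hr /\ d <= dl /\ d <= dr /\ d <= d1 / 2 /\ d <= d2 / 2 /\ d <= 1 / 2).
 { unfold d. ar. }
 destruct D as [D1 [D2 [D3 [D4 [D5 [D6 D7]]]]]].
 destruct (near_preimages gamma Sigma g a l r d H Pd Hlr HU) as [p [Pp Kp]].
 (* The arc through [a], parametrised by [[-d,d]] also when [a] is the closing point. *)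
 set (Gam := fun x => if Rle_dec x 0 then gamma (l + x) else gamma (r + x)).
 set (c := Rmin cl cr). assert (Pc : 0 < c) by pos. assert (Hcl : c <= cl) by apply Rmin_l. assert (Hcr : c <= cr) by apply Rmin_r.
 set (K := Rmax Kl' Kr'). assert (HKl : Kl' <= K) by apply Rmax_l. assert (HKr : Kr' <= K) by apply Rmax_r. assert (PK : 0 < K) by lra.
 assert (G0 : Gam 0 = a). { unfold Gam. destruct (Rle_dec 0 0); [|lra]. now rewrite Rplus_0_r. }
 assert (GN : forall x, x <= 0 -> Gam x = gamma (l + x)). { intros x Hx. unfold Gam. destruct (Rle_dec x 0); auto; lra. }
 assert (GP : forall x, 0 <= x -> Gam x = gamma (r + x)).
 { intros x Hx. unfold Gam. destruct (Rle_dec x 0); auto. replace x with 0 by lra. rewrite !Rplus_0_r. congruence. }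
 assert (GLn : forall x y, - d <= y -> y <= x -> x <= 0 -> c * (x - y) <= Re (lam * (Gam x - Gam y)) /\ Rabs (Im (lam * (Gam x - Gam y))) <= K * Re (lam * (Gam x - Gam y))).
 { intros x y Hy Hxy Hx. rewrite !GN by lra. destruct (Gl (- y) (- x) LRA LRA) as [Q1 Q2].
  replace (l - - y) with (l + y) in Q1, Q2 by ring. replace (l - - x) with (l + x) in Q1, Q2 by ring.
  replace (- lam * (gamma (l + y)%R - gamma (l + x)%R))%C with (lam * (gamma (l + x)%R - gamma (l + y)%R))%C in Q1, Q2 by ring.
  replace (- y - - x) with (x - y) in Q1 by ring. assert (c * (x - y) <= cl * (x - y)) by nra.
  assert (0 <= c * (x - y)) by nra. sp. eapply Rle_trans. eauto. apply Rmult_le_compat_r; lra. }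
 assert (GLp : forall x y, 0 <= y -> y <= x -> x <= d -> c * (x - y) <= Re (lam * (Gam x - Gam y)) /\ Rabs (Im (lam * (Gam x - Gam y))) <= K * Re (lam * (Gam x - Gam y))).
 { intros x y Hy Hxy Hx. rewrite !GP by lra. destruct (Gr x y LRA LRA) as [Q1 Q2].
  assert (c * (x - y) <= cr * (x - y)) by nra.
  assert (0 <= c * (x - y)) by nra. sp. eapply Rle_trans. eauto. nra. }
 assert (GL : forall x y, - d <= y -> y <= x -> x <= d -> c * (x - y) <= Re (lam * (Gam x - Gam y)) /\ Rabs (Im (lam * (Gam x - Gam y))) <= K * Re (lam * (Gam x - Gam y))).
 { intros x y Hy Hxy Hx. destruct (Rle_lt_dec x 0) as [Lx|Lx]. auto. destruct (Rle_lt_dec 0 y) as [Ly|Ly]. auto.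
  destruct (GLn 0 y) as [A1 A2]; try lra. destruct (GLp x 0) as [B1 B2]; try lra.
  replace (lam * (Gam x - Gam y))%C with (lam * (Gam x - Gam 0%R) + lam * (Gam 0%R - Gam y))%C by ring.
  rewrite re_plus, im_plus. sp. eapply Rle_trans. apply Rabs_triang. lra. }
 assert (GI : forall x y, - d <= x <= d -> - d <= y <= d -> Re (lam * (Gam x - Gam y)) = 0 -> x = y).
 { intros x y Hx Hy E. destruct (Rle_lt_dec y x) as [L|L].
  - destruct (GL x y) as [Q _]; try lra. rewrite E in Q. destruct (Req_dec x y); auto. assert (0 < c * (x - y)) by pos. lra.
  - destruct (GL y x) as [Q _]; try lra. replace (lam * (Gam y - Gam x))%C with (- (lam * (Gam x - Gam y)))%C in Q by ring.
   rewrite re_opp, E in Q. assert (0 < c * (y - x)) by pos. lra. }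
 assert (GIm : forall z, `|z - a| < p -> image gamma z -> exists x, - d <= x <= d /\ Gam x = z).
 { intros z Hz [s [Hs <-]]. destruct (Kp s Hs Hz) as [Q|Q].
  - exists (s - l). sp. rewrite GN by lra. f_equal; ring.
  - exists (s - r). sp. rewrite GP by lra. f_equal; ring. }
 assert (GImg : forall x, - d <= x <= d -> image gamma (Gam x)).
 { intros x Hx. destruct (Rle_lt_dec x 0). rewrite GN by lra. exists (l + x). sa. ar. rewrite GP by lra. exists (r + x). sa. ar. }
 (* [side (-1) t] says that on the vertical line through [t] the arc passes only below [t], and
    [side 1 t] that it passes only above. *)
 set (side := fun e t => forall x, - d <= x <= d -> Re (lam * (Gam x - t)) = 0 -> 0 < e * Im (lam * (Gam x - t))).
 assert (Hrr : 0 < R0 / 2 < R0) by lra.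
 destruct (far_part gamma Sigma g a l r d p H Pd) as [Rest [HRest ERest]]; auto; try lra.
 destruct (near_part gamma g f a R0 (R0 / 2) (l - d) l) as [CL [HCL ECL]]; auto.
 { apply smooth_arc_sub with (3 := Al); lra. } { lra. } { rsub Hc. }
 { intros s Hs. assert (Q : `|gamma s - a| < e). { rewrite <- El. apply C1. lra. rabs. }
  sp. symmetry. apply Ef. lra. exists s. sa. ar. }
 destruct (near_part gamma g f a R0 (R0 / 2) r (r + d)) as [CR [HCR ECR]]; auto.
 { apply smooth_arc_sub with (3 := Ar); lra. } { lra. } { rsub Hc. }
 { intros s Hs. assert (Q : `|gamma s - a| < e). { rewrite <- Er. apply C2. lra. rabs. }
  sp. symmetry. apply Ef. lra. exists s. sa. ar. }
 set (zu := gamma (l - d)). set (zv := gamma (r + d)).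
 (* The expression of [W] valid below the arc. It involves only the ends of the arc, so it is
    holomorphic on both sides and across the arc. *)
 set (Wd := fun t => (Log (- Ci * (lam * (zv - t))) - Log (- Ci * (lam * (zu - t))))%C).
 (* The ends of the arc have abscissa at least [c d] away from that of [a]; the last bound keeps the
    abscissa of [t] strictly between them. *)
 set (rho := Rmin (Rmin (p / 2) (R0 / 4)) (c * d / (2 * `|lam|))).
 assert (Pcd : 0 < c * d) by pos.
 assert (Prho : 0 < rho). pos.
 assert (Hrho1 : rho <= p / 2) by (unfold rho; eapply Rle_trans; apply Rmin_l).
 assert (Hrho2 : rho <= R0 / 4) by (unfold rho; eapply Rle_trans; [apply Rmin_l|apply Rmin_r]).
 assert (Hrho3 : rho * (2 * `|lam|) <= c * d). { apply Rle_div_r. lra. apply Rmin_r. }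
 assert (REt : forall t, `|t - a| < rho -> Rabs (Re (lam * (t - a))) <= c * d / 2).
 { intros t Ht. eapply Rle_trans. apply re_le_Cmod. rewrite Cmod_mult. nra. }
 assert (REv : forall t, `|t - a| < rho -> 0 < Re (lam * (zv - t))).
 { intros t Ht. destruct (GL d 0) as [Q _]; try lra. rewrite G0, GP in Q by lra. fold zv in Q.
  replace (lam * (zv - t))%C with (lam * (zv - a) - lam * (t - a))%C by ring. unfold Cminus at 1. rewrite re_plus, re_opp.
  specialize (REt t Ht). generalize (Rle_abs (Re (lam * (t - a)))). lra. }
 assert (REu : forall t, `|t - a| < rho -> Re (lam * (zu - t)) < 0).
 { intros t Ht. destruct (GL 0 (- d)) as [Q _]; try lra. rewrite G0, GN in Q by lra. change (l + - d) with (l - d) in Q. fold zu in Q.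
  replace (lam * (zu - t))%C with (- (lam * (a - zu)) - lam * (t - a))%C by ring. unfold Cminus at 1. rewrite re_plus, !re_opp.
  specialize (REt t Ht). generalize (Rle_abs (- Re (lam * (t - a)))). rewrite Rabs_Ropp. lra. }
 assert (slit1 : forall q, (Re q = 0 -> 0 < 1 * Im q) -> slit (- Ci * q)%C).
 { intros q Hq. unfold slit. replace (- Ci * q)%C with (- (Ci * q))%C by ring. rewrite im_opp, re_opp, im_Ci_mult, re_Ci_mult. lra. }
 assert (slit2 : forall q, (Re q = 0 -> 0 < -1 * Im q) -> slit (Ci * q)%C).
 { intros q Hq. unfold slit. rewrite im_Ci_mult, re_Ci_mult. lra. }
 assert (Ncl : (Ci * lam)%C <> RtoC 0) by (apply Cmult_neq_0; auto; apply Ci_nz).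
 assert (Ncl' : (- Ci * lam)%C <> RtoC 0). { intros E. apply Ncl. replace (Ci * lam)%C with (- (- Ci * lam))%C by ring. rewrite E. ring. }
 assert (Al' : smooth_arc gamma (l - d) l) by (apply smooth_arc_sub with (3 := Al); lra).
 assert (Ar' : smooth_arc gamma r (r + d)) by (apply smooth_arc_sub with (3 := Ar); lra).
 set (W := fun t => (ctype (curve_derivative gamma) gamma (l - d) l t + ctype (curve_derivative gamma) gamma r (r + d) t)%C).
 assert (HW : forall mu e t, (mu * lam)%C <> RtoC 0 -> (forall q, (Re q = 0 -> 0 < e * Im q) -> slit (mu * q)%C) -> side e t ->
  W t = (Log (mu * (lam * (zv - t))) - Log (mu * (lam * (zu - t))))%C).
 { intros mu e' t Nm Hmu Lt. unfold W. rewrite (arc_log gamma (l - d) l (mu * lam) t), (arc_log gamma r (r + d) (mu * lam) t); auto; try lra.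
  - rewrite El, Er, !Cmult_assoc. unfold zv, zu. ring.
  - intros s Hs. rewrite <- Cmult_assoc. apply Hmu. specialize (Lt (s - r) LRA). rewrite GP in Lt by lra.
   replace (r + (s - r)) with s in Lt by ring. auto.
  - intros s Hs. rewrite <- Cmult_assoc. apply Hmu. specialize (Lt (s - l) LRA). rewrite GN in Lt by lra.
   replace (l + (s - l)) with s in Lt by ring. auto. }
 assert (WUp : forall t, `|t - a| < rho -> side (-1) t -> W t = (Wd t + RtoC (2 * PI) * Ci)%C).
 { intros t Ht Lt. rewrite (HW Ci (-1)) by auto. unfold Wd.
  assert (Jv := Log_jump (lam * (zv - t)) ltac:(specialize (REv t Ht); lra)). assert (Ju := Log_jump (lam * (zu - t)) ltac:(specialize (REu t Ht); lra)).
  specialize (REv t Ht). specialize (REu t Ht).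
  destruct (Rlt_dec 0 (Re (lam * (zv - t)))); [|lra]. destruct (Rlt_dec 0 (Re (lam * (zu - t)))); [lra|].
  rewrite RtoC_opp in Ju. rewrite RtoC_mult.
  apply Cminus_eq0.
  replace (Log (Ci * (lam * (zv - t))) - Log (Ci * (lam * (zu - t))) - (Log (- Ci * (lam * (zv - t))) - Log (- Ci * (lam * (zu - t))) + RtoC 2 * RtoC PI * Ci))%C with
   ((Log (Ci * (lam * (zv - t))) - Log (- Ci * (lam * (zv - t)))) - (Log (Ci * (lam * (zu - t))) - Log (- Ci * (lam * (zu - t)))) - RtoC 2 * RtoC PI * Ci)%C by ring.
  rewrite Jv, Ju. ring. }
 assert (Off : forall e t, `|t - a| < rho -> side e t -> ~ image gamma t).
 { intros e' t Ht Ut It. destruct (GIm t LRA It) as [x [Hx <-]]. specialize (Ut x Hx).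
  replace (lam * (Gam x - Gam x))%C with (RtoC 0) in Ut by ring. rewrite re_RtoC, im_RtoC in Ut. lra. }
 set (Phi := fun t => (two_pi_i_inv * (Rest t + CL t + CR t + f t * Wd t))%C).
 assert (Npi : (RtoC (2 * PI) * Ci)%C <> RtoC 0). { apply Cmult_neq_0. intros E. apply RtoC_inj in E. generalize PI_RGT_0; lra. apply Ci_nz. }
 assert (Ieq : forall t, `|t - a| < rho -> ~ image gamma t -> cauchy_integral gamma g t =
  (two_pi_i_inv * (Rest t + CL t + CR t + f t * W t))%C).
 { intros t Ht Nt. destruct (off_image_ball gamma t HP Nt) as [q [Pq Kq]].
  rewrite cauchy_integral_ctype, ERest by (auto; lra). rewrite (ECL t q), (ECR t q); auto; try lra; try (intros; apply Kq; lra). unfold W. ring. }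
 assert (Hlin : forall x, (lam * (RtoC x * w))%C = (Ci * RtoC (x * (`|w| * `|w|)))%C).
 { intros x. unfold lam. replace (`|w| * `|w|) with (`|w| ^ 2) by ring. rewrite RtoC_mult, RtoC_pow, <- RtoC_pow, Cmod2_conj. ring. }
 assert (Pw : 0 < `|w| * `|w|). { assert (w <> RtoC 0). { intros ->. apply Nl. unfold lam. replace (Cconj 0) with (RtoC 0). ring. apply C_ext; simpl; ring. } assert (0 < `|w|) by now apply Cmod_gt_0. nra. }
 assert (Shift : forall e t x, side e t -> x * e <= 0 -> side e (t + RtoC x * w)%C).
 { intros e' t x Ut Hx y Hy. replace (lam * (Gam y - (t + RtoC x * w)))%C with (lam * (Gam y - t) - lam * (RtoC x * w))%C by ring. rewrite (Hlin x). unfold Cminus at 1 3.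
  rewrite re_plus, im_plus, re_opp, im_opp, re_Ci_mult, im_Ci_mult, re_RtoC, im_RtoC. specialize (Ut y Hy). nra. }
 assert (Cone : forall t x, - d <= x <= d -> Re (lam * (Gam x - t)) = 0 -> Rabs (Im (lam * (Gam x - a))) <= K * Rabs (cross (t - a) w)).
 { intros t x Hx E. rewrite cross_re. fold lam.
  assert (E2 : Re (lam * (t - a)) = Re (lam * (Gam x - a))).
  { replace (lam * (Gam x - a))%C with (lam * (Gam x - t) + lam * (t - a))%C by ring. rewrite re_plus, E. lra. }
  rewrite E2. rewrite <- G0. destruct (Rle_lt_dec 0 x).
  - destruct (GL x 0) as [Q1 Q2]; try lra. assert (0 <= c * (x - 0)) by (apply Rmult_le_pos; lra). rewrite (Rabs_pos_eq (Re _)) by lra. auto.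
  - destruct (GL 0 x) as [Q1 Q2]; try lra. assert (0 <= c * (0 - x)) by (apply Rmult_le_pos; lra).
   replace (lam * (Gam x - Gam 0%R))%C with (- (lam * (Gam 0%R - Gam x)))%C by ring. rewrite re_opp, im_opp, !Rabs_Ropp, (Rabs_pos_eq (Re _)) by lra. auto. }
 assert (ConeY : forall t x, Im (lam * (Gam x - t)) = Im (lam * (Gam x - a)) - Re (Cconj w * (t - a))).
 { intros t x. replace (lam * (Gam x - t))%C with (lam * (Gam x - a) - Ci * (Cconj w * (t - a)))%C by (unfold lam; ring).
  unfold Cminus at 1. rewrite im_plus, im_opp, im_Ci_mult. ring. }
 assert (HWd : forall t, `|t - a| < rho -> holo Wd t).
 { assert (HL0 : forall z0 t, (Re (lam * (z0 - t)) <> 0) -> holo (fun t => Log (- Ci * (lam * (z0 - t)))) t).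
  { intros z0 t N. apply (holo_comp (fun t => - Ci * (lam * (z0 - t)))%C Log).
   - auto.
   - eexists. apply cderiv_Log. apply slit1. lra. }
  intros t Ht. apply holo_minus; apply HL0. specialize (REv t Ht). lra. specialize (REu t Ht). lra. }
 assert (Cases : forall t, `|t - a| < rho -> ~ image gamma t -> side (-1) t \/ side 1 t).
 { intros t Ht Nt. destruct (classic (side (-1) t)) as [|Nu]; auto. right. intros x Hx E.
  apply not_all_ex_not in Nu. destruct Nu as [y Ny]. apply imply_to_and in Ny. destruct Ny as [Hy Ny]. apply imply_to_and in Ny. destruct Ny as [E' Ny].
  assert (x = y). { apply GI; auto. replace (lam * (Gam x - Gam y))%C with (lam * (Gam x - t) - lam * (Gam y - t))%C by ring. unfold Cminus at 1. rewrite re_plus, re_opp. lra. }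
  subst y. destruct (Req_dec (Im (lam * (Gam x - t))) 0) as [Ny'|]; [|lra]. exfalso. apply Nt.
  assert (Z : (lam * (Gam x - t))%C = RtoC 0) by (apply C_ext; rewrite ?re_RtoC, ?im_RtoC; auto).
  apply Cmult_integral in Z. destruct Z as [Z|Z]; [contradiction|]. apply Cminus_eq0 in Z. rewrite <- Z. auto. }
 (* [J] is continuous off the curve and takes only the values [0] and [2 pi i], whose distance
    exceeds [1]. Hence the sides are open, and the formulas hold as equalities of germs. *)
 set (J := fun t => (W t - Wd t)%C).
 assert (HJ : forall t, `|t - a| < rho -> ~ image gamma t -> exists q, 0 < q /\ forall z, `|z - t| < q ->
  `|z - a| < rho /\ ~ image gamma z /\ `|J z - J t| < 1).
 { intros t Ht Nt. destruct (off_image_ball gamma t HP Nt) as [q [Pq Kq]].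
  destruct (arc_density gamma (l - d) l LRA Al') as [M1 [PM1 Dn1]]. destruct (arc_density gamma r (r + d) LRA Ar') as [M2 [PM2 Dn2]].
  assert (HJt : holo J t).
  { apply holo_minus; auto. apply holo_plus.
   - apply (ctype_holo (curve_derivative gamma) gamma (l - d) l M1 t q); auto; try lra. rsub Hc. intros; apply Kq; lra.
   - apply (ctype_holo (curve_derivative gamma) gamma r (r + d) M2 t q); auto; try lra. rsub Hc. intros; apply Kq; lra. }
  destruct (holo_ccont J t HJt 1 LRA) as [q' [Pq' Kq']].
  exists (Rmin q' (Rmin q (rho - `|t - a|))). split. pos.
  intros z Hz. rmin.
  split. triang. split. intros [s [Hs <-]]. specialize (Kq s Hs). lra. apply Kq'. lra. }
 assert (C2pi : 1 < `|RtoC (2 * PI) * Ci|).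
 { rewrite Cmod_mult, Cmod_R. replace (`|Ci|) with 1. rewrite Rabs_pos_eq; generalize PI2_1; lra. unfold Cmod, Ci; simpl. rewrite <- sqrt_1 at 1. f_equal. lra. }
 assert (JU : forall t, `|t - a| < rho -> side (-1) t -> J t = (RtoC (2 * PI) * Ci)%C). { intros t Ht Ut. unfold J. rewrite WUp; auto. ring. }
 assert (JL : forall t, side 1 t -> J t = RtoC 0). { intros t Ut. unfold J. rewrite (HW (- Ci)%C 1); auto. unfold Wd. ring. }
 assert (Same : forall e t, e = 1 \/ e = -1 -> `|t - a| < rho -> side e t -> ~ image gamma t /\ exists q, 0 < q /\ forall z, `|z - t| < q ->
  `|z - a| < rho /\ ~ image gamma z /\ side e z).
 { intros e' t He Ht Ut. assert (Nt := Off e' t Ht Ut). sa. destruct (HJ t Ht Nt) as [q [Pq Kq]]. exists q. sa.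
  intros z Hz. destruct (Kq z Hz) as [Hza [Nz Jz]]. sa. sa.
  assert (N0 : `|RtoC (2 * PI) * Ci - 0|%C = `|RtoC (2 * PI) * Ci|) by (f_equal; ring).
  destruct (Cases z Hza Nz) as [U|U]; destruct He; subst; auto; exfalso; [rewrite (JU z), (JL t) in Jz|rewrite (JL z), (JU t), Cmod_minus_sym in Jz]; auto; lra. }
 exists rho, K, Phi, (side (-1)), (side 1). constructor; auto.
 - intros t Ht. apply holo_mult. auto. apply holo_plus. apply holo_plus. apply holo_plus.
  + apply HRest. lra. + apply HCL. lra. + apply HCR. lra.
  + apply holo_mult. apply Hf. lra. auto.
 - apply hold_sub with (1 := Hf). self.
 - intros t Ht Ut. destruct (Same (-1) t) as [Nt [q [Pq Kq]]]; auto. sa. apply germ_eq_Cmod. exists q. sa.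
  intros z Hz. destruct (Kq z Hz) as [Hza [Nz U]].
  rewrite Ieq, WUp; auto. unfold Phi. assert (T1 : (two_pi_i_inv * (RtoC (2 * PI) * Ci))%C = RtoC 1) by now apply Cinv_l.
  transitivity (two_pi_i_inv * (Rest z + CL z + CR z + f z * Wd z) + f z * (two_pi_i_inv * (RtoC (2 * PI) * Ci)))%C. ring. rewrite T1. ring.
 - intros t Ht Ut. destruct (Same 1 t) as [Nt [q [Pq Kq]]]; auto. sa. apply germ_eq_Cmod. exists q. sa.
  intros z Hz. destruct (Kq z Hz) as [Hza [Nz U]]. rewrite Ieq, (HW (- Ci)%C 1); auto.
 - intros t Ht x Hx E. rewrite ConeY. specialize (Cone t x Hx E). generalize (Rle_abs (Im (lam * (Gam x - a)))). lra.
 - intros t Ht x Hx E. rewrite ConeY. specialize (Cone t x Hx E). generalize (Rle_abs (- Im (lam * (Gam x - a)))). rewrite Rabs_Ropp. lra.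
 - intros t x Ut Px. apply Shift; auto. lra.
 - intros t x Ut Px. replace (t - RtoC x * w)%C with (t + RtoC (- x) * w)%C by (rewrite RtoC_opp; ring). apply Shift; auto. lra.
Qed.

(** * Rationality implies trivial monodromy *)

Lemma choice_on {A B} (Q : A -> Prop) (R : A -> B -> Prop) (b : B) : (forall a, Q a -> exists y, R a y) -> exists f, forall a, Q a -> R a (f a).
Proof.
 intros H. apply (choice (fun a y => Q a -> R a y)). intros a. destruct (classic (Q a)) as [q|q]. destruct (H a q) as [y K]. eauto. exists b. easy.
Qed.

Lemma germ_eq_pointwise a f h : (forall z, f z = h z) -> germ_eq a f h.
Proof. intros H. apply germ_eq_Cmod. exists 1. sa. lra. Qed.

Lemma germ_eq_sym a f h : germ_eq a f h -> germ_eq a h f.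
Proof. intros H. apply germ_eq_Cmod in H. destruct H as [r [Pr K]]. apply germ_eq_Cmod. exists r. sa. intros. now rewrite K. Qed.

Lemma germ_eq_rel a (P : C -> Prop) f h f' h' : germ_eq a f h -> germ_eq a f' h' ->
 (forall z, f z = h z -> f' z = h' z -> P z) -> locally (T := C_UniformSpace) a P.
Proof.
 intros H H' K. apply germ_eq_Cmod in H. destruct H as [r [Pr A]]. apply germ_eq_Cmod in H'. destruct H' as [r' [Pr' A']].
 apply locally_Cmod. exists (Rmin r r'). sp. intros z Hz.
 apply K; [apply A|apply A']; eapply Rlt_le_trans; try apply Hz. ar. ar.
Qed.

Lemma germ_eq_trans a f h k : germ_eq a f h -> germ_eq a h k -> germ_eq a f k.
Proof. intros A B. apply (germ_eq_rel a _ f h h k A B). congruence. Qed.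

Lemma germ_eq_plus a f h f' h' : germ_eq a f h -> germ_eq a f' h' -> germ_eq a (fun z => f z + f' z)%C (fun z => h z + h' z)%C.
Proof. intros A B. apply (germ_eq_rel a _ f h f' h' A B). congruence. Qed.

Lemma germ_eq_minus a f h f' h' : germ_eq a f h -> germ_eq a f' h' -> germ_eq a (fun z => f z - f' z)%C (fun z => h z - h' z)%C.
Proof. intros A B. apply (germ_eq_rel a _ f h f' h' A B). congruence. Qed.

Lemma germ_eq_mult a f h f' h' : germ_eq a f h -> germ_eq a f' h' -> germ_eq a (fun z => f z * f' z)%C (fun z => h z * h' z)%C.
Proof. intros A B. apply (germ_eq_rel a _ f h f' h' A B). congruence. Qed.

Lemma germ_eq_refl a f : germ_eq a f f.
Proof. now apply germ_eq_pointwise. Qed.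

Lemma cross_bound u w : Rabs (cross u w) <= `|u| * `|w|.
Proof. unfold cross. eapply Rle_trans. apply im_le_Cmod. rewrite Cmod_mult, Cmod_conj. lra. Qed.

Lemma cross_scal_r x v w : cross v (RtoC x * w) = x * cross v w.
Proof. unfold cross. replace (Cconj v * (RtoC x * w))%C with (RtoC x * (Cconj v * w))%C by ring. apply im_scal_l. Qed.

Lemma cross_scal_l x v w : cross (RtoC x * v) w = x * cross v w.
Proof. unfold cross. rewrite !im_mult, !re_conj, !im_conj, re_scal_l, im_scal_l. lra. Qed.

Lemma cross_plus_l u v w : cross (u + v) w = cross u w + cross v w.
Proof. unfold cross. rewrite !im_mult, !re_conj, !im_conj, re_plus, im_plus. lra. Qed.

Lemma cross_self w : cross w w = 0.
Proof. unfold cross. rewrite im_mult, re_conj, im_conj. lra. Qed.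

Lemma re_conj_self w : Re (Cconj w * w) = `|w| * `|w|.
Proof. replace (`|w| * `|w|) with (`|w| ^ 2) by ring. rewrite Cmult_comm, <- Cmod2_conj, re_RtoC. auto. Qed.

(** A point within [eta x] of [a + x w] has ordinate dominating [K] times its abscissa; with this
    [eta] the two error terms together take half of [x |w|^2]. *)
Lemma side_cone gamma g a f w rho K Phi upper lower : side_structure gamma g a f w rho K Phi upper lower -> w <> RtoC 0 ->
 exists eta, 0 < eta /\ forall t x, 0 < x ->
  (`|t - a - RtoC x * w| <= eta * x -> upper t) /\ (`|t - a + RtoC x * w| <= eta * x -> lower t).
Proof.
 intros SS Nw. assert (Pw : 0 < `|w|) by now apply Cmod_gt_0. assert (HK := ss_K SS).
 exists (`|w| / (2 * (K + 1))). assert (Pe : 0 < `|w| / (2 * (K + 1))) by pos. sa.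
 set (eta := `|w| / (2 * (K + 1))) in *.
 assert (Ee : eta * (2 * (K + 1)) = `|w|) by (unfold eta; field; lra).
 intros t x Px.
 assert (Main : forall y u, `|u - RtoC y * w| <= eta * x -> K * Rabs (cross u w) <= K * (eta * x * `|w|) /\
  Rabs (Re (Cconj w * u) - y * (`|w| * `|w|)) <= eta * x * `|w|).
 { intros y u Hu. set (v := (u - RtoC y * w)%C) in *. assert (E : u = (RtoC y * w + v)%C) by (unfold v; ring).
  split.
  - apply Rmult_le_compat_l. lra. rewrite E, cross_plus_l, cross_scal_l, cross_self. rewrite Rmult_0_r, Rplus_0_l.
   eapply Rle_trans. apply cross_bound. nra.
  - rewrite E. replace (Cconj w * (RtoC y * w + v))%C with (RtoC y * (Cconj w * w) + Cconj w * v)%C by ring.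
   rewrite re_plus, re_scal_l, re_conj_self. replace (y * (`|w| * `|w|) + Re (Cconj w * v) - y * (`|w| * `|w|)) with (Re (Cconj w * v)) by ring.
   eapply Rle_trans. apply re_le_Cmod. rewrite Cmod_mult, Cmod_conj. nra. }
 assert (Q : K * (eta * x * `|w|) + eta * x * `|w| < x * (`|w| * `|w|)).
 { replace (K * (eta * x * `|w|) + eta * x * `|w|) with (eta * (2 * (K + 1)) * (x * `|w|) / 2) by lra. rewrite Ee.
  assert (0 < x * (`|w| * `|w|)) by pos. lra. }
 split; intros Ht.
 - apply (ss_cone_up SS). destruct (Main x (t - a)%C Ht) as [A B]. apply Rabs_le_between in B. lra.
 - apply (ss_cone_low SS).
  destruct (Main (- x) (t - a)%C) as [A B]. { replace (t - a - RtoC (- x) * w)%C with (t - a + RtoC x * w)%C; auto. rewrite RtoC_opp. ring. }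
  apply Rabs_le_between in B. lra.
Qed.

Lemma velocity_exists gamma s : piecewise_smooth gamma -> I01 s -> exists v, velocity gamma s v.
Proof.
 intros H [H0 H1]. destruct (Rlt_le_dec s 1).
 - destruct (piecewise_right gamma s H) as [h [Ph [_ A]]]. lra. destruct (half_branch_right gamma s h Ph A) as [u Hu].
  exists u. apply velocity_right; auto. 
 - destruct (piecewise_left gamma s H) as [h [Ph [_ A]]]. lra. destruct (half_branch_left gamma s h Ph A) as [u Hu].
  exists (- u)%C. apply velocity_left; auto. lra.
Qed.

Lemma positive_cross_nonzero gamma a w : piecewise_smooth gamma -> image gamma a ->
 (forall s v, I01 s -> gamma s = a -> velocity gamma s v -> 0 < cross v w) -> w <> RtoC 0.
Proof.
 intros HP [s [Hs Es]] H ->. destruct (velocity_exists gamma s HP Hs) as [v Hv]. specialize (H s v Hs Es Hv).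
 unfold cross in H. rewrite Cmult_0_r, im_RtoC in H. lra.
Qed.

(** [jump] is applied to the direction [e w], which points to the left of the curve whatever the
    sign of the crossing. For [e = -1] the path comes from the upper side, so the two germs exchange
    their roles. *)
Lemma crossing_sides gamma Sigma g S x e f : setting gamma Sigma g -> punctured gamma Sigma (S x) -> rcont_on 0 1 S -> I01 x ->
 crosses gamma S x e -> branch_at gamma g (S x) f ->
 exists Pm Pp, holomorphic_at Pm (S x) /\ holomorphic_at Pp (S x) /\ germ_eq (S x) Pp (fun z => Pm z + RtoC e * f z)%C /\
 exists d, 0 < d /\ forall t, I01 t ->
  (x - d < t < x -> ~ image gamma (S t) /\ germ_eq (S t) (cauchy_integral gamma g) Pm) /\
  (x < t < x + d -> ~ image gamma (S t) /\ germ_eq (S t) (cauchy_integral gamma g) Pp).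
Proof.
 intros H Pa HS Hx [He [w [Dw Hw]]] Hf.
 assert (Hw' : forall s v, I01 s -> gamma s = S x -> velocity gamma s v -> 0 < cross v (RtoC e * w)).
 { intros s v A B D. rewrite cross_scal_r. eauto. }
 assert (Nw := positive_cross_nonzero gamma (S x) _ (gamma_piecewise_smooth _ _ _ H) (proj1 Pa) Hw').
 destruct (jump gamma Sigma g (S x) f (RtoC e * w)%C H Pa Hf Hw') as [rho [K [Phi [upper [lower SS]]]]].
 destruct (side_cone _ _ _ _ _ _ _ _ _ _ SS Nw) as [eta [Pe Cone]].
 apply rderiv_is_derive in Dw. destruct (Dw (eta / 2)) as [d1 [Pd1 K1]]. lra.
 assert (Prho := ss_rho SS).
 destruct (HS x Hx (rho / 2)) as [d2 [Pd2 K2]]. lra.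
 assert (ee : e * e = 1) by (destruct He; subst; lra).
 assert (Near : forall t, I01 t -> t <> x -> Rabs (t - x) < Rmin d1 d2 ->
  `|S t - S x| < rho /\ (0 < e * (t - x) -> upper (S t)) /\ (e * (t - x) < 0 -> lower (S t))).
 { intros t Ht Nt L. assert (L1 := lt_minl L). assert (L2 := lt_minr L).
  specialize (K1 t L1). specialize (K2 t Ht L2). assert (Pt : 0 < Rabs (t - x)) by (apply Rabs_pos_lt; lra).
  sp.
  assert (B : `|S t - S x - RtoC (t - x) * w| <= eta * Rabs (t - x)) by nra.
  split; intros Q; apply (Cone (S t) (Rabs (t - x)) Pt).
  - replace (RtoC (Rabs (t - x)) * (RtoC e * w))%C with (RtoC (t - x) * w)%C; auto.
   rewrite Cmult_assoc, <- RtoC_mult. do 2 f_equal. destruct He; subst e. rewrite Rabs_pos_eq; lra. rewrite Rabs_left; lra.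
  - replace (S t - S x + RtoC (Rabs (t - x)) * (RtoC e * w))%C with (S t - S x - RtoC (t - x) * w)%C; auto.
   rewrite Cmult_assoc, <- RtoC_mult. replace (Rabs (t - x) * e) with (- (t - x)). rewrite RtoC_opp; ring.
   destruct He; subst e. rewrite Rabs_left; lra. rewrite Rabs_pos_eq; lra. }
 assert (Pd : 0 < Rmin d1 d2) by pos.
 assert (HPhi := ss_Phi SS). assert (Hhf := ss_f SS).
 assert (Up : forall t, I01 t -> t <> x -> Rabs (t - x) < Rmin d1 d2 -> 0 < e * (t - x) -> ~ image gamma (S t) /\ germ_eq (S t) (cauchy_integral gamma g) (fun z => Phi z + f z)%C).
 { intros t Ht Nt L Q. destruct (Near t Ht Nt L) as [A [B _]]. apply (ss_upper SS); auto. }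
 assert (Lo : forall t, I01 t -> t <> x -> Rabs (t - x) < Rmin d1 d2 -> e * (t - x) < 0 -> ~ image gamma (S t) /\ germ_eq (S t) (cauchy_integral gamma g) Phi).
 { intros t Ht Nt L Q. destruct (Near t Ht Nt L) as [A [_ B]]. apply (ss_lower SS); auto. }
 assert (H1 : holomorphic_at Phi (S x)). { apply hold_holomorphic_at with (1 := HPhi). self. }
 assert (H2 : holomorphic_at (fun z => Phi z + f z)%C (S x)).
 { apply hold_holomorphic_at with (S x) rho. intros z Hz. apply holo_plus; auto. self. }
 destruct He as [-> | ->].
 - exists Phi, (fun z => Phi z + f z)%C. sa. sa. split. { apply germ_eq_pointwise. intros z. ring. }
  exists (Rmin d1 d2). sa. intros t Ht. split; intros Q; [apply Lo|apply Up]; auto; try lra; rabs.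
 - exists (fun z => Phi z + f z)%C, Phi. sa. sa. split. { apply germ_eq_pointwise. intros z. ring. }
  exists (Rmin d1 d2). sa. intros t Ht. split; intros Q; [apply Up|apply Lo]; auto; try lra; rabs.
Qed.

Definition csum (l : list R) (F : R -> C) : C := fold_right Cplus (RtoC 0) (map F l).

Lemma csum_ext l F G : (forall t, In t l -> F t = G t) -> csum l F = csum l G.
Proof. unfold csum. intros H. induction l; simpl; auto. simpl in H. rewrite H, IHl; auto. Qed.

Lemma csum_plus l F G : csum l (fun t => F t + G t)%C = (csum l F + csum l G)%C.
Proof. unfold csum. induction l; simpl. ring. rewrite IHl. ring. Qed.

Lemma csum_zero l : csum l (fun _ => RtoC 0) = RtoC 0.
Proof. unfold csum. induction l; simpl; auto. rewrite IHl. ring. Qed.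

Lemma csum_single l x F : NoDup l -> csum l (fun t => if Req_EM_T t x then F t else RtoC 0) = (if in_dec Req_EM_T x l then F x else RtoC 0).
Proof.
 intros H. induction H as [|y l Ny Hl IH]. auto.
 change (csum (y :: l) (fun t => if Req_EM_T t x then F t else RtoC 0)) with ((if Req_EM_T y x then F y else RtoC 0) + csum l (fun t => if Req_EM_T t x then F t else RtoC 0))%C.
 rewrite IH. destruct (in_dec Req_EM_T x (y :: l)) as [i|i]; destruct (in_dec Req_EM_T x l) as [j|j]; destruct (Req_EM_T y x); subst; try contradiction; try ring;
  exfalso; simpl in *; tauto.
Qed.

(** The family of germs [Psi] has one-sided analytic continuations at [x]: just before [x] it is
    [Pm] and just after it is [Pp]. Both are holomorphic at [S x], even where the path crosses the
    curve. *)
Definition lateral (S : R -> C) (x : R) (Psi : R -> C -> C) (Pm Pp : C -> C) : Prop :=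
 holomorphic_at Pm (S x) /\ holomorphic_at Pp (S x) /\ exists d, 0 < d /\ forall t, I01 t ->
  (x - d < t < x -> germ_eq (S t) (Psi t) Pm) /\ (x < t < x + d -> germ_eq (S t) (Psi t) Pp).

Lemma holomorphic_at_map2 (op : C -> C -> C) f h z : (forall f h z, holo f z -> holo h z -> holo (fun z => op (f z) (h z)) z) ->
 holomorphic_at f z -> holomorphic_at h z -> holomorphic_at (fun z => op (f z) (h z)) z.
Proof.
 intros K A B. apply holomorphic_at_hold in A. destruct A as [r [Pr A]]. apply holomorphic_at_hold in B. destruct B as [r' [Pr' B]].
 apply holomorphic_at_hold. exists (Rmin r r'). sp.
 intros t Ht. apply K; [apply A|apply B]; eapply Rlt_le_trans; try apply Ht. ar. ar.
Qed.

Lemma lateral_map2 (op : C -> C -> C) S x Psi Psi' Pm Pp Pm' Pp' : (forall f h z, holo f z -> holo h z -> holo (fun z => op (f z) (h z)) z) ->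
 lateral S x Psi Pm Pp -> lateral S x Psi' Pm' Pp' ->
 lateral S x (fun t z => op (Psi t z) (Psi' t z)) (fun z => op (Pm z) (Pm' z)) (fun z => op (Pp z) (Pp' z)).
Proof.
 intros Hop [A [B [d [Pd K]]]] [A' [B' [d' [Pd' K']]]]. split. now apply holomorphic_at_map2. split. now apply holomorphic_at_map2.
 exists (Rmin d d'). sp. intros t Ht. rmin.
 destruct (K t Ht) as [K1 K2]. destruct (K' t Ht) as [K1' K2'].
 split; intros Q; [specialize (K1 LRA); specialize (K1' LRA)|specialize (K2 LRA); specialize (K2' LRA)].
 - apply (germ_eq_rel _ _ _ _ _ _ K1 K1'). congruence.
 - apply (germ_eq_rel _ _ _ _ _ _ K2 K2'). congruence.
Qed.

Lemma lateral_const S x f : holomorphic_at f (S x) -> lateral S x (fun _ => f) f f.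
Proof. intros H. sa. sa. exists 1. sp. intros t Ht. split; intros; apply germ_eq_refl. Qed.

(** The term of the crossing [s] is switched on once [s] has been passed. At [x = s] it is absent on
    the left and present on the right, whence the strict and the weak inequality. *)
Lemma lateral_jump S x s F e : I01 s -> I01 x -> continuation_along S s 1 F ->
 lateral S x (fun t z => if Rlt_dec s t then RtoC e * F t z else RtoC 0)%C
  (fun z => if Rlt_dec s x then RtoC e * F x z else RtoC 0)%C (fun z => if Rle_dec s x then RtoC e * F x z else RtoC 0)%C.
Proof.
 intros Hs Hx HF.
 assert (H0 : holomorphic_at (fun _ => RtoC 0) (S x)). { apply holomorphic_at_ex. auto. }
 assert (H1 : s <= x -> holomorphic_at (fun z => RtoC e * F x z)%C (S x)).
 { intros L. destruct (HF x) as [A _]. ar. apply (holomorphic_at_map2 Cmult (fun _ => RtoC e)); auto. apply holomorphic_at_ex. auto. }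
 unfold I01 in *. split. destruct (Rlt_dec s x); auto. apply H1; lra. split. destruct (Rle_dec s x); auto.
 destruct (Rle_lt_dec s x) as [L|L].
 - destruct (HF x) as [_ [d [Pd K]]]. lra. exists (Rmin d (if Rlt_dec s x then x - s else 1)). split. apply Rmin_glb_lt; auto. destruct (Rlt_dec s x); lra.
  intros t Ht. rmin.
  split; intros Q.
  + destruct (Rlt_dec s x). destruct (Rlt_dec s t); [|lra]. apply germ_eq_mult. apply germ_eq_refl. apply K. lra. rabs.
   destruct (Rlt_dec s t); [lra|]. apply germ_eq_refl.
  + unfold I01 in Ht. assert (Q2 : x < t < x + d) by lra. destruct (Rle_dec s x); [|lra]. destruct (Rlt_dec s t); [|lra]. apply germ_eq_mult. apply germ_eq_refl. apply K. lra. rabs.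
 - exists (s - x). sp. intros t Ht. destruct (Rlt_dec s x); [lra|]. destruct (Rle_dec s x); [lra|].
  split; intros Q; destruct (Rlt_dec s t); try lra; apply germ_eq_refl.
Qed.

Lemma lateral_csum S x l Psi Pm Pp : (forall s, In s l -> lateral S x (Psi s) (Pm s) (Pp s)) ->
 lateral S x (fun t z => csum l (fun s => Psi s t z)) (fun z => csum l (fun s => Pm s z)) (fun z => csum l (fun s => Pp s z)).
Proof.
 induction l as [|s l IH]; intros H.
 - apply (lateral_const S x (fun _ => RtoC 0)). apply holomorphic_at_ex. auto.
 - apply (lateral_map2 Cplus). auto. apply H. now left. apply IH. intros; apply H. now right.
Qed.

(** [E] is meaningful only at the parameters in [N], those off the curve. The germs [Psi] fill the
    isolated gaps, and choosing one at each parameter gives an ordinary continuation. *)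
Lemma punctured_continuation_zero S (E : R -> C -> C) (N : R -> Prop) : rcont_on 0 1 S ->
 (forall x, I01 x -> exists Psi d, 0 < d /\ holomorphic_at Psi (S x) /\ forall t, I01 t -> Rabs (t - x) < d ->
  (t <> x -> N t) /\ (N t -> germ_eq (S t) (E t) Psi)) ->
 N 0 -> N 1 -> germ_eq (S 0) (E 0) (fun _ => RtoC 0) -> germ_eq (S 1) (E 1) (fun _ => RtoC 0).
Proof.
 intros HS H N0 N1 H0.
 destruct (choice_on I01 _ (fun _ => RtoC 0) H) as [F HF].
 assert (EF : forall x, I01 x -> N x -> germ_eq (S x) (E x) (F x)).
 { intros x Hx Nx. destruct (HF x Hx) as [d [Pd [_ K]]]. apply K; auto. rabs. }
 assert (I0 : I01 0) by ar. assert (I1 : I01 1) by ar.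
 apply germ_eq_trans with (F 1); auto.
 apply (continuation_zero S 0 1 F); auto. lra.
 2: { apply germ_eq_trans with (E 0); auto. now apply germ_eq_sym, EF. }
 intros x Hx. destruct (HF x Hx) as [d [Pd [Hh K]]]. sa.
 apply holomorphic_at_hold in Hh. destruct Hh as [r [Pr Hh]]. destruct (HS x Hx r Pr) as [d1 [Pd1 K1]].
 exists (Rmin d d1). sp. intros t Ht L.
 assert (L1 := lt_minl L). assert (L2 := lt_minr L).
 destruct (Req_dec t x) as [->|Ntx]. apply germ_eq_refl.
 apply germ_eq_trans with (E t). apply germ_eq_sym, EF; auto. apply K; auto. apply K; auto. apply K; auto.
Qed.

Lemma continuous_on_rcont_on S : continuous_on (T := R_UniformSpace) (U := C_UniformSpace) I01 S <-> rcont_on 0 1 S.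
Proof.
 split.
 - intros H x Hx e He.
  assert (L : locally (T := C_UniformSpace) (S x) (fun z : C => `|z - S x| < e)) by (apply locally_Cmod; eauto).
  apply (H x Hx) in L. destruct (proj1 (locally_Rabs x _) L) as [d [Pd K]]. eauto.
 - intros H x Hx P HP. apply locally_Cmod in HP. destruct HP as [e [Pe HP]]. destruct (H x Hx e Pe) as [d [Pd K]].
  apply locally_Rabs. eauto.
Qed.

Lemma component_absorbs E D a K : is_component E D -> D a -> connected K -> (forall z, K z -> E z) -> K a -> forall z, K z -> D z.
Proof.
 intros [_ [HE [Hc Hm]]] Da HK KE Ka. destruct (component_of E a (HE a Da)) as [D' [[_ [HE' [Hc' _]]] [Da' HD']]]. eauto.
Qed.

Lemma connected_ball a r : connected (fun z : C => `|z - a| < r).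
Proof.
 apply (connected_star _ a). intros z Hz. exists (fun w => exists s, 0 <= s <= 1 /\ seg a z s = w). split.
 { apply connected_arc. apply rcont_rcont_on. intros; apply rcont_seg. }
 assert (Pr : 0 < r) by cm.
 split. { intros w [s [Hs <-]]. apply seg_ball; auto. self. }
 split. exists 0. sp. apply seg_0. exists 1. sp. apply seg_1.
Qed.

Lemma component_ball gamma D a : piecewise_smooth gamma -> is_component (fun z => ~ image gamma z) D -> D a ->
 exists r, 0 < r /\ forall z, `|z - a| < r -> D z.
Proof.
 intros HP HD Da. assert (Na : ~ image gamma a) by (destruct HD as [_ [H _]]; now apply H).
 destruct (off_image_ball gamma a HP Na) as [r [Pr K]]. exists r. sa.
 apply (component_absorbs _ D a _ HD Da (connected_ball a r)).
 - intros z Hz [s [Hs <-]]. specialize (K s Hs). lra.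
 - self.
Qed.

Lemma holomorphic_at_ext f h a : germ_eq a f h -> holomorphic_at f a -> holomorphic_at h a.
Proof.
 intros E H. apply holomorphic_at_hold in H. destruct H as [r [Pr H]]. apply germ_eq_Cmod in E. destruct E as [r' [Pr' E]].
 apply holomorphic_at_hold. exists (Rmin r r'). sp.
 apply hold_ext with f. intros w Hw. apply E. ar.
 apply hold_sub with (1 := H). rewrite Cmod_sub_self. ar.
Qed.

Lemma branch_at_ext gamma g a f h : branch_at gamma g a f -> germ_eq a f h -> branch_at gamma g a h.
Proof.
 intros [A B] E. split. now apply (holomorphic_at_ext f). apply germ_eq_Cmod in E. destruct E as [r [Pr E]]. apply locally_Cmod in B. destruct B as [r' [Pr' B]].
 apply locally_Cmod. exists (Rmin r r'). sp. intros z Hz Iz. rewrite <- E. apply B; auto.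
 apply (lt_minr Hz). apply (lt_minl Hz).
Qed.

Lemma germ_eq_near a f h : germ_eq a f h -> exists r, 0 < r /\ forall b, `|b - a| < r -> germ_eq b f h.
Proof.
 intros E. apply germ_eq_Cmod in E. destruct E as [r [Pr E]]. exists r. sa. intros b Hb. apply germ_eq_Cmod. exists (r - `|b - a|).
 sp. intros w Hw. apply E. triang.
Qed.

Lemma csum_germ a l F G : (forall s, In s l -> germ_eq a (F s) (G s)) -> germ_eq a (fun w => csum l (fun s => F s w)) (fun w => csum l (fun s => G s w)).
Proof.
 induction l as [|s l IH]; intros H. apply germ_eq_refl. apply (germ_eq_plus a (F s) (G s)). apply H. now left. apply IH. intros; apply H. now right.
Qed.

(** The germ [q (I - G) - p] vanishes at the start. At each crossing [I] and the partial sum [G]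
    have the same jump, so it continues and vanishes at the end, where [q I = p] again. *)
Lemma sum_of_branches_of_rational gamma Sigma g D c S h : setting gamma Sigma g -> is_component (fun z => ~ image gamma z) D -> D c ->
 rational_on D (cauchy_integral gamma g) -> admissible gamma Sigma g c c S -> sum_of_branches gamma g S h ->
 germ_eq c h (fun _ => RtoC 0).
Proof.
 intros H HD Dc [p [q [Nq Hpq]]] [Nc [_ [HS [S0 [S1 [HU HX]]]]]] [l [e [k [Hnd [Hl [Hk Hh]]]]]].
 apply continuous_on_rcont_on in HS.
 set (I := cauchy_integral gamma g) in *.
 destruct (component_ball gamma D c (gamma_piecewise_smooth _ _ _ H) HD Dc) as [r0 [Pr0 Kr0]].
 destruct (choice_on (fun s => In s l) (fun s Fs => continuation_along S s 1 Fs /\ branch_at gamma g (S s) (Fs s) /\ germ_eq (S 1) (Fs 1) (k s)) (fun _ _ => RtoC 0)) as [F HF].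
 { intros s i.
  destruct (Hk s i) as [_ [f [[Hf1 Hf2] [Fs [A [B D']]]]]]. exists Fs. sa. sa.
  assert (Is : I01 s) by (apply Hl; auto). unfold I01 in Is.
  apply branch_at_ext with f. easy. now apply germ_eq_sym. }
 (* The partial sum of the crossings strictly before [t]. Since [c] is off the curve no crossing has
    parameter [0] or [1], so [G] is empty at the start and complete at the end. *)
 set (G := fun t z => csum l (fun s => if Rlt_dec s t then (RtoC (e s) * F s t z)%C else RtoC 0)).
 set (E := fun t z => (peval q z * (I z - G t z) - peval p z)%C).
 assert (EE : germ_eq (S 1) (E 1) (fun _ => RtoC 0)).
 { apply (punctured_continuation_zero S E (fun t => ~ image gamma (S t)) HS); try now rewrite ?S0, ?S1.
  - intros x Hx.
   set (Gm := fun z => csum l (fun s => if Rlt_dec s x then (RtoC (e s) * F s x z)%C else RtoC 0)).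
   set (Gp := fun z => csum l (fun s => if Rle_dec s x then (RtoC (e s) * F s x z)%C else RtoC 0)).
   assert (LG : lateral S x G Gm Gp).
   { unfold G, Gm, Gp. apply (lateral_csum S x l (fun s t z => if Rlt_dec s t then (RtoC (e s) * F s t z)%C else RtoC 0)
     (fun s z => if Rlt_dec s x then (RtoC (e s) * F s x z)%C else RtoC 0) (fun s z => if Rle_dec s x then (RtoC (e s) * F s x z)%C else RtoC 0)).
    intros s Hs. apply lateral_jump; auto. apply Hl; auto. now apply HF. }
   (* Passing from the left to the right of [x] adds one term if [x] is a crossing, and none
      otherwise. *)
   assert (EG : forall z, Gp z = (Gm z + if in_dec Req_EM_T x l then (RtoC (e x) * F x x z)%C else RtoC 0)%C).
   { intros z. rewrite <- (csum_single l x (fun s => (RtoC (e s) * F s x z)%C)) by auto. unfold Gm. rewrite <- csum_plus. apply csum_ext.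
    intros s Hs. destruct (Rle_dec s x), (Rlt_dec s x), (Req_EM_T s x); try lra; ring. }
   assert (exists Pm Pp, lateral S x (fun _ => I) Pm Pp /\ germ_eq (S x) Pp (fun z => Pm z + if in_dec Req_EM_T x l then (RtoC (e x) * F x x z)%C else RtoC 0)%C
    /\ (~ image gamma (S x) -> Pm = I) /\ exists d, 0 < d /\ forall t, I01 t -> Rabs (t - x) < d -> t <> x -> ~ image gamma (S t))
    as [Pm [Pp [LI [EP [EI [d1 [Pd1 K1]]]]]]].
   { destruct (in_dec Req_EM_T x l) as [i|i].
    - destruct (HF x i) as [_ [Hb _]]. destruct (Hk x i) as [Hc _]. assert (Hi : image gamma (S x)) by (apply Hl; auto).
     destruct (crossing_sides gamma Sigma g S x (e x) (F x x) H) as [Pm [Pp [A [B [C0 [d [Pd K]]]]]]]; auto.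
     { sa. destruct (HU x Hx); auto. }
     exists Pm, Pp. split. { sa. sa. exists d. sa. intros t Ht. split; intros Q; now apply (K t Ht). }
     sa. split. easy. exists d. sa. intros t Ht L N. apply Rabs_def2 in L.
     destruct (Rtotal_order t x) as [Q|[Q|Q]]; [apply (proj1 (K t Ht)); lra|lra|apply (proj2 (K t Ht)); lra].
    - assert (Hi : ~ image gamma (S x)) by (intros Q; apply i, Hl; auto).
     destruct (off_image_ball gamma (S x) (gamma_piecewise_smooth _ _ _ H) Hi) as [r [Pr Kr]].
     exists I, I. split. { apply lateral_const. apply holomorphic_at_hold. exists r. sa. intros z Hz. apply (cauchy_integral_holo gamma Sigma); auto.
      intros [s [Hs <-]]. specialize (Kr s Hs). lra. }
     split. { apply germ_eq_pointwise. intros z. ring. } sa.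
     destruct (HS x Hx r Pr) as [d [Pd K]]. exists d. sa. intros t Ht L _ [s [Hs E0]]. specialize (Kr s Hs). specialize (K t Ht L). rewrite <- E0 in K. lra. }
   assert (Hp : forall p, lateral S x (fun _ => peval p) (peval p) (peval p)).
   { intros p'. apply lateral_const, holomorphic_at_ex, holo_peval. }
   assert (LE : lateral S x E (fun z => peval q z * (Pm z - Gm z) - peval p z)%C (fun z => peval q z * (Pp z - Gp z) - peval p z)%C).
   { apply (lateral_map2 Cminus S x (fun t z => peval q z * (I z - G t z))%C (fun _ => peval p)); auto using holo_minus.
    apply (lateral_map2 Cmult S x (fun _ => peval q) (fun t z => I z - G t z)%C); auto.
    apply (lateral_map2 Cminus S x (fun _ => I)); auto using holo_minus. }
   destruct LE as [L1 [_ [d2 [Pd2 K2]]]].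
   destruct (germ_eq_near _ _ _ EP) as [r [Pr Kr]]. destruct (HS x Hx r Pr) as [d3 [Pd3 K3]].
   exists (fun z => peval q z * (Pm z - Gm z) - peval p z)%C, (Rmin d1 (Rmin d2 d3)).
   split. pos. sa.
   intros t Ht L. rmin.
   split. apply K1; auto; lra.
   intros Nt. destruct (Rtotal_order t x) as [Q|[Q|Q]].
   + apply Rabs_def2 in L. apply (proj1 (K2 t Ht)). lra.
   + subst t. apply germ_eq_pointwise. intros z. rewrite EI; auto.
   + destruct (K2 t Ht) as [_ K2']. apply Rabs_def2 in L. specialize (K2' LRA).
    assert (Kt : germ_eq (S t) Pp (fun z => Pm z + if in_dec Req_EM_T x l then (RtoC (e x) * F x x z)%C else RtoC 0)%C).
    { apply Kr, K3; auto. rabs. }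
    apply (germ_eq_rel _ _ _ _ _ _ K2' Kt). intros z -> ->. rewrite EG. ring.
  - rewrite S0. apply germ_eq_Cmod. exists r0. sa. intros z Hz. destruct (Hpq z (Kr0 z Hz)) as [Nz Ez]. unfold E. fold I in Ez. rewrite Ez.
   assert (EG0 : G 0 z = RtoC 0). { unfold G. transitivity (csum l (fun _ => RtoC 0)); [|apply csum_zero]. apply csum_ext. intros s Hs. apply Hl in Hs. destruct Hs as [Hs _]. unfold I01 in Hs. destruct (Rlt_dec s 0); [lra|auto]. }
   rewrite EG0. field. auto. }
 assert (EG1 : germ_eq c (fun w => csum l (fun s => RtoC (e s) * k s w)%C) (G 1)).
 { apply (csum_germ c l (fun s w => RtoC (e s) * k s w)%C (fun s w => if Rlt_dec s 1 then RtoC (e s) * F s 1 w else RtoC 0)%C).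
  intros s Hs. destruct (HF s Hs) as [_ [_ A]]. rewrite S1 in A. destruct (Rlt_dec s 1).
  - apply germ_eq_mult. apply germ_eq_refl. now apply germ_eq_sym.
  - exfalso. apply Hl in Hs. destruct Hs as [[_ Hs] Hi]. assert (s = 1) by lra. congruence. }
 rewrite S1 in Hh, EE. apply germ_eq_trans with (1 := Hh). apply germ_eq_trans with (1 := EG1).
 apply germ_eq_Cmod in EE. destruct EE as [r1 [Pr1 K1]]. apply germ_eq_Cmod. exists (Rmin r0 r1). sp.
 intros z Hz. specialize (K1 z (lt_minr Hz)). destruct (Hpq z (Kr0 z (lt_minl Hz))) as [Nz Ez].
 unfold E in K1. fold I in Ez. rewrite Ez in K1.
 assert (K2 : (peval q z * G 1 z)%C = RtoC 0). { replace (peval q z * G 1 z)%C with (- (peval q z * (peval p z / peval q z - G 1 z) - peval p z))%C by (field; auto). rewrite K1. ring. }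
 apply Cmult_integral in K2. tauto.
Qed.

(** * Trivial monodromy implies rationality *)

Lemma rderiv_affine S w t k m : rderiv S (k * t + m) w -> rderiv (fun x => S (k * x + m)) t (RtoC k * w)%C.
Proof.
 intros H e He. assert (Pk : 0 < Rabs k + 1) by (generalize (Rabs_pos k); lra).
 destruct (H (e / (Rabs k + 1))) as [d [Pd K]]. pos.
 exists (d / (Rabs k + 1)). sp.
 intros s Hs. assert (E : k * s + m - (k * t + m) = k * (s - t)) by ring.
 assert (Q : Rabs k * Rabs (s - t) <= (Rabs k + 1) * Rabs (s - t)) by (generalize (Rabs_pos (s - t)); nra).
 assert (Q' : (Rabs k + 1) * Rabs (s - t) < d). { apply Rlt_div_r in Hs; lra. }
 specialize (K (k * s + m)). rewrite E, Rabs_mult in K. specialize (K LRA).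
 replace (RtoC (s - t) * (RtoC k * w))%C with (RtoC (k * (s - t)) * w)%C by (rewrite RtoC_mult; ring).
 eapply Rle_trans. eauto.
 apply Rle_trans with (e / (Rabs k + 1) * ((Rabs k + 1) * Rabs (s - t))).
 apply Rmult_le_compat_l; auto. nra. right. field. lra.
Qed.

Lemma rcont_on_affine S k m a b a' b' : (forall t, a' <= t <= b' -> a <= k * t + m <= b) -> rcont_on a b S -> rcont_on a' b' (fun x => S (k * x + m)).
Proof.
 intros HI H t Ht e He. destruct (H (k * t + m) (HI t Ht) e He) as [d [Pd K]].
 assert (Pk : 0 < Rabs k + 1) by (generalize (Rabs_pos k); lra).
 exists (d / (Rabs k + 1)). sp.
 intros s Hs L. apply K. auto. replace (k * s + m - (k * t + m)) with (k * (s - t)) by ring. rewrite Rabs_mult.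
 apply Rlt_div_r in L; auto. generalize (Rabs_pos (s - t)). nra.
Qed.

Lemma crosses_affine gamma S t e k m : 0 < k -> crosses gamma S (k * t + m) e -> crosses gamma (fun x => S (k * x + m)) t e.
Proof.
 intros Pk [He [w [Dw Hw]]]. sa. exists (RtoC k * w)%C. split.
 - apply rderiv_is_derive. apply rderiv_is_derive in Dw. now apply rderiv_affine.
 - intros s v A B D. rewrite cross_scal_r. specialize (Hw s v A B D). nra.
Qed.

Lemma crosses_local gamma S S' t e r : 0 < r -> (forall x, Rabs (x - t) < r -> S x = S' x) -> crosses gamma S t e -> crosses gamma S' t e.
Proof.
 intros Pr E [He [w [Dw Hw]]]. sa. exists w.
 assert (E0 : S t = S' t) by (apply E; rewrite Rminus_diag, Rabs_R0; auto).
 split; [|now rewrite <- E0].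
 apply rderiv_is_derive. apply rderiv_is_derive in Dw. intros x Hx. destruct (Dw x Hx) as [d [Pd K]].
 exists (Rmin d r). sp. intros s Hs. rewrite <- E0, <- E. apply K.
 apply (lt_minl Hs). apply (lt_minr Hs).
Qed.

(** * Germs annihilated by [P] and the finite exceptional set *)

Definition satisfies (P : list (list C)) (f : C -> C) (z : C) : Prop := locally z (fun w : C => peval2 P w (f w) = RtoC 0).

Lemma satisfies_ext P f h z : germ_eq z f h -> satisfies P f z -> satisfies P h z.
Proof.
 intros E H. apply (germ_eq_rel z _ (fun w => peval2 P w (f w)) (fun _ => RtoC 0) f h); auto. congruence.
Qed.

Lemma satisfies_continuation P S u v F : u <= v -> rcont_on u v S -> continuation_along S u v F -> satisfies P (F u) (S u) -> satisfies P (F v) (S v).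
Proof.
 intros L HS HF H. apply (continuation_zero S u v (fun t z => peval2 P z (F t z))); auto.
 intros t Ht. destruct (HF t Ht) as [A [d [Pd K]]]. split. now apply holomorphic_at_peval2.
 exists d. sa. intros t' Ht' L'. specialize (K t' Ht' L'). apply (germ_eq_rel _ _ _ _ _ _ K K). congruence.
Qed.

Lemma continuation_glue S u m v F K z d : rcont_on u v S -> u <= m <= v -> continuation_along S u m F -> hold K z d ->
 (forall t, m <= t <= v -> `|S t - z| < d) -> germ_eq (S m) (F m) K ->
 continuation_along S u v (fun t => if Rle_dec t m then F t else K).
Proof.
 intros HS Hm HF HK Hd E t Ht. destruct (Rle_dec t m) as [L|L].
 - destruct (HF t LRA) as [A [dl [Pdl Kd]]]. sa. destruct (Rlt_dec t m) as [L'|L'].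
  + exists (Rmin dl (m - t)). sp. intros t' Ht' Q. assert (Q1 := lt_minl Q). assert (Q2 := lt_minr Q).
   apply Rabs_def2 in Q2. destruct (Rle_dec t' m); [|lra]. apply Kd; auto. lra.
  + assert (t = m) by lra. subst t. destruct (germ_eq_near _ _ _ E) as [r [Pr Kr]]. destruct (HS m Ht r Pr) as [d' [Pd' K']].
   exists (Rmin dl d'). sp. intros t' Ht' Q. assert (Q1 := lt_minl Q). assert (Q2 := lt_minr Q).
   destruct (Rle_dec t' m). apply Kd; auto. lra. apply germ_eq_sym, Kr, K'; auto.
 - split. apply hold_holomorphic_at with z d; auto. apply Hd. lra.
  exists (t - m). sp. intros t' Ht' Q. apply Rabs_def2 in Q. destruct (Rle_dec t' m); [lra|]. apply germ_eq_refl.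
Qed.

(** Off [Z] a germ annihilated by [P], once continued into the disc around [z], extends to the whole
    disc. So a continuation up to [z] can be completed, and [z] is not singular. This makes [Sigma1]
    finite. *)
Lemma Sigma1_bad gamma Sigma g P Z z : setting gamma Sigma g -> (forall z, punctured gamma Sigma z -> has_branch gamma g P z) ->
 extends_off P Z -> Sigma1 gamma Sigma g z -> In z Z.
Proof.
 intros H HB HZ [[S [f [HS [S0 [S1 [Hf [Hc Nc]]]]]]] _]. apply NNPP. intros Nz. apply Nc. clear Nc.
 apply continuous_on_rcont_on in HS. destruct (HZ z Nz) as [d [Pd Kd]].
 destruct (HS 1 LRA d Pd) as [dl [Pdl Kdl]]. rewrite S1 in Kdl.
 (* From [m] on the path stays in the disc where every germ extends. *)
 set (m := Rmax 0 (1 - dl / 2)). assert (Hm : 0 <= m < 1) by (unfold m; split; [apply Rmax_l|apply Rmax_lub_lt; lra]).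
 assert (Hm' : 1 - dl / 2 <= m) by apply Rmax_r.
 assert (Near : forall t, m <= t <= 1 -> `|S t - z| < d). { intros t Ht. apply Kdl. lra. rabs. }
 destruct (Hc m Hm) as [h [F [HF [F0 Fm]]]].
 assert (HSm : rcont_on 0 m S) by (rsub HS).
 assert (Pm : satisfies P (F m) (S m)).
 { apply (satisfies_continuation P S 0 m F); auto. lra. apply satisfies_ext with f. now apply germ_eq_sym.
  apply (branch_algebraic gamma Sigma g P); auto. }
 destruct (Kd (S m) (F m)) as [K [HK EK]]; auto. apply Near; lra. apply HF; lra.
 exists K, (fun t => if Rle_dec t m then F t else K). split; [|split].
 - apply continuation_glue with z d; auto. lra. now apply germ_eq_sym.
 - destruct (Rle_dec 0 m); [|lra]. auto.
 - destruct (Rle_dec 1 m); [lra|]. apply germ_eq_refl.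
Qed.

Definition good_disc (P : list (list C)) (Bad : list C) (a : C) (d : R) : Prop :=
 0 < d /\ (forall z, `|z - a| < d -> ~ In z Bad) /\
 forall z f, `|z - a| < d -> holomorphic_at f z -> satisfies P f z -> exists F, hold F a d /\ germ_eq z F f.

Lemma good_disc_sub P Bad a d d' : good_disc P Bad a d -> 0 < d' <= d -> good_disc P Bad a d'.
Proof.
 intros [Pd [HB HE]] Hd. sp. split. { intros z Hz. apply HB. lra. }
 intros z f Hz Hf Pf. destruct (HE z f) as [F [HF EF]]; auto. lra. exists F. sa. apply hold_sub with (1 := HF). self.
Qed.

Lemma good_disc_exists P Z Bad a : extends_off P Z -> (forall z, In z Z -> In z Bad) -> ~ In a Bad -> exists d, good_disc P Bad a d.
Proof.
 intros HZ HB Na. destruct (HZ a) as [d [Pd Kd]]; auto. destruct (list_isolated Bad a) as [r [Pr Kr]].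
 exists (Rmin d r). assert (0 < Rmin d r) by pos. sa. split.
 - intros z Hz Bz. assert (z <> a) by congruence. specialize (Kr z Bz H0). ar.
 - intros z f Hz Hf Pf. rmin. destruct (Kd z f) as [F [HF EF]]; auto. lra. exists F. sa. apply hold_sub with (1 := HF). self.
Qed.

(** A finite list that contains every point where some local argument may fail. It may be larger
    than the complement of [U] and may contain corners of the curve or the base point; paths are
    chosen to avoid it. *)
Record bad_set (gamma : R -> C) (Sigma : list C) (g : C -> C) (P : list (list C)) (Bad : list C) : Prop := {
 bs_nonzero : pnonzero2 P;
 bs_branch : forall z, punctured gamma Sigma z -> has_branch gamma g P z;
 bs_disc : forall a, ~ In a Bad -> exists d, good_disc P Bad a d;
 bs_U : forall z, ~ In z Bad -> U_set gamma Sigma g z;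
 bs_regular : forall a, ~ In a Bad -> image gamma a -> exists v, v <> RtoC 0 /\ forall s w, I01 s -> gamma s = a -> velocity gamma s w -> w = v
}.

Arguments bs_nonzero {_ _ _ _ _}.
Arguments bs_branch {_ _ _ _ _}.
Arguments bs_disc {_ _ _ _ _}.
Arguments bs_U {_ _ _ _ _}.
Arguments bs_regular {_ _ _ _ _}.

Lemma bad_set_exists gamma Sigma g : setting gamma Sigma g -> exists P Bad, bad_set gamma Sigma g P Bad.
Proof.
 intros H. destruct (algebraic_global gamma Sigma g H) as [P [NP HB]]. destruct (algebraic_continuation P NP) as [Z HZ].
 destruct (piecewise_breaks gamma (gamma_piecewise_smooth _ _ _ H)) as [L [L0 [L1 HL]]].
 exists P, (Z ++ Sigma ++ map gamma L). constructor; auto.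
 - intros a Na. apply good_disc_exists with Z; auto. intros z Hz. apply in_or_app. auto.
 - intros z Nz. rewrite !in_app_iff in Nz. split. auto. intros Hz. apply (Sigma1_bad gamma Sigma g P Z) in Hz; auto.
 - intros a Na [s [Hs Es]]. rewrite !in_app_iff in Na.
  assert (Ns : ~ In s L). { intros Q. apply Na. right. right. rewrite <- Es. now apply in_map. }
  destruct (HL s Hs Ns) as [h [Ph [A [B SA]]]]. destruct (smooth_arc_eq gamma _ _ SA) as [d [d' [Dd [_ Ed]]]].
  (* A second preimage would make [a] a multiple point, hence a point of [Sigma]; the closing pair
     is excluded because [s] is interior. *)
  exists (d' s). split. { apply Ed. lra. }
  intros t w Ht Et Hw. assert (t = s).
  { destruct (Req_dec t s) as [|N]; auto. exfalso. apply Na. right. left.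
   destruct (Rdichotomy t s N) as [Q|Q].
   - rewrite <- Et. apply (Sigma_multiple_points _ _ _ H t s). unfold self_intersection, I01 in *. repeat split; try lra. congruence. 
   - rewrite <- Es. apply (Sigma_multiple_points _ _ _ H s t). unfold self_intersection, I01 in *. repeat split; try lra. congruence. }
  subst t. apply (velocity_smooth gamma s h d d' w Ph Dd); auto. intros x Hx. now apply Ed.
Qed.

Lemma hold_csum l (F : R -> C -> C) a d : (forall t, In t l -> hold (F t) a d) -> hold (fun z => csum l (fun t => F t z)) a d.
Proof.
 induction l as [|t l IH]; intros H z Hz. apply (holo_const (RtoC 0)).
 apply (holo_plus (F t) (fun z => csum l (fun t => F t z))). apply (H t); simpl; auto. apply IH; auto. intros; apply H. now right.
Qed.

Lemma hold_equal f h a d b : hold f a d -> hold h a d -> `|b - a| < d -> germ_eq b f h -> forall z, `|z - a| < d -> f z = h z.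
Proof.
 intros Hf Hh Hb E z Hz. apply Cminus_eq0. apply (hold_identity (fun z => f z - h z)%C a d b); auto.
 intros w Hw. auto.
 apply (germ_eq_rel _ _ _ _ _ _ E E). intros w -> _. ring.
Qed.

(** * Concatenation of paths and polygonal paths avoiding a finite set *)

Lemma csum_app l1 l2 F : csum (l1 ++ l2) F = (csum l1 F + csum l2 F)%C.
Proof. unfold csum. induction l1; simpl. ring. rewrite IHl1. ring. Qed.

Lemma csum_map l (k : R -> R) F : csum (map k l) F = csum l (fun t => F (k t)).
Proof. unfold csum. now rewrite map_map. Qed.

(** The segment to [d] is attached on [[T,T+1]] without rescaling, so that the crossing parameters
    of [S] remain unchanged. *)
Definition append (S : R -> C) T d t := if Rle_dec t T then S t else seg (S T) d (t - T).

Lemma append_l S T d t : t <= T -> append S T d t = S t.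
Proof. intros Ht. unfold append. destruct (Rle_dec t T); auto; lra. Qed.

Lemma append_r S T d t : T <= t -> append S T d t = seg (S T) d (t - T).
Proof. intros Ht. unfold append. destruct (Rle_dec t T); auto. replace t with T by lra. rewrite Rminus_diag, seg_0; auto. Qed.

Lemma append_end S T d : append S T d (T + 1) = d.
Proof. rewrite append_r by lra. replace (T + 1 - T) with 1 by ring. apply seg_1. Qed.

Lemma crosses_append gamma S T d t e : t < T -> crosses gamma S t e -> crosses gamma (append S T d) t e.
Proof.
 intros Ht. apply (crosses_local gamma S _ t e (T - t)). lra. intros x Hx. apply Rabs_def2 in Hx. rewrite append_l; auto. lra.
Qed.

Lemma continuation_append S T d t F : continuation_along S t T F -> continuation_along (append S T d) t T F.
Proof.
 intros D x Hx. destruct (D x Hx) as [D1 [q [Pq D2]]]. rewrite append_l by lra. sa. exists q. sa. intros y Hy L. rewrite append_l by lra. auto.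
Qed.

Lemma rcont_on_append S T d : rcont_on 0 T S -> 0 < T -> rcont_on 0 (T + 1) (append S T d).
Proof.
 intros HS PT. set (S' := append S T d).
 intros t Ht x Hx.
  assert (A1 : t <= T -> exists q, 0 < q /\ forall s, 0 <= s <= T -> Rabs (s - t) < q -> `|S' s - S' t| < x).
  { intros L. destruct (HS t LRA x Hx) as [q [Pq Kq]]. exists q. sa. intros s Hs L'. unfold S'; rewrite !append_l by lra. auto. }
  assert (A2 : T <= t -> exists q, 0 < q /\ forall s, T <= s -> Rabs (s - t) < q -> `|S' s - S' t| < x).
  { intros L. destruct (rcont_seg (S T) d (t - T) x Hx) as [q [Pq Kq]]. exists q. sa. intros s Hs L'. unfold S'; rewrite !append_r by lra. apply Kq. now replace (s - T - (t - T)) with (s - t) by ring. }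
  destruct (Rtotal_order t T) as [L|[L|L]].
  - destruct (A1 LRA) as [q [Pq Kq]]. exists (Rmin q (T - t)). sp. intros s Hs Q.
   assert (Q1 := lt_minl Q). assert (Q2 := lt_minr Q). apply Rabs_def2 in Q2. apply Kq; auto. lra.
  - destruct (A1 LRA) as [q [Pq Kq]]. destruct (A2 LRA) as [q' [Pq' Kq']]. exists (Rmin q q'). sp. intros s Hs Q.
   assert (Q1 := lt_minl Q). assert (Q2 := lt_minr Q). destruct (Rle_dec s T). apply Kq; auto; lra. apply Kq'; auto; lra.
  - destruct (A2 LRA) as [q [Pq Kq]]. exists (Rmin q (t - T)). sp. intros s Hs Q.
   assert (Q1 := lt_minl Q). assert (Q2 := lt_minr Q). apply Rabs_def2 in Q2. apply Kq; auto. lra. 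
Qed.

Lemma seg_rev a b t : seg b a t = seg a b (1 - t).
Proof. unfold seg. rewrite RtoC_minus. ring. Qed.

Lemma rderiv_seg a b t : rderiv (seg a b) t (b - a)%C.
Proof.
 intros e He. exists 1. sp. intros s _. unfold seg. replace (a + RtoC s * (b - a) - (a + RtoC t * (b - a)) - RtoC (s - t) * (b - a))%C with (RtoC 0) by (rewrite RtoC_minus; ring).
 rewrite Cmod_0. generalize (Rabs_pos (s - t)). nra.
Qed.

(* Moving the corner along the perpendicular bisector, each point of [L] is met for at most one position. *)
Lemma polyline_avoiding (L : list C) a b e : ~ In a L -> ~ In b L -> 0 < e -> exists x, 0 < x < e /\
 forall t, 0 <= t <= 1 -> ~ In (seg a (seg a b (1 / 2) + RtoC x * Ci * (b - a))%C t) L /\ ~ In (seg (seg a b (1 / 2) + RtoC x * Ci * (b - a))%C b t) L.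
Proof.
 intros Na Nb He.
 set (q := fun z w => ((z - w) / (b - a))%C).
 (* In the coordinate [q], the points of the first leg are [t (1/2 + i x)] as seen from [a], and
    those of the second [(1-t) (-1/2 + i x)] as seen from [b]. So a point of [L] on a leg determines
    [x]. *)
 set (X := map (fun z => Im (q z a) / (2 * Re (q z a))) L ++ map (fun z => - Im (q z b) / (2 * Re (q z b))) L).
 destruct (Rlist_isolated X 0) as [q0 [Pq0 Kq0]].
 assert (exists x, 0 < x < e /\ ~ In x X) as [x [Hx Nx]].
 { set (x := Rmin (q0 / 2) (e / 2)). assert (0 < x) by pos. exists x. generalize (Rmin_l (q0 / 2) (e / 2)) (Rmin_r (q0 / 2) (e / 2)). fold x. intros.
  sp. intros i. specialize (Kq0 x i LRA). rewrite Rminus_0_r, Rabs_pos_eq in Kq0; lra. }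
 exists x. sa. intros t Ht.
 destruct (classic (b = a)) as [->|N].
 { assert (E : (seg a a (1 / 2) + RtoC x * Ci * (a - a))%C = a) by (unfold seg; ring). rewrite E. unfold seg. replace (a + RtoC t * (a - a))%C with a by ring. auto. }
 apply Cminus_neq0 in N.
 assert (E1 : seg a b (1 / 2) = (a + RtoC (1 / 2) * (b - a))%C) by auto.
 assert (RH : RtoC (1 / 2) = (/ RtoC 2)%C). { replace (1 / 2) with (/ 2) by lra. now rewrite RtoC_inv. }
 split; intros i; apply Nx; apply in_or_app.
 - left. apply in_map_iff. eexists. split; [|apply i].
  assert (Eq : q (seg a (seg a b (1 / 2) + RtoC x * Ci * (b - a))%C t) a = (RtoC (t / 2) + Ci * RtoC (t * x))%C).
  { unfold q, seg. replace (t / 2) with (t * (1 / 2)) by lra. rewrite !RtoC_mult. field. auto. }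
  rewrite Eq. rewrite re_plus, im_plus, re_Ci_mult, im_Ci_mult, !re_RtoC, !im_RtoC.
  destruct (Req_dec t 0) as [->|]; [exfalso; rewrite seg_0 in i; auto|]. field; lra.
 - right. apply in_map_iff. eexists. split; [|apply i].
  assert (Eq : q (seg (seg a b (1 / 2) + RtoC x * Ci * (b - a))%C b t) b = (RtoC (- ((1 - t) / 2)) + Ci * RtoC ((1 - t) * x))%C).
  { unfold q, seg. replace (- ((1 - t) / 2)) with ((1 - t) * (1 / 2) - (1 - t)) by lra. rewrite !RtoC_minus, !RtoC_mult, !RtoC_minus. field. auto. }
  rewrite Eq. rewrite re_plus, im_plus, re_Ci_mult, im_Ci_mult, !re_RtoC, !im_RtoC.
  destruct (Req_dec t 1) as [->|]; [exfalso; rewrite seg_1 in i; auto|]. field. lra.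
Qed.

Lemma continuation_affine S a b F k m a' b' : (forall x, a' <= x <= b' -> a <= k * x + m <= b) -> continuation_along S a b F ->
 continuation_along (fun x => S (k * x + m)) a' b' (fun x => F (k * x + m)).
Proof.
 intros HI H x Hx. destruct (H (k * x + m) (HI x Hx)) as [A [d [Pd K]]]. sa.
 assert (Pk : 0 < Rabs k + 1) by (generalize (Rabs_pos k); lra).
 exists (d / (Rabs k + 1)). sp. intros y Hy L. apply K; auto.
 replace (k * y + m - (k * x + m)) with (k * (y - x)) by ring. rewrite Rabs_mult. apply Rlt_div_r in L; auto. generalize (Rabs_pos (y - x)). nra.
Qed.

Lemma continuation_minus S u v F F' : continuation_along S u v F -> continuation_along S u v F' ->
 continuation_along S u v (fun t z => F t z - F' t z)%C.
Proof.
 intros H H' t Ht. destruct (H t Ht) as [A [d [Pd K]]]. destruct (H' t Ht) as [A' [d' [Pd' K']]]. split.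
 now apply (holomorphic_at_map2 Cminus); auto using holo_minus.
 exists (Rmin d d'). sp. intros s Hs L. apply germ_eq_minus; [apply K|apply K']; auto; eapply Rlt_le_trans; try apply L. ar. ar.
Qed.

Lemma continuation_unique S u v F F' : u <= v -> rcont_on u v S -> continuation_along S u v F -> continuation_along S u v F' ->
 germ_eq (S u) (F u) (F' u) -> germ_eq (S v) (F v) (F' v).
Proof.
 intros L HS H H' E. assert (Z := continuation_zero S u v _ L HS (continuation_minus _ _ _ _ _ H H')). 
 assert (E' : germ_eq (S v) (fun z => F v z - F' v z)%C (fun _ => RtoC 0)). { apply Z. apply (germ_eq_rel _ _ _ _ _ _ E E). intros z -> _. ring. }
 apply (germ_eq_rel _ _ _ _ _ _ E' E'). intros z Q _. now apply Cminus_eq0.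
Qed.

(** The path is reversed by the reflection of [[u,v]]. *)
Lemma continuation_zero_back S u v F : u <= v -> rcont_on u v S -> continuation_along S u v F ->
 germ_eq (S v) (F v) (fun _ => RtoC 0) -> germ_eq (S u) (F u) (fun _ => RtoC 0).
Proof.
 intros L HS H E. assert (HI : forall x, u <= x <= v -> u <= -1 * x + (u + v) <= v) by ar.
 assert (Z := continuation_zero _ u v _ L (rcont_on_affine S (-1) (u + v) u v u v HI HS) (continuation_affine S u v F (-1) (u + v) u v HI H)).
 cbv beta in Z. replace (-1 * u + (u + v)) with v in Z by ring. replace (-1 * v + (u + v)) with u in Z by ring. auto.
Qed.

Lemma continuation_eq S S' u v F : (forall x, u <= x <= v -> S x = S' x) -> continuation_along S u v F -> continuation_along S' u v F.
Proof. intros E H x Hx. destruct (H x Hx) as [A [d [Pd K]]]. rewrite <- E by auto. sa. exists d. sa. intros y Hy L. rewrite <- E; auto. Qed.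

Lemma continuation_sub S u v u' v' F : u <= u' -> v' <= v -> continuation_along S u v F -> continuation_along S u' v' F.
Proof. intros A B H x Hx. destruct (H x LRA) as [D [d [Pd K]]]. sa. exists d. sa. intros y Hy L. apply K; auto. lra. Qed.

Lemma continuation_scal S u v F k : continuation_along S u v F -> continuation_along S u v (fun x z => RtoC k * F x z)%C.
Proof.
 intros H x Hx. destruct (H x Hx) as [D [d [Pd K]]]. split.
 - apply (holomorphic_at_map2 Cmult (fun _ => RtoC k)); auto. apply holomorphic_at_ex. auto.
 - exists d. sa. intros y Hy L. apply germ_eq_mult; auto. apply germ_eq_refl.
Qed.

Lemma continuation_csum S u v l (F : R -> R -> C -> C) : (forall t, In t l -> continuation_along S u v (F t)) ->
 continuation_along S u v (fun x z => csum l (fun t => F t x z)).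
Proof.
 induction l as [|t l IH]; intros H x Hx.
 - split. apply (holomorphic_at_ex (fun _ => RtoC 0)). auto. exists 1. sp. intros; apply germ_eq_refl.
 - destruct (H t (or_introl eq_refl) x Hx) as [A [d [Pd K]]]. destruct (IH (fun s Hs => H s (or_intror Hs)) x Hx) as [A' [d' [Pd' K']]]. split.
  + apply (holomorphic_at_map2 Cplus (F t x) (fun z => csum l (fun t => F t x z))); auto using holo_plus.
  + exists (Rmin d d'). sp. intros y Hy L. apply (germ_eq_plus _ (F t y) (F t x)); [apply K|apply K']; auto; eapply Rlt_le_trans; try apply L. ar. ar.
Qed.

Lemma satisfies_at P f t : satisfies P f t -> peval2 P t (f t) = RtoC 0.
Proof. intros H. apply locally_Cmod in H. destruct H as [r [Pr K]]. apply K. self. Qed.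

Definition count_le (X : list R) (y : R) : nat := length (filter (fun x => if Rle_dec x y then true else false) X).

Lemma count_le_mono X y z : y <= z -> (count_le X y <= count_le X z)%nat /\ (In z X -> y < z -> (S (count_le X y) <= count_le X z)%nat).
Proof.
 intros L. unfold count_le. induction X as [|x X [IH1 IH2]]; simpl. lia.
 destruct (Rle_dec x y), (Rle_dec x z); simpl; try lra; (split; [lia|]).
 - intros [->|i] L'. lra. specialize (IH2 i L'). lia.
 - lia.
 - intros [->|i] L'. lra. auto.
Qed.

Lemma Eit_injective x y : 0 <= x < 2 * PI -> 0 <= y < 2 * PI -> Eit x = Eit y -> x = y.
Proof.
 assert (W : forall x y, 0 <= x -> y < 2 * PI -> x < y -> Eit x = Eit y -> False).
 { intros a b Ha Hb L E. injection E as E1 E2.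
  assert (C1 : cos (b - a) = 1). { rewrite cos_minus, <- E1, <- E2. generalize (sin2_cos2 a). unfold Rsqr. lra. }
  replace (b - a) with (2 * ((b - a) / 2)) in C1 by lra. rewrite cos_2a_sin in C1.
  assert (0 < sin ((b - a) / 2)) by (apply sin_gt_0; lra). nra. }
 intros Hx Hy E. destruct (Rtotal_order x y) as [L|[L|L]]; auto; exfalso; [apply (W x y)|apply (W y x)]; auto; lra.
Qed.

Lemma list_lower_bound {A} (l : list A) (f : A -> R) : (forall a, In a l -> 0 < f a) -> exists e, 0 < e /\ forall a, In a l -> e <= f a.
Proof.
 induction l as [|a l IH]; intros H. exists 1. sp. easy.
 destruct IH as [e [Pe Ke]]. intros; apply H; now right. exists (Rmin e (f a)). split. apply Rmin_glb_lt; auto. apply H; now left.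
 intros b [<-|i]. ar. eapply Rle_trans. apply Rmin_l. auto.
Qed.

Lemma germ_eq_at a f h : germ_eq a f h -> f a = h a.
Proof. intros H. apply germ_eq_Cmod in H. destruct H as [r [Pr K]]. apply K. self. Qed.

(* A half branch [b] of the curve at [p] that meets each small circle around [p] once and avoids the line of direction [th]. *)
Definition arm (p th : C) (b : R -> C) (d : R) : Prop :=
 b 0 = p /\ (forall y x, 0 <= y <= x -> x <= d -> `|b x - b y| <= 3 * (`|b x - p| - `|b y - p|)) /\
 (forall x, 0 < x <= d -> cross (b x - p) th <> 0) /\ exists L, forall x y, 0 <= x <= d -> 0 <= y <= d -> `|b x - b y| <= L * Rabs (x - y).

Lemma arm_exists p th b u : half_branch b u -> b 0 = p -> cross u th <> 0 -> exists d, 0 < d /\ arm p th b d.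
Proof.
 intros [Nu H] Eb Hc. assert (PU : 0 < `|u|) by now apply Cmod_gt_0.
 assert (Pc : 0 < Rabs (cross u th)) by now apply Rabs_pos_lt. assert (Pt := Cmod_ge_0 th).
 (* The first bound makes the branch straight enough for its distance to [p] to grow at least a
    third as fast as its chords; the second is small against the angle between [u] and [th]. *)
 set (e := Rmin (`|u| / 8) (Rabs (cross u th) / (2 * (`|th| + 1)))).
 assert (Pe : 0 < e). pos.
 assert (He1 : e <= `|u| / 8) by apply Rmin_l.
 assert (He2 : e * (2 * (`|th| + 1)) <= Rabs (cross u th)). { apply Rle_div_r. lra. apply Rmin_r. }
 destruct (H e Pe) as [d [Pd K]]. exists d. sa. sa. split; [|split].
 - intros y x Hy Hx.
  assert (B1 := K x y LRA LRA). assert (B2 := K y 0 LRA LRA). rewrite Eb, Rminus_0_r in B2. rewrite (Rabs_pos_eq (x - y)) in B1 by lra. rewrite (Rabs_pos_eq y) in B2 by lra.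
  set (A := (b y - p)%C) in *. set (D := (b x - b y)%C) in *. set (a1 := (A - RtoC y * u)%C) in *. set (d1 := (D - RtoC (x - y) * u)%C) in *.
  assert (EA : A = (RtoC y * u + a1)%C) by (unfold a1; ring). assert (ED : D = (RtoC (x - y) * u + d1)%C) by (unfold d1; ring).
  replace (b x - p)%C with (A + D)%C by (unfold A, D; ring). set (U := `|u|) in *. set (w := x - y) in *. assert (Pw : 0 <= w) by (unfold w; lra).
  assert (HD : `|D| <= 9 / 8 * U * w). { rewrite ED. tri. rewrite Cmod_mult, Cmod_R, Rabs_pos_eq by lra. fold U. nra. }
  assert (HD2 : 7 / 8 * U * w <= `|D|). { rewrite ED. generalize (Cmod_plus_ge (RtoC w * u) d1). rewrite Cmod_mult, Cmod_R, Rabs_pos_eq by lra. fold U. nra. }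
  assert (HA : `|A| <= 9 / 8 * U * y). { rewrite EA. tri. rewrite Cmod_mult, Cmod_R, Rabs_pos_eq by lra. fold U. nra. }
  destruct (Req_dec y 0) as [Y0|Y0].
  { assert (A0 : A = RtoC 0). { apply Cmod_eq_zero. nra. } rewrite A0, Cplus_0_l, Cmod_0. lra. }
  assert (PA : 0 < `|A|). { generalize (Cmod_plus_ge (RtoC y * u) a1). rewrite <- EA, Cmod_mult, Cmod_R, Rabs_pos_eq by lra. fold U. nra. }
  assert (Re1 : y * w * (U * U) / 2 <= Re (Cconj A * D)).
  { rewrite EA, ED. replace (Cconj (RtoC y * u + a1) * (RtoC w * u + d1))%C with (RtoC (y * w) * (Cconj u * u) + (RtoC y * (Cconj u * d1) + RtoC w * (Cconj a1 * u) + Cconj a1 * d1))%C.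
   2: { rewrite Cplus_conj, Cmult_conj, RtoC_mult. replace (Cconj (RtoC y)) with (RtoC y) by (apply C_ext; simpl; ring). ring. }
   rewrite re_plus, re_scal_l, re_conj_self. fold U. set (rest := (RtoC y * (Cconj u * d1) + RtoC w * (Cconj a1 * u) + Cconj a1 * d1)%C).
   assert (`|rest| <= y * w * (U * U) / 2).
   { unfold rest. tri. eapply Rle_trans. apply Rplus_le_compat_r, Cmod_triangle.
    rewrite !Cmod_mult, !Cmod_conj, !Cmod_R, !Rabs_pos_eq by lra. fold U.
    assert (Q1 : `|d1| <= U / 8 * w) by nra. assert (Q2 : `|a1| <= U / 8 * y) by nra. assert (G1 := Cmod_ge_0 a1). nra. }
   generalize (re_le_Cmod rest). unfold Rabs. destruct (Rcase_abs (Re rest)); lra. }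
  assert (Re2 : `|A| * `|A| + Re (Cconj A * D) <= `|A| * `|A + D|).
  { rewrite <- re_conj_self, <- re_plus. replace (Cconj A * A + Cconj A * D)%C with (Cconj A * (A + D))%C by ring.
   rewrite <- (Cmod_conj A), <- Cmod_mult. generalize (re_le_Cmod (Cconj A * (A + D))). unfold Rabs. destruct (Rcase_abs _); lra. }
  assert (Fin : `|A| * `|D| <= `|A| * (3 * (`|A + D| - `|A|))). nra. nra.
 - intros x Hx E. assert (B := K x 0 LRA LRA). rewrite Eb, Rminus_0_r, (Rabs_pos_eq x) in B by lra.
  set (v := (b x - p - RtoC x * u)%C) in *. replace (b x - p)%C with (RtoC x * u + v)%C in E by (unfold v; ring).
  rewrite cross_plus_l, cross_scal_l in E. assert (Q := cross_bound v th).
  assert (E2 : Rabs (x * cross u th) = Rabs (cross v th)). { replace (x * cross u th) with (- cross v th) by lra. apply Rabs_Ropp. }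
  rewrite Rabs_mult, (Rabs_pos_eq x) in E2 by lra. generalize (Cmod_ge_0 v). intros. assert (x * Rabs (cross u th) <= e * x * `|th|) by nra.
  assert (x * (e * (2 * (`|th| + 1))) <= x * Rabs (cross u th)) by nra. nra.
 - exists (`|u| + e). intros x y Hx Hy. assert (B := K x y Hx Hy). replace (b x - b y)%C with (RtoC (x - y) * u + (b x - b y - RtoC (x - y) * u))%C by ring.
  tri. rewrite Cmod_mult, Cmod_R. lra.
Qed.

Lemma arm_sub p th b d d' : d' <= d -> arm p th b d -> arm p th b d'.
Proof.
 intros L [A [B [D [M K]]]]. sa. split. { intros y x Hy Hx. apply B; lra. } split. { intros x Hx. apply D. lra. }
 exists M. intros x y Hx Hy. apply K; lra.
Qed.

Lemma arm_radius p th b d r : arm p th b d -> 0 <= r <= `|b d - p| -> 0 < d -> exists x, 0 <= x <= d /\ `|b x - p| = r.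
Proof.
 intros [Eb [_ [_ [M HM]]]] Hr Pd. destruct (Req_dec r 0) as [->|Nr]. { exists 0. sp. rewrite Eb. apply Cmod_sub_self. }
 apply NNPP. intros N. apply Rle_not_lt with (1 := proj2 Hr).
 assert (PM : 0 < Rabs M + 1) by (generalize (Rabs_pos M); lra).
 replace (b d - p)%C with ((fun x => b (clamp 0 d x) - p)%C d) by (rewrite (clamp_id 0 d d); [auto|lra]).
 apply (Cmod_trapped (fun x => b (clamp 0 d x) - p)%C r 0 d).
 - minmax. intros t Ht. split.
  + intros e He. exists (e / (Rabs M + 1)). sp. intros s Hs.
   replace (b (clamp 0 d s) - p - (b (clamp 0 d t) - p))%C with (b (clamp 0 d s) - b (clamp 0 d t))%C by ring.
   eapply Rle_lt_trans. apply HM; apply clamp_in; lra. assert (Q := clamp_lip 0 d s t LRA). apply Rlt_div_r in Hs; auto.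
   generalize (Rle_abs M) (Rabs_pos (s - t)) (Rabs_pos (clamp 0 d s - clamp 0 d t)). nra.
  + rewrite clamp_id by lra. eauto.
 - rewrite clamp_id by lra. rewrite Eb, Cmod_sub_self. lra.
Qed.

(** Each preimage of [p] gives at most two half-branches, and elsewhere the curve keeps a positive
    distance from [p]. *)
Lemma half_branches_at gamma p : piecewise_smooth gamma -> exists bs : list (R -> C), (forall b, In b bs -> b 0 = p /\ exists u, half_branch b u) /\
 forall d, 0 < d -> exists R0, 0 < R0 /\ forall s, 0 <= s <= 1 -> `|gamma s - p| < R0 -> exists b x, In b bs /\ 0 <= x <= d /\ gamma s = b x.
Proof.
 intros HP. destruct (finite_preimage gamma p HP) as [L HL].
 assert (exists bs : list (R -> C), (forall b, In b bs -> b 0 = p /\ exists u, half_branch b u) /\ forall s, In s L -> 0 <= s <= 1 -> gamma s = p ->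
  (s < 1 -> In (fun x => gamma (s + x)) bs) /\ (0 < s -> In (fun x => gamma (s - x)) bs)) as [bs [B1 B2]].
 { clear HL. induction L as [|s L [bs [B1 B2]]]. exists nil. easy.
  destruct (classic (0 <= s <= 1 /\ gamma s = p)) as [[Hs Es]|N].
  2: { exists bs. sa. intros t [<-|i] Ht Et. tauto. auto. }
  assert (exists b1, (forall b, In b b1 -> b 0 = p /\ exists u, half_branch b u) /\ (s < 1 -> In (fun x => gamma (s + x)) b1)) as [b1 [X1 X2]].
  { destruct (Rlt_dec s 1). destruct (piecewise_right gamma s HP) as [h [Ph [_ A]]]. lra. destruct (half_branch_right gamma s h Ph A) as [u Hu].
   exists ((fun x => gamma (s + x)) :: nil). split. intros b [<-|[]]. split. now rewrite Rplus_0_r. now exists u. intros; now left. exists nil. easy. }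
  assert (exists b2, (forall b, In b b2 -> b 0 = p /\ exists u, half_branch b u) /\ (0 < s -> In (fun x => gamma (s - x)) b2)) as [b2 [Y1 Y2]].
  { destruct (Rlt_dec 0 s). destruct (piecewise_left gamma s HP) as [h [Ph [_ A]]]. lra. destruct (half_branch_left gamma s h Ph A) as [u Hu].
   exists ((fun x => gamma (s - x)) :: nil). split. intros b [<-|[]]. split. now rewrite Rminus_0_r. now exists u. intros; now left. exists nil. easy. }
  exists (b1 ++ b2 ++ bs). split. intros b Hb. rewrite !in_app_iff in Hb. destruct Hb as [|[|]]; auto.
  intros t [<-|i] Ht Et; rewrite !in_app_iff. sa. destruct (B2 t i Ht Et). sa. }
 exists bs. sa. intros d Pd.
 destruct (distance_outside gamma 0 1 p (fun s => exists b x, In b bs /\ 0 <= x <= d /\ gamma s = b x)) as [R0 [PR K]]. lra. now apply piecewise_rcont_on.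
 - intros s Hs Es. destruct (B2 s (HL s Hs Es) Hs Es) as [C1 C2]. exists d. sa. intros s' Hs' L'. apply Rabs_def2 in L'.
  destruct (Rle_dec s s').
  + destruct (Req_dec s 1) as [->|]. exists (fun x => gamma (1 - x)), 0. split. apply C2. lra. sp. f_equal. lra.
   exists (fun x => gamma (s + x)), (s' - s). split. apply C1. lra. sp. f_equal. lra.
  + exists (fun x => gamma (s - x)), (s - s'). split. apply C2. lra. sp. f_equal. lra.
 - exists R0. sa. intros s Hs L'. destruct (K s Hs) as [Q|Q]; auto. lra.
Qed.

(** The slope [q/2] is positive and smaller in modulus than every non-zero slope of the list. *)
Lemma direction_avoiding (us : list C) : (forall u, In u us -> u <> RtoC 0) -> exists th, `|th| = 1 /\ forall u, In u us -> cross u th <> 0.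
Proof.
 intros H. destruct (Rlist_isolated (map (fun u => Im u / Re u) us) 0) as [q [Pq Kq]]. set (w := (1, q / 2) : C).
 assert (Pw : 0 < `|w|). { apply Cmod_gt_0. intros E. apply (f_equal fst) in E. simpl in E. lra. }
 exists (RtoC (/ `|w|) * w)%C. split. { rewrite Cmod_mult, Cmod_R, Rabs_pos_eq. field. lra. apply Rlt_le, Rinv_0_lt_compat; auto. }
 intros u Hu. rewrite cross_scal_r. apply Rmult_integral_contrapositive_currified. apply Rinv_neq_0_compat. lra.
 assert (E : cross u w = Re u * (q / 2) - Im u). { unfold cross. rewrite im_mult, re_conj, im_conj. unfold w; simpl. lra. } rewrite E. intros Z.
 destruct (Req_dec (Re u) 0) as [R0|R0]. { apply (H u Hu). apply C_ext. auto. rewrite im_RtoC. rewrite R0 in Z. lra. }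
 assert (Q : In (q / 2) (map (fun u => Im u / Re u) us)). { apply in_map_iff. exists u. sa. replace (Im u) with (Re u * (q / 2)) by lra. field; lra. }
 specialize (Kq _ Q LRA). rewrite Rminus_0_r, Rabs_pos_eq in Kq; lra.
Qed.

Lemma arms_at gamma p : piecewise_smooth gamma -> exists th bs d R0, `|th| = 1 /\ 0 < d /\ 0 < R0 /\ (forall b, In b bs -> arm p th b d) /\
 forall s, 0 <= s <= 1 -> `|gamma s - p| < R0 -> exists b x, In b bs /\ 0 <= x <= d /\ gamma s = b x.
Proof.
 intros HP. destruct (half_branches_at gamma p HP) as [bs [B1 B2]].
 destruct (choice (fun b u => In b bs -> half_branch b u)) as [U HU].
 { intros b. destruct (classic (In b bs)) as [i|i]. destruct (B1 b i) as [_ [u Hu]]. eauto. exists (RtoC 0). easy. }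
 destruct (direction_avoiding (map U bs)) as [th [T1 T2]]. { intros u Hu. apply in_map_iff in Hu. destruct Hu as [b [<- Hb]]. apply (HU b Hb). }
 destruct (choice (fun b d => In b bs -> 0 < d /\ arm p th b d)) as [dd Hd].
 { intros b. destruct (classic (In b bs)) as [i|i]; [|exists 0; tauto]. destruct (arm_exists p th b (U b)) as [d K]; auto. apply B1; auto. apply T2. now apply in_map. now exists d. }
 destruct (list_lower_bound bs dd) as [d [Pd Kd]]. intros; now apply Hd. destruct (B2 d Pd) as [R0 [PR K]].
 exists th, bs, d, R0. do 3 (split; auto). sa. intros b Hb. apply (arm_sub p th b (dd b)); auto; now apply Hd.
Qed.

(** * Estimates for polynomials near a point and at infinity *)

Lemma roots_prod_zero l z : In z l -> roots_prod l z = RtoC 0.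
Proof. induction l as [|a l IH]; simpl. lra. intros [->|i]. ring. rewrite IH; auto. ring. Qed.

Lemma roots_prod_small l z : (forall a, In a l -> `|z - a| <= 1) -> `|roots_prod l z| <= 1 /\ forall a, In a l -> `|roots_prod l z| <= `|z - a|.
Proof.
 induction l as [|b l IH]; simpl; intros H. rewrite Cmod_1. easy.
 destruct IH as [A B]. auto. rewrite Cmod_mult. assert (Hb := H b (or_introl eq_refl)).
 generalize (Cmod_ge_0 (z - b)) (Cmod_ge_0 (roots_prod l z)); intros. split. nra. intros a [<-|i]. nra. specialize (B a i). nra.
Qed.

Lemma peval_growth p : exists K N, 0 <= K /\ forall z, 1 <= `|z| -> `|peval p z| <= K * `|z| ^ N.
Proof.
 induction p as [|a p [K [N [PK H]]]]. exists 0, 0%nat. sp. intros z _. rewrite peval_nil, Cmod_0. lra.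
 exists (`|a| + K), (S N). assert (A := Cmod_ge_0 a). sp. intros z Hz. rewrite peval_cons. tri. rewrite Cmod_mult.
 specialize (H z Hz). assert (1 <= `|z| ^ N) by now apply pow_R1_Rle. simpl. assert (1 <= `|z| * `|z| ^ N) by nra. nra.
Qed.

Lemma coef_sum_growth P : exists K N, 0 <= K /\ forall z, 1 <= `|z| -> coef_sum P z <= K * `|z| ^ N.
Proof.
 induction P as [|p P [K [N [PK H]]]]. exists 0, 0%nat. sp. intros z _. simpl. lra.
 destruct (peval_growth p) as [K' [N' [PK' H']]]. exists (K' + K), (N' + N)%nat. sp. intros z Hz. specialize (H z Hz). specialize (H' z Hz).
 change (`|peval p z| + coef_sum P z <= (K' + K) * `|z| ^ (N' + N)).
 assert (`|z| ^ N' <= `|z| ^ (N' + N)) by (apply Rle_pow; auto; lia). assert (`|z| ^ N <= `|z| ^ (N' + N)) by (apply Rle_pow; auto; lia). nra.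
Qed.

Lemma peval_lower q : pnonzero q -> exists m R0, 0 < m /\ 0 < R0 /\ forall z, R0 <= `|z| -> m <= `|peval q z|.
Proof.
 induction q as [|a q IH]. intros [a [[] _]].
 intros [b [Hb Nb]]. destruct (classic (pnonzero q)) as [Hq|Nq].
 - destruct (IH Hq) as [m [R0 [Pm [PR H]]]]. exists m, (Rmax R0 ((`|a| + m) / m)). sa. split. eapply Rlt_le_trans. eauto. apply Rmax_l.
  intros z Hz. assert (Z1 := Rle_trans _ _ _ (Rmax_l _ _) Hz). assert (Z2 := Rle_trans _ _ _ (Rmax_r _ _) Hz). specialize (H z Z1).
  rewrite peval_cons, Cplus_comm. eapply Rle_trans; [|apply Cmod_plus_ge]. rewrite Cmod_mult. apply Rle_div_l in Z2; auto. nra.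
 - destruct Hb as [->|Hb]. 2: { exfalso. apply Nq. now exists b. }
  exists (`|b|), 1. assert (0 < `|b|) by now apply Cmod_gt_0. sa. sp. intros z _. rewrite peval_cons.
  replace (peval q z) with (RtoC 0). rewrite Cmult_0_r, Cplus_0_r. lra. symmetry. apply NNPP. intros N. apply Nq. now apply pnonzero_peval with z.
Qed.

(** The punctured disc is connected by broken lines with two legs that avoid [t]; a small offset of
    the corner keeps them inside the disc. *)
Lemma punctured_identity f t r z1 z2 : (forall z, 0 < `|z - t| < r -> holo f z) -> 0 < `|z1 - t| < r -> 0 < `|z2 - t| < r ->
 germ_eq z1 f (fun _ => RtoC 0) -> germ_eq z2 f (fun _ => RtoC 0).
Proof.
 intros Hf H1 H2 E. assert (Ne : forall z, 0 < `|z - t| -> ~ In z (t :: nil)). { intros z Hz [<-|[]]. rewrite Cmod_sub_self in Hz. lra. }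
 set (mid := seg z1 z2 (1 / 2)). assert (Hmid : `|mid - t| < r) by (apply seg_ball; lra).
 assert (Pz := Cmod_ge_0 (z2 - z1)).
 destruct (polyline_avoiding (t :: nil) z1 z2 ((r - `|mid - t|) / (`|z2 - z1| + 1))) as [x [Hx K]]. apply Ne, H1. apply Ne, H2. pos.
 fold mid in K. set (m := (mid + RtoC x * Ci * (z2 - z1))%C) in *.
 assert (Hm : `|m - t| < r).
 { replace (m - t)%C with ((mid - t) + RtoC x * Ci * (z2 - z1))%C by (unfold m; ring). eapply Rle_lt_trans. apply Cmod_triangle.
  rewrite !Cmod_mult, Cmod_R, Rabs_pos_eq by lra. replace (`|Ci|) with 1 by (unfold Cmod, Ci; simpl; rewrite <- sqrt_1 at 1; f_equal; ring).
  destruct Hx as [Hx1 Hx2]. apply Rlt_div_r in Hx2; nra. }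
 assert (W : forall u v, (forall s, 0 <= s <= 1 -> ~ In (seg u v s) (t :: nil)) -> `|u - t| < r -> `|v - t| < r -> germ_eq u f (fun _ => RtoC 0) -> germ_eq v f (fun _ => RtoC 0)).
 { intros u v Hs Hu Hv. apply seg_identity. intros s Hs'. assert (B := seg_ball u v t r s Hs' Hu Hv). assert (0 < `|seg u v s - t|).
  { apply Cmod_gt_0, Cminus_neq0. intros Q. apply (Hs s Hs'). now left. }
  apply holomorphic_at_hold. exists (Rmin (`|seg u v s - t|) (r - `|seg u v s - t|)). sp.
  intros z Hz. generalize (Rmin_l (`|seg u v s - t|) (r - `|seg u v s - t|)) (Rmin_r (`|seg u v s - t|) (r - `|seg u v s - t|))
   (Cmod_triangle_minus z (seg u v s) t) (Cmod_triangle_minus (seg u v s) z t). rewrite (Cmod_minus_sym (seg u v s) z). intros. apply Hf. lra. }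
 apply (W m); auto; try lra. intros; now apply K. apply (W z1); auto; try lra. intros; now apply K.
Qed.

(** Holomorphy may fail at isolated points, so the open sets [A] and [B] are defined by punctured
    neighbourhoods: on them [F] and [G] agree, or their germs agree nowhere. *)
Lemma equal_on_connected (D : C -> Prop) (L : list C) F G c1 : connected D -> (forall t, D t -> exists r, 0 < r /\ forall z, 0 < `|z - t| < r -> holo F z /\ holo G z) ->
 D c1 -> ~ In c1 L -> germ_eq c1 F G -> (forall t, D t -> exists r, 0 < r /\ forall z, 0 < `|z - t| < r -> F z = G z).
Proof.
 intros HD HH D1 N1 E1.
 set (A := fun t => exists r, 0 < r /\ forall z, 0 < `|z - t| < r -> F z = G z).
 set (B := fun t => exists r, 0 < r /\ forall z, 0 < `|z - t| < r -> ~ germ_eq z F G).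
 assert (Op : forall Q : C -> Prop, open (fun t => exists r, 0 < r /\ forall z, 0 < `|z - t| < r -> Q z)).
 { intros Q t [r [Pr K]]. apply locally_Cmod. exists r. sa. intros t' Ht'. destruct (classic (t' = t)) as [->|N]. eauto.
  assert (0 < `|t' - t|) by now apply Cmod_gt_0, Cminus_neq0. exists (Rmin (`|t' - t|) (r - `|t' - t|)). sp.
  intros z Hz. rmin; generalize (Cmod_triangle_minus z t' t) (Cmod_triangle_minus t' z t).
  rewrite (Cmod_minus_sym t' z). intros. apply K. lra. }
 assert (GE : forall z, germ_eq z (fun w => F w - G w)%C (fun _ => RtoC 0) <-> germ_eq z F G).
 { intros z. split; intros E; apply (germ_eq_rel _ _ _ _ _ _ E E); intros w Q _. now apply Cminus_eq0. rewrite Q. ring. }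
 assert (AofGerm : forall t, D t -> forall r z, (forall z, 0 < `|z - t| < r -> holo F z /\ holo G z) -> 0 < `|z - t| < r -> germ_eq z F G -> A t).
 { intros t Dt r z Hr Hz E. exists r. sp. intros w Hw. apply germ_eq_at. apply GE. apply (punctured_identity _ t r z w); auto. intros v Hv. apply holo_minus; now apply Hr. now apply GE. }
 assert (Cov : forall t, D t -> A t \/ B t).
 { intros t Dt. destruct (HH t Dt) as [r [Pr K]]. destruct (classic (exists z, 0 < `|z - t| < r /\ germ_eq z F G)) as [[z [Hz E]]|N].
  - eauto. - right. exists r. sa. eauto. }
 assert (Pt : forall t r, 0 < r -> exists z, 0 < `|z - t| < r).
 { intros t r Pr. exists (t + RtoC (r / 2))%C. replace (t + RtoC (r / 2) - t)%C with (RtoC (r / 2)) by ring. rewrite Cmod_R, Rabs_pos_eq; lra. }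
 assert (Disj : forall t, A t -> B t -> False).
 { intros t [r [Pr KA]] [r' [Pr' KB]]. destruct (Pt t (Rmin r r')) as [z Hz]. pos. rmin.
  apply (KB z). lra. apply germ_eq_Cmod. exists (Rmin (`|z - t|) (r - `|z - t|)). sp.
  intros w Hw. rmin; generalize (Cmod_triangle_minus w z t) (Cmod_triangle_minus z w t).
  rewrite (Cmod_minus_sym z w). intros. apply KA. lra. }
 assert (A1 : A c1). { apply germ_eq_Cmod in E1. destruct E1 as [r [Pr K]]. exists r. sa. intros z Hz. apply K. lra. }
 intros t Dt. destruct (Cov t Dt) as [|Bt]; auto. exfalso.
 destruct (HD A B (Op _) (Op _) Cov) as [z [_ [Az Bz]]]. eauto. eauto. eauto.
Qed.

(** * Sums of branches along paths issuing from [c] *)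

Section Continuation.

Context (gamma : R -> C) (Sigma : list C) (g : C -> C) (P : list (list C)) (Bad : list C) (c : C).
Context (HS : setting gamma Sigma g) (HB : bad_set gamma Sigma g P Bad).

(** A path from [c] with the data of its sum of branches; [F t x] is the germ at [S x] of the branch
    met at the crossing [t]. The length [T] is free because paths are prolonged by unit segments. *)
Record sum_path (S : R -> C) (T : R) (l : list R) (e : R -> R) (F : R -> R -> C -> C) : Prop := {
 sp_T : 0 < T;
 sp_cont : rcont_on 0 T S;
 sp_start : S 0 = c;
 sp_U : forall t, 0 <= t <= T -> U_set gamma Sigma g (S t);
 sp_nodup : NoDup l;
 sp_list : forall t, In t l <-> 0 <= t <= T /\ image gamma (S t);
 sp_term : forall t, In t l ->
  crosses gamma S t (e t) /\ branch_at gamma g (S t) (F t t) /\ continuation_along S t T (F t)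
}.

Arguments sp_T {_ _ _ _ _}.
Arguments sp_cont {_ _ _ _ _}.
Arguments sp_start {_ _ _ _ _}.
Arguments sp_U {_ _ _ _ _}.
Arguments sp_nodup {_ _ _ _ _}.
Arguments sp_list {_ _ _ _ _}.
Arguments sp_term {_ _ _ _ _}.

Lemma sum_path_lt S T l e F t : sum_path S T l e F -> ~ image gamma (S T) -> In t l -> 0 <= t < T.
Proof.
 intros HQ N Ht. apply (sp_list HQ) in Ht. destruct Ht as [[A B] D]. sa. destruct (Req_dec t T) as [->|]; [easy|lra].
Qed.

(** A relation rather than a function: at one point there may be many sums, one for each path, until
    trivial monodromy shows that they agree. *)
Definition reach (d : C) (h : C -> C) : Prop :=
 ~ image gamma d /\ exists S T l e F, sum_path S T l e F /\ S T = d /\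
  germ_eq d h (fun z => csum l (fun t => RtoC (e t) * F t T z)%C).

Lemma reach_admissible d h : ~ image gamma c -> reach d h ->
 exists S, admissible gamma Sigma g c d S /\ sum_of_branches gamma g S h.
Proof.
 intros Nc [Nd [S [T [l [e [F [H [ST Hh]]]]]]]]. destruct H.
 assert (HI : forall t, 0 <= t <= 1 -> 0 <= T * t + 0 <= T) by (intros; split; nra).
 set (S' := fun t => S (T * t + 0)).
 assert (E1 : S' 1 = d). { unfold S'. rewrite <- ST. f_equal. lra. }
 assert (Inl : forall t, In t (map (fun x => x / T) l) <-> In (T * t + 0) l).
 { intros t. rewrite in_map_iff. split. intros [x [<- Hx]]. replace (T * (x / T) + 0) with x by (field; lra). auto.
  intros Hx. exists (T * t + 0). sa. field. lra. }
 exists S'. split.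
 - sa. sa. split. { apply continuous_on_rcont_on. now apply rcont_on_affine with 0 T. }
  split. { unfold S'. rewrite Rmult_0_r, Rplus_0_r. auto. } sa. split. eauto.
  intros t Ht It. exists (e (T * t + 0)). apply crosses_affine; auto. apply sp_term0. apply sp_list0. sa.
 - exists (map (fun x => x / T) l), (fun t => e (T * t + 0)), (fun t => F (T * t + 0) T). split.
  { apply FinFun.Injective_map_NoDup; auto. intros x y E. apply (f_equal (fun z => z * T)) in E. unfold Rdiv in E. rewrite !Rmult_assoc, Rinv_l, !Rmult_1_r in E; auto. lra. }
  split. { intros t. rewrite Inl, sp_list0. unfold I01. split; intros [A B]; sa. split; nra. }
  split.
  + intros t Ht. apply Inl in Ht. destruct (sp_term0 _ Ht) as [A [B D]]. split. now apply crosses_affine.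
   exists (F (T * t + 0) (T * t + 0)). sa. exists (fun x => F (T * t + 0) (T * x + 0)).
   split; [|split]. 2: apply germ_eq_refl. 2: { replace (T * 1 + 0) with T by ring. apply germ_eq_refl. }
   intros x Hx. destruct (D (T * x + 0)) as [D1 [dl [Pdl D2]]]. nra. split. auto. exists (dl / T). sp.
   intros y Hy L. apply D2. nra. replace (T * y + 0 - (T * x + 0)) with (T * (y - x)) by ring. rewrite Rabs_mult, (Rabs_pos_eq T) by lra.
   apply Rlt_div_r in L; auto. lra.
  + rewrite E1. apply germ_eq_trans with (1 := Hh). apply germ_eq_pointwise. intros z.
   unfold csum. rewrite map_map. apply f_equal. apply map_ext. intros x. replace (T * (x / T) + 0) with x by (field; lra). auto.
Qed.

Lemma sum_path_satisfies S T l e F t : sum_path S T l e F -> In t l -> satisfies P (F t T) (S T) /\ holomorphic_at (F t T) (S T).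
Proof.
 intros HQ Ht. destruct (sp_term HQ t Ht) as [_ [A B]].
 destruct (proj1 (sp_list HQ t) Ht) as [Ht1 Ht2].
 assert (Pn : punctured gamma Sigma (S t)). { sa. apply (sp_U HQ t Ht1). }
 split. apply satisfies_continuation with (3 := B). lra. apply rcont_on_sub with (3 := sp_cont HQ); lra.
 apply (branch_algebraic gamma Sigma g P); auto. now apply (bs_branch HB). apply B. lra.
Qed.

Lemma sum_path_terms S T l e F a d : sum_path S T l e F -> good_disc P Bad a d -> `|S T - a| < d ->
 exists K, forall t, In t l -> hold (K t) a d /\ germ_eq (S T) (F t T) (K t).
Proof.
 intros HQ HG Hd.
 apply (choice_on (fun t => In t l) (fun t Kt => hold Kt a d /\ germ_eq (S T) (F t T) Kt) (fun _ => RtoC 0)). intros t i.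
 destruct (sum_path_satisfies _ _ _ _ _ _ HQ i) as [A B].
 destruct HG as [_ [_ HG]]. destruct (HG (S T) (F t T) Hd B A) as [K [HK EK]]. exists K. sa. now apply germ_eq_sym.
Qed.

Lemma reach_hold d h a r : good_disc P Bad a r -> `|d - a| < r ->
 reach d h -> exists H, hold H a r /\ germ_eq d h H.
Proof.
 intros HG Hd [_ [S [T [l [e [F [HQ [<- Hh]]]]]]]].
 destruct (sum_path_terms _ _ _ _ _ _ _ HQ HG Hd) as [K HK].
 exists (fun z => csum l (fun t => RtoC (e t) * K t z)%C). split.
 - apply (hold_csum l (fun t z => RtoC (e t) * K t z)%C). intros t Ht z Hz. apply holo_mult. auto. now apply HK.
 - apply germ_eq_trans with (1 := Hh). apply (csum_germ _ l (fun t z => RtoC (e t) * F t T z)%C (fun t z => RtoC (e t) * K t z)%C).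
  intros t Ht. apply germ_eq_mult. apply germ_eq_refl. now apply HK.
Qed.

(* [l2], [e2], [f2] describe the crossings of the segment [d d']. *)
Lemma reach_step d d' H a r l2 e2 f2 : good_disc P Bad a r ->
 `|d - a| < r -> `|d' - a| < r -> ~ image gamma d' -> hold H a r -> reach d H ->
 NoDup l2 -> (forall s, In s l2 <-> 0 <= s <= 1 /\ image gamma (seg d d' s)) ->
 (forall s, In s l2 -> crosses gamma (seg d d') s (e2 s) /\ branch_at gamma g (seg d d' s) (f2 s) /\ hold (f2 s) a r) ->
 reach d' (fun z => H z + csum l2 (fun s => RtoC (e2 s) * f2 s z))%C.
Proof.
 intros HG Hd Hd' Nd' HH [Nd [S [T [l [e [F [HQ [<- Hh]]]]]]]] Hnd2 Hl2 Ht2. sa.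
 destruct (sum_path_terms _ _ _ _ _ _ _ HQ HG Hd) as [K HK].
 assert (PT := sp_T HQ).
 assert (Hl := sp_list HQ).
 assert (Seg : forall t, 0 <= t <= 1 -> `|seg (S T) d' t - a| < r) by (intros; now apply seg_ball).
 assert (PosL2 : forall s, In s l2 -> 0 < s < 1).
 { intros s Hs. apply Hl2 in Hs. destruct Hs as [[A B] D]. split.
  - destruct (Req_dec s 0) as [->|]; [|lra]. rewrite seg_0 in D. easy.
  - destruct (Req_dec s 1) as [->|]; [|lra]. rewrite seg_1 in D. easy. }
 assert (LtL := fun t => sum_path_lt S T l e F t HQ Nd).
 set (S' := append S T d').
 assert (S'1 := append_l S T d'). assert (S'2 := append_r S T d'). fold S' in S'1, S'2.
 (* An old term is prolonged over the segment by its extension [K t] to the disc; a new term is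
    given on the disc from the outset. *)
 set (F' := fun t => if Rle_dec t T then (fun x => if Rle_dec x T then F t x else K t) else (fun _ : R => f2 (t - T))).
 set (e' := fun t => if Rle_dec t T then e t else e2 (t - T)).
 set (l2' := map (fun s => s + T) l2).
 assert (Inl2 : forall t, In t l2' <-> In (t - T) l2).
 { intros t. unfold l2'. rewrite in_map_iff. split. intros [x [<- Hx]]. replace (x + T - T) with x by ring. auto. intros Hx. exists (t - T). sa. lra. }
 assert (HS' : rcont_on 0 (T + 1) S') by (apply rcont_on_append; auto; apply (sp_cont HQ)).
 assert (S'near : forall t, T <= t <= T + 1 -> `|S' t - a| < r). { intros t Ht. rewrite S'2 by lra. apply Seg. lra. }
 exists S', (T + 1), (l ++ l2'), e', F'. split; [constructor|split].
 - lra.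
 - auto.
 - rewrite S'1 by lra. apply (sp_start HQ).
 - intros t Ht. destruct (Rle_dec t T). rewrite S'1 by lra. apply (sp_U HQ). lra.
  apply (bs_U HB). apply HG. apply S'near. lra.
 - apply NoDup_app. apply (sp_nodup HQ). apply FinFun.Injective_map_NoDup; auto. intros x y E. lra.
  intros t Ht Ht'. apply Inl2, PosL2 in Ht'. apply LtL in Ht. lra.
 - intros t. rewrite in_app_iff, Inl2, Hl, Hl2. split.
  + intros [[A B]|[A B]]. rewrite S'1 by lra. sa. lra. rewrite S'2 by lra. sa. lra.
  + intros [A B]. destruct (Rle_dec t T). rewrite S'1 in B by lra. tauto. rewrite S'2 in B by lra. right. sa. lra.
 - intros t Ht. apply in_app_iff in Ht. destruct Ht as [Ht|Ht].
  + assert (Lt := LtL t Ht). destruct (sp_term HQ t Ht) as [A [B D]]. destruct (HK t Ht) as [HK1 HK2].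
   unfold e', F'. destruct (Rle_dec t T); [|lra]. rewrite S'1 by lra. split; [|split].
   * apply crosses_append; auto. lra.
   * destruct (Rle_dec t T); [auto|lra].
   * apply continuation_glue with a r; auto.
    -- rsub HS'.
    -- lra.
    -- now apply continuation_append.
    -- now rewrite S'1 by lra.
  + apply Inl2 in Ht. assert (Lt := PosL2 _ Ht). destruct (Ht2 _ Ht) as [A [B D]].
   unfold e', F'. destruct (Rle_dec t T); [lra|]. rewrite S'2 by lra. split; [|split].
   * apply (crosses_local gamma (fun x => seg (S T) d' (1 * x + - T)) S' t _ (t - T)). lra.
    intros x Hx. apply Rabs_def2 in Hx. rewrite S'2 by lra. f_equal. ring. apply crosses_affine. lra. replace (1 * t + - T) with (t - T) by ring. auto.
   * auto.
   * intros x Hx. split. apply hold_holomorphic_at with a r; auto. apply S'near. lra. exists 1. sp. intros; apply germ_eq_refl.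
 - apply append_end.
 - apply germ_eq_Cmod. exists (r - `|d' - a|). sp. intros z Hz.
  assert (Bz : `|z - a| < r) by triang.
  rewrite csum_app. f_equal.
  + assert (Eh : germ_eq (S T) H (fun z => csum l (fun t => RtoC (e t) * K t z)%C)).
   { apply germ_eq_trans with (1 := Hh). apply (csum_germ _ l (fun t z => RtoC (e t) * F t T z)%C (fun t z => RtoC (e t) * K t z)%C).
    intros t Ht. apply germ_eq_mult. apply germ_eq_refl. now apply HK. }
   rewrite (hold_equal H (fun z => csum l (fun t => RtoC (e t) * K t z)%C) a r (S T)); auto.
   * apply csum_ext. intros t Ht. assert (Lt := LtL t Ht). unfold e', F'. destruct (Rle_dec t T); [|lra]. destruct (Rle_dec (T + 1) T); [lra|auto].
   * apply (hold_csum l (fun t z => RtoC (e t) * K t z)%C). intros t Ht w Hw. apply holo_mult. auto. now apply HK.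
  + unfold l2'. rewrite csum_map. apply csum_ext. intros s Hs. assert (Ls := PosL2 s Hs). unfold e', F'. destruct (Rle_dec (s + T) T); [lra|].
   now replace (s + T - T) with s by ring.
Qed.

Lemma reach_ext d h h' : germ_eq d h h' -> reach d h -> reach d h'.
Proof.
 intros E [A [S [T [l [e [F [B [D K]]]]]]]]. sa. exists S, T, l, e, F. sa. sa. apply germ_eq_trans with h; auto. now apply germ_eq_sym.
Qed.

Lemma reach_same d d' H a r : good_disc P Bad a r ->
 `|d - a| < r -> `|d' - a| < r -> hold H a r -> (forall t, 0 <= t <= 1 -> ~ image gamma (seg d d' t)) ->
 reach d H <-> reach d' H.
Proof.
 intros HG Hd Hd' HH Hs.
 assert (W : forall d d', `|d - a| < r -> `|d' - a| < r -> (forall t, 0 <= t <= 1 -> ~ image gamma (seg d d' t)) -> reach d H -> reach d' H).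
 { clear d d' Hd Hd' Hs. intros d d' Hd Hd' Hs HR.
  apply reach_ext with (fun z => H z + csum nil (fun s => RtoC 0 * RtoC 0))%C.
  { apply germ_eq_pointwise. intros z. unfold csum; simpl. ring. }
  apply (reach_step d d' H a r nil (fun _ => 0) (fun _ _ => RtoC 0)); auto.
  - rewrite <- (seg_1 d d'). apply Hs. lra.
  - constructor.
  - intros s. split. intros []. intros [A B]. apply (Hs s); auto.
  - easy. }
 split; apply W; auto. intros t Ht. rewrite seg_rev. apply Hs. lra.
Qed.

Lemma reach_cross d d' H a r e f : good_disc P Bad a r ->
 `|d - a| < r -> `|d' - a| < r -> hold H a r -> hold f a r -> 
 (forall t, 0 <= t <= 1 -> t <> 1 / 2 -> ~ image gamma (seg d d' t)) -> seg d d' (1 / 2) = a -> branch_at gamma g a f -> image gamma a ->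
 crosses gamma (seg d d') (1 / 2) e ->
 reach d H -> reach d' (fun z => H z + RtoC e * f z)%C.
Proof.
 intros HG Hd Hd' HH Hf Hs Ea Hb Ia Hc HR.
 apply reach_ext with (fun z => H z + csum ((1 / 2)%R :: nil) (fun s => RtoC e * f z))%C.
 { apply germ_eq_pointwise. intros z. unfold csum; simpl. ring. }
 apply (reach_step d d' H a r (1 / 2 :: nil) (fun _ => e) (fun _ => f)); auto.
 - rewrite <- (seg_1 d d'). apply Hs; lra.
 - constructor; auto. constructor.
 - intros s. split.
  + intros [<-|[]]. sp. congruence.
  + intros [A B]. destruct (Req_dec s (1 / 2)). subst; now left. exfalso. apply (Hs s); auto.
 - intros s [<-|[]]. rewrite Ea. auto.
Qed.

Lemma reach_off d h : reach d h -> ~ image gamma d.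
Proof. now intros []. Qed.

(* Near [a] both the integral and the sums of branches differ on the two sides of the curve by the same germ [f],
 so that their difference continues analytically across the curve. *)
Lemma local_sides a : ~ In a Bad ->
 exists r rho Phi f p, 0 < rho <= r /\ good_disc P Bad a r /\ hold Phi a r /\ hold f a r /\
  (image gamma a -> satisfies P f a) /\ (~ image gamma a -> forall t, `|t - a| < r -> ~ image gamma t) /\
  `|p - a| < r /\ ~ image gamma p /\
  (forall e, 0 < e -> exists t, `|t - a| < e /\ ~ image gamma t) /\
  forall t, `|t - a| < rho -> ~ image gamma t -> exists j, (j = 0 \/ (j = 1 /\ image gamma a)) /\
   germ_eq t (cauchy_integral gamma g) (fun z => Phi z + RtoC j * f z)%C /\
   forall H, hold H a r -> (reach t (fun z => H z + RtoC j * f z)%C <-> reach p H).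
Proof.
 intros Na. destruct (bs_disc HB a Na) as [r0 HG0].
 assert (HP := gamma_piecewise_smooth _ _ _ HS).
 assert (Pr0 : 0 < r0) by apply HG0.
 assert (Ext0 : forall t H f, germ_eq t (fun z => H z + RtoC 0 * f z)%C H). { intros. apply germ_eq_pointwise. intros z. ring. }
 destruct (classic (image gamma a)) as [Ia|Ia].
 2: { destruct (off_image_ball gamma a HP Ia) as [q [Pq Kq]]. set (r := Rmin r0 q). assert (Pr : 0 < r) by pos.
  assert (Off : forall t, `|t - a| < r -> ~ image gamma t). { intros t Ht [s [Hs <-]]. specialize (Kq s Hs). generalize (Rmin_r r0 q). fold r. lra. }
  assert (HG : good_disc P Bad a r). { apply good_disc_sub with r0; auto. sa. apply Rmin_l. }
  exists r, r, (cauchy_integral gamma g), (fun _ => RtoC 0), a.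
  sp. sa. split. { intros z Hz. apply (cauchy_integral_holo gamma Sigma); auto. }
  split. easy. split. easy. sa. split. self. sa.
  split. { intros e He. exists a. self. }
  intros t Ht Nt. exists 0. sa. split. { apply germ_eq_pointwise. intros z. ring. }
  intros H HH. assert (E : reach t H <-> reach a H).
  { apply (reach_same t a H a r); auto. self.
   intros x Hx. apply Off. apply seg_ball; auto. self. }
  rewrite <- E. split; apply reach_ext; auto. now apply germ_eq_sym. }
 destruct (bs_regular HB a Na Ia) as [v [Nv Hv]].
 assert (Pn : punctured gamma Sigma a). { sa. apply (bs_U HB a Na). }
 destruct (bs_branch HB a Pn) as [f [Hf Pf]].
 (* The normal pointing to the left of the curve, [v] being its only tangent at [a]. *)
 set (w := (Ci * v)%C).
 assert (Pv : 0 < `|v|) by now apply Cmod_gt_0.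
 assert (Hw : forall s u, I01 s -> gamma s = a -> velocity gamma s u -> 0 < cross u w).
 { intros s u A B D. rewrite (Hv s u A B D). unfold cross, w. replace (Cconj v * (Ci * v))%C with (Ci * (Cconj v * v))%C by ring. rewrite im_Ci_mult, re_conj_self. nra. }
 destruct (jump gamma Sigma g a f w HS Pn Hf Hw) as [rho0 [K [Phi [upper [lower SS]]]]].
 assert (Nw := positive_cross_nonzero gamma a w HP Ia Hw). assert (Pw : 0 < `|w|) by now apply Cmod_gt_0.
 destruct (side_cone _ _ _ _ _ _ _ _ _ _ SS Nw) as [eta [Pe Cone]].
 assert (Prho0 := ss_rho SS).
 set (r := Rmin r0 rho0). assert (Pr : 0 < r) by pos.
 assert (Hr1 : r <= r0) by apply Rmin_l. assert (Hr2 : r <= rho0) by apply Rmin_r.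
 assert (HG : good_disc P Bad a r). { apply good_disc_sub with r0; auto. }
 (* A move by [lam w] has length [r/4], which stays in the disc, and [rho <= eta lam] puts the
    displaced small ball into the cone of [side_cone]. *)
 set (lam := r / (4 * `|w|)). assert (Pl : 0 < lam) by pos.
 assert (El : lam * `|w| = r / 4) by (unfold lam; field; lra).
 set (rho := Rmin (r / 4) (eta * lam)). assert (Prho : 0 < rho). pos.
 assert (Hrho1 : rho <= r / 4) by apply Rmin_l. assert (Hrho2 : rho <= eta * lam) by apply Rmin_r.
 assert (Bw : forall x, 0 <= x <= lam -> `|RtoC x * w| <= r / 4). { intros x Hx. rewrite Cmod_mult, Cmod_R, Rabs_pos_eq by lra. nra. }
 assert (Ball1 : forall t x, `|t - a| < rho -> 0 <= x <= lam -> `|t + RtoC x * w - a| < r).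
 { intros t x Ht Hx. replace (t + RtoC x * w - a)%C with ((t - a) + RtoC x * w)%C by ring. generalize (Cmod_triangle (t - a) (RtoC x * w)) (Bw x Hx). lra. }
 assert (Ball2 : forall t x, `|t - a| < rho -> 0 <= x <= lam -> `|t - RtoC x * w - a| < r).
 { intros t x Ht Hx. replace (t - RtoC x * w - a)%C with ((t - a) - RtoC x * w)%C by ring. generalize (Cmod_minus_le (t - a) (RtoC x * w)) (Bw x Hx). lra. }
 set (pm := (a - RtoC lam * w)%C). set (pp := (a + RtoC lam * w)%C).
 assert (Hpm : `|pm - a| < r). { unfold pm. apply Ball2; try lra. self. }
 assert (Hpp : `|pp - a| < r). { unfold pp. apply Ball1; try lra. self. }
 assert (UpOff : forall t, `|t - a| < r -> upper t -> ~ image gamma t). { intros t Ht U. apply (ss_upper SS); auto. lra. }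
 assert (LoOff : forall t, `|t - a| < r -> lower t -> ~ image gamma t). { intros t Ht U. apply (ss_lower SS); auto. lra. }
 assert (AxisUp : forall x, 0 < x -> upper (a + RtoC x * w)%C).
 { intros x Hx. apply (Cone _ x Hx). replace (a + RtoC x * w - a - RtoC x * w)%C with (RtoC 0) by ring. rewrite Cmod_0. nra. }
 assert (AxisLo : forall x, 0 < x -> lower (a - RtoC x * w)%C).
 { intros x Hx. apply (Cone _ x Hx). replace (a - RtoC x * w - a + RtoC x * w)%C with (RtoC 0) by ring. rewrite Cmod_0. nra. }
 assert (HPhi : hold Phi a r). { apply hold_sub with (1 := ss_Phi SS). self. }
 assert (Hhf : hold f a r). { apply hold_sub with (1 := ss_f SS). self. }
 (* From [t] one first moves up along [w], which does not leave the upper side, and then straight to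
    [pp] inside the cone. The curve is not met, so the sums are unchanged. *)
 assert (Tup : forall t H, `|t - a| < rho -> upper t -> hold H a r -> (reach t H <-> reach pp H)).
 { intros t H Ht Ut HH. assert (B1 : `|t + RtoC lam * w - a| < r) by (apply Ball1; auto; lra).
  transitivity (reach (t + RtoC lam * w)%C H); apply reach_same with (a := a) (r := r); auto; try lra; intros x Hx.
  - replace (seg t (t + RtoC lam * w) x) with (t + RtoC (x * lam) * w)%C by (unfold seg; rewrite RtoC_mult; ring).
   apply UpOff. apply Ball1; auto. nra. apply (ss_up SS); auto. nra.
  - apply UpOff. now apply seg_ball. apply (Cone _ lam Pl). apply Rle_trans with rho; auto. unfold pp.
   replace (seg (t + RtoC lam * w) (a + RtoC lam * w) x - a - RtoC lam * w)%C with (RtoC (1 - x) * (t - a))%C by (unfold seg; rewrite RtoC_minus; ring).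
   rewrite Cmod_mult, Cmod_R, Rabs_pos_eq by lra. nra. }
 assert (Tlo : forall t H, `|t - a| < rho -> lower t -> hold H a r -> (reach t H <-> reach pm H)).
 { intros t H Ht Ut HH. assert (B1 : `|t - RtoC lam * w - a| < r) by (apply Ball2; auto; lra).
  transitivity (reach (t - RtoC lam * w)%C H); apply reach_same with (a := a) (r := r); auto; try lra; intros x Hx.
  - replace (seg t (t - RtoC lam * w) x) with (t - RtoC (x * lam) * w)%C by (unfold seg; rewrite RtoC_mult; ring).
   apply LoOff. apply Ball2; auto. nra. apply (ss_low SS); auto. nra.
  - apply LoOff. now apply seg_ball. apply (Cone _ lam Pl). apply Rle_trans with rho; auto. unfold pm.
   replace (seg (t - RtoC lam * w) (a - RtoC lam * w) x - a + RtoC lam * w)%C with (RtoC (1 - x) * (t - a))%C by (unfold seg; rewrite RtoC_minus; ring).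
   rewrite Cmod_mult, Cmod_R, Rabs_pos_eq by lra. nra. }
 assert (SegEq : forall x, seg pm pp x = (a + RtoC ((2 * x - 1) * lam) * w)%C).
 { intros x. unfold seg, pm, pp. rewrite RtoC_mult, RtoC_minus, RtoC_mult. ring. }
 assert (SegOff : forall x, 0 <= x <= 1 -> x <> 1 / 2 -> ~ image gamma (seg pm pp x)).
 { intros x Hx Nx. assert (Bx : `|seg pm pp x - a| < r) by now apply seg_ball. rewrite SegEq in *. destruct (Rlt_dec x (1 / 2)).
  - apply LoOff; auto. replace (a + RtoC ((2 * x - 1) * lam) * w)%C with (a - RtoC ((1 - 2 * x) * lam) * w)%C by (rewrite !RtoC_mult, !RtoC_minus; ring). apply AxisLo. nra.
  - apply UpOff; auto. apply AxisUp. nra. }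
 assert (SegA : seg pm pp (1 / 2) = a). { rewrite SegEq. replace ((2 * (1 / 2) - 1) * lam) with 0 by lra. ring. }
 assert (Cr1 : crosses gamma (seg pm pp) (1 / 2) 1).
 { sa. exists (pp - pm)%C. split. apply rderiv_is_derive, rderiv_seg. rewrite SegA. intros s u A B D.
  replace (pp - pm)%C with (RtoC (2 * lam) * w)%C by (unfold pp, pm; rewrite RtoC_mult; ring). rewrite cross_scal_r. specialize (Hw s u A B D). nra. }
 assert (SegA' : seg pp pm (1 / 2) = a). { rewrite seg_rev. replace (1 - 1 / 2) with (1 / 2) by lra. auto. }
 assert (Cr2 : crosses gamma (seg pp pm) (1 / 2) (-1)).
 { sa. exists (pm - pp)%C. split. apply rderiv_is_derive, rderiv_seg. rewrite SegA'. intros s u A B D.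
  replace (pm - pp)%C with (RtoC (-2 * lam) * w)%C by (unfold pp, pm; rewrite RtoC_mult; replace (RtoC (-2)) with (- RtoC 2)%C by (rewrite <- RtoC_opp; f_equal; lra); ring). rewrite cross_scal_r. specialize (Hw s u A B D). nra. }
 assert (Trans : forall H, hold H a r -> (reach pp (fun z => H z + RtoC 1 * f z)%C <-> reach pm H)).
 { intros H HH. assert (HH1 : hold (fun z => H z + RtoC 1 * f z)%C a r). { intros z Hz. auto. }
  split; intros HR.
  - apply reach_ext with (fun z => (H z + RtoC 1 * f z) + RtoC (-1) * f z)%C.
   { apply germ_eq_pointwise. intros z. ring. }
   apply (reach_cross pp pm (fun z => H z + RtoC 1 * f z)%C a r (-1) f); auto.
   intros t Ht Nt. rewrite seg_rev. apply SegOff; lra.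
  - apply (reach_cross pm pp H a r 1 f); auto. }
 exists r, rho, Phi, f, pm. sp. sa. sa. sa. sa. split. auto. sa. split. eauto.
 split. { intros e He. set (x := Rmin lam (e / 2 / `|w|)). assert (Px : 0 < x). pos.
  exists (a + RtoC x * w)%C. split.
  - replace (a + RtoC x * w - a)%C with (RtoC x * w)%C by ring. rewrite Cmod_mult, Cmod_R, Rabs_pos_eq by lra.
   assert (x * `|w| <= e / 2). { apply Rle_trans with (e / 2 / `|w| * `|w|). apply Rmult_le_compat_r. lra. apply Rmin_r. right. field. lra. } lra.
  - apply UpOff; auto. apply Ball1. self. sp. apply Rmin_l. }
 intros t Ht Nt. destruct (ss_cases SS t LRA Nt) as [U|U].
 - exists 1. sa. split.
  + apply germ_eq_trans with (fun z => Phi z + f z)%C. apply (ss_upper SS); auto. lra. apply germ_eq_pointwise. intros z. ring.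
  + intros H HH. rewrite <- Trans; auto. apply Tup; auto. intros z Hz. auto.
 - exists 0. sa. split.
  + apply germ_eq_trans with Phi. apply (ss_lower SS); auto. lra. apply germ_eq_pointwise. intros z. ring.
  + intros H HH. rewrite <- (Tlo t); auto. split; apply reach_ext; auto. now apply germ_eq_sym.
Qed.

(** * Independence of the path and the global function *)

Definition unique_sum (d : C) : Prop :=
 forall h h', reach d h -> reach d h' -> germ_eq d h h'.

(** Around [a] the function [I] minus the sum of branches is well defined off the curve and extends
    holomorphically across it, to [Phi]. *)
Definition nice (a : C) (rho : R) (Phi : C -> C) : Prop :=
 0 < rho /\ hold Phi a rho /\ forall t, `|t - a| < rho -> ~ image gamma t ->
  exists H, reach t H /\ unique_sum t /\
   germ_eq t Phi (fun z => cauchy_integral gamma g z - H z)%C.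

Lemma off_image_dense a e : ~ In a Bad -> 0 < e ->
 exists t, `|t - a| < e /\ ~ image gamma t.
Proof.
 intros Na He. destruct (local_sides a Na) as [r [rho [Phi [f [p [_ [_ [_ [_ [_ [_ [_ [_ [K _]]]]]]]]]]]]]]. auto.
Qed.

(** Uniqueness of the sum at one point near [a] is enough. By [local_sides] sums at two points near
    [a] correspond to each other up to a multiple of [f], the same for all sums, and this multiple
    is also the difference of [I]. *)
Lemma nice_of_reach a : ~ In a Bad ->
 exists rho, 0 < rho /\ forall t h, `|t - a| < rho -> reach t h -> unique_sum t ->
  exists Phi, nice a rho Phi.
Proof.
 intros Na. destruct (local_sides a Na) as [r [rho [Phi [f [p [Hrho [HG [HPhi [Hf [_ [_ [Hp [Np [_ K]]]]]]]]]]]]]].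
 exists rho. sp. intros t h Ht Rt Ut. assert (Nt := reach_off _ _ Rt).
 destruct (K t Ht Nt) as [j [_ [_ Kt]]].
 destruct (reach_hold t h a r HG LRA Rt) as [H0 [HH0 E0]].
 assert (Hh : forall G x, hold G a r -> hold (fun z => G z + RtoC x * f z)%C a r).
 { intros G x HGr z Hz. auto. }
 assert (Cancel : forall G x y d, germ_eq d (fun z => G z + RtoC x * f z + RtoC y * f z)%C (fun z => G z + RtoC (x + y) * f z)%C).
 { intros. apply germ_eq_pointwise. intros z. rewrite RtoC_plus. ring. }
 assert (Zero : forall G x d, x = 0 -> germ_eq d (fun z => G z + RtoC x * f z)%C G). { intros G x d ->. apply germ_eq_pointwise. intros z. ring. }
 set (H := fun z => (H0 z + RtoC (- j) * f z)%C). assert (HH : hold H a r) by eauto.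
 assert (Rp : reach p H).
 { apply Kt; auto. apply reach_ext with h; auto. apply germ_eq_trans with (1 := E0). apply germ_eq_sym. apply germ_eq_trans with (1 := Cancel H0 (- j) j t). apply Zero. lra. }
 exists (fun z => Phi z - H z)%C. sp. split. { intros z Hz. apply holo_minus; [apply HPhi|apply HH]; lra. }
 intros t' Ht' Nt'. destruct (K t' Ht' Nt') as [j' [_ [EI Kt']]]. exists (fun z => H z + RtoC j' * f z)%C. split. now apply Kt'. split.
 - intros h1 h2 R1 R2.
  destruct (reach_hold t' h1 a r HG LRA R1) as [H1 [HH1 E1]].
  destruct (reach_hold t' h2 a r HG LRA R2) as [H2 [HH2 E2]].
  (* A sum at [t'] is transported to [p] and on to [t]; two sums receive the same correction, so
     they can be compared at [t]. *)
  assert (W : forall h G, reach t' h -> hold G a r -> germ_eq t' h G -> reach t (fun z => G z + RtoC (- j' + j) * f z)%C).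
  { intros k G Rk HGr Ek. apply reach_ext with (1 := Cancel G (- j') j t). apply Kt; auto. apply Kt'; auto.
   apply reach_ext with k; auto. apply germ_eq_trans with (1 := Ek). apply germ_eq_sym. apply germ_eq_trans with (1 := Cancel G (- j') j' t'). apply Zero. lra. }
  assert (E := Ut _ _ (W h1 H1 R1 HH1 E1) (W h2 H2 R2 HH2 E2)).
  apply germ_eq_trans with (1 := E1). apply germ_eq_sym. apply germ_eq_trans with (1 := E2).
  apply germ_eq_Cmod. exists (r - `|t' - a|). sp. intros z Hz.
  apply (hold_equal H2 H1 a r t); auto. lra. apply germ_eq_sym. apply (germ_eq_rel _ _ _ _ _ _ E E). intros w Q _.
  apply (f_equal (fun x => x - RtoC (- j' + j) * f w)%C) in Q. ring_simplify in Q. auto.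
  generalize (Cmod_triangle_minus z t' a). lra.
 - apply (germ_eq_rel _ _ _ _ _ _ EI EI). intros z -> _. ring.
Qed.

(** The existence of a nice neighbourhood is an open and closed condition off [Bad]: nearby points
    share points off the curve where the sum is unique. *)
Lemma nice_spread a : ~ In a Bad ->
 exists d, 0 < d /\ forall b, ~ In b Bad -> `|b - a| < d ->
  ((exists rho Phi, nice b rho Phi) -> exists rho Phi, nice a rho Phi) /\
  ((exists rho Phi, nice a rho Phi) -> exists rho Phi, nice b rho Phi).
Proof.
 intros Na. destruct (nice_of_reach a Na) as [d [Pd Kd]].
 assert (To : forall b, ~ In b Bad -> forall a' q, 0 < q -> `|b - a'| < q -> (exists rho Phi, nice b rho Phi) ->
  exists t h, `|t - a'| < q /\ reach t h /\ unique_sum t).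
 { intros b Nb a' q Pq Hb [rho [Phi [Pr [_ K]]]].
  destruct (off_image_dense b (Rmin rho (q - `|b - a'|))) as [t [Ht Nt]]; auto. pos.
  rmin.
  destruct (K t LRA Nt) as [H' [RH [UH _]]]. exists t, H'. sa. triang. }
 assert (From : forall b, ~ In b Bad -> `|b - a| < d -> (exists rho Phi, nice b rho Phi) -> exists rho Phi, nice a rho Phi).
 { intros b Nb Hb Hn. destruct (To b Nb a d Pd Hb Hn) as [t [h [Ht [Rt Ut]]]]. eauto. }
 destruct (classic (exists rho Phi, nice a rho Phi)) as [Ya|No].
 - destruct Ya as [rho [Phi [Pr [HPhi K]]]]. exists (Rmin d rho). sp. intros b Nb Hb.
  rmin. split. intros _. exists rho, Phi. sa. intros _.
  destruct (nice_of_reach b Nb) as [q [Pq Kq]].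
  destruct (off_image_dense b (Rmin q (rho - `|b - a|))) as [t [Ht Nt]]; auto. pos.
  rmin.
  destruct (K t) as [H' [RH [UH _]]]; auto. triang.
  exists q. apply (Kq t H'); auto. lra.
 - exists d. sa. intros b Nb Hb. split. eauto. easy.
Qed.

Lemma nice_path S u v : u <= v -> rcont_on u v S ->
 (forall t, u <= t <= v -> ~ In (S t) Bad) -> (exists rho Phi, nice (S u) rho Phi) -> exists rho Phi, nice (S v) rho Phi.
Proof.
 intros Huv Hc HN H0. apply (interval_induction_right (fun t => exists rho Phi, nice (S t) rho Phi) u v); auto.
 intros x Hx. destruct (nice_spread (S x) (HN x Hx)) as [d [Pd Kd]]. destruct (Hc x Hx d Pd) as [q [Pq Kq]].
 exists q. sa. split; intros t Ht L; apply (Kd (S t)); try apply HN; try apply Kq; try lra; rabs.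
Qed.

Lemma continuation_extends S u m v F : u <= m <= v -> rcont_on u v S ->
 (forall t, m <= t <= v -> ~ In (S t) Bad) -> continuation_along S u m F -> satisfies P (F u) (S u) ->
 exists F', continuation_along S u v F' /\ germ_eq (S u) (F' u) (F u).
Proof.
 intros Hm Hc HN HF PF.
 apply (interval_induction_right (fun y => exists F', continuation_along S u y F' /\ germ_eq (S u) (F' u) (F u)) m v). lra.
 { exists F. sa. apply germ_eq_refl. }
 intros x Hx. destruct (bs_disc HB (S x) (HN x Hx)) as [r HG]. assert (Pr : 0 < r) by apply HG.
 destruct (Hc x LRA r Pr) as [d [Pd Kd]].
 assert (W : forall y z, m <= y <= z -> z <= v -> x - d < y -> z < x + d -> 
  (exists F', continuation_along S u y F' /\ germ_eq (S u) (F' u) (F u)) -> exists F', continuation_along S u z F' /\ germ_eq (S u) (F' u) (F u)).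
 { intros y z Hy Hz L1 L2 [F' [A B]].
  assert (Py : satisfies P (F' y) (S y)). { apply (satisfies_continuation P S u y F'); auto. lra. rsub Hc. apply satisfies_ext with (F u); auto. now apply germ_eq_sym. }
  assert (Near : forall t, y <= t <= z -> `|S t - S x| < r). { intros t Ht. apply Kd. lra. rabs. }
  destruct HG as [_ [_ HG]]. destruct (HG (S y) (F' y)) as [K [HK EK]]; auto. apply Near; lra. apply A; lra.
  exists (fun t => if Rle_dec t y then F' t else K). split.
  - apply continuation_glue with (S x) r; auto. rsub Hc. lra. now apply germ_eq_sym.
  - destruct (Rle_dec u y); [auto|lra]. }
 exists d. sa. split; intros t Ht L; apply W; lra.
Qed.

(* The centre [c] itself may be exceptional for the algebraic equation; there only the definition of [U] helps. *)
Lemma unique_sum_near_base : ~ image gamma c -> U_set gamma Sigma g c ->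
 (forall S h, admissible gamma Sigma g c c S -> sum_of_branches gamma g S h -> germ_eq c h (fun _ => RtoC 0)) ->
 exists r, 0 < r /\ forall c1, `|c1 - c| < r -> c1 <> c ->
  ~ In c1 Bad /\ reach c1 (fun _ => RtoC 0) /\ unique_sum c1.
Proof.
 intros Nc HU HM. destruct (off_image_ball gamma c (gamma_piecewise_smooth _ _ _ HS) Nc) as [r1 [Pr1 Kr1]].
 destruct (list_isolated Bad c) as [r2 [Pr2 Kr2]]. exists (Rmin r1 r2). sp.
 intros c1 Hc1 N1.
 assert (SegOff : forall t, 0 <= t <= 1 -> ~ image gamma (seg c c1 t)).
 { intros t Ht [s [Hs E]]. specialize (Kr1 s Hs). assert (`|seg c c1 t - c| < r1). apply seg_ball; auto. self. ar. rewrite E in Kr1. lra. }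
 assert (NB : forall z, `|z - c| < r2 -> z <> c -> ~ In z Bad). { intros z Hz Nz i. specialize (Kr2 z i Nz). lra. }
 assert (SegEq : forall t, (seg c c1 t - c)%C = (RtoC t * (c1 - c))%C) by (intros; unfold seg; ring).
 assert (P1 : 0 < `|c1 - c|). { apply Cmod_gt_0. now apply Cminus_neq0. }
 assert (SegNB : forall t, 0 < t <= 1 -> ~ In (seg c c1 t) Bad).
 { intros t Ht. apply NB. apply seg_ball. lra. self. ar.
  intros E. assert (Q : (RtoC t * (c1 - c))%C = RtoC 0). { rewrite <- SegEq, E. ring. } apply Cmult_integral in Q. destruct Q as [Q|Q].
  apply RtoC_inj in Q. lra. apply Cminus_eq0 in Q. auto. }
 split. { apply NB; auto. ar. }
 assert (N1' : ~ image gamma c1). { rewrite <- (seg_1 c c1). apply SegOff. lra. }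
 split.
 { sa. exists (seg c c1), 1, nil, (fun _ => 0), (fun _ _ _ => RtoC 0). split; [constructor|split].
  - lra.
  - apply rcont_rcont_on. intros; apply rcont_seg.
  - apply seg_0.
  - intros t Ht. destruct (Req_dec t 0) as [->|]. now rewrite seg_0. apply (bs_U HB). apply SegNB. lra.
  - constructor.
  - intros t. split. intros []. intros [A B]. apply (SegOff t); auto.
  - easy.
  - apply seg_1.
  - apply germ_eq_refl. }
 (* A path to [c1] is closed by the segment back to [c]. The sum along the loop vanishes by
    hypothesis, and the vanishing is carried back along the segment. *)
 assert (Main : forall h, reach c1 h -> germ_eq c1 h (fun _ => RtoC 0)).
 { intros h [_ [S [T [l [e [F [HP [ST Hh]]]]]]]]. rewrite <- ST in *.
  assert (PT := sp_T HP). assert (Hl := sp_list HP).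
  assert (LtL := fun t => sum_path_lt S T l e F t HP N1').
  set (S' := append S T c).
  assert (S'1 := append_l S T c). assert (S'2 := append_r S T c). fold S' in S'1, S'2.
  assert (S'3 : forall t, T <= t -> S' t = seg c (S T) (T + 1 - t)). { intros t Ht. rewrite S'2, seg_rev by auto. f_equal. lra. }
  assert (HS' : rcont_on 0 (T + 1) S') by (apply rcont_on_append; auto; apply (sp_cont HP)).
  assert (End := append_end S T c). fold S' in End.
  destruct (choice_on (fun t => In t l) (fun t Ft => continuation_along S' t (T + 1) Ft /\ germ_eq (S t) (Ft t) (F t t)) (fun _ _ => RtoC 0)) as [F' HF'].
  { intros t i.
   assert (Lt := LtL t i). destruct (sp_term HP t i) as [_ [Hb HF]].
   assert (Pn : punctured gamma Sigma (S t)). { split. now apply Hl. apply (sp_U HP). lra. }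
   assert (HF2 := continuation_append S T c t (F t) HF). fold S' in HF2.
   set (kk := T + 1 - t).
   assert (NotSing : ~ singular_point gamma Sigma g c). { intros Q. apply (proj2 HU). easy. }
   (* Along the closing segment the branch continues up to any point before [c], as these points are
      not in [Bad]. If it did not continue to [c], then [c] would be a singular point, against [c]
      being in [U]. *)
   assert (exists h0, continues_to (fun x => S' (kk * x + t)) 0 1 (F t t) h0) as [h0 [F0 [HF0 [E0 E1]]]].
   { apply NNPP. intros N. apply NotSing. exists (fun x => S' (kk * x + t)), (F t t).
    assert (Z0 : kk * 0 + t = t) by ring.
    split. { apply continuous_on_rcont_on. apply rcont_on_affine with 0 (T + 1); auto. intros x Hx. unfold kk. split; nra. }
    rewrite Z0. rewrite S'1 by lra. sa. split. { replace (kk * 1 + t) with (T + 1). auto. unfold kk. lra. } sa. sa.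
    intros x Hx. set (y := Rmax T (kk * x + t)). assert (Hy : T <= y) by apply Rmax_l. assert (Hy' : kk * x + t <= y) by apply Rmax_r.
    assert (Hy2 : y < T + 1). { apply Rmax_lub_lt. lra. unfold kk. nra. }
    destruct (continuation_extends S' t T y (F t)) as [Fy [A B]]; auto. lra.
    { rsub HS'. }
    { intros s Hs. rewrite S'3 by lra. apply SegNB. lra. }
    { rewrite S'1 by lra. apply (branch_algebraic gamma Sigma g P); auto. now apply (bs_branch HB). }
    exists (Fy (kk * x + t)), (fun w => Fy (kk * w + t)). split; [|split].
    - apply continuation_affine with t y; auto. intros w Hw. unfold kk in *. split; nra.
    - congruence.
    - apply germ_eq_refl. }
   exists (fun x => F0 (/ kk * x + - t / kk)). assert (Pkk : 0 < kk) by (unfold kk; lra). split.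
   - assert (Q := continuation_affine (fun x => S' (kk * x + t)) 0 1 F0 (/ kk) (- t / kk) t (T + 1)).
    apply (continuation_eq (fun x => S' (kk * (/ kk * x + - t / kk) + t))).
    + intros x _. f_equal. field. lra.
    + apply Q; auto. intros x Hx. replace (/ kk * x + - t / kk) with ((x - t) / kk) by lra. split. apply Rdiv_le_0_compat; lra.
     apply Rle_div_l; auto. unfold kk. lra.
   - replace (/ kk * t + - t / kk) with 0 by lra. replace (kk * 0 + t) with t in E0 by ring. rewrite S'1 in E0 by lra. auto. }
  assert (NewPath : sum_path S' (T + 1) l e F').
  { constructor.
   - lra.
   - auto.
   - rewrite S'1 by lra. apply (sp_start HP).
   - intros t Ht. destruct (Rle_dec t T). rewrite S'1 by lra. apply (sp_U HP). lra.
    destruct (Req_dec t (T + 1)) as [->|]. congruence. rewrite S'3 by lra. apply (bs_U HB). apply SegNB. lra.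
   - apply (sp_nodup HP).
   - intros t. rewrite Hl. split. intros [A B]. rewrite S'1 by lra. sa. lra.
    intros [A B]. destruct (Rle_dec t T). rewrite S'1 in B by lra. easy. exfalso. rewrite S'3 in B by lra. apply (SegOff (T + 1 - t)); auto. lra.
   - intros t Ht. assert (Lt := LtL t Ht). destruct (sp_term HP t Ht) as [A [B _]]. destruct (HF' t Ht) as [D1 D2]. rewrite S'1 by lra. split; [|split]; auto.
    + apply crosses_append; auto. lra.
    + apply branch_at_ext with (F t t); auto. now apply germ_eq_sym. }
  assert (RK : reach c (fun z => csum l (fun t => RtoC (e t) * F' t (T + 1)%R z)%C)).
  { sa. exists S', (T + 1), l, e, F'. sa. sa. apply germ_eq_refl. }
  destruct (reach_admissible c _ Nc RK) as [S2 [A2 B2]]. assert (Z := HM S2 _ A2 B2).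
  assert (Z1 : germ_eq (S T) (fun z => csum l (fun t => RtoC (e t) * F' t T z)%C) (fun _ => RtoC 0)).
  { rewrite <- (S'1 T) by lra. apply (continuation_zero_back S' T (T + 1) (fun x z => csum l (fun t => RtoC (e t) * F' t x z)%C)).
   - lra.
   - rsub HS'.
   - apply (continuation_csum S' T (T + 1) l (fun t x z => RtoC (e t) * F' t x z)%C). intros t Ht. apply continuation_scal.
    apply continuation_sub with t (T + 1); try lra. specialize (LtL t Ht); lra. now apply HF'.
   - congruence. }
  apply germ_eq_trans with (1 := Hh). apply germ_eq_trans with (2 := Z1). apply (csum_germ _ l (fun t z => RtoC (e t) * F t T z)%C (fun t z => RtoC (e t) * F' t T z)%C).
  intros t Ht. apply germ_eq_mult. apply germ_eq_refl. assert (Lt := LtL t Ht). destruct (HF' t Ht) as [D1 D2].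
  destruct (sp_term HP t Ht) as [_ [_ D3]].
  apply (continuation_unique S t T (F t) (F' t)); auto. lra. apply rcont_on_sub with (3 := sp_cont HP); lra.
  { apply (continuation_eq S'). intros x Hx. apply S'1. lra. apply continuation_sub with t (T + 1); auto; lra. }
  now apply germ_eq_sym. }
 intros h h' Hh Hh'. apply germ_eq_trans with (1 := Main h Hh). apply germ_eq_sym. auto.
Qed.

Lemma nice_everywhere a : ~ image gamma c -> U_set gamma Sigma g c ->
 (forall S h, admissible gamma Sigma g c c S -> sum_of_branches gamma g S h -> germ_eq c h (fun _ => RtoC 0)) ->
 ~ In a Bad -> exists rho Phi, nice a rho Phi.
Proof.
 intros Nc HU HM Na. destruct (unique_sum_near_base Nc HU HM) as [r [Pr Kr]].
 destruct (infinite_away (c :: nil) c r Pr) as [c1 [Hc1 N1]]. destruct (Kr c1 Hc1) as [N2 [R1 U1]]. { intros ->. apply N1. now left. }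
 assert (H1 : exists rho Phi, nice c1 rho Phi).
 { destruct (nice_of_reach c1 N2) as [q [Pq Kq]]. exists q. apply (Kq c1 (fun _ => RtoC 0)); auto. self. }
 destruct (polyline_avoiding Bad c1 a 1 N2 Na) as [x [_ Hx]]. lra. set (m := (seg c1 a (1 / 2) + RtoC x * Ci * (a - c1))%C) in *.
 assert (W : forall u v, (forall t, 0 <= t <= 1 -> ~ In (seg u v t) Bad) -> (exists rho Phi, nice u rho Phi) -> exists rho Phi, nice v rho Phi).
 { intros u v Huv Hu. rewrite <- (seg_1 u v). apply (nice_path (seg u v) 0 1); auto. lra. apply rcont_rcont_on. intros; apply rcont_seg. now rewrite seg_0. }
 apply (W m). intros; now apply Hx. apply (W c1); auto. intros; now apply Hx.
Qed.

(** Two local functions agree near a common point: points off the curve are dense, and there both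
    are [I] minus the unique sum. The value at [a] is taken from the function chosen at [a]. *)
Lemma global_function : (forall a, ~ In a Bad -> exists rho Phi, nice a rho Phi) ->
 exists F, forall a, ~ In a Bad -> exists rho, nice a rho F.
Proof.
 intros HN.
 destruct (choice (fun a (x : R * (C -> C)) => ~ In a Bad -> nice a (fst x) (snd x))) as [N KN].
 { intros a. destruct (classic (In a Bad)) as [i|i]. exists (0, fun _ => RtoC 0). easy. destruct (HN a i) as [rho [Phi K]]. now exists (rho, Phi). }
 exists (fun a => snd (N a) a). intros a Na. destruct (KN a Na) as [Pr [Hh K]]. destruct (bs_disc HB a Na) as [r [Prr [HG _]]].
 set (rho := Rmin (fst (N a)) r). assert (Prho : 0 < rho) by pos. assert (L1 : rho <= fst (N a)) by apply Rmin_l. assert (L2 : rho <= r) by apply Rmin_r.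
 assert (E : forall b, `|b - a| < rho -> snd (N a) b = snd (N b) b).
 { intros b Hb. assert (Nb : ~ In b Bad) by (apply HG; lra). destruct (KN b Nb) as [Pb [Hhb Kb]].
  set (q := Rmin (fst (N b)) (fst (N a) - `|b - a|)). assert (Pq : 0 < q) by pos.
  assert (q <= fst (N b)) by apply Rmin_l. assert (q <= fst (N a) - `|b - a|) by apply Rmin_r.
  destruct (off_image_dense b q Nb Pq) as [t [Ht Nt]].
  destruct (K t) as [H1 [R1 [U1 E1]]]; auto. triang.
  destruct (Kb t) as [H2 [R2 [_ E2]]]; auto. lra.
  apply (hold_equal (snd (N a)) (snd (N b)) b q t); auto.
  - apply hold_sub with (1 := Hh). lra.
  - apply hold_sub with (1 := Hhb). self.
  - apply germ_eq_trans with (1 := E1). apply germ_eq_sym. apply germ_eq_trans with (1 := E2). apply germ_eq_minus. apply germ_eq_refl. now apply U1.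
  - self. }
 exists rho. sa. split.
 - apply hold_ext with (snd (N a)); auto. apply hold_sub with (1 := Hh). self.
 - intros t Ht Nt. destruct (K t) as [H [RH [UH EH]]]; auto. lra. exists H. sa. sa. apply germ_eq_trans with (2 := EH).
  apply germ_eq_Cmod. exists (rho - `|t - a|). sp. intros z Hz. symmetry. apply E. triang.
Qed.

(** * Growth of the continued function *)

Lemma nice_holo a rho F : nice a rho F -> holo F a.
Proof. intros [Pr [Hh _]]. apply Hh. self. Qed.

Context (F : C -> C) (HN : forall a, ~ In a Bad -> exists rho, nice a rho F).

(** For the growth only the number of terms and the equation satisfied by each of them matter, so
    the paths are forgotten. Coefficients of modulus at most [1] cover both signs of a crossing and
    its absence. *)
Inductive psum (t : C) : nat -> (C -> C) -> Prop :=
| psum_nil : psum t 0 (fun _ => RtoC 0)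
| psum_cons n h e f : Rabs e <= 1 -> holomorphic_at f t -> satisfies P f t -> psum t n h -> psum t (S n) (fun z => RtoC e * f z + h z)%C.

Definition counted (n : nat) (t : C) : Prop :=
 exists m h, (m <= n)%nat /\ psum t m h /\ germ_eq t F (fun z => cauchy_integral gamma g z - h z)%C.

Lemma psum_csum t l e (k : R -> C -> C) : (forall s, In s l -> Rabs (e s) <= 1 /\ holomorphic_at (k s) t /\ satisfies P (k s) t) ->
 psum t (length l) (fun z => csum l (fun s => RtoC (e s) * k s z)%C).
Proof.
 induction l as [|s l IH]; intros H. apply psum_nil. destruct (H s (or_introl eq_refl)) as [A [B D]].
 apply (psum_cons t (length l) (fun z => csum l (fun s => RtoC (e s) * k s z)%C) (e s) (k s)); auto. apply IH. intros; apply H. now right.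
Qed.

Lemma psum_bound t n h M : psum t n h -> (forall w, peval2 P t w = RtoC 0 -> `|w| <= M) -> `|h t| <= INR n * M.
Proof.
 intros H HM. induction H as [|n h e f He _ Hs _ IH]. rewrite Cmod_0. simpl; lra.
 rewrite S_INR. assert (Q := HM _ (satisfies_at _ _ _ Hs)). tri. rewrite Cmod_mult, Cmod_R. generalize (Rabs_pos e) (Cmod_ge_0 (f t)). nra.
Qed.

Lemma psum_extend a r t n h : good_disc P Bad a r -> `|t - a| < r -> psum t n h ->
 exists H, hold H a r /\ germ_eq t h H /\ forall t', `|t' - a| < r -> psum t' n H.
Proof.
 intros HG Ht H. induction H as [|n h e f He Hf Hs _ [H [HH [EH KH]]]].
 - exists (fun _ => RtoC 0). split. easy. split. apply germ_eq_refl. intros; apply psum_nil.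
 - destruct HG as [_ [_ HG]]. destruct (HG t f Ht Hf Hs) as [K [HK EK]]. exists (fun z => RtoC e * K z + H z)%C. split; [|split].
  + intros z Hz. auto.
  + apply germ_eq_plus; auto. apply germ_eq_mult. apply germ_eq_refl. now apply germ_eq_sym.
  + intros t' Ht'. apply psum_cons; auto. now apply hold_holomorphic_at with a r.
   assert (Z : forall z, `|z - a| < r -> peval2 P z (K z) = RtoC 0).
   { apply (hold_identity (fun z => peval2 P z (K z)) a r t); auto. intros z Hz. apply holo_peval2; auto.
    apply (germ_eq_rel t _ _ _ _ _ (germ_eq_sym _ _ _ EK) Hs). congruence. }
   apply locally_Cmod. exists (r - `|t' - a|). sp. intros z Hz. apply Z. triang.
Qed.

Lemma counted_of_nice a rho : nice a rho F -> ~ image gamma a ->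
 exists n, counted n a.
Proof.
 intros [Pr [_ K]] Na. destruct (K a) as [H [[_ [S [T [l [e [k [HP [ST Hh]]]]]]]] [_ EF]]]; auto. self.
 exists (length l), (length l), (fun z => csum l (fun s => RtoC (e s) * k s T z)%C). sa. split.
 - apply (psum_csum a l e (fun s => k s T)). intros s Hs. destruct (sum_path_satisfies _ _ _ _ _ _ HP Hs) as [A B]. rewrite ST in A, B.
  sa. destruct (sp_term HP s Hs) as [[[-> | ->] _] _]. rewrite Rabs_R1; lra. rewrite Rabs_left; lra.
 - apply germ_eq_trans with (1 := EF). apply germ_eq_minus; auto. apply germ_eq_refl.
Qed.

(** Near [a] two points off the curve differ by at most one crossing of the curve through [a], hence
    by one term [(j' - j) f]; if [a] is off the curve there is no difference. *)
Lemma counted_transfer a : ~ In a Bad ->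
 exists d, 0 < d /\ forall n t t', `|t - a| < d -> `|t' - a| < d -> ~ image gamma t -> ~ image gamma t' ->
  counted n t -> (~ image gamma a -> counted n t') /\ counted (S n) t'.
Proof.
 intros Na. destruct (HN a Na) as [rF [PrF [HF _]]]. destruct (local_sides a Na) as [r [rho [Phi [f [p [Hrho [HG [HPhi [Hf [Sf [_ [_ [_ [_ K]]]]]]]]]]]]]].
 set (d := Rmin rF rho). assert (Pd : 0 < d) by pos. assert (L1 : d <= rF) by apply Rmin_l. assert (L2 : d <= rho) by apply Rmin_r.
 exists d. sa. intros n t t' Ht Ht' Nt Nt' [m [h [Hm [Ph EF]]]].
 destruct (K t LRA Nt) as [j [Hj [EI _]]]. destruct (K t' LRA Nt') as [j' [Hj' [EI' _]]].
 destruct (psum_extend a r t m h HG LRA Ph) as [H [HH [EH KH]]].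
 assert (E : forall z, `|z - a| < d -> F z = (Phi z + RtoC j * f z - H z)%C).
 { apply hold_equal with t; auto. apply hold_sub with (1 := HF). self.
  intros z Hz. apply holo_minus; [apply holo_plus; [apply HPhi|apply holo_mult; [apply holo_const|apply Hf]]|apply HH]; lra.
  apply germ_eq_trans with (1 := EF). apply germ_eq_minus; auto. }
 assert (E' : germ_eq t' F (fun z => cauchy_integral gamma g z - (RtoC (j' - j) * f z + H z))%C).
 { apply germ_eq_trans with (fun z => Phi z + RtoC j * f z - H z)%C.
  - apply germ_eq_Cmod. exists (d - `|t' - a|). sp. intros z Hz. apply E. triang.
  - apply (germ_eq_rel _ _ _ _ _ _ EI' EI'). intros z -> _. rewrite RtoC_minus. ring. }
 assert (Zero : j = j' -> counted n t').
 { intros ->. exists m, H. sa. split. apply KH; lra. apply germ_eq_trans with (1 := E'). apply germ_eq_pointwise. intros z. rewrite Rminus_diag. ring. }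
 split. { intros Ni. apply Zero. destruct Hj as [->|[_ A]]; [|contradiction]. destruct Hj' as [->|[_ A]]; [auto|contradiction]. }
 destruct (classic (image gamma a)) as [Ia|Ia].
 - exists (S m), (fun z => RtoC (j' - j) * f z + H z)%C. split. lia. sa. apply psum_cons; auto.
  + destruct Hj as [->|[-> _]], Hj' as [->|[-> _]]; apply Rabs_le; lra.
  + apply hold_holomorphic_at with a r; auto; lra.
  + specialize (Sf Ia). assert (Z : forall z, `|z - a| < r -> peval2 P z (f z) = RtoC 0).
   { apply (hold_identity (fun z => peval2 P z (f z)) a r a); auto. intros z Hz. apply holo_peval2; auto. self. }
   apply locally_Cmod. exists (r - `|t' - a|). sp. intros z Hz. apply Z. triang.
  + apply KH; lra.
 - assert (j = j'). { destruct Hj as [->|[_ A]]; [|contradiction]. destruct Hj' as [->|[_ A]]; [auto|contradiction]. }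
  destruct (Zero H0) as [m' [h' [A [B D]]]]. exists m', h'. sa.
Qed.

Lemma counted_mono n m t : (n <= m)%nat -> counted n t -> counted m t.
Proof. intros L [k [h [A B]]]. exists k, h. sa. lia. Qed.

(** Each parameter at which the path meets the curve adds at most one term. The crossings need not
    be transversal, since only values off the curve are compared. *)
Lemma counted_path Z u v X n : u <= v -> rcont_on u v Z -> (forall s, u <= s <= v -> ~ In (Z s) Bad) ->
 (forall s, u <= s <= v -> image gamma (Z s) -> In s X) -> ~ image gamma (Z u) -> ~ image gamma (Z v) -> counted n (Z u) ->
 counted (n + length X) (Z v).
Proof.
 intros Huv Hc HA HX Nu Nv H0.
 destruct (choice_on (fun a => ~ In a Bad) _ 0 counted_transfer) as [dd Kd].
 (* The path may lie on the curve at a parameter, so the induction speaks of all nearby points off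
    the curve. *)
 set (cn := fun m a => forall t, `|t - a| < dd a -> ~ image gamma t -> counted m t).
 assert (Pd : forall s, u <= s <= v -> 0 < dd (Z s)) by (intros s Hs; apply (Kd (Z s)); auto).
 assert (Tr : forall s, u <= s <= v -> forall m t t', `|t - Z s| < dd (Z s) -> `|t' - Z s| < dd (Z s) -> ~ image gamma t -> ~ image gamma t' ->
  counted m t -> (~ image gamma (Z s) -> counted m t') /\ counted (S m) t') by (intros s Hs; apply (Kd (Z s)); auto).
 assert (Common : forall y x m, u <= y <= v -> cn m (Z y) -> `|Z y - Z x| < dd (Z x) -> exists t, `|t - Z y| < dd (Z y) /\ `|t - Z x| < dd (Z x) /\ ~ image gamma t /\ counted m t).
 { intros y x m Hy Hm L. destruct (off_image_dense (Z y) (Rmin (dd (Z y)) (dd (Z x) - `|Z y - Z x|))) as [t [Ht Nt]]; auto. pos. assert (A := lt_minl Ht). assert (B := lt_minr Ht).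
  exists t. sa. split. triang. auto. }
 assert (Q : cn (n + count_le X v)%nat (Z v)).
 { apply (interval_induction_right (fun y => cn (n + count_le X y)%nat (Z y)) u v); auto.
  { intros t Ht Nt. apply counted_mono with n. lia. apply (Tr u LRA n (Z u)); auto. rewrite Cmod_sub_self. cm. }
  intros x Hx. destruct (Hc x Hx (dd (Z x)) (Pd x Hx)) as [q [Pq Kq]]. destruct (Rlist_isolated X x) as [q' [Pq' Kq']].
  exists (Rmin q q'). sp. rmin. split.
  - intros y Hy L HQ. destruct (Req_dec y x) as [->|N]; auto. destruct (count_le_mono X y x) as [M1 M2]. lra.
   destruct (Common y x _ LRA HQ) as [t [A [B [Nt Ct]]]]. apply Kq. lra. rabs.
   intros t' Ht' Nt'. destruct (Tr x Hx _ t t' B Ht' Nt Nt' Ct) as [D1 D2].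
   destruct (classic (image gamma (Z x))) as [Ix|Ix].
   + apply counted_mono with (2 := D2). specialize (M2 (HX x Hx Ix) LRA). lia.
   + apply counted_mono with (2 := D1 Ix). lia.
  - intros y Hy L HQ. destruct (Req_dec y x) as [->|N]; auto. destruct (count_le_mono X x y) as [M1 _]. lra.
   assert (Iy : ~ image gamma (Z y)). { intros Iy. specialize (Kq' y (HX y LRA Iy) N). rewrite Rabs_pos_eq in Kq'; lra. }
   assert (Ny : `|Z y - Z x| < dd (Z x)). { apply Kq. lra. rabs. }
   intros t' Ht' Nt'. apply (Tr y LRA _ (Z y) t'); auto. rewrite Cmod_sub_self. cm.
   apply counted_mono with (n + count_le X x)%nat. lia. auto. }
 apply counted_mono with (n + count_le X v)%nat. { unfold count_le. assert (W := filter_length_le (fun x => if Rle_dec x v then true else false) X). lia. }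
 apply Q; auto. rewrite Cmod_sub_self. apply Pd; lra.
Qed.

Lemma counted_on_circle p w r l n z : 0 < r -> `|w| = 1 -> (forall a, `|a - p| = r -> ~ In a Bad) ->
 (forall a, `|a - p| = r -> image gamma a -> In a l) -> ~ image gamma (p + RtoC r * w)%C -> counted n (p + RtoC r * w)%C ->
 `|z - p| = r -> ~ image gamma z -> counted (n + length l) z.
Proof.
 intros Pr Hw HA Hl N0 H0 Hz Nz. assert (Ww : w <> RtoC 0). { intros ->. rewrite Cmod_0 in Hw. lra. }
 set (Z := fun x => (p + RtoC r * w * Eit x)%C).
 assert (Zp : forall x, (Z x - p)%C = (RtoC r * w * Eit x)%C) by (intros; unfold Z; ring).
 assert (Zr : forall x, `|Z x - p| = r). { intros x. rewrite Zp, !Cmod_mult, Cmod_R, Cmod_Eit, Hw, Rabs_pos_eq; lra. }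
 assert (Nrw : (RtoC r * w)%C <> RtoC 0). { apply Cmult_neq_0; auto. intros Q. apply RtoC_inj in Q. lra. }
 assert (Onto : forall a, `|a - p| = r -> exists x, 0 <= x < 2 * PI /\ Z x = a).
 { intros a Ha. destruct (polar 0 ((a - p) / (RtoC r * w))%C) as [x [Hx Ex]].
  assert (E : ((a - p) / (RtoC r * w))%C = Eit x).
  { rewrite Ex at 1. replace (`|(a - p) / (RtoC r * w) - 0|) with 1. unfold circle. ring.
   replace ((a - p) / (RtoC r * w) - 0)%C with ((a - p) / (RtoC r * w))%C by ring. rewrite Cmod_div, Cmod_mult, Cmod_R, Hw, Ha, Rabs_pos_eq by (auto; lra). field. lra. }
  assert (Ea : a = (p + RtoC r * w * ((a - p) / (RtoC r * w)))%C). { field. sa. intros Q. apply RtoC_inj in Q. lra. }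
  destruct (Req_dec x (2 * PI)) as [->|].
  - exists 0. split. generalize PI_RGT_0; lra. rewrite Ea, E, Eit_2PI. unfold Z. now rewrite Eit_0.
  - exists x. sp. rewrite Ea, E. auto. }
 destruct (choice_on (fun a => `|a - p| = r) _ 0 Onto) as [sel Ksel].
 destruct (Onto z Hz) as [x [Hx Ex]]. rewrite <- (length_map sel l). rewrite <- Ex.
 apply (counted_path Z 0 x (map sel l) n); auto; try lra.
 - apply rcont_rcont_on. intros t _. unfold Z. intros e He. destruct (rcont_Eit t (e / r)) as [d [Pd K]]. pos.
  exists d. sa. intros s Hs. replace (p + RtoC r * w * Eit s - (p + RtoC r * w * Eit t))%C with (RtoC r * w * (Eit s - Eit t))%C by ring.
  rewrite !Cmod_mult, Cmod_R, Hw, Rabs_pos_eq, Rmult_1_r by lra. specialize (K s Hs). apply Rlt_div_r in K; lra.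
 - intros s Hs Is. replace s with (sel (Z s)). apply in_map. apply Hl; auto.
  destruct (Ksel (Z s) (Zr s)) as [A B]. apply Eit_injective; auto. lra.
  assert (B2 : (RtoC r * w * (Eit (sel (Z s)) - Eit s))%C = RtoC 0). { transitivity (Z (sel (Z s)) - Z s)%C. unfold Z; ring. rewrite B. ring. }
  apply Cmult_integral in B2. destruct B2; [contradiction|]. now apply Cminus_eq0.
 - unfold Z. rewrite Eit_0, Cmult_1_r. auto.
 - congruence.
 - unfold Z. rewrite Eit_0, Cmult_1_r. auto.
Qed.

Lemma counted_value n t M : counted n t -> 0 <= M -> (forall w, peval2 P t w = RtoC 0 -> `|w| <= M) ->
 `|F t| <= `|cauchy_integral gamma g t| + INR n * M.
Proof.
 intros [m [h [Hm [Hp E]]]] PM HM. rewrite (germ_eq_at _ _ _ E). eapply Rle_trans. apply Cmod_minus_le. apply Rplus_le_compat_l.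
 eapply Rle_trans. apply (psum_bound t m h M Hp HM). apply Rmult_le_compat_r; auto. now apply le_INR.
Qed.

Lemma counted_segment a b n : (forall t, 0 <= t <= 1 -> ~ In (seg a b t) Bad /\ ~ image gamma (seg a b t)) ->
 counted n a -> counted n b.
Proof.
 intros H H0. rewrite <- (seg_1 a b). replace n with (n + length (@nil R))%nat by (simpl; lia).
 apply (counted_path (seg a b) 0 1 nil n); auto; try lra; [| | | | |now rewrite seg_0].
 - apply rcont_rcont_on. intros; apply rcont_seg.
 - intros s Hs. now apply H.
 - intros s Hs I. now destruct (H s Hs).
 - apply H. lra.
 - apply H. lra.
Qed.

(** A small circle meets the curve in at most one point for each arm, so the number of terms on it
    is at most [n] plus the number of arms. [I] is bounded by the inverse distance to the curve,
    hence by the inverse of [roots_prod] at these points, and the branches by [e^(-k)], with [k] the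
    order at [p] of the leading coefficient [q]. *)
Lemma pole_at p : exists n h R, 0 < R /\ hold h p R /\ forall z, 0 < `|z - p| < R -> h z = ((z - p) ^ n * F z)%C.
Proof.
 destruct (arms_at gamma p (gamma_piecewise_smooth _ _ _ HS)) as [th [bs [d [R0 [Hth [Pd [PR0 [Harm HR0]]]]]]]].
 destruct (list_isolated Bad p) as [R1 [PR1 K1]].
 set (R2 := Rmin (Rmin R0 R1) 1). assert (PR2 : 0 < R2) by pos.
 assert (R2 <= R0 /\ R2 <= R1 /\ R2 <= 1) as [L0 [L1 L2]]. { unfold R2. ar. }
 assert (NB : forall z, 0 < `|z - p| < R2 -> ~ In z Bad).
 { intros z Hz i. assert (z <> p). { intros ->. rewrite Cmod_sub_self in Hz. lra. } specialize (K1 z i H). lra. }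
 (* The arms avoid the direction [th], so along this ray the number [n] of terms stays the same down
    to every small radius. *)
 assert (Ray : forall r, 0 < r < R2 -> `|p + RtoC r * th - p| = r /\ ~ image gamma (p + RtoC r * th)%C).
 { intros r Hr. assert (E : (p + RtoC r * th - p)%C = (RtoC r * th)%C) by ring.
  assert (Q : `|p + RtoC r * th - p| = r). { rewrite E, Cmod_mult, Hth, Cmod_R, Rabs_pos_eq; lra. } sa.
  intros [s [Hs Es]]. destruct (HR0 s Hs) as [b [x [Hb [Hx Ex]]]]. rewrite Es, Q; lra. destruct (Harm b Hb) as [Eb [_ [Hc _]]].
  destruct (Req_dec x 0) as [->|Nx]. rewrite Es, Eb in Ex. rewrite Ex, Cmod_sub_self in Q. lra.
  apply (Hc x). lra. rewrite <- Ex, Es, E, cross_scal_l, cross_self. lra. }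
 assert (PH : 0 < R2 / 2 < R2) by lra.
 destruct (HN (p + RtoC (R2 / 2) * th)%C) as [rho Hn]. { apply NB. destruct (Ray _ PH) as [-> _]. lra. }
 destruct (counted_of_nice _ rho Hn) as [n Cn]. { now apply Ray. }
 destruct (root_bound P (bs_nonzero HB)) as [q [Nq Kq]]. destruct (factor_root p _ q eq_refl Nq) as [k [u [Nu Hu]]].
 destruct (peval_nonzero_near u p Nu) as [d1 [c1 [Pd1 [Pc1 Kd1]]]]. destruct (coef_sum_bounded P p) as [Kc [PKc HKc]].
 destruct (cauchy_integral_bound gamma Sigma g HS) as [C0 [PC0 HC0]].
 destruct (list_lower_bound bs (fun b => `|b d - p|)) as [e1 [Pe1 Ke1]].
 { intros b Hb. apply Cmod_gt_0. intros E. destruct (Harm b Hb) as [_ [_ [Hc _]]]. apply (Hc d). lra. rewrite E. unfold cross. rewrite im_mult, !im_conj, !re_conj, re_RtoC, im_RtoC. lra. }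
 set (e0 := Rmin (Rmin (R2 / 4) d1) e1). assert (Pe0 : 0 < e0) by pos.
 assert (e0 <= R2 / 4 /\ e0 <= d1 /\ e0 <= e1) as [M0 [M1 M2]]. { unfold e0. ar. }
 (* [1/4] is the constant of [Near] below for the points of the arms, and [R0/2] serves for the part
    of the curve outside the disc of radius [R0]. *)
 set (c' := Rmin (/ 4) (R0 / 2)). assert (Pc' : 0 < c') by pos. assert (Hc1' : c' <= / 4) by apply Rmin_l. assert (Hc2' : c' <= R0 / 2) by apply Rmin_r.
 set (N := (n + length bs)%nat).
 assert (PKK : 0 <= C0 / c' + INR N * (Kc / c1)).
 { apply Rplus_le_le_0_compat. now apply Rdiv_le_0_compat. apply Rmult_le_pos. apply pos_INR. now apply Rdiv_le_0_compat. }
 destruct (pole_of_moderate_growth F p R2 (length bs) k (C0 / c' + INR N * (Kc / c1)) e0) as [h [Hh Eh]]; auto.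
 { intros z Hz. destruct (HN z (NB z Hz)) as [r Hr]. now apply nice_holo in Hr. }
 2: { now exists (S k + length bs)%nat, h, R2. }
 intros e He.
 destruct (choice (fun b x => In b bs -> 0 <= x <= d /\ `|b x - p| = e)) as [sel Hsel].
 { intros b. destruct (classic (In b bs)) as [i|i]; [|exists 0; tauto]. destruct (arm_radius p th b d e (Harm b i)) as [x Hx]; auto. specialize (Ke1 b i). lra. now exists x. }
 exists (map (fun b => b (sel b)) bs). split. apply length_map.
 assert (Hl : forall a, In a (map (fun b => b (sel b)) bs) -> `|a - p| = e). { intros a Ha. apply in_map_iff in Ha. destruct Ha as [b [<- Hb]]. now apply Hsel. }
 sa. set (l := map (fun b => b (sel b)) bs) in *.
 (* The point of the arm on the circle is almost as close to [z] as any other point of the arm: by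
    the property of arms sliding to it costs three times the distance, and the triangle inequality
    adds one. *)
 assert (Near : forall b x z, In b bs -> 0 <= x <= d -> `|z - p| = e -> `|z - b (sel b)| <= 4 * `|z - b x|).
 { intros b x z Hb Hx Hz. destruct (Hsel b Hb) as [S1 S2]. destruct (Harm b Hb) as [_ [HM _]].
  assert (B : `|b x - b (sel b)| <= 3 * Rabs (`|b x - p| - e)).
  { rewrite <- S2. destruct (Rle_dec (sel b) x). eapply Rle_trans. apply HM; lra. apply Rmult_le_compat_l. lra. apply Rle_abs.
   rewrite Cmod_minus_sym, Rabs_minus_sym. eapply Rle_trans. apply HM; lra. apply Rmult_le_compat_l. lra. apply Rle_abs. }
  assert (B2 : Rabs (`|b x - p| - e) <= `|z - b x|).
  { rewrite <- Hz. generalize (Cmod_triangle_minus (b x) z p) (Cmod_triangle_minus z (b x) p). rewrite (Cmod_minus_sym (b x) z). intros. apply Rabs_le. lra. }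
  generalize (Cmod_triangle_minus z (b x) (b (sel b))). lra. }
 intros z Hz. assert (Hze : 0 < `|z - p| < R2) by lra.
 assert (Inl : image gamma z -> In z l).
 { intros [s [Hs Es]]. destruct (HR0 s Hs) as [b [x [Hb [Hx Ex]]]]. rewrite Es; lra. apply in_map_iff. exists b. sa.
  assert (Q := Near b x z Hb Hx Hz). rewrite <- Es, Ex, Cmod_sub_self in Q. symmetry. rewrite <- Es, Ex. apply Cminus_eq0, Cmod_eq_zero. lra. }
 destruct (classic (image gamma z)) as [Iz|Nz]. { rewrite roots_prod_zero by auto. rewrite Cmod_0. lra. }
 assert (Small : forall a, In a l -> `|z - a| <= 1). { intros a Ha. specialize (Hl a Ha). triang. }
 destruct (roots_prod_small l z Small) as [Pi1 Pi2]. set (pi := `|roots_prod l z|) in *. assert (Ppi : 0 <= pi) by apply Cmod_ge_0.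
 assert (Ek : 0 < e ^ k) by (apply pow_lt; lra). assert (Ek1 : e ^ k <= 1) by (rewrite <- (pow1 k); apply pow_incr; lra).
 destruct (Req_dec pi 0) as [->|Npi]. lra.
 assert (Cz : counted N z).
 { unfold N. rewrite <- (length_map (fun b => b (sel b)) bs). apply (counted_on_circle p th e); auto; try lra.
  - intros a Ha. apply NB. lra.
  - intros a Ha Ia. destruct Ia as [s [Hs Es]]. destruct (HR0 s Hs) as [b [x [Hb [Hx Ex]]]]. rewrite Es; lra. apply in_map_iff. exists b. sa.
   assert (Q := Near b x a Hb Hx Ha). rewrite <- Es, Ex, Cmod_sub_self in Q. symmetry. rewrite <- Es, Ex. apply Cminus_eq0, Cmod_eq_zero. lra.
  - apply Ray. lra.
  - apply (counted_segment (p + RtoC (R2 / 2) * th)%C); auto. intros t Ht.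
   replace (seg (p + RtoC (R2 / 2) * th) (p + RtoC e * th) t) with (p + RtoC (R2 / 2 + t * (e - R2 / 2)) * th)%C by (unfold seg; rewrite RtoC_plus, RtoC_mult, RtoC_minus; ring).
   assert (Q : 0 < R2 / 2 + t * (e - R2 / 2) < R2) by nra. destruct (Ray _ Q) as [A B]. sa. apply NB. lra. }
 assert (BI : `|cauchy_integral gamma g z| <= C0 / (c' * pi)).
 { apply HC0. pos. intros s Hs. destruct (Rlt_dec (`|gamma s - p|) R0) as [Q|Q].
  - destruct (HR0 s Hs Q) as [b [x [Hb [Hx ->]]]]. assert (In (b (sel b)) l) by (apply in_map_iff; now exists b). specialize (Pi2 _ H).
   specialize (Near b x z Hb Hx Hz). rewrite (Cmod_minus_sym (b x)). nra.
  - generalize (Cmod_triangle_minus (gamma s) z p). nra. }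
 assert (BW : forall w, peval2 P z w = RtoC 0 -> `|w| <= Kc / c1 / e ^ k).
 { intros w Hw. specialize (Kq z w Hw). rewrite Hu, Cmod_mult, Cmod_pow, Hz in Kq. specialize (Kd1 z LRA). specialize (HKc z LRA).
  apply Rmult_le_reg_l with (e ^ k * c1). pos. replace (e ^ k * c1 * (Kc / c1 / e ^ k)) with Kc by (field; lra). nra. }
 assert (PM : 0 <= Kc / c1 / e ^ k) by (apply Rdiv_le_0_compat; auto; now apply Rdiv_le_0_compat).
 assert (BF := counted_value N z _ Cz PM BW).
 apply Rle_trans with ((C0 / (c' * pi) + INR N * (Kc / c1 / e ^ k)) * pi * e ^ k).
 { apply Rmult_le_compat_r. lra. nra. }
 replace ((C0 / (c' * pi) + INR N * (Kc / c1 / e ^ k)) * pi * e ^ k) with (C0 / c' * e ^ k + INR N * (Kc / c1) * pi) by (field; lra).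
 assert (0 <= C0 / c') by now apply Rdiv_le_0_compat. assert (0 <= INR N * (Kc / c1)). { apply Rmult_le_pos. apply pos_INR. now apply Rdiv_le_0_compat. }
 nra.
Qed.

(** Outside a large disc there is neither curve nor exceptional point, so one number of terms serves
    for all points; the branches are bounded by a power of [|z|]. *)
Lemma growth_at_infinity : exists K R0 N, forall z, R0 <= `|z| -> ~ In z Bad /\ `|F z| <= K * `|z| ^ N.
Proof.
 destruct (rcont_on_bounded 0 1 gamma) as [M [PM HM]]. lra. apply piecewise_rcont_on, (gamma_piecewise_smooth _ _ _ HS).
 destruct (list_lower_bound Bad (fun b => / (1 + `|b|))) as [e [Pe Ke]]. { intros b _. apply Rinv_0_lt_compat. cm. }
 destruct (root_bound P (bs_nonzero HB)) as [q [Nq Kq]]. destruct (peval_lower q Nq) as [m [R1 [Pm [PR1 H1]]]].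
 destruct (coef_sum_growth P) as [K [N [PK H2]]]. destruct (cauchy_integral_bound gamma Sigma g HS) as [C0 [PC0 HC0]].
 set (R0 := M + 1 + / e + R1). assert (Pie : 0 < / e) by now apply Rinv_0_lt_compat.
 assert (Far : forall z, R0 <= `|z| -> ~ In z Bad /\ ~ image gamma z /\ forall s, 0 <= s <= 1 -> 1 <= `|gamma s - z|).
 { intros z Hz. split; [|split].
  - intros i. specialize (Ke z i). generalize (Cmod_ge_0 z). intros. apply Rinv_le_contravar in Ke; auto. rewrite Rinv_inv in Ke. unfold R0 in Hz. lra.
  - intros [s [Hs <-]]. specialize (HM s Hs). unfold R0 in Hz. lra.
  - intros s Hs. specialize (HM s Hs). rewrite Cmod_minus_sym. generalize (Cmod_minus_ge z (gamma s)). unfold R0 in Hz. lra. }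
 assert (Axis : forall r, 0 < r -> `|0 + RtoC r * 1| = r). { intros r Hr. rewrite Cplus_0_l, Cmult_1_r, Cmod_R, Rabs_pos_eq; lra. }
 assert (PR0 : 1 < R0) by (unfold R0; lra).
 destruct (HN (0 + RtoC R0 * 1)%C) as [rho Hn]. { apply Far. rewrite Axis; lra. }
 destruct (counted_of_nice _ rho Hn) as [n Cn]. { apply Far. rewrite Axis; lra. }
 exists (C0 + INR n * (K / m)), R0, N. intros z Hz. split. now apply Far.
 assert (PN : 0 <= INR n) by apply pos_INR. assert (Pz : 1 <= `|z| ^ N) by (apply pow_R1_Rle; lra).
 assert (Cz : counted n z).
 { replace n with (n + length (@nil C))%nat by (simpl; lia).
  assert (E0 : forall a, (a - 0)%C = a) by (intros; ring).
  apply (counted_on_circle 0 1 (`|z|) nil n); auto; try lra; rewrite ?Cmod_1, ?E0; auto.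
  - intros a Ha. rewrite E0 in Ha. apply Far. lra.
  - intros a Ha I. rewrite E0 in Ha. exfalso. apply (Far a); auto. lra.
  - apply Far. rewrite Axis; lra.
  - apply (counted_segment (0 + RtoC R0 * 1)%C); auto. intros t Ht.
   assert (Q : R0 <= R0 + t * (`|z| - R0)) by nra.
   replace (seg (0 + RtoC R0 * 1) (0 + RtoC (`|z|) * 1) t) with (0 + RtoC (R0 + t * (`|z| - R0)) * 1)%C by (unfold seg; rewrite RtoC_plus, RtoC_mult, RtoC_minus; ring).
   split; apply Far; rewrite Axis; lra.
  - now apply Far. }
 assert (PKm : 0 <= K / m) by now apply Rdiv_le_0_compat.
 assert (B := counted_value n z (K / m * `|z| ^ N) Cz ltac:(apply Rmult_le_pos; lra)).
 eapply Rle_trans. apply B.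
 - intros w Hw. specialize (Kq z w Hw). specialize (H1 z ltac:(unfold R0 in Hz; lra)). specialize (H2 z LRA).
  apply Rmult_le_reg_l with m; auto. replace (m * (K / m * `|z| ^ N)) with (K * `|z| ^ N) by (field; lra). generalize (Cmod_ge_0 w). nra.
 - assert (BI := HC0 z 1 LRA (proj2 (proj2 (Far z Hz)))). nra.
Qed.

End Continuation.

(** * Conclusion: the continued function is rational and extends [I] from [D] *)

Lemma rational_of_trivial gamma Sigma g D c : setting gamma Sigma g -> is_component (fun z => ~ image gamma z) D -> D c -> U_set gamma Sigma g c ->
 (forall S h, admissible gamma Sigma g c c S -> sum_of_branches gamma g S h -> germ_eq c h (fun _ => RtoC 0)) ->
 rational_on D (cauchy_integral gamma g).
Proof.
 intros HS HD Dc HU HM. destruct (bad_set_exists gamma Sigma g HS) as [P [Bad HB]]. assert (HP := gamma_piecewise_smooth _ _ _ HS).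
 assert (Off : forall t, D t -> ~ image gamma t) by (destruct HD as [_ [H _]]; auto).
 destruct (global_function gamma Sigma g P Bad c HS HB) as [F HF]. { intros a Na. now apply (nice_everywhere gamma Sigma g P Bad); auto. }
 set (I := cauchy_integral gamma g).
 assert (HI : forall t, D t -> holo I t) by (intros t Dt; apply (cauchy_integral_holo gamma Sigma); auto).
 assert (HhF : forall z, ~ In z Bad -> holo F z). { intros z Nz. destruct (HF z Nz) as [r Hr]. now apply nice_holo in Hr. }
 assert (Pun : forall t, exists r, 0 < r /\ forall z, 0 < `|z - t| < r -> ~ In z Bad).
 { intros t. destruct (list_isolated Bad t) as [r [Pr K]]. exists r. sa. intros z Hz i. assert (z <> t). { intros ->. rewrite Cmod_sub_self in Hz. lra. } specialize (K z i H). lra. }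
 (* Close to [c] the empty sum is reached, so there [F] is [I]; the identity theorem spreads this
    over the component. *)
 assert (EqD : forall t, D t -> exists r, 0 < r /\ forall z, 0 < `|z - t| < r -> F z = I z).
 { destruct (component_ball gamma D c HP HD Dc) as [r0 [Pr0 Kr0]].
  destruct (unique_sum_near_base gamma Sigma g P Bad c HS HB (Off c Dc) HU HM) as [r [Pr Kr]].
  destruct (infinite_away (c :: nil) c (Rmin r r0)) as [c1 [Hc1 N1]]. pos.
  destruct (Kr c1) as [N2 [R1 U1]]. ar. { intros ->. apply N1. now left. }
  assert (D1 : D c1). { apply Kr0. ar. }
  apply (equal_on_connected D Bad F I c1); auto. apply HD.
  - intros t Dt. destruct (Pun t) as [q [Pq Kq]]. destruct (component_ball gamma D t HP HD Dt) as [q' [Pq' Kq']]. exists (Rmin q q'). sp.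
   intros z Hz. rmin. split. apply HhF, Kq. lra. apply HI, Kq'. lra.
  - destruct (HF c1 N2) as [rho [Prho [_ K]]]. destruct (K c1) as [H [RH [UH EH]]]; auto. self.
   apply germ_eq_trans with (1 := EH). assert (E0 := U1 _ _ RH R1). apply (germ_eq_rel _ _ _ _ _ _ E0 E0). intros z -> _. unfold I. ring. }
 (* At points of [Bad] the value of [F] carries no information; inside [D] it is corrected to that
    of [I]. *)
 set (F1 := fun z => if excluded_middle_informative (D z /\ In z Bad) then I z else F z).
 (* Only exceptional points outside [D] remain as possible poles, so that the denominator has no
    zero in [D]. *)
 set (L := filter (fun z => if excluded_middle_informative (D z) then false else true) Bad).
 assert (InL : forall z, In z L <-> In z Bad /\ ~ D z). { intros z. unfold L. rewrite filter_In. destruct (excluded_middle_informative (D z)); intuition congruence. }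
 assert (F1F : forall z, ~ In z Bad -> F1 z = F z). { intros z Nz. unfold F1. destruct (excluded_middle_informative (D z /\ In z Bad)); tauto. }
 assert (F1I : forall z, D z -> F1 z = I z).
 { intros z Dz. unfold F1. destruct (excluded_middle_informative (D z /\ In z Bad)) as [Q|Q]; auto. assert (Nz : ~ In z Bad) by auto.
  apply Cminus_eq0. apply Cmod_small. intros e He. destruct (EqD z Dz) as [r [Pr K]].
  destruct (holo_ccont _ z (holo_minus F I z (HhF z Nz) (HI z Dz)) e He) as [d [Pd Kd]]. set (q := Rmin r d / 2). assert (Pq : 0 < q). pos.
  assert (Eq : (z + RtoC q - z)%C = RtoC q) by ring. assert (q <= r / 2 /\ q <= d / 2) by (unfold q; rmin; lra). specialize (Kd (z + RtoC q)%C). specialize (K (z + RtoC q)%C). rewrite Eq, Cmod_R, Rabs_pos_eq in Kd, K by lra.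
  rewrite K in Kd by lra. rewrite Cmod_minus_sym in Kd. replace (F z - I z - (I (z + RtoC q) - I (z + RtoC q)))%C with (F z - I z)%C in Kd by ring. lra. }
 destruct (growth_at_infinity gamma Sigma g P Bad c HS HB F HF) as [K [R0 [N HG]]].
 destruct (rational_of_poles L F1 K R0 N) as [Pp [Q [[lp Hp] [[lq Hq] HR]]]].
 - intros z Nz. rewrite InL in Nz. destruct (Pun z) as [r [Pr Kr]]. destruct (classic (D z)) as [Dz|NDz].
  + destruct (component_ball gamma D z HP HD Dz) as [r' [Pr' Kr']]. apply (holo_ext_loc I F1 z r'); auto. intros w Hw. symmetry. auto.
  + assert (Nb : ~ In z Bad) by auto. apply (holo_ext_loc F F1 z r); auto. intros w Hw. symmetry. apply F1F. destruct (classic (w = z)) as [->|Nw]; auto. apply Kr. sa. now apply Cmod_gt_0, Cminus_neq0.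
 - intros p _. destruct (pole_at gamma Sigma g P Bad c HS HB F HF p) as [n [h [R [PR [Hh Eh]]]]]. destruct (Pun p) as [r [Pr Kr]].
  exists n, h, (Rmin R r). sp. rmin. split. apply hold_sub with (1 := Hh). self.
  intros z Hz. rewrite F1F. apply Eh. lra. apply Kr. lra.
 - intros z Hz. destruct (HG z Hz). rewrite F1F; auto.
 - assert (NL : forall t, D t -> ~ In t L). { intros t Dt. rewrite InL. easy. }
  exists lp, lq. split.
  + apply pnonzero_peval with c. rewrite <- Hq. now apply HR, NL.
  + intros t Dt. destruct (HR t (NL t Dt)) as [A B]. rewrite F1I in B by auto. rewrite <- Hp, <- Hq. auto.
Qed.

Lemma constant_homotopy E S : continuous_on (T := R_UniformSpace) (U := C_UniformSpace) I01 S -> (forall t, I01 t -> E (S t)) -> homotopic_in E S S.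
Proof.
 intros Hc HE. exists (fun x => S (snd x)). repeat sa.
 intros [x y] [Hx Hy] Q HQ. specialize (Hc y Hy Q HQ). destruct Hc as [d Kd]. exists d. intros [x' y'] [Bx By] [Hx' Hy']. auto.
Qed.

Theorem theorem4p7
 (gamma : R -> C) (Sigma : list C) (g : C -> C)
 (Hset : setting gamma Sigma g)
 (D : C -> Prop) (HD : is_component (fun z => ~ image gamma z) D)
 (c : C) (Hc : D c) (HcU : U_set gamma Sigma g c) :
 rational_on D (cauchy_integral gamma g) <->
 trivial_monodromy gamma Sigma g c.
Proof.
 split.
 - intros HR K _ h [S [_ [HA HSum]]]. now apply (sum_of_branches_of_rational gamma Sigma g D c S h).
 - intros HT. apply (rational_of_trivial gamma Sigma g D c); auto. intros S h HA HSum.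
  assert (Lp : loop_in (U_set gamma Sigma g) c S). { destruct HA as [_ [_ [A [B [E [F _]]]]]]. easy. }
  (* An admissible loop represents its own homotopy class. *)
  apply (HT (fun S' => loop_in (U_set gamma Sigma g) c S' /\ homotopic_in (U_set gamma Sigma g) S S')).
  + exists S. easy.
  + exists S. split; [|split]; auto. sa. apply constant_homotopy; apply Lp.
Qed.
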